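(* Let $p\in\{3,5,7,13\}$, let $s\geq 2$ be an integer, and let $m$ be a negative integer with $(-1)^sm\equiv 0,1\pmod 4$. Then the Poincaré series $F^{(4p)}_{s+1/2,m}$ is a weakly holomorphic modular form of weight $s+1/2$ on $\Gamma_0(4p)$ with Fourier expansion at $\infty$ of the form $$F^{(4p)}_{s+1/2,m}=q^m+\sum_{n\geq 0,\ n\equiv 0,(-1)^s\pmod 4}p^{(4p)}_{s+1/2}(m,n)q^n.$$ It is holomorphic (and in fact vanishes) at the cusps $0,\frac12,\frac14$ of $\Gamma_0(4p)$, and it has a pole at the cusp $\infty$, together with poles at the cusps $\frac1p$ and $\frac1{2p}$.
   Context: $q=e^{2\pi iz}$, $z\in\mathbb{H}$, $k=s+1/2$. Half-integral weight modular forms on $\Gamma_0(4p)$ are taken with respect to the theta multiplier $j(\gamma,z)=\theta(\gamma z)/\theta(z)$, $\theta(z)=\sum_{n\in\mathbb{Z}}q^{n^2}$. Let $G$ be the metaplectic group of pairs $(M,\phi)$ with $M\in GL_2^+(\mathbb{Q})$ and $\phi$ a holomorphic function on $\mathbb{H}$ with $\phi(z)^2=t\det(M)^{-1/2}(cz+d)$ for some $|t|=1$ (where $M=\left(\begin{smallmatrix}a&b\\c&d\end{smallmatrix}\right)$), with multiplication $(M,\phi)(N,\psi)=(MN,\phi(Nz)\psi(z))$; it acts on functions in weight $k$ by $g|(M,\phi)(z)=\phi(z)^{-2k}g(Mz)$. For $A\in\Gamma_0(4)$ put $A^*=(A,j(A,z))\in G$. Let $\xi=\left(\left(\begin{smallmatrix}4&1\\0&4\end{smallmatrix}\right),e^{\pi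 i/4}\right)$ and $A_v=\left(\begin{smallmatrix}1&0\\4pv&1\end{smallmatrix}\right)$. The projection operator is $$g|pr=(-1)^{\lfloor (s+1)/2\rfloor}\frac{1}{3\sqrt2}\sum_{v\in\{-1,0,1,2\}}g|\xi A_v^*+\frac13 g.$$ For $m$ as in the claim, define $\mathcal{F}_m(z)=\sum_{A\in\Gamma_\infty\backslash\Gamma_0(4p)}\left(e^{2\pi i m z}\right)|A^*$, where $\Gamma_\infty$ is the subgroup of translations, and define the Poincaré series $F^{(4p)}_{s+1/2,m}=\frac32\,\mathcal{F}_m|pr$.
   Formalization: The clause ''poles at the cusps 1/p and 1/2p'' fails as stated and is corrected: there is a pole at 1/p exactly when (-1)^s m ≡ 0 (mod 4), and at 1/2p exactly when (-1)^s m ≡ 1 (mod 4), so at exactly one of the two for each m. *)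

(* Defs.v *)
From HB Require Import structures.
From mathcomp Require Import all_boot all_order all_algebra.
From mathcomp Require Import finmap complex.
From mathcomp Require Import all_classical all_reals all_analysis summability.

Set Implicit Arguments.
Unset Strict Implicit.
Unset Printing Implicit Defensive.
Import Order.TTheory GRing.Theory Num.Theory.
Import numFieldNormedType.Exports.

Local Open Scope classical_set_scope.
Local Open Scope ring_scope.

(* R[i] viewed through its numClosedFieldType structure, so that the topology
   and normed-module instances of MathComp-Analysis are found. *)
Definition CC (R : realType) : numClosedFieldType := R[i].

Definition mx2 (T : Type) (a b c d : T) : 'M[T]_2 :=
  \matrix_(i, j) if i == 0 then (if j == 0 then a else b)
                 else (if j == 0 then c else d).

Section Analysis.
Variable R : realType.
Local Notation C := (CC R).

Definition cexp (z : C) : C :=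
  Complex (expR (complex.Re z) * cos (complex.Im z))
          (expR (complex.Re z) * sin (complex.Im z)).

Definition ofR (x : R) : C := Complex x 0.

Definition imagi : C := Complex 0 1.

(* e z = exp (2 pi i z), so that q ^ x is e (x * z). *)
Definition e (z : C) : C := cexp (2 * ofR pi * imagi * z).

Definition upper_half : set C := [set z | 0 < complex.Im z].

Definition holomorphic_on_H (f : C -> C) : Prop :=
  forall z, upper_half z -> derivable f z 1.

(* Unordered (equivalently, absolutely convergent) summation. *)
Definition has_sum (I : choiceType) (x : I -> C) (l : C) : Prop :=
  partial_sum x @ totally --> l.

Definition mobius (M : 'M[rat]_2) (z : C) : C :=
  (ratr (M 0 0) * z + ratr (M 0 1)) / (ratr (M 1 0) * z + ratr (M 1 1)).

Definition mxQ (A : 'M[int]_2) : 'M[rat]_2 := map_mx intr A.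

Definition Gamma0 (N : nat) : set 'M[int]_2 :=
  [set A : 'M[int]_2 | \det A = 1 /\ (N%:Z %| A 1%R 0%R)%Z].

Definition theta (z : C) : C := summability.sum (fun n : int => e ((n ^+ 2)%:~R * z)).

Definition theta_j (A : 'M[int]_2) (z : C) : C :=
  theta (mobius (mxQ A) z) / theta z.

(* Raw pairs (M, phi); membership in the group G is the predicate [metaplectic].
   The values of phi outside the upper half-plane are irrelevant. *)
Definition mpair : Type := ('M[rat]_2 * (C -> C))%type.

Definition metaplectic (X : mpair) : Prop :=
  [/\ 0 < \det X.1, holomorphic_on_H X.2 &
      exists t : C, `|t| = 1 /\
        forall z, upper_half z ->
          X.2 z ^+ 2 = t * (ofR (Num.sqrt (ratr (\det X.1))))^-1
                         * (ratr (X.1 1 0) * z + ratr (X.1 1 1))].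

Definition mp_mul (X Y : mpair) : mpair :=
  (X.1 *m Y.1, fun z => X.2 (mobius Y.1 z) * Y.2 z).

(* The weight is k = s + 1/2, hence phi ^ (- 2 k) = phi ^- (2 s + 1). *)
Definition slash (s : nat) (g : C -> C) (X : mpair) : C -> C :=
  fun z => X.2 z ^- (2 * s + 1) * g (mobius X.1 z).

Definition star (A : 'M[int]_2) : mpair := (mxQ A, theta_j A).

Definition xi : mpair := (mx2 4 1 0 4, fun=> cexp (ofR (pi / 4) * imagi)).

Definition A_ (p : nat) (v : int) : 'M[int]_2 := mx2 1 0 (4 * p%:Z * v) 1.

Definition pr (p s : nat) (g : C -> C) : C -> C :=
  fun z =>
    (-1) ^+ (s.+1)./2 * (3 * ofR (Num.sqrt 2))^-1 *
      \sum_(v <- [:: -1; 0; 1; 2 : int]) slash s g (mp_mul xi (star (A_ p v))) z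
    + 3^-1 * g z.

(* The matrices acting as translations z -> z + n. Both signs are needed: A and
   - A act identically, and Gamma_infty \ Gamma_0(4p) must not count them twice
   (otherwise the leading coefficient would be 2 instead of 1). *)
Definition Gamma_infty : set 'M[int]_2 :=
  [set T | exists n : int, T = mx2 1 n 0 1 \/ T = - mx2 1 n 0 1].

Definition cosets (N : nat) : set (set 'M[int]_2) :=
  [set [set T *m A | T in Gamma_infty] | A in Gamma0 N].

(* The summand depends only on the coset, so it is evaluated at an arbitrarily
   chosen representative (the default 1%:M is never used). *)
Definition Fcal (p s : nat) (m : int) : C -> C :=
  fun z => summability.sum (fun K : cosets (4 * p) =>
    slash s (fun w => e (m%:~R * w)) (star (xget 1%:M (val K))) z).

Definition poincare (p s : nat) (m : int) : C -> C :=
  fun z => 3 / 2 * pr p s (Fcal p s m) z.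

(* Cusps are points of the projective line over rat; None is infinity. *)
Definition image_of_infty (A : 'M[int]_2) : option rat :=
  if A 1 0 == 0 then None else Some ((A 0 0)%:~R / (A 1 0)%:~R).

Definition cusp_expansion (s : nat) (f : C -> C) (X : mpair)
    (h : nat) (a : int -> C) : Prop :=
  [/\ (0 < h)%N,
      exists n0 : int, forall n, n < n0 -> a n = 0 &
      forall z, upper_half z ->
        has_sum (fun n : int => a n * e (n%:~R * z / h%:R)) (slash s f X z)].

(* For every gamma in SL_2(Z) with gamma oo = r and every lift X of gamma to G,
   f | X has an expansion in q ^ (1 / h) with finitely many negative exponents,
   whose coefficients satisfy P. Here h need not be the width of the cusp: it
   also absorbs the roots of unity coming from the theta multiplier. *)
Definition at_cusp (s : nat) (f : C -> C) (r : option rat)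
    (P : (int -> C) -> Prop) : Prop :=
  forall (gamma : 'M[int]_2) (X : mpair),
    Gamma0 1 gamma -> image_of_infty gamma = r ->
    metaplectic X -> X.1 = mxQ gamma ->
    exists h a, cusp_expansion s f X h a /\ P a.

Definition meromorphic_at s f r := at_cusp s f r (fun=> True).

Definition holomorphic_at s f r :=
  at_cusp s f r (fun a => forall n, n < 0 -> a n = 0).

Definition vanishes_at s f r :=
  at_cusp s f r (fun a => forall n, n <= 0 -> a n = 0).

Definition has_pole_at s f r :=
  at_cusp s f r (fun a => exists n, n < 0 /\ a n <> 0).

Definition weakly_holomorphic_form (N s : nat) (f : C -> C) : Prop :=
  [/\ holomorphic_on_H f,
      forall A, Gamma0 N A -> forall z, upper_half z ->
        f (mobius (mxQ A) z) = theta_j A z ^+ (2 * s + 1) * f z &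
      forall r, meromorphic_at s f r].

End Analysis.

(* Main.v *)
(* The slash action of xi A_v^* on a form f on Gamma0(4p) depends only on v mod 4, so
   the sum W f of the four terms is again such a form, and
   F = (f + al^-1 W f) / 2 with al = om + om^-1 = ± sqrt 2, om = e(k/4), where f is
   the plain Poincaré series. The v = 0 and v = 2 terms are the translates
   om^-1 f(z + 1/4) and om f(z - 1/4); the v = ±1 terms are multiplied by a constant
   under z -> z + 1/4. On q-expansions this gives the plus-space condition.

   The multiplier system of theta comes from the Gaussian inversion formula and a
   descent in Gamma0(4); besides theta(Az)^2 one follows the ratio
   theta(z + 1/2) / theta(z), which is enough to evaluate all phases.

   In f|M, a coset A contributes a term tending to 0 as Im z tends to infinity,
   unless A M has lower left entry 0, and these bounds are summable. At the cusps 0,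
   1/2, 1/4 no coset is exceptional. At infinity only the identity coset is, in f and
   in the v = 0, 2 terms. At 1/p and 1/(2p) each of the four terms xi A_v has exactly
   one exceptional coset and f has none; the four principal parts agree up to phases,
   whose sum is 4 or 0 according to the residue of (-1)^s m mod 4. The phases are
   compared through the linear relations between theta(z), theta(z + 1/2) and
   theta(z + 1/4). *)
Require Import Defs.
From HB Require Import structures.
From mathcomp Require Import all_boot all_order all_algebra.
From mathcomp Require Import finmap complex.
From mathcomp Require Import all_classical all_reals all_analysis summability.
From mathcomp Require Import ring lra zify.
Set Implicit Arguments.
Unset Strict Implicit.
Unset Printing Implicit Defensive.
Import Order.TTheory GRing.Theory Num.Theory.
Import numFieldNormedType.Exports.
Local Open Scope ring_scope.

(** The obstacle is the sign of the theta multiplier. The formula for theta(Az)^2 gives j(A,z) only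
    up to sign, and the odd power 2s+1 keeps that sign. No quadratic symbol is evaluated. Factors
    are compared at points that differ by 1/4, and theta(z + 1/4) is a linear combination of
    theta(z) and theta(z + 1/2), so their quotients become expressions in [thetaD], where the sign
    has cancelled. Square roots are treated as holomorphic functions with a prescribed square; two
    of them with proportional squares differ by a constant. Convergence rests on 2s+1 >= 5:
    |cz+d|^(-5/2) is at most a multiple of |c|^(-5/4) |d|^(-5/4), with 1 in place of a zero entry,
    and the double sum splits into two simple ones. Up to a common factor the four phases are
    e(kpv/4), with k = -m at 1/p and k = m - (2s+1) at 1/(2p). As 2s+1 is congruent to (-1)^s modulo
    4, each admissible residue of (-1)^s m makes exactly one of these k divisible by 4. Hence
    exactly one of the two cusps carries a pole, and the last conjunct is a pair of equivalences. *)

Notation Re := complex.Re.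
Notation Im := complex.Im.

(** * Complex numbers and unordered sums *)

Section ComplexNumbers.
Variable R : realType.
Local Notation C := (CC R).
Implicit Types (z w : C) (x y : R).

(** The norm of [C] takes its values in [C]; this real copy lets suprema and linear arithmetic work
    in [R]. *)
Definition nm z : R := Num.sqrt (Re z ^+ 2 + Im z ^+ 2).

Lemma normE z : `|z| = ofR (nm z).
Proof. exact: (normc_def (z : R[i])). Qed.

Lemma ceq z w : Re z = Re w -> Im z = Im w -> z = w.
Proof. by case: z => a b; case: w => c d /= -> ->. Qed.

Lemma ReD z w : Re (z + w) = Re z + Re w. Proof. by case: z; case: w. Qed.
Lemma ImD z w : Im (z + w) = Im z + Im w. Proof. by case: z; case: w. Qed.
Lemma ReN z : Re (- z) = - Re z. Proof. by case: z. Qed.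
Lemma ImN z : Im (- z) = - Im z. Proof. by case: z. Qed.
Lemma ReB z w : Re (z - w) = Re z - Re w. Proof. by rewrite ReD ReN. Qed.
Lemma ImB z w : Im (z - w) = Im z - Im w. Proof. by rewrite ImD ImN. Qed.
Lemma ReM z w : Re (z * w) = Re z * Re w - Im z * Im w.
Proof. by case: z; case: w. Qed.
Lemma ImM z w : Im (z * w) = Re z * Im w + Im z * Re w.
Proof. by case: z => a b; case: w => c d /=. Qed.
Lemma Im0 : Im (0 : C) = 0. Proof. by []. Qed.
Lemma Re1 : Re (1 : C) = 1. Proof. by []. Qed.
Lemma Im1 : Im (1 : C) = 0. Proof. by []. Qed.
Lemma Re_ofR x : Re (ofR x) = x. Proof. by []. Qed.
Lemma Im_ofR x : Im (ofR x) = 0. Proof. by []. Qed.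
Lemma Im_i : Im (imagi R) = 1. Proof. by []. Qed.

Lemma ofRD x y : ofR (x + y) = ofR x + ofR y.
Proof. by apply: ceq; rewrite ?ReD ?ImD /= ?addr0. Qed.
Lemma ofRN x : ofR (- x) = - ofR x.
Proof. by apply: ceq; rewrite ?ReN ?ImN /= ?oppr0. Qed.
Lemma ofRM x y : ofR (x * y) = ofR x * ofR y.
Proof. by apply: ceq; rewrite ?ReM ?ImM /= ?(mul0r, mulr0, subr0, addr0). Qed.
Lemma ofR0 : ofR 0 = 0 :> C. Proof. by []. Qed.
Lemma ofR1 : ofR 1 = 1 :> C. Proof. by []. Qed.
Lemma ofR_eq0 x : (ofR x == 0 :> C) = (x == 0).
Proof. by apply/eqP/eqP => [[]//|->]. Qed.
Lemma ofRV x : ofR x^-1 = (ofR x)^-1 :> C.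
Proof.
have [->|x0] := eqVneq x 0; first by rewrite invr0 ofR0 invr0.
have xC : ofR x != 0 :> C by rewrite ofR_eq0.
by apply: (mulfI xC); rewrite -ofRM !divff.
Qed.
Lemma ofR_nat n : ofR n%:R = n%:R :> C.
Proof. by elim: n => [//|n IH]; rewrite -addn1 !natrD ofRD IH. Qed.
Lemma ofR_int (n : int) : ofR n%:~R = n%:~R :> C.
Proof.
case: n => n; first by rewrite -!pmulrn ofR_nat.
by rewrite NegzE !mulrNz ofRN -!pmulrn ofR_nat.
Qed.
Lemma ofRX x n : ofR (x ^+ n) = ofR x ^+ n :> C.
Proof. by elim: n => [//|n IH]; rewrite !exprS ofRM IH. Qed.

Lemma Re_int (n : int) : Re (n%:~R : C) = n%:~R. Proof. by rewrite -ofR_int. Qed.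
Lemma Im_int (n : int) : Im (n%:~R : C) = 0. Proof. by rewrite -ofR_int. Qed.
Lemma Re_ofRM x z : Re (ofR x * z) = x * Re z.
Proof. by rewrite ReM /= mul0r subr0. Qed.
Lemma Im_ofRM x z : Im (ofR x * z) = x * Im z.
Proof. by rewrite ImM /= mul0r addr0. Qed.
Lemma Re_Mi z : Re (imagi R * z) = - Im z.
Proof. by rewrite ReM /= mul0r mul1r sub0r. Qed.
Lemma Im_Mi z : Im (imagi R * z) = Re z.
Proof. by rewrite ImM /= mul0r mul1r add0r. Qed.
Lemma imagi2 : imagi R ^+ 2 = -1.
Proof. by apply: ceq; rewrite expr2 ?ReM ?ImM ?ReN ?ImN /=; ring. Qed.
Lemma ReIm z : z = ofR (Re z) + imagi R * ofR (Im z).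
Proof.
by apply: ceq; rewrite ?ReD ?ImD ?ReM ?ImM /= ?(mul0r, mulr0, mul1r, addr0, add0r, subr0).
Qed.

Lemma nm_ge0 z : 0 <= nm z. Proof. exact: sqrtr_ge0. Qed.
Hint Resolve nm_ge0 : core.
Lemma nm2 z : nm z ^+ 2 = Re z ^+ 2 + Im z ^+ 2.
Proof. by rewrite sqr_sqrtr // addr_ge0 ?sqr_ge0. Qed.
Lemma le_ofR x y : (ofR x <= ofR y :> C) = (x <= y).
Proof. exact: lecR. Qed.
Lemma lt_ofR x y : (ofR x < ofR y :> C) = (x < y).
Proof. exact: ltcR. Qed.
Lemma ofR_inj x y : ofR x = ofR y :> C -> x = y.
Proof. by case. Qed.
Lemma nmM z w : nm (z * w) = nm z * nm w.
Proof. by apply: ofR_inj; rewrite ofRM -!normE normrM. Qed.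
Lemma nmD z w : nm (z + w) <= nm z + nm w.
Proof. by rewrite -le_ofR ofRD -!normE ler_normD. Qed.
Lemma nmN z : nm (- z) = nm z.
Proof. by apply: ofR_inj; rewrite -!normE normrN. Qed.
Lemma nmB z w : nm (z - w) <= nm z + nm w.
Proof. by rewrite (le_trans (nmD _ _)) // nmN. Qed.
Lemma nmC z w : nm (z - w) = nm (w - z).
Proof. by rewrite -nmN opprB. Qed.
Lemma nmBD u z w : nm (z - w) <= nm (z - u) + nm (u - w).
Proof. by apply: le_trans (nmD _ _); rewrite addrA subrK. Qed.
Lemma nm_ler z w : nm z - nm w <= nm (z - w).
Proof. by rewrite lerBlDr -{1}(subrK w z) nmD. Qed.
Lemma nm0 : nm 0 = 0. Proof. by apply: ofR_inj; rewrite -normE normr0. Qed.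
Lemma nm1 : nm 1 = 1. Proof. by apply: ofR_inj; rewrite -normE normr1. Qed.
Lemma nm_eq0 z : (nm z == 0) = (z == 0).
Proof. by rewrite -(@normr_eq0 _ C) normE ofR_eq0. Qed.
Lemma nm_gt0 z : (0 < nm z) = (z != 0).
Proof. by rewrite lt_neqAle nm_ge0 andbT eq_sym nm_eq0. Qed.
Lemma nmV z : nm z^-1 = (nm z)^-1.
Proof. by apply: ofR_inj; rewrite ofRV -!normE normfV. Qed.
Lemma nmX z n : nm (z ^+ n) = nm z ^+ n.
Proof. by elim: n => [|n IH]; rewrite ?nm1 // !exprS nmM IH. Qed.
Lemma nm_ofR x : nm (ofR x) = `|x|.
Proof. by rewrite /nm /= expr0n addr0 sqrtr_sqr. Qed.
Lemma nm_i : nm (imagi R) = 1.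
Proof. by rewrite /nm /= expr0n add0r expr1n sqrtr1. Qed.
Lemma nm_nat n : nm (n%:R : C) = n%:R.
Proof. by rewrite -ofR_nat nm_ofR ger0_norm. Qed.
Lemma nm_int (n : int) : nm (n%:~R : C) = `|n%:~R|.
Proof. by rewrite -ofR_int nm_ofR. Qed.
Lemma nm_Re z : `|Re z| <= nm z.
Proof. by rewrite -[X in X <= _]sqrtr_sqr ler_sqrt ?lerDl ?sqr_ge0 // addr_ge0 ?sqr_ge0. Qed.
Lemma nm_Im z : `|Im z| <= nm z.
Proof. by rewrite -[X in X <= _]sqrtr_sqr ler_sqrt ?lerDr ?sqr_ge0 // addr_ge0 ?sqr_ge0. Qed.
Lemma nm_leRI z : nm z <= `|Re z| + `|Im z|.
Proof.
rewrite {1}(ReIm z); apply: le_trans (nmD _ _) _.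
by rewrite nmM nm_i mul1r !nm_ofR.
Qed.
Lemma nm_sum (I : Type) (r : seq I) (P : pred I) (f : I -> C) :
  nm (\sum_(i <- r | P i) f i) <= \sum_(i <- r | P i) nm (f i).
Proof.
elim/big_rec2: _ => [|i y x _ IH]; first by rewrite nm0.
by apply: le_trans (nmD _ _) _; rewrite lerD2l.
Qed.

Lemma eq_of_nm_small z w : (forall eps, 0 < eps -> nm (z - w) <= eps) -> z = w.
Proof.
move=> H; apply/eqP; rewrite -subr_eq0 -nm_eq0 eq_le nm_ge0 andbT.
by apply/ler_addgt0Pl => e /H; rewrite addr0.
Qed.

Lemma exists_nat_ge x : exists n : nat, x <= n.+1%:R.
Proof.
exists (absz (Num.ceil x)); apply: le_trans (ceil_ge _) _.
apply: (@le_trans _ _ `|Num.ceil x|%:~R); first by rewrite ler_int ler_norm.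
by rewrite -abszE -pmulrn ler_nat leqnSn.
Qed.

End ComplexNumbers.
#[global] Hint Extern 0 (is_true (0 <= nm _)) => exact: nm_ge0 : core.

Local Open Scope fset_scope.
Local Open Scope ring_scope.

(** * Unordered sums and dominated convergence *)

Section UnorderedSums.
Variable R : realType.
Local Notation C := (CC R).

(** Summability of a majorant with an explicit constant. It passes to re-indexings by injections,
    which is how sums over cosets are compared with sums over pairs of integers. *)
Definition sumb (I : choiceType) (b : I -> R) (B : R) :=
  forall J : {fset I}, \sum_(i <- J) b i <= B.

Lemma fsumU (I : choiceType) (V : nmodType) (x : I -> V) (J J' : {fset I}) :
  [disjoint J & J'] -> \sum_(i <- J `|` J') x i = \sum_(i <- J) x i + \sum_(i <- J') x i.
Proof.
move=> dJ; rewrite (big_fsetID _ (mem J)) /=; congr (_ + _); apply: eq_fbigl => i.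
  by rewrite !inE /=; case: (i \in J) => //; rewrite andbF.
rewrite !inE /=; case: (boolP (i \in J)) => //= iJ; last by rewrite andbT.
by rewrite (negPf (fdisjointP dJ _ iJ)).
Qed.

Lemma fsum_sub (I : choiceType) (b : I -> R) (J J' : {fset I}) :
  (forall i, 0 <= b i) -> J `<=` J' -> \sum_(i <- J) b i <= \sum_(i <- J') b i.
Proof.
move=> b0 /fsetUidPr <-.
have -> : J `|` J' = J `|` (J' `\` J).
  by apply/fsetP => i; rewrite !inE; case: (i \in J).
rewrite (fsumU) ?lerDl ?sumr_ge0 //=.
by apply/fdisjointP => i iJ; rewrite !inE iJ.
Qed.

Lemma has_sumP (I : choiceType) (x : I -> C) (l : C) :
  has_sum x l <-> forall eps : R, 0 < eps -> exists J0 : {fset I},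
    forall J, J0 `<=` J -> nm (\sum_(i <- J) x i - l) < eps.
Proof.
rewrite /has_sum; split.
  move=> /cvgrPdist_lt H eps e0.
  have e0' : 0 < ofR eps :> C by rewrite -[0]ofR0 lt_ofR.
  have [J0 _ HJ] := H totally_filter _ e0'; exists J0 => J /HJ /=.
  by rewrite normE lt_ofR /partial_sum -(big_seq_fsetE _ _ xpredT) nmC.
move=> H; apply/(cvgrPdist_lt (FF := totally_filter)) => eps e0.
have eR : eps = ofR (Re eps) by rewrite -[LHS](RRe_real (gtr0_real e0)).
have e0' : 0 < Re eps by rewrite -lt_ofR -eR.
have [J0 HJ] := H _ e0'; exists J0 => // J /= /HJ.
by rewrite normE eR lt_ofR nmC /partial_sum -(big_seq_fsetE _ _ xpredT).
Qed.

Lemma has_sum_unique (I : choiceType) (x : I -> C) (l l' : C) :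
  has_sum x l -> has_sum x l' -> l = l'.
Proof.
move=> /has_sumP H /has_sumP H'; apply: eq_of_nm_small => e e0.
have e2 : 0 < e / 2 by rewrite divr_gt0.
have [J HJ] := H _ e2; have [J' HJ'] := H' _ e2.
have /HJ h1 : J `<=` J `|` J' by apply: fsubsetUl.
have /HJ' h2 : J' `<=` J `|` J' by apply: fsubsetUr.
apply: le_trans (nmBD (\sum_(i <- J `|` J') x i) _ _) _.
by rewrite (nmC l) (splitr e) lerD // ltW.
Qed.

Lemma has_sum_sum (I : choiceType) (x : I -> C) (l : C) :
  has_sum x l -> summability.sum x = l.
Proof.
move=> H; apply: has_sum_unique (H).
by rewrite /has_sum /summability.sum; apply: (cvgP l H).
Qed.

Lemma eq_has_sum (I : choiceType) (x y : I -> C) (l : C) :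
  x =1 y -> has_sum x l -> has_sum y l.
Proof. by move=> /funext ->. Qed.

Lemma has_sum0 (I : choiceType) : has_sum (fun _ : I => 0 : C) 0.
Proof.
by apply/has_sumP => e e0; exists fset0 => J _; rewrite big1 // subrr nm0.
Qed.

Lemma has_sumD (I : choiceType) (x y : I -> C) (l l' : C) :
  has_sum x l -> has_sum y l' -> has_sum (fun i => x i + y i) (l + l').
Proof.
move=> /has_sumP H /has_sumP H'; apply/has_sumP => e e0.
have e2 : 0 < e / 2 by rewrite divr_gt0.
have [J HJ] := H _ e2; have [J' HJ'] := H' _ e2.
exists (J `|` J') => K; rewrite fsubUset => /andP[/HJ h /HJ' h'].
rewrite big_split /= opprD addrACA (splitr e).
by apply: le_lt_trans (nmD _ _) _; rewrite ltrD.
Qed.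

Lemma has_sumZ (I : choiceType) (c : C) (x : I -> C) (l : C) :
  has_sum x l -> has_sum (fun i => c * x i) (c * l).
Proof.
move=> /has_sumP H; apply/has_sumP => e e0.
have c0 : 0 < nm c + 1 by apply: (ltr_wpDl (nm_ge0 c)).
have [J HJ] := H _ (divr_gt0 e0 c0).
exists J => K /HJ; rewrite -mulr_sumr -mulrBr nmM ltr_pdivlMr //.
by apply: le_lt_trans; rewrite mulrC; apply: ler_wpM2l => //; rewrite lerDl.
Qed.

Lemma has_sumN (I : choiceType) (x : I -> C) (l : C) :
  has_sum x l -> has_sum (fun i => - x i) (- l).
Proof.
by move=> /(has_sumZ (c := -1)); rewrite mulN1r; apply: eq_has_sum => i; rewrite mulN1r.
Qed.

Lemma has_sumB (I : choiceType) (x y : I -> C) (l l' : C) :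
  has_sum x l -> has_sum y l' -> has_sum (fun i => x i - y i) (l - l').
Proof. by move=> Hx /has_sumN; apply: has_sumD. Qed.

Lemma has_sum_big (I : choiceType) (T : Type) (r : seq T) (x : T -> I -> C) (l : T -> C) :
  (forall t, has_sum (x t) (l t)) ->
  has_sum (fun i => \sum_(t <- r) x t i) (\sum_(t <- r) l t).
Proof.
move=> H; elim: r => [|t r IH].
  by rewrite big_nil; apply: eq_has_sum (has_sum0 I) => i; rewrite big_nil.
rewrite big_cons; apply: eq_has_sum (has_sumD (H t) IH) => i.
by rewrite big_cons.
Qed.

Lemma has_sum_fin (I : choiceType) (x : I -> C) (J : {fset I}) :
  (forall i, i \notin J -> x i = 0) -> has_sum x (\sum_(i <- J) x i).
Proof.
move=> x0; apply/has_sumP => e e0; exists J => K JK.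
rewrite [X in nm (_ - X)](big_fset_incl _ JK) ?subrr ?nm0 //.
by move=> i _ iJ; rewrite x0.
Qed.

Lemma has_sum_delta (I : choiceType) (i0 : I) (c : C) :
  has_sum (fun i => if i == i0 then c else 0) c.
Proof.
have := @has_sum_fin I (fun i => if i == i0 then c else 0) [fset i0].
rewrite big_seq_fset1 eqxx; apply => i.
by rewrite !inE => /negPf ->.
Qed.

Lemma has_sum_le (I : choiceType) (x : I -> C) (l : C) (B : R) :
  has_sum x l -> sumb (fun i => nm (x i)) B -> nm l <= B.
Proof.
move=> /has_sumP H HB; apply/ler_addgt0Pl => e /H [J /(_ J (fsubset_refl _)) h].
rewrite -(subKr (\sum_(i <- J) x i) l).
apply: le_trans (nmB _ _) _; rewrite addrC lerD ?(ltW h) //.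
exact: le_trans (nm_sum _ _ _) (HB J).
Qed.

Lemma sumb_tail (I : choiceType) (b : I -> R) (B : R) :
  (forall i, 0 <= b i) -> sumb b B -> forall eps, 0 < eps ->
  exists J0 : {fset I}, forall J, [disjoint J & J0] -> \sum_(i <- J) b i <= eps.
Proof.
move=> b0 HB e e0.
pose S : set R := [set s | exists J : {fset I}, s = \sum_(i <- J) b i]%classic.
have hS : has_sup S.
  split; first by exists 0; exists fset0; rewrite big_seq_fset0.
  by exists B => _ [J ->].
have [_ [J0 ->] hJ0] := sup_adherent e0 hS.
exists J0 => J dJ.
have : \sum_(i <- (J `|` J0)) b i <= sup S.
  by apply: sup_ubound; [case: hS | exists (J `|` J0)].
rewrite (fsumU) //=; lra.
Qed.

(** The finite set is chosen from the majorant alone, so the cut-off is uniform over all families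
    that [b] dominates. *)
Lemma has_sum_tail (I : choiceType) (b : I -> R) (B : R) :
  (forall i, 0 <= b i) -> sumb b B -> forall eps, 0 < eps ->
  exists J0 : {fset I}, forall (x : I -> C) (l : C),
    (forall i, nm (x i) <= b i) -> has_sum x l -> nm (l - \sum_(i <- J0) x i) <= eps.
Proof.
move=> b0 HB e e0; have [J0 HJ0] := sumb_tail b0 HB e0.
exists J0 => x l xb /has_sumP H; apply/ler_addgt0Pl => d /H [J hJ].
have /hJ h : J `<=` J0 `|` (J `\` J0).
  by apply/fsubsetP => i iJ; rewrite !inE iJ; case: (i \in J0).
apply: le_trans (nmBD (\sum_(i <- J0 `|` (J `\` J0)) x i) _ _) _.
apply: lerD; first by rewrite nmC ltW.
rewrite (fsumU) /=; last first.
  by apply/fdisjointP => i iJ; rewrite !inE iJ.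
rewrite addrC addKr; apply: le_trans (nm_sum _ _ _) _.
apply: le_trans (HJ0 (J `\` J0) _); first by apply: ler_sum => i _.
by apply/fdisjointP => i; rewrite !inE => /andP[].
Qed.

Lemma sumb_real_sum (I : choiceType) (y : I -> R) (B : R) :
  (forall i, 0 <= y i) -> sumb y B ->
  exists s, has_sum (fun i => ofR (y i) : C) (ofR s).
Proof.
move=> y0 HB.
pose S : set R := [set s | exists J : {fset I}, s = \sum_(i <- J) y i]%classic.
have hS : has_sup S.
  split; first by exists 0; exists fset0; rewrite big_seq_fset0.
  by exists B => _ [J ->].
exists (sup S); apply/has_sumP => e e0.
have [_ [J0 ->] hJ0] := sup_adherent e0 hS.
exists J0 => J JJ.
have -> : \sum_(i <- J) ofR (y i) = ofR (\sum_(i <- J) y i) :> C.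
  by elim/big_rec2: _ => [//|i a b _ ->]; rewrite ofRD.
rewrite -ofRN -ofRD nm_ofR distrC.
have h1 : \sum_(i <- J) y i <= sup S by apply: sup_ubound; [case: hS | exists J].
have h2 := fsum_sub y0 JJ.
rewrite ger0_norm; lra.
Qed.

Lemma summable_has_sum (I : choiceType) (x : I -> C) (b : I -> R) (B : R) :
  (forall i, nm (x i) <= b i) -> sumb b B -> exists l, has_sum x l.
Proof.
move=> xb HB.
have hb i : 0 <= b i by apply: le_trans (xb i).
have [s Hs] := sumb_real_sum hb HB.
have aux (f : C -> R) : (forall z, `|f z| <= nm z) ->
    exists s', has_sum (fun i => ofR (f (x i)) : C) (ofR s').
  move=> hf.
  (* Adding the majorant makes the real or imaginary part non-negative, where a supremum provides
     the sum; the sum of the majorant is subtracted afterwards. *)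
  have h1 i : 0 <= b i + f (x i).
    have := le_trans (hf (x i)) (xb i); rewrite ler_norml; lra.
  have h2 : sumb (fun i => b i + f (x i)) (B + B).
    move=> J; rewrite big_split /= lerD ?HB //; apply: le_trans (HB J).
    apply: ler_sum => i _; apply: le_trans (xb i).
    exact: le_trans (ler_norm _) (hf _).
  have [s1 Hs1] := sumb_real_sum h1 h2.
  exists (s1 - s); rewrite ofRD ofRN; apply: eq_has_sum (has_sumB Hs1 Hs) => i.
  by rewrite ofRD addrAC subrr add0r.
have [u Hu] := aux _ (@nm_Re R); have [v Hv] := aux _ (@nm_Im R).
exists (ofR u + imagi R * ofR v).
apply: eq_has_sum (has_sumD Hu (has_sumZ (c := imagi R) Hv)) => i.
by rewrite -ReIm.
Qed.

Lemma sum_has_sum (I : choiceType) (x : I -> C) (b : I -> R) (B : R) :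
  (forall i, nm (x i) <= b i) -> sumb b B -> has_sum x (summability.sum x).
Proof.
by move=> xb HB; have [l Hl] := summable_has_sum xb HB; rewrite (has_sum_sum Hl).
Qed.

(** Dominated convergence for series: a finite set carries all but eps/3 of the majorant, and on it
    finitely many pointwise limits suffice. The filter is arbitrary because the lemma serves both
    the number of sample points tending to infinity and Im z tending to infinity. *)
Lemma tannery (T : Type) (F : set_system T) (FF : Filter F) (I : choiceType)
  (b : I -> R) (B : R) (x : T -> I -> C) (L : T -> C) (y : I -> C) (l : C) :
  sumb b B ->
  (\forall t \near F, forall i, nm (x t i) <= b i) ->
  (\forall t \near F, has_sum (x t) (L t)) ->
  (forall i, nm (y i) <= b i) -> has_sum y l ->
  (forall i (eps : R), 0 < eps -> \forall t \near F, nm (x t i - y i) <= eps) ->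
  forall eps : R, 0 < eps -> \forall t \near F, nm (L t - l) <= eps.
Proof.
move=> HB xb xL yb yl xy e e0.
have e3 : 0 < e / 3 by rewrite divr_gt0.
have b0 i : 0 <= b i by apply: le_trans (yb i).
have [J0 HJ0] := has_sum_tail b0 HB e3.
have [d d0 hd] : exists2 d, 0 < d & \sum_(i <- J0) d <= e / 3.
  exists (e / 3 / (size (enum_fset J0)).+1%:R); first by rewrite divr_gt0.
  rewrite big_const_seq count_predT iter_addr_0 -[_ *+ size _]mulr_natr -(mulrA (e / 3)).
  apply: ler_piMr; first exact: ltW.
  by rewrite mulrC ler_pdivrMr // mul1r ler_nat.
have near_all : \forall t \near F, forall i, i \in J0 -> nm (x t i - y i) <= d.
  have : \forall t \near F, forall i, i \in enum_fset J0 -> nm (x t i - y i) <= d.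
    elim: (enum_fset J0) => [|j s IH]; first by apply: filterE => t i; rewrite inE.
    apply: filterS2 (xy j d d0) IH => t h1 h2 i; rewrite inE => /predU1P[->//|].
    exact: h2.
  by apply: filterS => t h i; apply: h.
apply: filterS3 xb xL near_all => t h1 h2 h3.
have k1 := HJ0 _ _ h1 h2; have k2 := HJ0 _ _ yb yl.
have -> : e = e / 3 + (e / 3 + e / 3) by field.
apply: le_trans (nmBD (\sum_(i <- J0) x t i) _ _) _; apply: lerD => //.
apply: le_trans (nmBD (\sum_(i <- J0) y i) _ _) _; apply: lerD; last by rewrite nmC.
rewrite -sumrB; apply: le_trans (nm_sum _ _ _) _; apply: le_trans hd.
by rewrite big_seq [leRHS]big_seq; apply: ler_sum => i /h3.
Qed.

Lemma has_sum_inj (I J : choiceType) (f : I -> J) (x : J -> C) (l : C) :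
  injective f -> (forall j, (forall i, j <> f i) -> x j = 0) ->
  has_sum x l <-> has_sum (fun i => x (f i)) l.
Proof.
move=> fI x0.
have img (K : {fset I}) : \sum_(j <- f @` K) x j = \sum_(i <- K) x (f i).
  by rewrite big_imfset //= => a c _ _; apply: fI.
have pre (K : {fset J}) : exists K' : {fset I}, forall i, (i \in K') = (f i \in K).
  suff : exists K' : {fset I}, forall i, (i \in K') = (f i \in enum_fset K).
    by case=> K' h; exists K' => i; rewrite h.
  elim: (enum_fset K) => [|j s [K' IH]].
    by exists fset0 => i; rewrite !inE.
  have [[i0 ->]|h] := pselect (exists i0, j = f i0).
    by exists (i0 |` K') => i; rewrite !inE IH (inj_eq fI).
  exists K' => i; rewrite !inE IH; case: eqP => // e.
  by case: h; exists i.
split=> /has_sumP H; apply/has_sumP => e /H [K hK].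
  have [K' hK'] := pre K; exists K' => L KL.
  rewrite -img; suff <- : \sum_(j <- (f @` L `|` K)) x j = \sum_(j <- f @` L) x j.
    by apply: hK; apply: fsubsetUr.
  symmetry; apply: big_fset_incl; first exact: fsubsetUl.
  move=> j; rewrite inE => /orP[->//|jK] jL; apply: x0 => i ji; subst j.
  move/negP: jL; apply; apply/imfsetP; exists i => //=.
  by apply: (fsubsetP KL); rewrite hK'.
exists (f @` K) => L KL.
have [L' hL'] := pre L.
have -> : \sum_(j <- L) x j = \sum_(i <- L') x (f i).
  rewrite -img; symmetry; apply: big_fset_incl.
    by apply/fsubsetP => j /imfsetP[i /=]; rewrite hL' => h ->.
  move=> j jL jn; apply: x0 => i ji; subst j; move/negP: jn; apply.
  by apply/imfsetP; exists i => //=; rewrite hL'.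
apply: hK; apply/fsubsetP => i iK; rewrite hL'; apply: (fsubsetP KL).
by apply/imfsetP; exists i.
Qed.

Lemma sumb_inj (I J : choiceType) (f : I -> J) (b : I -> R) (b' : J -> R) (B : R) :
  injective f -> (forall i, b i <= b' (f i)) -> sumb b' B -> sumb b B.
Proof.
move=> fI bb HB K; apply: le_trans (HB (f @` K)).
rewrite big_imfset /=; last by move=> a c _ _; apply: fI.
by apply: ler_sum => i _.
Qed.

Lemma sumb_le (I : choiceType) (b b' : I -> R) (B : R) :
  (forall i, b i <= b' i) -> sumb b' B -> sumb b B.
Proof. exact: (@sumb_inj _ _ id). Qed.

Lemma sumbZ (I : choiceType) (b : I -> R) (B k : R) : 0 <= k ->
  sumb b B -> sumb (fun i => k * b i) (k * B).
Proof. by move=> k0 HB J; rewrite -mulr_sumr ler_wpM2l. Qed.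

(** Applied at one point of the half-plane, it turns convergence of an expansion into a growth bound
    for the coefficients. A term outside a good finite set is the difference of two partial sums
    close to the limit. *)
Lemma has_sum_bounded (I : choiceType) (x : I -> C) (l : C) :
  has_sum x l -> exists B, forall i, nm (x i) <= B.
Proof.
move=> /has_sumP /(_ 1 ltr01) [J0 H].
exists (\sum_(i <- J0) nm (x i) + 2) => i.
have [iJ|iJ] := boolP (i \in J0).
  rewrite (big_fsetD1 i) //= -addrA lerDl addr_ge0 // sumr_ge0 //.
have h1 := H _ (fsubset_refl J0).
have h2 : nm (\sum_(j <- (i |` J0)) x j - l) < 1 by apply: H; apply: fsubsetU1.
rewrite big_fsetU1 //= in h2.
have -> : x i = (x i + \sum_(j <- J0) x j - l) - (\sum_(j <- J0) x j - l) by ring.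
apply: le_trans (nmB _ _) _.
have : 0 <= \sum_(j <- J0) nm (x j) by apply: sumr_ge0.
lra.
Qed.

End UnorderedSums.

(** Kept over a general field: it is used over [C] for holomorphy and over [R] to feed the mean
    value theorem. *)
Lemma is_derive_eps (K : numFieldType) (f : K -> K) (x l : K) :
  (forall eps : K, 0 < eps -> exists2 d : K, 0 < d &
     forall h : K, `|h| < d -> `|f (x + h) - f x - l * h| <= eps * `|h|) ->
  is_derive x (1 : K) f l.
Proof.
move=> H.
have L : (h^-1 *: ((f \o shift x) (h *: (1 : K)) - f x) @[h --> 0^'] --> l)%classic.
  apply/cvgrPdist_le => eps e0; have [d d0 Hd] := H _ e0.
  near=> h.
  have h0 : h != 0 by near: h; apply: nbhs_dnbhs_neq.
  have hd : `|h| < d.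
    near: h; apply: dnbhs0_lt => //.
  have := Hd h hd.
  rewrite /= -[h *: 1]/(h * 1) mulr1 -[h^-1 *: _]/(h^-1 * _) [h + x]addrC.
  have -> : l - h^-1 * (f (x + h) - f x) = - (h^-1 * (f (x + h) - f x - l * h)).
    by field.
  rewrite normrN normrM normfV.
  have hn : 0 < `|h| by rewrite normr_gt0.
  by rewrite ler_pdivrMl // [eps * _]mulrC.
apply: DeriveDef; first by apply/cvg_ex; exists l.
exact: (cvg_lim _ L).
Unshelve. all: by end_near.
Qed.

Lemma derivable_eps (K : numFieldType) (f : K -> K) (x : K) :
  derivable f x 1 -> exists l : K, forall eps : K, 0 < eps -> exists2 d : K, 0 < d &
     forall h : K, `|h| < d -> `|f (x + h) - f x - l * h| <= eps * `|h|.
Proof.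
move=> /cvg_ex [/= l /cvgrPdist_le L]; exists l => eps e0.
have /nbhs_ballP [d d0 Hd] := L _ e0.
exists d => // h hd.
have [->|h0] := eqVneq h 0; first by rewrite addr0 subrr mulr0 subr0 !normr0 mulr0.
have := Hd h; rewrite /ball /= sub0r normrN => /(_ hd h0).
rewrite -[h *: 1]/(h * 1) mulr1 -[h^-1 *: _]/(h^-1 * _) [h + x]addrC.
have -> : l - h^-1 * (f (x + h) - f x) = - (h^-1 * (f (x + h) - f x - l * h)).
  by field.
by rewrite normrN normrM normfV mulrC ler_pdivrMr ?normr_gt0.
Qed.

(** * Complex differentiability *)

Section Derivatives.
Variable R : realType.
Local Notation C := (CC R).

Definition cderiv (f : C -> C) (z l : C) := forall eps : R, 0 < eps ->
  exists2 d : R, 0 < d &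
    forall h, nm h < d -> nm (f (z + h) - f z - l * h) <= eps * nm h.

Lemma cderiv_derivable (f : C -> C) (z l : C) : cderiv f z l -> derivable f z 1.
Proof.
move=> H; suff : is_derive z (1 : C) f l by case.
apply: is_derive_eps => eps e0.
have eR : eps = ofR (Re eps) by rewrite -[LHS](RRe_real (gtr0_real e0)).
have e0' : 0 < Re eps by rewrite -lt_ofR -eR.
have [d d0 Hd] := H _ e0'; exists (ofR d); first by rewrite -[0]ofR0 lt_ofR.
by move=> h; rewrite eR !normE lt_ofR -ofRM le_ofR; apply: Hd.
Qed.

Lemma derivable_cderiv (f : C -> C) (z : C) : derivable f z 1 -> exists l, cderiv f z l.
Proof.
move=> /derivable_eps [l H]; exists l => eps e0.
have e0' : 0 < ofR eps :> C by rewrite -[0]ofR0 lt_ofR.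
have [d d0 Hd] := H _ e0'.
have dR : d = ofR (Re d) by rewrite -[LHS](RRe_real (gtr0_real d0)).
exists (Re d); first by rewrite -lt_ofR -dR.
by move=> h hd; rewrite -le_ofR ofRM -!normE; apply: Hd; rewrite normE dR lt_ofR.
Qed.

Lemma cderiv_loc (f g : C -> C) z l (r : R) : 0 < r ->
  (forall w, nm (w - z) < r -> f w = g w) -> cderiv f z l -> cderiv g z l.
Proof.
move=> r0 fg H e e0; have [d d0 Hd] := H e e0.
exists (Num.min d r); first by rewrite lt_min d0 r0.
move=> h; rewrite lt_min => /andP[hd hr].
rewrite -!fg ?subrr ?nm0 //; first exact: Hd.
by rewrite addrAC subrr add0r.
Qed.

Lemma cderiv_H (f g : C -> C) z l : upper_half z ->
  (forall w, upper_half w -> f w = g w) -> cderiv f z l -> cderiv g z l.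
Proof.
move=> zH fg; apply: (@cderiv_loc _ _ _ _ (Im z)) => // w wz; apply: fg.
have := le_lt_trans (nm_Im _) wz; rewrite ImB ltr_norml /upper_half /=.
rewrite /upper_half /= in zH; lra.
Qed.

Lemma cderiv_unique f z l l' : cderiv f z l -> cderiv f z l' -> l = l'.
Proof.
move=> H H'; apply: eq_of_nm_small => e e0.
have e2 : 0 < e / 2 by rewrite divr_gt0.
have [d d0 Hd] := H _ e2; have [d' d'0 Hd'] := H' _ e2.
pose t := Num.min d d' / 2.
have t0 : 0 < t by rewrite divr_gt0 // lt_min d0.
have td : t < d by rewrite ltr_pdivrMr // (@le_lt_trans _ _ d) ?ge_min ?lexx // ltr_pMr // ltr1n.
have td' : t < d' by rewrite ltr_pdivrMr // (@le_lt_trans _ _ d') ?ge_min ?lexx ?orbT // ltr_pMr // ltr1n.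
have nt : nm (ofR t) = t by rewrite nm_ofR gtr0_norm.
have h1 := Hd (ofR t); have h2 := Hd' (ofR t); rewrite nt in h1 h2.
rewrite -(ler_pM2r t0) -{1}nt -nmM.
have -> : (l - l') * ofR t = (f (z + ofR t) - f z - l' * ofR t) - (f (z + ofR t) - f z - l * ofR t).
  by ring.
apply: le_trans (nmB _ _) _.
by rewrite [e]splitr mulrDl lerD ?h1 ?h2.
Qed.

Lemma cderiv_bound f z l : cderiv f z l -> exists2 d : R, 0 < d &
  forall h, nm h < d -> nm (f (z + h) - f z) <= (nm l + 1) * nm h.
Proof.
move=> /(_ 1 ltr01) [d d0 Hd]; exists d => // h /Hd hh.
rewrite -(subrK (l * h) (_ - _)); apply: le_trans (nmD _ _) _.
by rewrite nmM mulrDl addrC lerD.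
Qed.

Lemma cderiv_cont f z l : cderiv f z l -> forall eps : R, 0 < eps ->
  exists2 d : R, 0 < d & forall h, nm h < d -> nm (f (z + h) - f z) < eps.
Proof.
move=> /cderiv_bound [d d0 Hd] e e0.
have n0 : 0 < nm l + 1 by apply: (ltr_wpDl (nm_ge0 l)).
exists (Num.min d (e / (nm l + 1))); first by rewrite lt_min d0 divr_gt0.
move=> h; rewrite lt_min => /andP[/Hd h1]; rewrite ltr_pdivlMr // mulrC.
exact: le_lt_trans.
Qed.

Lemma cderiv_cst (c z : C) : cderiv (fun=> c) z 0.
Proof.
move=> e e0; exists 1 => // h _.
by rewrite subrr mul0r subr0 nm0 mulr_ge0 // ltW.
Qed.

Lemma cderiv_id z : cderiv id z 1.
Proof.
move=> e e0; exists 1 => // h _.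
have -> : id (z + h) - id z - 1 * h = 0 :> C by rewrite /= mul1r addrAC addrK subrr.
by rewrite nm0 mulr_ge0 // ltW.
Qed.

Lemma cderivD f g z l l' : cderiv f z l -> cderiv g z l' ->
  cderiv (fun w => f w + g w) z (l + l').
Proof.
move=> Hf Hg e e0; have e2 : 0 < e / 2 by rewrite divr_gt0.
have [d d0 Hd] := Hf _ e2; have [d' d'0 Hd'] := Hg _ e2.
exists (Num.min d d'); first by rewrite lt_min d0.
move=> h; rewrite lt_min => /andP[/Hd h1 /Hd' h2].
have -> : f (z + h) + g (z + h) - (f z + g z) - (l + l') * h =
  (f (z + h) - f z - l * h) + (g (z + h) - g z - l' * h) by ring.
by apply: le_trans (nmD _ _) _; rewrite [e]splitr mulrDl lerD.
Qed.

Lemma cderivM f g z l l' : cderiv f z l -> cderiv g z l' ->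
  cderiv (fun w => f w * g w) z (l * g z + f z * l').
Proof.
move=> Hf Hg e e0.
pose M := nm (f z) + nm (g z) + nm l + 1 + 1.
have M0 : 0 < M by rewrite /M; have := nm_ge0 (f z); have := nm_ge0 (g z); have := nm_ge0 l; lra.
have e3 : 0 < e / 3 / M by rewrite !divr_gt0.
have [d d0 Hd] := Hf _ e3; have [d' d'0 Hd'] := Hg _ e3.
have [c c0 Hc] := cderiv_cont Hg e3.
have [c' c'0 Hc'] := cderiv_cont Hg ltr01.
exists (Num.min (Num.min d d') (Num.min c c')); first by rewrite !lt_min d0 d'0 c0.
move=> h; rewrite !lt_min => /andP[/andP[/Hd h1 /Hd' h2] /andP[/Hc h3 /Hc' h4]].
have -> : f (z + h) * g (z + h) - f z * g z - (l * g z + f z * l') * h =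
  (f (z + h) - f z - l * h) * g (z + h) + f z * (g (z + h) - g z - l' * h)
   + l * h * (g (z + h) - g z) by ring.
have -> : e * nm h = e / 3 * nm h + e / 3 * nm h + e / 3 * nm h by field.
apply: le_trans (nmD _ _) _; apply: lerD.
  apply: le_trans (nmD _ _) _; apply: lerD.
    rewrite nmM; have gM : nm (g (z + h)) <= M.
      rewrite -(subrK (g z) (g (z + h))); apply: le_trans (nmD _ _) _.
      by rewrite /M; have := nm_ge0 (f z); have := nm_ge0 l; lra.
    apply: le_trans (ler_pM _ _ h1 gM) _ => //.
    by rewrite mulrAC divfK ?gt_eqF.
  rewrite nmM; have fM : nm (f z) <= M.
    by rewrite /M; have := nm_ge0 (g z); have := nm_ge0 l; lra.
  apply: le_trans (ler_pM _ _ fM h2) _ => //.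
  by rewrite mulrA [M * _]mulrC divfK ?gt_eqF.
rewrite !nmM; have lM : nm l <= M.
  by rewrite /M; have := nm_ge0 (g z); have := nm_ge0 (f z); lra.
rewrite mulrAC; apply: ler_wpM2r => //.
apply: le_trans (ler_pM _ _ lM (ltW h3)) _ => //.
by rewrite mulrC divfK ?gt_eqF.
Qed.

Lemma cderivZ c f z l : cderiv f z l -> cderiv (fun w => c * f w) z (c * l).
Proof.
move=> H; have := cderivM (cderiv_cst c z) H.
by rewrite mul0r add0r.
Qed.

Lemma cderivN f z l : cderiv f z l -> cderiv (fun w => - f w) z (- l).
Proof.
move=> /(cderivZ (-1)); rewrite mulN1r.
by under [X in cderiv X]funext do rewrite mulN1r.
Qed.

Lemma cderivB f g z l l' : cderiv f z l -> cderiv g z l' ->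
  cderiv (fun w => f w - g w) z (l - l').
Proof. by move=> Hf /cderivN; apply: cderivD. Qed.

Lemma cderiv_comp f g z l l' : cderiv f (g z) l -> cderiv g z l' ->
  cderiv (fun w => f (g w)) z (l * l').
Proof.
move=> Hf Hg e e0.
have [b b0 Hb] := cderiv_bound Hg.
have n0 : 0 < nm l' + 1 by apply: (ltr_wpDl (nm_ge0 l')).
have m0 : 0 < nm l + 1 by apply: (ltr_wpDl (nm_ge0 l)).
have e1 : 0 < e / 2 / (nm l' + 1) by rewrite !divr_gt0.
have e2 : 0 < e / 2 / (nm l + 1) by rewrite !divr_gt0.
have [d d0 Hd] := Hf _ e1; have [d' d'0 Hd'] := Hg _ e2.
have [c c0 Hc] := cderiv_cont Hg d0.
exists (Num.min (Num.min b d') c); first by rewrite !lt_min b0 d'0.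
move=> h; rewrite !lt_min => /andP[/andP[/Hb h1 /Hd' h2] /Hc /Hd h3].
have -> : f (g (z + h)) - f (g z) - l * l' * h =
  (f (g z + (g (z + h) - g z)) - f (g z) - l * (g (z + h) - g z))
  + l * (g (z + h) - g z - l' * h).
  by rewrite [g z + _]addrC subrK; ring.
apply: le_trans (nmD _ _) _; rewrite [e]splitr mulrDl; apply: lerD.
  apply: le_trans h3 _.
  apply: le_trans (ler_wpM2l (ltW e1) h1) _.
  by rewrite mulrA divfK ?gt_eqF.
rewrite nmM; apply: le_trans (ler_wpM2l (nm_ge0 l) h2) _.
rewrite mulrA ler_wpM2r // mulrCA ler_piMr ?divr_ge0 ?ltW //.
by rewrite ltr_pdivrMr // mul1r ltrDl.
Qed.

Lemma cderivV f z l : f z != 0 -> cderiv f z l ->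
  cderiv (fun w => (f w)^-1) z (- l / f z ^+ 2).
Proof.
move=> f0 Hf.
suff inv (a : C) : a != 0 -> cderiv (fun w => w^-1) a (- (a ^- 2)).
  by have := cderiv_comp (inv _ f0) Hf; rewrite mulNr mulrC -mulNr.
move=> a0 e e0.
have na : 0 < nm a by rewrite nm_gt0.
exists (Num.min (nm a / 2) (e * nm a ^+ 3 / 2)).
  by rewrite lt_min !divr_gt0 // mulr_gt0 // exprn_gt0.
move=> h; rewrite lt_min => /andP[h1 h2].
have ah : nm a / 2 <= nm (a + h).
  have := nm_ler a (- h); rewrite opprK nmN; lra.
have ah0 : a + h != 0 by rewrite -nm_gt0; apply: lt_le_trans ah; rewrite divr_gt0.
have -> : (a + h)^-1 - a^-1 - - a ^- 2 * h = h * (h * (a + h)^-1 / a ^+ 2).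
  by field; rewrite ah0 a0.
rewrite nmM mulrC ler_wpM2r // !nmM !nmV nmX.
rewrite ler_pdivrMr ?exprn_gt0 // ler_pdivrMr ?(lt_le_trans _ ah) ?divr_gt0 //.
apply: le_trans (ltW h2) _.
have -> : e * nm a ^+ 3 / 2 = e * nm a ^+ 2 * (nm a / 2) by field.
by rewrite ler_wpM2l // mulr_ge0 ?exprn_ge0 // ltW.
Qed.

Lemma cderivX f z l n : cderiv f z l ->
  cderiv (fun w => f w ^+ n) z (n%:R * l * f z ^+ n.-1).
Proof.
move=> Hf; elim: n => [|n IH].
  by rewrite !mul0r; apply: cderiv_cst.
have := cderivM Hf IH.
under [X in cderiv X]funext do rewrite -exprS.
congr cderiv; case: n {IH} => [|n] /=; first by rewrite !mul0r mulr0 addr0 mul1r expr0.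
by rewrite [in RHS]exprS -[in RHS]addn1 natrD exprS; ring.
Qed.

End Derivatives.

(** * The complex exponential *)

Section Exponential.
Variable R : realType.
Local Notation C := (CC R).

Lemma cexpD (z w : C) : cexp (z + w) = cexp z * cexp w.
Proof.
by apply: ceq; rewrite ?ReM ?ImM /cexp ReD ImD /= expRD ?cosD ?sinD; ring.
Qed.

Lemma cexp0 : cexp 0 = 1 :> C.
Proof. by apply: ceq; rewrite /cexp /= expR0 ?cos0 ?sin0 ?mulr1 ?mulr0. Qed.

Lemma nm_cexp (z : C) : nm (cexp z) = expR (Re z).
Proof.
apply/eqP; rewrite -(eqrXn2 (n := 2)) ?expR_ge0 // nm2 /cexp /=.
by rewrite !exprMn -mulrDr cos2Dsin2 mulr1.
Qed.

Lemma real_deriv_eps (f : R -> R) (x l : R) : is_derive x 1 f l ->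
  forall eps : R, 0 < eps -> exists2 d : R, 0 < d &
     forall h, `|h| < d -> `|f (x + h) - f x - l * h| <= eps * `|h|.
Proof.
move=> [df dl]; have [l' H] := derivable_eps df.
suff -> : l = l' by [].
rewrite -dl; have := is_derive_eps H; case=> _ <- //.
Qed.

Lemma cderiv_cexp (z : C) : cderiv (@cexp R) z (cexp z).
Proof.
(* The functional equation reduces differentiability to the origin. *)
suff d0 : cderiv (@cexp R) (0 : C) 1.
  move=> e e0; have e1 : 0 < e / (nm (cexp z)) by rewrite divr_gt0 // nm_cexp expR_gt0.
  have [d dd Hd] := d0 _ e1; exists d => // h /Hd.
  rewrite add0r cexp0 mul1r => hh.
  have -> : cexp (z + h) - cexp z - cexp z * h = cexp z * (cexp h - 1 - h).
    by rewrite cexpD; ring.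
  rewrite nmM; apply: le_trans (ler_wpM2l _ hh) _ => //.
  by rewrite mulrA [nm _ * _]mulrC divfK // nm_cexp gt_eqF ?expR_gt0.
move=> e e0.
have e6 : 0 < Num.min 1 (e / 6) by rewrite lt_min ltr01 divr_gt0.
have He := real_deriv_eps (is_derive_expR (0 : R)) e6.
have Hc := real_deriv_eps (is_derive_cos (0 : R)) e6.
have Hs := real_deriv_eps (is_derive_sin (0 : R)) e6.
rewrite expR0 in He; rewrite sin0 cos0 in Hc; rewrite cos0 sin0 in Hs.
move: He Hc Hs => [d1 d10 H1] [d2 d20 H2] [d3 d30 H3].
exists (Num.min (Num.min d1 d2) (Num.min d3 (Num.min 1 (e / 6)))).
  by rewrite !lt_min d10 d20 d30 ltr01 divr_gt0.
move=> h; rewrite !lt_min => /andP[/andP[h1 h2] /andP[h3 /andP[h4 h5]]].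
set a := Re h; set b := Im h.
have ah := nm_Re h; have bh := nm_Im h; rewrite -/a -/b in ah bh.
have k1 : `|expR a - 1 - a| <= e / 6 * nm h.
  have := H1 a (le_lt_trans ah h1); rewrite add0r mul1r => k.
  by apply: le_trans k _; apply: ler_pM => //; rewrite ?ge_min ?lexx ?orbT // ltW.
have k2 : `|cos b - 1| <= Num.min 1 (e / 6) * nm h.
  have := H2 b (le_lt_trans bh h2); rewrite add0r oppr0 mul0r subr0 => k.
  by apply: le_trans k _; rewrite ler_wpM2l // ltW.
have k3 : `|sin b - b| <= Num.min 1 (e / 6) * nm h.
  have := H3 b (le_lt_trans bh h3); rewrite add0r mul1r subr0 => k.
  by apply: le_trans k _; rewrite ler_wpM2l // ltW.
rewrite add0r cexp0 mul1r.
(* With h = a + ib the remainder is (e^a - 1 - a) e^(ib) + (1 + a)(e^(ib) - 1 - ib) + iab, and each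
   piece is o(h). *)
have -> : cexp h - 1 - h = ofR (expR a - 1 - a) * Complex (cos b) (sin b)
   + ofR (1 + a) * Complex (cos b - 1) (sin b - b) + imagi R * ofR (a * b).
  by apply: ceq; rewrite ?(ReD, ImD, ReN, ImN, ReM, ImM) /= -?/a -?/b; ring.
have n1 : nm (Complex (cos b) (sin b) : C) = 1.
  by rewrite /nm /= cos2Dsin2 sqrtr1.
have n2 : nm (Complex (cos b - 1) (sin b - b) : C) <= (e / 6 + e / 6) * nm h.
  apply: le_trans (nm_leRI _) _; rewrite /= mulrDl; apply: lerD.
    by apply: le_trans k2 _; rewrite ler_wpM2r // ge_min lexx orbT.
  by apply: le_trans k3 _; rewrite ler_wpM2r // ge_min lexx orbT.
have n3 : `|1 + a| <= 2.
  apply: le_trans (ler_normD _ _) _; rewrite normr1 -[2]/(1 + 1) lerD2l.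
  exact: le_trans ah (ltW h4).
have -> : e * nm h = e / 6 * nm h + (2 * ((e / 6 + e / 6) * nm h) + e / 6 * nm h) by field.
apply: le_trans (nmD _ _) _.
apply: le_trans (lerD (nmD _ _) (lexx _)) _.
rewrite !nmM nm_i n1 !nm_ofR mulr1 mul1r -addrA.
have n4 : `|a * b| <= e / 6 * nm h.
  by rewrite normrM; apply: ler_pM => //; apply: le_trans ah (ltW h5).
have n5 : `|1 + a| * nm (Complex (cos b - 1) (sin b - b) : C) <= 2 * ((e / 6 + e / 6) * nm h).
  by apply: ler_pM.
by apply: lerD k1 (lerD n5 n4).
Qed.

Lemma eD (z w : C) : e (z + w) = e z * e w.
Proof. by rewrite /e mulrDr cexpD. Qed.
Lemma e_0 : e 0 = 1 :> C. Proof. by rewrite /e mulr0 cexp0. Qed.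
Lemma nm_e (z : C) : nm (e z) = expR (- (2 * pi * Im z)).
Proof.
rewrite /e nm_cexp; congr expR.
rewrite -(ofR_nat R 2) -!mulrA !Re_ofRM Re_Mi; ring.
Qed.
Lemma e_neq0 (z : C) : e z != 0.
Proof. by rewrite -nm_gt0 nm_e expR_gt0. Qed.
Lemma eN (z : C) : e (- z) = (e z)^-1.
Proof. by apply: (mulfI (e_neq0 z)); rewrite -eD subrr e_0 divff ?e_neq0. Qed.
Lemma eB (z w : C) : e (z - w) = e z / e w.
Proof. by rewrite eD eN. Qed.
Lemma eMn (n : nat) (z : C) : e (n%:R * z) = e z ^+ n.
Proof.
elim: n => [|n IH]; first by rewrite mul0r e_0 expr0.
by rewrite -addn1 natrD mulrDl mul1r eD IH exprD.
Qed.
Lemma e_half : e (2^-1) = -1 :> C.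
Proof.
rewrite /e (_ : 2 * _ * _ / 2 = ofR pi * imagi R); last by field.
apply: ceq; rewrite /cexp ?ReN ?ImN /= ?(mulr0, mulr1, mul0r, subr0, subrr, addr0, add0r).
  by rewrite oppr0 expR0 cospi mul1r.
by rewrite sinpi mulr0 oppr0.
Qed.
Lemma e_1 : e 1 = 1 :> C.
Proof.
have h : e (2^-1 + 2^-1) = 1 :> C by rewrite eD e_half mulrNN mulr1.
by rewrite -[RHS]h; congr e; field.
Qed.
Lemma e_quarter : e (4^-1) = imagi R.
Proof.
rewrite /e (_ : 2 * _ * _ / 4 = ofR (pi / 2) * imagi R); last first.
  by rewrite ofRM ofRV (ofR_nat R 2); field.
apply: ceq; rewrite /cexp /= ?(mulr0, mulr1, mul0r, subr0, subrr, addr0, add0r).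
  by rewrite oppr0 expR0 cos_pihalf mulr0.
by rewrite oppr0 expR0 sin_pihalf mulr1.
Qed.
Lemma e_nat n : e n%:R = 1 :> C.
Proof. by rewrite -[n%:R]mulr1 eMn e_1 expr1n. Qed.
Lemma e_int (n : int) : e n%:~R = 1 :> C.
Proof. by case: n => n; rewrite ?NegzE ?mulrNz ?eN -?pmulrn ?e_nat ?invr1. Qed.
Lemma e_addint (z : C) (n : int) : e (z + n%:~R) = e z.
Proof. by rewrite eD e_int mulr1. Qed.
Lemma eMz (n : int) (z : C) : e (n%:~R * z) = e z ^ n.
Proof.
case: n => n; first by rewrite -pmulrn eMn.
by rewrite NegzE mulrNz mulNr eN -pmulrn eMn.
Qed.

Lemma cderiv_e (l z : C) :
  cderiv (fun w => e (l * w)) z (2 * ofR pi * imagi R * l * e (l * z)).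
Proof.
have h : cderiv (fun w : C => 2 * ofR pi * imagi R * (l * w)) z (2 * ofR pi * imagi R * (l * 1)).
  by apply: cderivZ; apply: cderivZ; apply: cderiv_id.
have := cderiv_comp (cderiv_cexp _) h.
by rewrite mulr1 [X in cderiv _ _ X]mulrC.
Qed.

End Exponential.

(** * Mean value and Taylor estimates *)

Section MeanValue.
Variable R : realType.
Local Notation C := (CC R).

Definition Uconv (U : C -> Prop) := forall a b (t : R), U a -> U b ->
  0 <= t <= 1 -> U (a + ofR t * (b - a)).

(** The real mean value theorem is applied to the real and to the imaginary part along the segment.
    The intermediate points differ, hence the factor 2. *)
Lemma mean_value (f f1 : C -> C) (M : R) (a b : C) :
  (forall t : R, 0 <= t <= 1 ->
     cderiv f (a + ofR t * (b - a)) (f1 (a + ofR t * (b - a))) /\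
     nm (f1 (a + ofR t * (b - a))) <= M) ->
  nm (f b - f a) <= 2 * M * nm (b - a).
Proof.
move=> H; pose p t := a + ofR t * (b - a).
have one (g : C -> R) : (forall z w, g (z - w) = g z - g w) ->
    (forall x z, g (ofR x * z) = x * g z) -> (forall z, `|g z| <= nm z) ->
    `|g (f b - f a)| <= M * nm (b - a).
  move=> gB gZ gn.
  have der (t : R) : 0 <= t <= 1 -> is_derive t 1 (fun t => g (f (p t))) (g (f1 (p t) * (b - a))).
    move=> /H [h1 _]; apply: is_derive_eps => eps e0.
    have n0 : 0 < nm (b - a) + 1 by apply: (ltr_wpDl (nm_ge0 (b - a))).
    have [d d0 Hd] := h1 _ (divr_gt0 e0 n0).
    exists (d / (nm (b - a) + 1)); first by rewrite divr_gt0.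
    move=> h; rewrite ltr_pdivlMr // => hd.
    have hn : nm (ofR h * (b - a)) <= `|h| * (nm (b - a) + 1).
      by rewrite nmM nm_ofR ler_wpM2l // lerDl.
    have := Hd _ (le_lt_trans hn hd).
    have -> : a + ofR t * (b - a) + ofR h * (b - a) = p (t + h).
      by rewrite /p ofRD; ring.
    rewrite -/(p t) => k.
    have -> : g (f (p (t + h))) - g (f (p t)) - g (f1 (p t) * (b - a)) * h =
      g (f (p (t + h)) - f (p t) - f1 (p t) * (ofR h * (b - a))).
      by rewrite !gB mulrCA gZ [h * _]mulrC.
    apply: le_trans (gn _) _; apply: le_trans k _.
    apply: le_trans (ler_wpM2l _ hn) _; first by rewrite divr_ge0 // ltW.
    by rewrite (mulrC `|h|) mulrA divfK ?gt_eqF.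
  have cont : ({within `[0, 1], continuous (fun t => g (f (p t)))})%classic.
    apply: continuous_in_subspaceT => t; rewrite inE /= in_itv /= => ht.
    apply: differentiable_continuous; apply/derivable1_diffP.
    by have [] := der t ht.
  have der' : forall t : R, t \in `]0, 1[ -> is_derive t 1 (fun t => g (f (p t))) (g (f1 (p t) * (b - a))).
    by move=> t; rewrite in_itv /= => /andP[t0 t1]; apply: der; rewrite !ltW.
  have [c] := MVT_segment ler01 der' cont.
  rewrite in_itv /= => ct.
  rewrite -gB subr0 mulr1 (_ : p 1 = b); last by rewrite /p mul1r addrC subrK.
  rewrite (_ : p 0 = a); last by rewrite /p mul0r addr0.
  move=> ->; apply: le_trans (gn _) _; rewrite nmM ler_wpM2r //.
  by have [] := H c ct.
apply: le_trans (nm_leRI _) _.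
rewrite mulrDl mul1r mulrDl; apply: lerD.
  by apply: one; [exact: ReB | exact: Re_ofRM | exact: nm_Re].
by apply: one; [exact: ImB | exact: Im_ofRM | exact: nm_Im].
Qed.

Lemma const_on_convex (U : C -> Prop) (f : C -> C) : Uconv U ->
  (forall z, U z -> cderiv f z 0) -> forall a b, U a -> U b -> f a = f b.
Proof.
move=> Uc H a b Ua Ub; apply: eq_of_nm_small => eps e0.
have := @mean_value f (fun=> 0) 0 b a.
rewrite mulr0 mul0r => h; apply: le_trans (h _) (ltW e0) => t t01.
by rewrite nm0; split=> //; apply: H; apply: Uc.
Qed.

(** [mean_value] is used twice, for [f] minus its linear part and for [f1]; each use costs a factor
    2. *)
Lemma taylor2 (U : C -> Prop) (f f1 f2 : C -> C) (M : R) : Uconv U -> 0 <= M ->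
  (forall z, U z -> [/\ cderiv f z (f1 z), cderiv f1 z (f2 z) & nm (f2 z) <= M]) ->
  forall z w, U z -> U w -> nm (f w - f z - f1 z * (w - z)) <= 4 * M * nm (w - z) ^+ 2.
Proof.
move=> Uc M0 H z w Uz Uw.
pose g v := f v - f1 z * v.
have -> : f w - f z - f1 z * (w - z) = g w - g z by rewrite /g; ring.
have -> : 4 * M * nm (w - z) ^+ 2 = 2 * (2 * M * nm (w - z)) * nm (w - z) by ring.
apply: (@mean_value g (fun v => f1 v - f1 z * 1)) => t t01.
have [h1 h2 h3] := H _ (Uc _ _ _ Uz Uw t01).
split; first by apply: cderivB => //; apply: cderivZ; apply: cderiv_id.
rewrite mulr1; have := @mean_value f1 f2 M z (z + ofR t * (w - z)).
move=> k; apply: le_trans (k _) _ => [u u01|].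
  rewrite addrAC subrr add0r mulrA -ofRM.
  have tu : 0 <= u * t <= 1.
    move/andP: u01 => [? ?]; move/andP: t01 => [? ?].
    by rewrite mulr_ge0 //= mulr_ile1.
  by have [? ? ?] := H _ (Uc _ _ _ Uz Uw tu).
rewrite addrAC subrr add0r nmM nm_ofR ler_wpM2l ?mulr_ge0 //.
by move/andP: t01 => [t0 t1]; rewrite ger0_norm // ler_piMl.
Qed.

End MeanValue.

Section Good.
Variable R : realType.
Local Notation C := (CC R).

(* Taylor's formula with an explicit constant. The constants add up, so a series of
   such functions stays in the class; Cauchy's integral is not needed for that. *)
Definition good (U : C -> Prop) (f f1 : C -> C) (K : R) :=
  [/\ 0 <= K, forall z, U z -> nm (f z) <= K, forall z, U z -> nm (f1 z) <= K &
      forall z w, U z -> U w -> nm (w - z) <= 1 ->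
        nm (f w - f z - f1 z * (w - z)) <= K * nm (w - z) ^+ 2].

Definition strip (y1 y2 : R) (z : C) := y1 <= Im z <= y2.
Definition box (B y1 y2 : R) (z : C) := `|Re z| <= B /\ y1 <= Im z <= y2.

Lemma convex_box B y1 y2 : Uconv (box B y1 y2).
Proof.
move=> a b t [ha /andP[a1 a2]] [hb /andP[b1 b2]] /andP[t0 t1].
have cv (x y lo hi : R) : lo <= x <= hi -> lo <= y <= hi -> lo <= x + t * (y - x) <= hi.
  move=> /andP[? ?] /andP[? ?]; apply/andP; split; nra.
split; last by rewrite ImD Im_ofRM ImB; apply: cv; apply/andP.
by rewrite ReD Re_ofRM ReB ler_norml; apply: cv; rewrite -ler_norml.
Qed.

Lemma convex_strip y1 y2 : Uconv (strip y1 y2).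
Proof.
move=> a b t /andP[a1 a2] /andP[b1 b2] /andP[t0 t1].
by rewrite /strip ImD Im_ofRM ImB; apply/andP; split; nra.
Qed.

Lemma convex_H : Uconv (@upper_half R).
Proof.
rewrite /upper_half => a b t /= a0 b0 /andP[t0 t1].
by rewrite ImD Im_ofRM ImB; nra.
Qed.

Lemma good_sub (U V : C -> Prop) f f1 K : (forall z, V z -> U z) ->
  good U f f1 K -> good V f f1 K.
Proof.
move=> VU [K0 h1 h2 h3]; split=> // [z /VU|z /VU|z w /VU Uz /VU Uw]; [exact: h1|exact: h2|exact: h3].
Qed.

Lemma good_le (U : C -> Prop) f f1 K L : K <= L -> good U f f1 K -> good U f f1 L.
Proof.
move=> KL [K0 h1 h2 h3]; split; first exact: le_trans KL.
- by move=> z /h1 h; apply: le_trans KL.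
- by move=> z /h2 h; apply: le_trans KL.
- move=> z w Uz Uw d1; apply: le_trans (h3 _ _ Uz Uw d1) _.
  by rewrite ler_wpM2r // exprn_ge0.
Qed.

Lemma good_ext (U : C -> Prop) f f1 g K : (forall z, U z -> f z = g z) ->
  good U f f1 K -> good U g f1 K.
Proof.
move=> fg [K0 h1 h2 h3]; split=> //.
- by move=> z Uz; rewrite -fg //; apply: h1.
- by move=> z w Uz Uw; rewrite -!fg //; apply: h3.
Qed.

Lemma goodD (U : C -> Prop) f f1 K g g1 L : good U f f1 K -> good U g g1 L ->
  good U (fun z => f z + g z) (fun z => f1 z + g1 z) (K + L).
Proof.
move=> [K0 h1 h2 h3] [L0 k1 k2 k3]; split; first exact: addr_ge0.
- by move=> z Uz; apply: le_trans (nmD _ _) _; apply: lerD; [apply: h1|apply: k1].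
- by move=> z Uz; apply: le_trans (nmD _ _) _; apply: lerD; [apply: h2|apply: k2].
- move=> z w Uz Uw d1.
  have -> : f w + g w - (f z + g z) - (f1 z + g1 z) * (w - z) =
    (f w - f z - f1 z * (w - z)) + (g w - g z - g1 z * (w - z)) by ring.
  by apply: le_trans (nmD _ _) _; rewrite mulrDl; apply: lerD; [apply: h3|apply: k3].
Qed.

Lemma goodM (U : C -> Prop) f f1 K g g1 L : good U f f1 K -> good U g g1 L ->
  good U (fun z => f z * g z) (fun z => f1 z * g z + f z * g1 z) (4 * (K * L)).
Proof.
move=> [K0 h1 h2 h3] [L0 k1 k2 k3].
have KL : 0 <= K * L by apply: mulr_ge0.
split; first by rewrite mulr_ge0.
- by move=> z Uz; rewrite nmM; have := ler_pM (nm_ge0 _) (nm_ge0 _) (h1 z Uz) (k1 z Uz); lra.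
- move=> z Uz; apply: le_trans (nmD _ _) _; rewrite !nmM.
  have := ler_pM (nm_ge0 _) (nm_ge0 _) (h2 z Uz) (k1 z Uz).
  have := ler_pM (nm_ge0 _) (nm_ge0 _) (h1 z Uz) (k2 z Uz); lra.
- move=> z w Uz Uw d1; set h := w - z.
  have -> : f w * g w - f z * g z - (f1 z * g z + f z * g1 z) * h =
    (f w - f z - f1 z * h) * g w + f z * (g w - g z - g1 z * h)
    + f1 z * h * ((g w - g z - g1 z * h) + g1 z * h) by ring.
  have n0 : 0 <= nm h ^+ 2 by apply: exprn_ge0.
  have e1 : nm ((f w - f z - f1 z * h) * g w) <= K * nm h ^+ 2 * L.
    by rewrite nmM; apply: ler_pM => //; [apply: h3 | apply: k1].
  have e2 : nm (f z * (g w - g z - g1 z * h)) <= K * (L * nm h ^+ 2).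
    by rewrite nmM; apply: ler_pM => //; [apply: h1 | apply: k3].
  have e3 : nm (f1 z * h * ((g w - g z - g1 z * h) + g1 z * h)) <=
      K * nm h * (L * nm h + L * nm h).
    rewrite 2!nmM; apply: ler_pM => //; first exact: mulr_ge0.
      by rewrite ler_wpM2r //; apply: h2.
    apply: le_trans (nmD _ _) _; apply: lerD.
      apply: le_trans (k3 _ _ Uz Uw d1) _.
      by rewrite ler_wpM2l // expr2 ler_piMr.
    by rewrite nmM ler_wpM2r //; apply: k2.
  apply: le_trans (nmD _ _) _; apply: le_trans (lerD (nmD _ _) (lexx _)) _.
  have -> : 4 * (K * L) * nm h ^+ 2 = K * nm h ^+ 2 * L + K * (L * nm h ^+ 2)
     + K * nm h * (L * nm h + L * nm h) by ring.
  by apply: lerD => //; apply: lerD.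
Qed.

Lemma goodZ (U : C -> Prop) f f1 K c : good U f f1 K ->
  good U (fun z => c * f z) (fun z => c * f1 z) (nm c * K).
Proof.
move=> [K0 h1 h2 h3]; split; first exact: mulr_ge0.
- by move=> z Uz; rewrite nmM ler_wpM2l //; apply: h1.
- by move=> z Uz; rewrite nmM ler_wpM2l //; apply: h2.
- move=> z w Uz Uw d1.
  have -> : c * f w - c * f z - c * f1 z * (w - z) = c * (f w - f z - f1 z * (w - z)) by ring.
  by rewrite nmM -mulrA ler_wpM2l //; apply: h3.
Qed.

(** The summands that occur are products of powers and exponentials, whose logarithmic derivative
    [rho] is polynomial or rational and easy to bound. The second derivative is then t (rho^2 +
    rho'). *)
Lemma good_rho (U : C -> Prop) (t rho rho1 : C -> C) (b r r' : R) : Uconv U ->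
  0 <= b -> 0 <= r -> 0 <= r' ->
  (forall z, U z -> [/\ cderiv t z (t z * rho z), cderiv rho z (rho1 z),
      nm (t z) <= b, nm (rho z) <= r & nm (rho1 z) <= r']) ->
  good U t (fun z => t z * rho z) (b * (1 + r + 4 * (r ^+ 2 + r'))).
Proof.
move=> Uc b0 r0 r0' H.
have r2 : 0 <= r ^+ 2 by apply: exprn_ge0.
have br : 0 <= b * r by apply: mulr_ge0.
have br2 : 0 <= b * r ^+ 2 by apply: mulr_ge0.
have br' : 0 <= b * r' by apply: mulr_ge0.
have E : b * (1 + r + 4 * (r ^+ 2 + r')) = b + b * r + 4 * (b * r ^+ 2 + b * r') by ring.
rewrite E; split; first lra.
- by move=> z /H [_ _ h _ _]; lra.
- move=> z /H [_ _ h1 h2 _]; rewrite nmM.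
  have := ler_pM (nm_ge0 _) (nm_ge0 _) h1 h2; lra.
- move=> z w Uz Uw _.
  apply: le_trans (taylor2 (f1 := fun z => t z * rho z)
     (f2 := fun z => (t z * rho z) * rho z + t z * rho1 z)
     (M := b * r ^+ 2 + b * r') Uc _ _ Uz Uw) _; first lra.
    move=> v /H [h1 h2 h3 h4 h5]; split=> //; first exact: cderivM.
    apply: le_trans (nmD _ _) _; rewrite !nmM; apply: lerD.
      by rewrite expr2 mulrA; apply: ler_pM => //; [apply: mulr_ge0 | apply: ler_pM].
    by apply: ler_pM.
  by rewrite ler_wpM2r ?exprn_ge0 //; lra.
Qed.

(** The Taylor remainder is linear in the function, so remainders add up termwise; the termwise
    derivative becomes the derivative of the sum without an interchange of limits. *)
Lemma good_series (I : choiceType) (U : C -> Prop) (t t1 : I -> C -> C)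
    (b : I -> R) (B : R) (f : C -> C) :
  (forall i, good U (t i) (t1 i) (b i)) -> sumb b B ->
  (forall z, U z -> has_sum (fun i => t i z) (f z)) ->
  good U f (fun z => summability.sum (fun i => t1 i z)) B.
Proof.
move=> H HB Hf.
have b0 i : 0 <= b i by case: (H i).
have B0 : 0 <= B by have := HB fset0; rewrite big_seq_fset0.
have Hf1 z : U z -> has_sum (fun i => t1 i z) (summability.sum (fun i => t1 i z)).
  by move=> Uz; apply: sum_has_sum HB => i; case: (H i) => _ _ + _; apply.
split=> // [z Uz|z Uz|z w Uz Uw d1].
- apply: has_sum_le (Hf z Uz) _ => J; apply: le_trans (HB J).
  by apply: ler_sum => i _; case: (H i) => _ + _ _; apply.
- apply: has_sum_le (Hf1 z Uz) _ => J; apply: le_trans (HB J).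
  by apply: ler_sum => i _; case: (H i) => _ _ + _; apply.
have S : has_sum (fun i => t i w - t i z - t1 i z * (w - z))
    (f w - f z - summability.sum (fun i => t1 i z) * (w - z)).
  apply: has_sumB; first by apply: has_sumB; apply: Hf.
  rewrite [X in has_sum _ X]mulrC; apply: eq_has_sum (has_sumZ (c := w - z) (Hf1 z Uz)) => i.
  by rewrite mulrC.
apply: has_sum_le S _ => J; apply: le_trans (_ : (\sum_(i <- J) b i) * nm (w - z) ^+ 2 <= _).
  rewrite mulr_suml; apply: ler_sum => i _; case: (H i) => _ _ _; exact.
by rewrite ler_wpM2r ?exprn_ge0.
Qed.

(** The boxes exhaust the half-plane. The constant may depend on the box, since the series converge
    only locally uniformly. *)
Definition goodH (f : C -> C) := forall B y1 y2 : R, 0 < y1 ->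
  exists f1 K, good (box B y1 y2) f f1 K.

Lemma good_cderiv (U : C -> Prop) f f1 K z (r : R) : good U f f1 K -> 0 < r ->
  (forall w, nm (w - z) < r -> U w) -> cderiv f z (f1 z).
Proof.
move=> [K0 _ _ h3] r0 Ur e e0.
have K1 : 0 < K + 1 by apply: (ltr_wpDl K0).
exists (Num.min (Num.min r 1) (e / (K + 1))).
  by rewrite !lt_min r0 ltr01 divr_gt0.
move=> h; rewrite !lt_min => /andP[/andP[hr h1] h2].
have E : z + h - z = h by rewrite addrAC subrr add0r.
have := h3 z (z + h); rewrite E => k.
apply: le_trans (k _ _ (ltW h1)) _; first by apply: Ur; rewrite subrr nm0.
  by apply: Ur; rewrite E.
rewrite expr2 mulrA ler_wpM2r //.
move: h2; rewrite ltr_pdivlMr // => h2; apply: le_trans (ltW h2).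
by rewrite mulrDr mulr1 mulrC lerDl.
Qed.

Lemma goodH_cderiv f z : goodH f -> upper_half z -> exists l, cderiv f z l.
Proof.
move=> H; rewrite /upper_half /= => z0.
have z2 : 0 < Im z / 2 by rewrite divr_gt0.
have [f1 [K g]] := H (`|Re z| + Im z) (Im z / 2) (2 * Im z) z2.
exists (f1 z); apply: good_cderiv g z2 _ => w wz.
have h1 := le_lt_trans (nm_Re _) wz; have h2 := le_lt_trans (nm_Im _) wz.
rewrite ReB in h1; rewrite ImB in h2.
have h3 : `|Re w| <= `|Re w - Re z| + `|Re z| by rewrite -{1}(subrK (Re z) (Re w)) ler_normD.
by move: h2; rewrite ltr_norml; split; lra.
Qed.

Lemma goodH_holomorphic f : goodH f -> holomorphic_on_H f.
Proof. by move=> H z /(goodH_cderiv H) [l]; apply: cderiv_derivable. Qed.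

Lemma goodHD f g : goodH f -> goodH g -> goodH (fun z => f z + g z).
Proof.
move=> Hf Hg B y1 y2 y0; have [f1 [K h]] := Hf B y1 y2 y0.
have [g1 [L k]] := Hg B y1 y2 y0.
by do 2!eexists; apply: goodD h k.
Qed.

Lemma goodHZ c f : goodH f -> goodH (fun z => c * f z).
Proof.
move=> Hf B y1 y2 y0; have [f1 [K h]] := Hf B y1 y2 y0.
by do 2!eexists; apply: goodZ h.
Qed.

Lemma goodH_sum (T : Type) (r : seq T) (f : T -> C -> C) :
  (forall t, goodH (f t)) -> goodH (fun z => \sum_(t <- r) f t z).
Proof.
move=> H; elim: r => [|t r IH].
  move=> B y1 y2 y0; exists (fun=> 0), 0; split=> //.
  - by move=> z _; rewrite big_nil nm0.
  - by move=> z _; rewrite nm0.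
  - by move=> z w _ _ _; rewrite !big_nil !mul0r !subr0 nm0.
move=> B y1 y2 y0.
have [f1 [K h]] := goodHD (H t) IH B y2 y0.
by exists f1, K; apply: good_ext h => z _; rewrite big_cons.
Qed.

Lemma goodH_ext f g : (forall z, upper_half z -> f z = g z) -> goodH f -> goodH g.
Proof.
move=> fg Hf B y1 y2 y0; have [f1 [K h]] := Hf B y1 y2 y0.
exists f1, K; apply: good_ext h => z [_ /andP[hz _]]; apply: fg.
exact: lt_le_trans y0 hz.
Qed.

Lemma good_exp (l : C) (U : C -> Prop) (b : R) : Uconv U -> 0 <= b ->
  (forall z, U z -> nm (e (l * z)) <= b) ->
  exists f1 K, good U (fun z => e (l * z)) f1 K.
Proof.
move=> Uc b0 H; exists (fun z => e (l * z) * (2 * ofR pi * imagi R * l)).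
eexists; apply: (@good_rho U _ (fun=> 2 * ofR pi * imagi R * l) (fun=> 0) b
  (nm (2 * ofR pi * imagi R * l)) 0) => // z Uz.
split=> //; [|exact: cderiv_cst|exact: H|by rewrite nm0].
by rewrite mulrC; apply: cderiv_e.
Qed.

End Good.

(** * Fourier series *)

Section Mean.
Variable R : realType.
Local Notation C := (CC R).

Definition avg (N : nat) (f : C -> C) (z : C) : C :=
  N%:R^-1 * \sum_(j < N) f (z + ofR (j%:R / N%:R)).

(* Stands for the integral of f over the segment from z to z + 1: for a 1-periodic
   f the Riemann sums converge at the rate 1/N. *)
Definition is_mean (f : C -> C) (z l : C) := exists2 c : R, 0 <= c &
  forall N, (0 < N)%N -> nm (avg N f z - l) <= c / N%:R.

Lemma sum_ord_mul (V : nmodType) (N M : nat) (F : nat -> V) :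
  \sum_(j < N * M) F j = \sum_(i < M) \sum_(a < N) F (a * M + i)%N.
Proof.
rewrite exchange_big /=; elim: N => [|N IH]; first by rewrite !big_ord0.
by rewrite big_ord_recr /= -IH mulSnr big_split_ord.
Qed.

Lemma avg_bound N f z (M : R) : (0 < N)%N ->
  (forall j : 'I_N, nm (f (z + ofR (j%:R / N%:R))) <= M) -> nm (avg N f z) <= M.
Proof.
move=> N0 H; have N0' : 0 < N%:R :> R by rewrite ltr0n.
rewrite nmM nmV nm_nat mulrC ler_pdivrMr //; apply: le_trans (nm_sum _ _ _) _.
apply: le_trans (ler_sum _ (fun j _ => H j)) _.
by rewrite sumr_const card_ord mulr_natr.
Qed.

Lemma avgB N f g z : avg N f z - avg N g z = avg N (fun w => f w - g w) z.
Proof. by rewrite /avg -mulrBr sumrB. Qed.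
Lemma avgD N f g z : avg N f z + avg N g z = avg N (fun w => f w + g w) z.
Proof. by rewrite /avg -mulrDr big_split. Qed.
Lemma avgZ N c f z : c * avg N f z = avg N (fun w => c * f w) z.
Proof. by rewrite /avg mulrCA mulr_sumr. Qed.
Lemma avg_shift N f u z : avg N f (z + u) = avg N (fun w => f (w + u)) z.
Proof. by rewrite /avg; congr (_ * _); apply: eq_bigr => j _; rewrite addrAC. Qed.

Lemma is_mean_unique f z l l' : is_mean f z l -> is_mean f z l' -> l = l'.
Proof.
move=> [c c0 H] [c' c0' H']; apply: eq_of_nm_small => eps e0.
have [n hn] : exists n : nat, (c + c') / eps <= n.+1%:R by exact: exists_nat_ge.
apply: le_trans (nmBD (avg n.+1 f z) _ _) _.
have h1 := H n.+1 isT; have h2 := H' n.+1 isT; rewrite nmC in h1.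
apply: le_trans (lerD h1 h2) _; rewrite -mulrDl ler_pdivrMr ?ltr0n //.
by rewrite ler_pdivrMr // mulrC in hn.
Qed.

Lemma is_meanZ k f z l : is_mean f z l -> is_mean (fun w => k * f w) z (k * l).
Proof.
move=> [c c0 H]; exists (nm k * c); first exact: mulr_ge0.
by move=> N N0; rewrite -avgZ -mulrBr nmM -mulrA ler_wpM2l //; apply: H.
Qed.

Lemma is_mean_ext f g z l : (forall x : R, f (z + ofR x) = g (z + ofR x)) ->
  is_mean f z l -> is_mean g z l.
Proof.
move=> fg [c c0 H]; exists c => // N /H.
have -> // : avg N f z = avg N g z.
by rewrite /avg; congr (_ * _); apply: eq_bigr => j _; apply: fg.
Qed.

Lemma is_mean_bound f z l (M : R) : is_mean f z l ->
  (forall x : R, nm (f (z + ofR x)) <= M) -> nm l <= M.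
Proof.
move=> [c c0 H] HM; apply/ler_addgt0Pr => eps e0.
have [n hn] : exists n : nat, c / eps <= n.+1%:R by exact: exists_nat_ge.
rewrite -(subKr (avg n.+1 f z) l); apply: le_trans (nmB _ _) _.
apply: lerD; first by apply: avg_bound => // j; apply: HM.
apply: le_trans (H n.+1 isT) _; rewrite ler_pdivrMr ?ltr0n //.
by rewrite ler_pdivrMr // mulrC in hn.
Qed.

Variables (y1 y2 : R) (f f1 : C -> C) (K : R).
Local Notation S := (strip y1 y2).
Hypothesis per : forall z, S z -> f (z + 1) = f z.
Hypothesis gd : good S f f1 K.

Lemma strip_ofR z (x : R) : S (z + ofR x) = S z.
Proof. by rewrite /strip ImD Im_ofR addr0. Qed.

Lemma taylor_strip z (h : C) : S z -> S (z + h) -> nm h <= 1 ->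
  nm (f (z + h) - f z - f1 z * h) <= K * nm h ^+ 2.
Proof.
move=> Sz Szh h1; case: gd => _ _ _ /(_ z (z + h) Sz Szh).
by rewrite [z + h - z]addrAC subrr add0r; apply.
Qed.

(** The increments of [f] between consecutive sample points telescope to 0 by periodicity, and each
    differs from [f1] times 1/N by a Taylor remainder of order 1/N^2. *)
Lemma avg_deriv N z : (0 < N)%N -> S z -> nm (avg N f1 z) <= K / N%:R.
Proof.
move=> N0 Sz; have N0' : 0 < N%:R :> R by rewrite ltr0n.
pose p (j : nat) := z + ofR (j%:R / N%:R) : C.
have pS j : p j.+1 = p j + ofR N%:R^-1.
  by rewrite /p -addrA -ofRD -natr1 mulrDl mul1r.
have tel : \sum_(j < N) (f (p j.+1) - f (p j)) = 0.
  rewrite -(big_mkord xpredT (fun j => f (p j.+1) - f (p j))) telescope_sumr //.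
  rewrite /p mul0r addr0 divff ?gt_eqF // per ?subrr //.
have -> : avg N f1 z = - \sum_(j < N) (f (p j + ofR N%:R^-1) - f (p j) - f1 (p j) * ofR N%:R^-1).
  rewrite sumrB; under eq_bigr do rewrite -pS; rewrite tel sub0r opprK -mulr_suml.
  by rewrite /avg mulrC ofRV ofR_nat.
rewrite nmN; apply: le_trans (nm_sum _ _ _) _.
have -> : K / N%:R = \sum_(j < N) K * N%:R^-1 ^+ 2.
  by rewrite sumr_const card_ord -[RHS]mulr_natr; field; rewrite gt_eqF.
apply: ler_sum => j _.
have nN : nm (ofR N%:R^-1 : C) = N%:R^-1 by rewrite nm_ofR ger0_norm // invr_ge0 ltW.
rewrite -[X in _ <= _ * X ^+ 2]nN; apply: taylor_strip; rewrite ?strip_ofR //.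
by rewrite nN invf_le1 // ler1n.
Qed.

Lemma avg_step N z w : (0 < N)%N -> S z -> S w -> nm (w - z) <= 1 ->
  nm (avg N f w - avg N f z) <= K / N%:R * nm (w - z) + K * nm (w - z) ^+ 2.
Proof.
move=> N0 Sz Sw d1; set h := w - z.
have -> : w = z + h by rewrite /h addrC subrK.
have -> : avg N f (z + h) - avg N f z = avg N f1 z * h +
   avg N (fun v => f (v + h) - f v - f1 v * h) z.
  rewrite avg_shift avgB [_ * h]mulrC avgZ avgD; congr (_ * _).
  by apply: eq_bigr => j _; ring.
apply: le_trans (nmD _ _) _; apply: lerD.
  by rewrite nmM ler_wpM2r //; apply: avg_deriv.
apply: avg_bound => // j; apply: taylor_strip; rewrite ?strip_ofR //.
by rewrite addrAC strip_ofR /h addrC subrK.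
Qed.

(** In the limit the mean does not depend on the base point. This plays the part of moving a contour
    of integration. *)
Lemma avg_dist z w : S z -> S w -> exists2 c : R, 0 <= c &
  forall N, (0 < N)%N -> nm (avg N f w - avg N f z) <= c / N%:R.
Proof.
move=> Sz Sw; set d := nm (w - z).
have K0 : 0 <= K by case: gd.
have d0 : 0 <= d by apply: nm_ge0.
exists (K * d + K * d ^+ 2); first by rewrite addr_ge0 ?mulr_ge0 ?exprn_ge0.
move=> N N0; have N0' : 0 < N%:R :> R by rewrite ltr0n.
have [M hM] : exists M : nat, d <= M.+1%:R by exact: exists_nat_ge.
(* A multiple of N, so that the quadratic errors of the P steps add up to O(1/N); and at least d, so
   that each step has length at most 1. *)
pose P := (N * M.+1)%N.
have P0 : 0 < P%:R :> R by rewrite ltr0n muln_gt0 N0.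
have dP : d <= P%:R.
  apply: le_trans hM _; rewrite natrM ler_peMl // ler1n //.
have NP : N%:R <= P%:R :> R by rewrite natrM ler_peMr ?ler1n // ltW.
pose q (i : nat) := z + ofR (i%:R / P%:R) * (w - z) : C.
have Sq i : (i <= P)%N -> S (q i).
  move=> iP; apply: convex_strip => //.
  by rewrite divr_ge0 ?ler0n //= ler_pdivrMr // mul1r ler_nat.
have -> : w = q P by rewrite /q divff ?gt_eqF // mul1r addrC subrK.
have -> : z = q 0%N by rewrite /q mul0r mul0r addr0.
rewrite -(telescope_sumr (fun i => avg N f (q i))) // big_mkord.
apply: le_trans (nm_sum _ _ _) _.
have -> : (K * d + K * d ^+ 2) / N%:R = \sum_(i < P) (K / N%:R * (d / P%:R) + K * d ^+ 2 / N%:R / P%:R).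
  by rewrite sumr_const card_ord -[RHS]mulr_natr; field; rewrite !gt_eqF.
apply: ler_sum => i _.
have qq : nm (q i.+1 - q i) = d / P%:R.
  have -> : q i.+1 - q i = ofR P%:R^-1 * (w - z).
    rewrite /q opprD addrACA subrr add0r -mulrBl -ofRN -ofRD -mulrBl -natr1.
    by rewrite addrAC subrr add0r mul1r.
  by rewrite nmM nm_ofR ger0_norm ?invr_ge0 ?ltW // mulrC.
apply: le_trans (avg_step N0 (Sq _ _) (Sq _ _) _) _; rewrite ?(ltnW (ltn_ord i)) //.
  by rewrite qq ler_pdivrMr // mul1r.
rewrite qq lerD2l expr_div_n -mulrA expr2 [in leLHS]expr2 invfM -!mulrA.
do 3![apply: ler_wpM2l => //]; apply: ler_wpM2r; first by rewrite invr_ge0 ltW.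
by rewrite lef_pV2.
Qed.

(** A Riemann sum with NM points is the average of M sums with N points, whose base points are
    shifted by less than 1/N. *)
Lemma avg_refine N M z : (0 < N)%N -> (0 < M)%N -> S z ->
  nm (avg (N * M) f z - avg N f z) <= 2 * K / N%:R ^+ 2.
Proof.
move=> N0 M0 Sz; have N0' : 0 < N%:R :> R by rewrite ltr0n.
have M0' : 0 < M%:R :> R by rewrite ltr0n.
have Nc : N%:R != 0 :> C by rewrite pnatr_eq0 -lt0n.
have Mc : M%:R != 0 :> C by rewrite pnatr_eq0 -lt0n.
have K0 : 0 <= K by case: gd.
have -> : avg (N * M) f z = M%:R^-1 * \sum_(i < M) avg N f (z + ofR (i%:R / (N * M)%:R)).
  rewrite /avg (sum_ord_mul _ _ (fun j => f (z + ofR (j%:R / (N * M)%:R)))).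
  rewrite -mulr_sumr natrM invfM mulrA [M%:R^-1 * _]mulrC; congr (_ * _).
  apply: eq_bigr => i _; apply: eq_bigr => a _; congr f; rewrite -addrA; congr (_ + _).
  rewrite -ofRD; congr ofR; rewrite natrD !natrM; field.
  by rewrite !gt_eqF.
have -> : avg N f z = M%:R^-1 * \sum_(i < M) avg N f z.
  by rewrite sumr_const card_ord -[LHS](mulKf Mc) mulr_natl.
rewrite -mulrBr -sumrB nmM nmV nm_nat mulrC ler_pdivrMr //.
apply: le_trans (nm_sum _ _ _) _.
rewrite [leRHS]mulr_natr -[M in leRHS]card_ord -sumr_const; apply: ler_sum => i _.
have hi : nm (ofR (i%:R / (N * M)%:R) : C) <= N%:R^-1.
  rewrite nm_ofR ger0_norm ?divr_ge0 ?ler0n // natrM invfM mulrCA ler_piMr ?invr_ge0 ?ltW //.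
  by rewrite ltr_pdivrMr // mul1r ltr_nat.
have hN1 : N%:R^-1 <= 1 :> R by rewrite invf_le1 // ler1n.
have E : z + ofR (i%:R / (N * M)%:R) - z = ofR (i%:R / (N * M)%:R) by rewrite addrAC subrr add0r.
apply: le_trans (avg_step N0 Sz _ _) _; rewrite ?strip_ofR // E.
  exact: le_trans hi hN1.
have -> : 2 * K / N%:R ^+ 2 = K / N%:R * N%:R^-1 + K * N%:R^-1 ^+ 2.
  by field; rewrite gt_eqF.
apply: lerD; first by rewrite ler_wpM2l // divr_ge0 // ltW.
apply: ler_wpM2l => //; apply: lerXn2r => //; rewrite nnegrE //.
Qed.

(** The intervals of radius c/N around u(N) meet pairwise, so the supremum of their left ends lies
    in all of them. *)
Lemma interval_limit (u : nat -> R) (c : R) : 0 <= c ->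
  (forall N M, (0 < N)%N -> (0 < M)%N -> `|u N - u M| <= c / N%:R + c / M%:R) ->
  exists l, forall N, (0 < N)%N -> `|u N - l| <= c / N%:R.
Proof.
move=> c0 H; pose E : set R := [set x | exists2 N, (0 < N)%N & x = u N - c / N%:R]%classic.
have ub M : (0 < M)%N -> ubound E (u M + c / M%:R).
  move=> M0 x [N N0 ->]; have := H N M N0 M0; rewrite ler_norml; lra.
have hE : has_sup E.
  by split; [exists (u 1%N - c / 1%:R); exists 1%N | exists (u 1%N + c / 1%:R); apply: ub].
exists (sup E) => N N0; rewrite ler_norml.
have h1 : u N - c / N%:R <= sup E by apply: sup_ubound; [case: hE | exists N].
have h2 : sup E <= u N + c / N%:R by apply: ge_sup; [case: hE | apply: ub].
lra.
Qed.

Lemma mean_exists z : S z -> exists l, is_mean f z l.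
Proof.
move=> Sz; have K0 : 0 <= K by case: gd.
have H N M : (0 < N)%N -> (0 < M)%N ->
    nm (avg N f z - avg M f z) <= 2 * K / N%:R + 2 * K / M%:R.
  move=> N0 M0; apply: le_trans (nmBD (avg (N * M) f z) _ _) _.
  have sq (P : nat) : (0 < P)%N -> 2 * K / P%:R ^+ 2 <= 2 * K / P%:R.
    move=> P0; rewrite ler_wpM2l ?mulr_ge0 // lef_pV2 ?posrE ?exprn_gt0 ?ltr0n //.
    by rewrite expr2 ler_peMr ?ler0n // ler1n.
  apply: lerD; last first.
    rewrite mulnC; apply: le_trans (sq _ M0); exact: avg_refine.
  rewrite nmC; apply: le_trans (sq _ N0); exact: avg_refine.
have c0 : 0 <= 2 * K by rewrite mulr_ge0.
have [u hu] : exists l, forall N, (0 < N)%N -> `|Re (avg N f z) - l| <= 2 * K / N%:R.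
  apply: interval_limit => // N M N0 M0; rewrite -ReB.
  exact: le_trans (nm_Re _) (H _ _ N0 M0).
have [v hv] : exists l, forall N, (0 < N)%N -> `|Im (avg N f z) - l| <= 2 * K / N%:R.
  apply: interval_limit => // N M N0 M0; rewrite -ImB.
  exact: le_trans (nm_Im _) (H _ _ N0 M0).
exists (Complex u v), (2 * K + 2 * K); first by rewrite addr_ge0.
move=> N N0; apply: le_trans (nm_leRI _) _; rewrite ReB ImB /= mulrDl.
by apply: lerD; [apply: hu | apply: hv].
Qed.

Lemma mean_move z w l : S z -> S w -> is_mean f z l -> is_mean f w l.
Proof.
move=> Sz Sw [c c0 H]; have [c' c0' H'] := avg_dist Sz Sw.
exists (c' + c); first exact: addr_ge0.
move=> N N0; apply: le_trans (nmBD (avg N f z) _ _) _; rewrite mulrDl.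
by apply: lerD; [apply: H' | apply: H].
Qed.

End Mean.

(** * Summable families over the integers *)

Section IntSums.
Variable R : realType.

Lemma sumb_nat (b : nat -> R) (B : R) : (forall n, 0 <= b n) ->
  (forall N, \sum_(n < N) b n <= B) -> sumb b B.
Proof.
move=> b0 H J; pose M := (\max_(n <- enum_fset J) n.+1)%N.
apply: le_trans (H M); rewrite -(big_mkord xpredT b) /index_iota subn0.
have h : {subset enum_fset J <= iota 0 M}.
  move=> n nJ; rewrite mem_iota /= add0n.
  by rewrite /M (big_rem n) //= leq_maxl.
rewrite [leRHS](bigID (mem (enum_fset J))) /=.
apply: (@le_trans _ _ (\sum_(i <- iota 0 M | i \in enum_fset J) b i)); last first.
  by rewrite lerDl sumr_ge0.
rewrite -[leRHS]big_filter; rewrite le_eqVlt; apply/orP; left; apply/eqP.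
apply: perm_big; apply: uniq_perm; rewrite ?fset_uniq ?filter_uniq ?iota_uniq //.
move=> n; rewrite mem_filter /=; apply/idP/andP => [nJ|[]//].
by split=> //; apply: h.
Qed.

Lemma sumb_int (b : nat -> R) (B : R) : (forall n, 0 <= b n) ->
  (forall N, \sum_(n < N) b n <= B) -> sumb (fun n : int => b `|n|%N) (2 * B).
Proof.
move=> b0 H J; rewrite (bigID (fun n : int => 0 <= n)) /= mulr_natl mulr2n.
have hs := sumb_nat b0 H.
have aux (P : pred int) : (forall n m : int, P n -> P m -> `|n|%N = `|m|%N -> n = m) ->
    \sum_(n <- J | P n) b `|n|%N <= B.
  move=> inj; pose J' := [fset n in J | P n]%fset.
  have E1 : perm_eq [seq n <- enum_fset J | P n] (enum_fset J').
    apply: uniq_perm; [exact/filter_uniq/fset_uniq|exact: fset_uniq|].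
    by move=> n; rewrite mem_filter !inE /= andbC.
  rewrite -big_filter (perm_big _ E1) /=.
  apply: le_trans (hs (absz @` J')%fset); rewrite [leRHS]big_imfset //=.
  by move=> n m; rewrite !inE /= => /andP[_ h1] /andP[_ h2]; apply: inj.
by apply: lerD; apply: aux => n m; lia.
Qed.

Definition inv2 (n : nat) : R := if n == 0%N then 1 else (n%:R ^+ 2)^-1.

Lemma inv2_ge0 n : 0 <= inv2 n.
Proof. by rewrite /inv2; case: ifP => // _; rewrite invr_ge0 exprn_ge0. Qed.

Lemma sumb_inv2 : sumb (fun n : int => inv2 `|n|%N) (2 * 3).
Proof.
apply: sumb_int; first exact: inv2_ge0.
have H N : \sum_(n < N.+2) inv2 n <= 3 - N.+1%:R^-1.
  elim: N => [|N IH].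
    by rewrite !big_ord_recr big_ord0 /= /inv2 /= expr1n invr1; lra.
  rewrite big_ord_recr /=; apply: le_trans (lerD IH (lexx _)) _.
  rewrite /inv2 /= -(natr1 N.+1); set a : R := N.+1%:R.
  have a0 : 0 < a by rewrite ltr0n.
  rewrite -addrA lerD2l.
  have -> : - (a + 1)^-1 = - a^-1 + (a * (a + 1))^-1 by field; rewrite !gt_eqF //; lra.
  by rewrite lerD2l lef_pV2 ?posrE ?exprn_gt0 ?mulr_gt0 //; nra.
case=> [|[|N]].
- by rewrite big_ord0.
- by rewrite big_ord_recr big_ord0 /= /inv2 /= add0r; lra.
- by apply: le_trans (H N) _; rewrite gerBl invr_ge0.
Qed.

End IntSums.

(** * Chord estimates and roots of unity *)

Section RootsOfUnity.
Variable R : realType.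
Local Notation C := (CC R).

(** From u cos u <= sin u at u = x/2 follows sin x = 2 sin u cos u >= 2u (cos u)^2 = u (1 + cos x)
    >= u. *)
Lemma sin_ge_half (x : R) : 0 <= x <= pi / 2 -> x / 2 <= sin x.
Proof.
move=> /andP[x0 x1]; have pi0 : 0 < pi :> R := pi_gt0 R.
have sin_cos (u : R) : 0 <= u <= pi / 2 -> u * cos u <= sin u.
  move=> /andP[u0 u1]; pose h (t : R) := sin t - t * cos t.
  have der (t : R) : is_derive t 1 h (t * sin t).
    rewrite /h; apply: is_derive_eq.
    by rewrite -!/(_ * _) /GRing.scale /=; ring.
  have cont : {within `[0, u], continuous h}%classic.
    apply: continuous_subspaceT => t; apply: differentiable_continuous.
    by apply/derivable1_diffP; case: (der t).
  have [c] := MVT_segment u0 (fun t _ => der t) cont.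
  rewrite in_itv /= => /andP[c0 c1].
  rewrite {2}/h sin0 mul0r !subr0 => E.
  have : 0 <= h u.
    rewrite E !mulr_ge0 // sin_ge0_pi //; apply/andP; split=> //; lra.
  by rewrite /h; lra.
have u2 : 0 <= x / 2 <= pi / 2 by apply/andP; split; lra.
have h1 := sin_cos _ u2.
have c0 : 0 <= cos (x / 2).
  apply: cos_ge0_pihalf; apply/andP; split; lra.
have cx : 0 <= cos x by apply: cos_ge0_pihalf; apply/andP; split; lra.
have E1 : sin x = 2 * (sin (x / 2) * cos (x / 2)).
  by rewrite {1}(splitr x) sinD; ring.
have E2 : cos x = 2 * cos (x / 2) ^+ 2 - 1.
  by rewrite {1}(splitr x) cosD -!expr2 sin2cos2; ring.
have h2 : x / 2 * cos (x / 2) * cos (x / 2) <= sin (x / 2) * cos (x / 2) by apply: ler_wpM2r.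
rewrite E1; nra.
Qed.

Lemma nm_e1 (x : R) : nm (e (ofR x) - 1 : C) = 2 * `|sin (pi * x)|.
Proof.
apply/eqP; rewrite -(eqrXn2 (n := 2)) // ?mulr_ge0 //.
rewrite nm2 exprMn real_normK ?num_real //.
have -> : e (ofR x) = Complex (cos (2 * (pi * x))) (sin (2 * (pi * x))) :> C.
  rewrite /e (_ : 2 * _ * _ * _ = ofR (2 * (pi * x)) * imagi R); last first.
    by rewrite !ofRM (ofR_nat R 2); ring.
  apply: ceq; rewrite /cexp /= ?(mulr0, mulr1, mul0r, subr0, subrr, addr0, add0r).
    by rewrite oppr0 expR0 mul1r.
  by rewrite oppr0 expR0 mul1r.
rewrite ReB ImB /= subr0 mulr_natl mulr2n cosD sinD -!expr2.
have := cos2Dsin2 (pi * x); set c := cos _; set s := sin _ => H.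
have -> : c ^+ 2 = 1 - s ^+ 2 by rewrite -H; ring.
have -> : (s * c + c * s) ^+ 2 = 4 * s ^+ 2 * c ^+ 2 by ring.
have -> : c ^+ 2 = 1 - s ^+ 2 by rewrite -H; ring.
apply/eqP; ring.
Qed.

Lemma nm_e1_ge (x : R) : `|x| <= 2^-1 -> 2 * `|x| <= nm (e (ofR x) - 1 : C).
Proof.
move=> hx; rewrite nm_e1 ler_wpM2l //.
have pi2 : 2 <= pi :> R := pi_ge2 R.
have -> : `|sin (pi * x)| = `|sin (pi * `|x|)|.
  have [x0|x0] := leP 0 x; first by rewrite (ger0_norm x0).
  by rewrite (ltr0_norm x0) mulrN sinN normrN.
have h : 0 <= pi * `|x| <= pi / 2.
  by apply/andP; split; [rewrite mulr_ge0 ?pi_ge0 | rewrite ler_wpM2l ?pi_ge0].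
have := sin_ge_half h; have := ler_norm (sin (pi * `|x|)).
have : 0 <= `|x| by [].
nra.
Qed.

Lemma e_root_neq1 (P j : nat) : (0 < j < P)%N -> e (- ofR (j%:R / P%:R)) != 1 :> C.
Proof.
move=> /andP[j0 jP]; rewrite -subr_eq0 -nm_eq0 -ofRN nm_e1 mulf_neq0 //.
have P0 : 0 < P%:R :> R by rewrite ltr0n (leq_ltn_trans _ jP).
rewrite mulrN sinN normrN normr_eq0 gt_eqF // sin_gt0_pi //.
have pi0 : 0 < pi :> R := pi_gt0 R.
apply/andP; split; first by rewrite mulr_gt0 // divr_gt0 // ltr0n.
by rewrite gtr_pMr // ltr_pdivrMr // mul1r ltr_nat.
Qed.

Lemma sum_roots (P j : nat) : (0 < j < P)%N ->
  \sum_(k < P) e (- ofR (j%:R / P%:R)) ^+ k = 0 :> C.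
Proof.
move=> jP; have h := e_root_neq1 jP.
have P0 : P%:R != 0 :> R by rewrite pnatr_eq0; case: P jP {h} => //; rewrite ltn0 andbF.
apply: (mulfI (_ : e (- ofR (j%:R / P%:R)) - 1 != 0 :> C)); first by rewrite subr_eq0.
rewrite mulr0 -subrX1 -eMn mulrN -ofR_nat -ofRM mulrC divfK //.
by rewrite eN ofR_nat e_nat invr1 subrr.
Qed.

End RootsOfUnity.

(** * Discrete Fourier transform and inversion *)

Section FourierInversion.
Variable R : realType.
Local Notation C := (CC R).
Variables (f f1 : C -> C) (K : R) (z0 : C).
Let S := strip (Im z0) (Im z0).
Hypothesis per : forall z, S z -> f (z + 1) = f z.
Hypothesis gd : good S f f1 K.
Variable a : int -> C.
Hypothesis am : forall n : int, is_mean (fun w => f w * e (- (n%:~R * w))) z0 (a n).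

Let x (P j : nat) : C := z0 + ofR (j%:R / P%:R).
Let dft (P : nat) (n : int) : C :=
  P%:R^-1 * \sum_(j < P) f (x P j) * e (- (n%:~R * ofR (j%:R / P%:R))).

Let Sx P j : S (x P j).
Proof. by rewrite /x /S strip_ofR /strip lexx. Qed.

Let dft_avg P n :
  dft P n = avg P (fun w => f w * e (- (n%:~R * w))) z0 * e (n%:~R * z0).
Proof.
rewrite /dft /avg -mulrA mulr_suml; congr (_ * _); apply: eq_bigr => j _.
by rewrite -mulrA -eD mulrDr opprD addrAC addNr add0r.
Qed.

Lemma dft_cvg n : exists2 c : R, 0 <= c &
  forall P, (0 < P)%N -> nm (dft P n - a n * e (n%:~R * z0)) <= c / P%:R.
Proof.
have [c c0 H] := am n; exists (c * nm (e (n%:~R * z0))); first exact: mulr_ge0.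
by move=> P P0; rewrite dft_avg -mulrBl nmM mulrAC ler_wpM2r //; apply: H.
Qed.

Lemma dft_inversion N :
  \sum_(k < N.*2.+1) dft N.*2.+1 (k%:Z - N%:Z) = f z0.
Proof.
set P := N.*2.+1.
have P0 : P%:R != 0 :> C by rewrite pnatr_eq0.
rewrite -mulr_sumr exchange_big /= (bigD1 ord0) //= [X in _ + X]big1; last first.
  move=> j j0; rewrite -mulr_sumr.
  rewrite (eq_bigr (fun k : 'I_P => e (N%:R * ofR (j%:R / P%:R)) *
     e (- ofR (j%:R / P%:R)) ^+ k)) => [|k _]; last first.
    by rewrite -eMn -eD rmorphB /= -!pmulrn; congr e; ring.
  by rewrite -mulr_sumr sum_roots ?mulr0 // ltn_ord lt0n andbT.
rewrite addr0 (eq_bigr (fun=> f z0)) => [|k _].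
  by rewrite sumr_const card_ord -[RHS](mulKf P0) mulr_natl.
by rewrite /x mul0r ofR0 addr0 mulr0 oppr0 e_0 mulr1.
Qed.

(** Summation by parts, twice: second differences of the samples are O(K / P^2), and taking them
    multiplies the transform by (w - 1)^2, where w = e(n/P). Since |w - 1| >= 2|n|/P, the bound
    K/n^2 results, uniformly in P. *)
Lemma dft_bound N (n : int) : (`|n| <= N)%N ->
  nm (dft N.*2.+1 n) <= K * inv2 R `|n|%N.
Proof.
move=> nN; set P := N.*2.+1.
have K0 : 0 <= K by case: gd.
have P0 : 0 < P%:R :> R by rewrite ltr0n.
have fK j : nm (f (x P j)) <= K by case: gd => _ + _ _; apply.
have ne (m : int) (r : R) : nm (e (- (m%:~R * ofR r)) : C) = 1.
  by rewrite nm_e -ofR_int -ofRM -ofRN Im_ofR mulr0 oppr0 expR0.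
have [->|n0] := eqVneq n 0.
  rewrite /inv2 /= mulr1 /dft nmM nmV nm_nat mulrC ler_pdivrMr //.
  apply: le_trans (nm_sum _ _ _) _; rewrite mulr_natr -[P in leRHS]card_ord -sumr_const.
  by apply: ler_sum => j _; rewrite nmM ne mulr1.
pose u : C := e (- (n%:~R * ofR P%:R^-1)).
pose w : C := e (n%:~R * ofR P%:R^-1).
have uw : u * w = 1 by rewrite /u /w -eD addNr e_0.
have u0 : u != 0 by apply: e_neq0.
have uP : u ^+ P = 1.
  rewrite /u -eMn (_ : P%:R * _ = (- n)%:~R); first by rewrite e_int.
  by rewrite ofRV ofR_nat rmorphN /=; field; rewrite pnatr_eq0.
pose c (j : nat) := f (x P j).
have cP j : c (j + P)%N = c j.
  rewrite /c -(per (Sx P j)); congr f; rewrite /x -addrA -ofR1 -ofRD natrD mulrDl.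
  by rewrite divff // gt_eqF.
pose T := \sum_(j < P) c j * u ^+ j.
have dT : dft P n = P%:R^-1 * T.
  rewrite /dft /T; congr (_ * _); apply: eq_bigr => j _; congr (_ * _).
  by rewrite /u -eMn; congr e; rewrite ofRM ofR_nat; ring.
have shift m : \sum_(j < P) c (j + m)%N * u ^+ j = w ^+ m * T.
  elim: m => [|m IH]; first by rewrite mul1r; apply: eq_bigr => j _; rewrite addn0.
  rewrite exprS -mulrA -IH mulr_sumr.
  pose G (j : nat) := w * (c (j + m)%N * u ^+ j).
  have -> : \sum_(j < P) c (j + m.+1)%N * u ^+ j = \sum_(j < P) G j.+1.
    apply: eq_bigr => j _; rewrite /G addnS addSn exprS.
    by rewrite -[LHS]mul1r -uw; ring.
  apply/eqP; rewrite -subr_eq0 -sumrB -(big_mkord xpredT (fun j => G j.+1 - G j)).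
  by rewrite telescope_sumr // /G uP addnC cP add0n expr0 subrr.
have E : \sum_(j < P) (c (j + 2)%N - 2 * c (j + 1)%N + c (j + 0)%N) * u ^+ j = (w - 1) ^+ 2 * T.
  rewrite (_ : (w - 1) ^+ 2 * T = w ^+ 2 * T - 2 * (w ^+ 1 * T) + w ^+ 0 * T); last by ring.
  rewrite -!shift mulr_sumr -sumrB -big_split /=; apply: eq_bigr => j _; ring.
have bd : nm ((w - 1) ^+ 2 * T) <= 2 * K / P%:R.
  rewrite -E; apply: le_trans (nm_sum _ _ _) _.
  have -> : 2 * K / P%:R = \sum_(j < P) 2 * K * P%:R^-1 ^+ 2.
    by rewrite sumr_const card_ord -[RHS]mulr_natr; field; rewrite gt_eqF.
  apply: ler_sum => j _; rewrite nmM nmX.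
  have -> : nm u = 1 by apply: ne.
  rewrite expr1n mulr1.
  have nh : nm (ofR P%:R^-1 : C) = P%:R^-1 by rewrite nm_ofR ger0_norm // invr_ge0 ltW.
  have h1 : nm (ofR P%:R^-1 : C) <= 1 by rewrite nh invf_le1 // ler1n.
  have x2 : x P (j + 2) = x P (j + 1) + ofR P%:R^-1.
    by rewrite /x -addrA -ofRD !natrD; congr (_ + ofR _); field; rewrite gt_eqF.
  have x0 : x P (j + 0) = x P (j + 1) + - ofR P%:R^-1.
    by rewrite /x -addrA -ofRN -ofRD !natrD; congr (_ + ofR _); field; rewrite gt_eqF.
  have t1 := taylor_strip gd (h := ofR P%:R^-1) (Sx P (j + 1)) _ h1.
  have t2 := taylor_strip gd (h := - ofR P%:R^-1) (Sx P (j + 1)).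
  rewrite nmN -x0 in t2; rewrite -x2 in t1.
  have := lerD (t1 (Sx _ _)) (t2 (Sx _ _) h1); rewrite nh => t3.
  have -> : 2 * K * P%:R^-1 ^+ 2 = K * P%:R^-1 ^+ 2 + K * P%:R^-1 ^+ 2 by ring.
  apply: le_trans t3; apply: le_trans (nmD _ _); rewrite /c le_eqVlt; apply/orP; left.
  by apply/eqP; congr nm; ring.
have na : 0 < `|n|%N%:R :> R by rewrite ltr0n absz_gt0.
have wn : 2 * (`|n|%N%:R / P%:R) <= nm (w - 1).
  have E1 : w = e (ofR (n%:~R / P%:R)) by rewrite /w ofRM ofR_int.
  have E2 : `|n%:~R / P%:R : R| = `|n|%N%:R / P%:R.
    rewrite normrM normfV (ger0_norm (ltW P0)); congr (_ / _).
    by rewrite -intr_norm -abszE -pmulrn.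
  (* The condition |n| <= N keeps |n|/P below 1/2, the range of the chord estimate. *)
  rewrite E1 -E2; apply: nm_e1_ge; rewrite E2 ler_pdivrMr // mulrC ler_pdivlMr //.
  by rewrite -natrM ler_nat /P; lia.
have k1 : (2 * (`|n|%N%:R / P%:R)) ^+ 2 * nm T <= 2 * K / P%:R.
  apply: le_trans bd; rewrite nmM nmX ler_wpM2r //; apply: lerXn2r => //.
    by rewrite nnegrE mulr_ge0 // divr_ge0 // ltW.
  by rewrite nnegrE.
rewrite dT nmM nmV nm_nat /inv2 absz_eq0 (negPf n0) mulrC.
rewrite ler_pdivrMr // mulrAC ler_pdivlMr ?exprn_gt0 //.
set A : R := `|n|%N%:R in na k1 *; set t := nm T in k1 *.
have E3 : (2 * (A / P%:R)) ^+ 2 * t = 4 * (t * A ^+ 2) / P%:R ^+ 2 by field; rewrite gt_eqF.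
move: k1; rewrite E3 ler_pdivrMr ?exprn_gt0 //.
have -> : 2 * K / P%:R * P%:R ^+ 2 = 2 * (K * P%:R) by field; rewrite gt_eqF.
have : 0 <= K * P%:R by rewrite mulr_ge0 // ltW.
lra.
Qed.

(* The discrete Fourier transform inverts exactly on an odd number of points; the
   series follows by dominated convergence. *)
Lemma fourier_inversion : has_sum (fun n : int => a n * e (n%:~R * z0)) (f z0).
Proof.
have K0 : 0 <= K by case: gd.
pose X (N : nat) (n : int) : C := \sum_(k < N.*2.+1)
  (if n == k%:Z - N%:Z then dft N.*2.+1 (k%:Z - N%:Z) else 0).
have XE N n : X N n = if (`|n| <= N)%N then dft N.*2.+1 n else 0.
  rewrite /X; case: ifP => h; last first.
    rewrite big1 // => k _; case: eqP => // E.
    by move: h (ltn_ord k); rewrite E; lia.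
  have kP : (absz (n + N%:Z)%R < N.*2.+1)%N by lia.
  rewrite (bigD1 (Ordinal kP)) //= big1 ?addr0.
    have -> : (absz (n + N%:Z))%:Z - N%:Z = n by lia.
    by rewrite eqxx.
  move=> k /eqP hk; case: eqP => // E; case: hk; apply: val_inj => /=; lia.
have sb := sumbZ K0 (sumb_inv2 R).
have bdX N n : nm (X N n) <= K * inv2 R `|n|%N.
  rewrite XE; case: ifP => h; first exact: dft_bound.
  by rewrite nm0 mulr_ge0 ?inv2_ge0.
have lim n : forall eps : R, 0 < eps -> \forall N \near (\oo)%classic,
    nm (X N n - a n * e (n%:~R * z0)) <= eps.
  move=> eps e0; have [c c0 H] := dft_cvg n.
  have [M hM] : exists M : nat, c / eps <= M.+1%:R by exact: exists_nat_ge.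
  exists (M + `|n|)%N => // N /= hN.
  rewrite XE ifT; last by apply: leq_trans hN; apply: leq_addl.
  apply: le_trans (H _ _) _ => //; rewrite ler_pdivrMr ?ltr0n //.
  move: hM; rewrite ler_pdivrMr // mulrC => hM; apply: le_trans hM _.
  apply: ler_wpM2l; first exact: ltW.
  by rewrite ler_nat; lia.
have bda n : nm (a n * e (n%:~R * z0)) <= K * inv2 R `|n|%N.
  apply/ler_addgt0Pr => eps e0; have [N _ HN] := lim n eps e0.
  have h := HN N (leqnn N); rewrite -(subKr (X N n) (a n * _)).
  by apply: le_trans (nmB _ _) _; apply: lerD.
have [l Hl] := summable_has_sum bda sb.
suff -> : f z0 = l by [].
apply: eq_of_nm_small => eps e0.
have := @tannery R nat (\oo)%classic _ _ _ _ X (fun=> f z0) _ l sb _ _ bda Hl lim eps e0.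
case=> [||N _ /(_ N (leqnn N))] //; first by apply: nearW => N n; apply: bdX.
apply: nearW => N; rewrite -(dft_inversion N); apply: has_sum_big => k.
exact: has_sum_delta.
Qed.

End FourierInversion.

(** * Fourier expansions on strips and on the half-plane *)

Section FourierStrip.
Variable R : realType.
Local Notation C := (CC R).

Lemma per_int (f : C -> C) (y1 y2 : R) :
  (forall z, strip y1 y2 z -> f (z + 1) = f z) ->
  forall (n : int) z, strip y1 y2 z -> f (z + n%:~R) = f z.
Proof.
move=> per; have sn (n : int) z : strip y1 y2 (z + n%:~R) = strip y1 y2 z.
  by rewrite -ofR_int strip_ofR.
have pn (n : nat) z : strip y1 y2 z -> f (z + n%:R) = f z.
  elim: n => [|n IH] Sz; first by rewrite addr0.
  by rewrite -natr1 addrA per ?IH // (sn n).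
case=> n z Sz; first by rewrite -pmulrn pn.
rewrite NegzE mulrNz -pmulrn -[in RHS](subrK (n.+1%:R) z) pn //.
by have := sn (- n.+1%:Z) z; rewrite mulrNz => ->.
Qed.

(** An integer translation brings one point to 0 <= Re z < 1; a second point at distance at most 1
    then has real part between -1 and 2, inside the box of half-width 3. *)
Lemma good_strip (f f1 : C -> C) (K y1 y2 : R) :
  (forall z, strip y1 y2 z -> f (z + 1) = f z) ->
  good (box 3 y1 y2) f f1 K ->
  good (strip y1 y2) f (fun z => f1 (z - (Num.floor (Re z))%:~R)) K.
Proof.
move=> per [K0 h1 h2 h3].
pose fl (z : C) : int := Num.floor (Re z).
have flP (z : C) : 0 <= Re (z - (fl z)%:~R) < 1.
  rewrite ReB Re_int subr_ge0 ltrBlDr; have := floor_itv (Re z).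
  by rewrite rmorphD /= addrC.
have E (n : int) z : strip y1 y2 z -> f (z - n%:~R) = f z.
  by move=> Sz; rewrite -rmorphN (per_int per).
have bx z n : strip y1 y2 z -> `|Re (z - n%:~R)| <= 3 -> box 3 y1 y2 (z - n%:~R).
  by rewrite /strip /box ImB Im_int subr0.
have bz z : strip y1 y2 z -> box 3 y1 y2 (z - (fl z)%:~R).
  move=> Sz; apply: bx => //; have := flP z; rewrite ler_norml; lra.
split=> //.
- by move=> z Sz; rewrite -(E (fl z)) //; apply/h1/bz.
- by move=> z Sz; apply/h2/bz.
- move=> z w Sz Sw d1.
  have -> : w - z = (w - (fl z)%:~R) - (z - (fl z)%:~R) by ring.
  rewrite -(E (fl z) z) // -(E (fl z) w) //; apply: h3; first exact: bz.
    apply: bx => //; have := le_trans (nm_Re _) d1; have := flP z.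
    rewrite !ReB !ler_norml; lra.
  by rewrite (_ : _ - _ - _ = w - z) //; ring.
Qed.

Lemma twist_per (f : C -> C) (n : int) z :
  f (z + 1) = f z -> f (z + 1) * e (- (n%:~R * (z + 1))) = f z * e (- (n%:~R * z)).
Proof.
by move=> ->; rewrite mulrDr mulr1 opprD eD [e (- n%:~R)]eN e_int invr1 mulr1.
Qed.

Lemma twist_good (f f1 : C -> C) (K y1 y2 : R) (n : int) :
  good (strip y1 y2) f f1 K ->
  exists g1 L, good (strip y1 y2) (fun z => f z * e (- (n%:~R * z))) g1 L.
Proof.
move=> gf; have [g1 [L gg]] : exists g1 L, good (strip y1 y2) (fun z => e ((- n%:~R) * z)) g1 L.
  apply: (good_exp (b := expR (2 * pi * `|n%:~R| * (`|y1| + `|y2|)))).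
  - exact: convex_strip.
  - exact: expR_ge0.
  move=> z /andP[z1 z2]; rewrite nm_e ler_expR.
  have -> : Im (- n%:~R * z) = - n%:~R * Im z by rewrite -ofR_int -ofRN Im_ofRM.
  have hz : `|Im z| <= `|y1| + `|y2|.
    have := ler_norm y1; have := ler_norm y2; have := ler_norm (- y1); have := ler_norm (- y2).
    rewrite !normrN ler_norml; lra.
  rewrite (_ : - (2 * pi * (- n%:~R * Im z)) = 2 * pi * (n%:~R * Im z)); last by ring.
  rewrite -[leRHS]mulrA; apply: ler_wpM2l; first by rewrite mulr_ge0 // pi_ge0.
  apply: le_trans (ler_norm _) _; rewrite normrM.
  exact: ler_wpM2l.
exists (fun z => f1 z * e ((- n%:~R) * z) + f z * g1 z), (4 * (K * L)).
by apply: good_ext (goodM gf gg) => z _; rewrite mulNr.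
Qed.

Section OneStrip.
Variables (f f1 : C -> C) (K y1 y2 : R).
Hypothesis per : forall z, strip y1 y2 z -> f (z + 1) = f z.
Hypothesis gd : good (strip y1 y2) f f1 K.

Lemma coef_exists z n : strip y1 y2 z ->
  exists c, is_mean (fun w => f w * e (- (n%:~R * w))) z c.
Proof.
move=> Sz; have [g1 [L gg]] := twist_good n gd.
by apply: (mean_exists _ gg Sz) => w Sw; apply/twist_per/per.
Qed.

Lemma coef_move z w n c : strip y1 y2 z -> strip y1 y2 w ->
  is_mean (fun w => f w * e (- (n%:~R * w))) z c ->
  is_mean (fun w => f w * e (- (n%:~R * w))) w c.
Proof.
move=> Sz Sw; have [g1 [L gg]] := twist_good n gd.
by apply: (mean_move (f1 := g1) (K := L) _ gg Sz Sw) => v Sv; apply/twist_per/per.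
Qed.

Lemma fourier_line z (a : int -> C) : strip y1 y2 z ->
  (forall n : int, is_mean (fun w => f w * e (- (n%:~R * w))) z (a n)) ->
  has_sum (fun n : int => a n * e (n%:~R * z)) (f z).
Proof.
move=> Sz am; have VU v : strip (Im z) (Im z) v -> strip y1 y2 v.
  move: Sz; rewrite /strip => /andP[? ?] /andP[? ?]; apply/andP; split; lra.
apply: (fourier_inversion (f1 := f1) (K := K)) => //.
  by move=> v /VU; apply: per.
exact: good_sub VU gd.
Qed.

End OneStrip.

Lemma twist_bound (f : C -> C) (n : int) (z : C) (M : R) :
  nm (f z) <= M -> nm (f z * e (- (n%:~R * z))) <= M * expR (2 * pi * n%:~R * Im z).
Proof.
move=> fM; rewrite nmM; apply: ler_pM => //.
by rewrite nm_e ImN -ofR_int Im_ofRM le_eqVlt; apply/orP; left; apply/eqP; congr expR; ring.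
Qed.

Lemma fourier_H (f : C -> C) : goodH f ->
  (forall z, upper_half z -> f (z + 1) = f z) ->
  exists a : int -> C, forall z, upper_half z ->
    (forall n : int, is_mean (fun w => f w * e (- (n%:~R * w))) z (a n)) /\
    has_sum (fun n : int => a n * e (n%:~R * z)) (f z).
Proof.
move=> gf per.
have st (y1 y2 : R) z : 0 < y1 -> strip y1 y2 z -> upper_half z.
  by move=> y0 /andP[h _]; apply: lt_le_trans h.
have gs (y1 y2 : R) : 0 < y1 -> exists f1 K, good (strip y1 y2) f f1 K.
  move=> y0; have [f1 [K g]] := gf 3 y1 y2 y0.
  do 2!eexists; apply: good_strip g => z Sz; apply: per; exact: st Sz.
have per' (y1 y2 : R) : 0 < y1 -> forall z, strip y1 y2 z -> f (z + 1) = f z.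
  by move=> y0 z /(st _ _ _ y0); apply: per.
have [a am] : exists a : int -> C,
    forall n : int, is_mean (fun w => f w * e (- (n%:~R * w))) (imagi R) (a n).
  have [f1 [K g]] := gs 1 1 ltr01.
  have S1 : strip 1 1 (imagi R) by rewrite /strip Im_i lexx.
  have := choice (fun n => coef_exists (per' 1 1 ltr01) g n S1).
  by case=> a H; exists a.
exists a => z; rewrite /upper_half /= => zH.
have m0 : 0 < Num.min (Im z) 1 by rewrite lt_min zH ltr01.
have [f1 [K g]] := gs (Num.min (Im z) 1) (Num.max (Im z) 1) m0.
have S1 : strip (Num.min (Im z) 1) (Num.max (Im z) 1) (imagi R).
  by rewrite /strip Im_i ge_min le_max lexx !orbT.
have Sz : strip (Num.min (Im z) 1) (Num.max (Im z) 1) z.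
  by rewrite /strip ge_min le_max lexx.
have am' n : is_mean (fun w => f w * e (- (n%:~R * w))) z (a n).
  exact: (coef_move (per' _ _ m0) g S1 Sz (am n)).
by split=> //; apply: (fourier_line (per' _ _ m0) g Sz am').
Qed.

Definition vanishes_infty (f : C -> C) :=
  forall eps : R, 0 < eps -> exists Y : R, forall z : C, Y <= Im z -> nm (f z) <= eps.

(** For n <= 0 the factor |e(-nw)| is at most 1 on the half-plane, so the mean, taken at a large
    height, is as small as [f] there. *)
Lemma coef_nonpos (f : C -> C) (c : C) (n : int) : vanishes_infty f -> n <= 0 ->
  (forall z, upper_half z -> is_mean (fun w => f w * e (- (n%:~R * w))) z c) -> c = 0.
Proof.
move=> fv n0 cm; apply: eq_of_nm_small => eps e0; rewrite subr0.
have [Y HY] := fv eps e0.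
pose y := Num.max Y 1.
have y1 : 1 <= y by rewrite /y le_max lexx orbT.
have zI (x : R) : Im (imagi R * ofR y + ofR x) = y by rewrite ImD Im_Mi Im_ofR addr0.
have zH : upper_half (imagi R * ofR y).
  by have := zI 0; rewrite addr0 /upper_half /= => ->; apply: lt_le_trans y1.
apply: is_mean_bound (cm _ zH) _ => x.
apply: le_trans (twist_bound (M := eps) n _) _; first by apply: HY; rewrite zI le_max lexx.
rewrite ler_piMr ?(ltW e0) // zI -[X in _ <= X]expR0 ler_expR.
have n0' : n%:~R <= 0 :> R by rewrite lerz0.
have p0 : 0 <= pi :> R := pi_ge0 R.
have : 0 <= 2 * pi * y by rewrite !mulr_ge0 //; lra.
nra.
Qed.

Lemma goodH_scale (f : C -> C) (h : nat) : (0 < h)%N -> goodH f ->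
  goodH (fun z => f (h%:R * z)).
Proof.
move=> h0 gf B y1 y2 y0; set H : R := h%:R.
have H1 : 1 <= H by rewrite ler1n.
have H0 : 0 < H by apply: lt_le_trans H1.
have [f1 [K [K0 h1 h2 h3]]] := gf (H * B) (H * y1) (H * y2) (mulr_gt0 H0 y0).
have bx z : box B y1 y2 z -> box (H * B) (H * y1) (H * y2) (h%:R * z).
  move=> [b /andP[b1 b2]]; rewrite /box -ofR_nat Re_ofRM Im_ofRM normrM (ger0_norm (ltW H0)).
  by split; rewrite ?ler_pM2l // b1.
have KH : K <= K * H by rewrite ler_peMr.
have KH2 : K * H <= K * H ^+ 2 by rewrite expr2 mulrA ler_peMr // mulr_ge0 // ltW.
exists (fun z => h%:R * f1 (h%:R * z)), (4 * (K * H ^+ 2)); split.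
- by lra.
- by move=> z /bx Uz; have := h1 _ Uz; lra.
- move=> z /bx Uz; rewrite nmM nm_nat; have := h2 _ Uz => k.
  have : H * nm (f1 (h%:R * z)) <= H * K by rewrite ler_wpM2l // ltW.
  rewrite -/H; lra.
- move=> z w /bx Uz /bx Uw d1; set d := nm (w - z).
  have E : nm (h%:R * w - h%:R * z) = H * d by rewrite -mulrBr nmM nm_nat.
  have d0 : 0 <= d by apply: nm_ge0.
  have E' : h%:R * f1 (h%:R * z) * (w - z) = f1 (h%:R * z) * (h%:R * w - h%:R * z) by ring.
  rewrite E'; have Kd : 0 <= K * (H * d) ^+ 2 by rewrite mulr_ge0 // exprn_ge0 // mulr_ge0 // ltW.
  have -> : 4 * (K * H ^+ 2) * d ^+ 2 = 4 * (K * (H * d) ^+ 2) by ring.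
  (* The dilation may push two points beyond distance 1, where the Taylor estimate says nothing;
     there the crude bounds are already dominated by the quadratic term. *)
  have [hd|hd] := leP (H * d) 1.
    have := h3 _ _ Uz Uw; rewrite E => /(_ hd); lra.
  apply: le_trans (nmB _ _) _; apply: le_trans (lerD (nmB _ _) (lexx _)) _.
  rewrite nmM E; have k1 := h1 _ Uz; have k2 := h1 _ Uw.
  have k3 : nm (f1 (h%:R * z)) * (H * d) <= K * (H * d).
    by rewrite ler_wpM2r ?h2 // mulr_ge0 // ltW.
  have k4 : K <= K * (H * d) by rewrite ler_peMr // ltW.
  have k5 : K * (H * d) <= K * (H * d) ^+ 2.
    have -> : K * (H * d) ^+ 2 = K * (H * d) * (H * d) by ring.
    by rewrite ler_peMr ?(ltW hd) // !mulr_ge0 // ltW.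
  lra.
Qed.

Lemma fourier_period (f : C -> C) (h : nat) : (0 < h)%N -> goodH f ->
  (forall z, upper_half z -> f (z + h%:R) = f z) -> vanishes_infty f ->
  exists a : int -> C, (forall n, n <= 0 -> a n = 0) /\
    forall z, upper_half z -> has_sum (fun n : int => a n * e (n%:~R * z / h%:R)) (f z).
Proof.
move=> h0 gf per van.
have H0 : 0 < h%:R :> R by rewrite ltr0n.
have hc : h%:R != 0 :> C by rewrite pnatr_eq0 -lt0n.
have up (z : C) : upper_half z -> upper_half (h%:R * z).
  by rewrite /upper_half /= -(ofR_nat R h) Im_ofRM => zH; rewrite mulr_gt0.
have [a Ha] : exists a : int -> C, forall z, upper_half z ->
    (forall n : int, is_mean (fun w => f (h%:R * w) * e (- (n%:~R * w))) z (a n)) /\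
    has_sum (fun n : int => a n * e (n%:~R * z)) (f (h%:R * z)).
  apply: (@fourier_H (fun z => f (h%:R * z))); first exact: goodH_scale.
  by move=> z zH; rewrite mulrDr mulr1 per //; apply: up.
have van' : vanishes_infty (fun z => f (h%:R * z)).
  move=> eps e0; have [Y HY] := van eps e0.
  exists (Y / h%:R) => z hz; apply: HY; rewrite -ofR_nat Im_ofRM mulrC.
  by rewrite -ler_pdivrMr.
exists a; split.
  move=> n n0; apply: (coef_nonpos (f := fun z => f (h%:R * z)) (n := n)) => // z zH.
  by have [] := Ha z zH.
move=> z zH; have zh : upper_half (h%:R^-1 * z).
  by rewrite /upper_half /= -ofR_nat -ofRV Im_ofRM pmulr_rgt0 // invr_gt0.
have [_] := Ha _ zh.
have -> : h%:R * (h%:R^-1 * z) = z by rewrite mulrA divff // mul1r.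
move=> S; apply: (eq_has_sum _ S) => n; congr (_ * e _).
by rewrite mulrA mulrAC.
Qed.

End FourierStrip.

(** * The inversion formula for theta *)

Section Gaussian.
Variable R : realType.
Local Notation C := (CC R).

Definition gauss (z w : C) (n : int) : C := e ((n%:~R + w) ^+ 2 * z).
(** The periodised Gaussian: theta(z) at w = 0, and 1-periodic in w, which makes Fourier expansion
    in w the Poisson summation formula. *)
Definition Phi (z w : C) : C := summability.sum (gauss z w).
Definition Qn (n : int) : R := 1 + n%:~R ^+ 2.

Lemma Qn_ge1 n : 1 <= Qn n.
Proof. by rewrite lerDl sqr_ge0. Qed.

Lemma Qn_inv2 n : (Qn n)^-1 <= inv2 R `|n|%N.
Proof.
rewrite /inv2 absz_eq0; case: eqP => [_|/eqP n0].
  by rewrite invf_le1 ?Qn_ge1 // (lt_le_trans ltr01 (Qn_ge1 n)).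
rewrite lef_pV2 ?posrE ?(lt_le_trans ltr01 (Qn_ge1 n)) //; last first.
  by rewrite exprn_gt0 // ltr0n absz_gt0.
by rewrite pmulrn abszE intr_norm real_normK ?num_real // /Qn lerDr.
Qed.

Lemma expRN_cube (t : R) : 0 <= t -> expR (- t) <= (1 + t / 3) ^- 3.
Proof.
move=> t0; have h : 1 + t / 3 <= expR (t / 3) by apply: expR_ge1Dx.
have p : 0 < 1 + t / 3 by lra.
rewrite expRN lef_pV2 ?posrE ?expR_gt0 ?exprn_gt0 //.
have -> : expR t = expR (t / 3) ^+ 3 by rewrite -expRM_natl; congr expR; field.
by apply: lerXn2r => //; rewrite nnegrE ?expR_ge0 // ltW.
Qed.

(** The exponent 3 leaves room for Taylor estimates: the square of the logarithmic derivative costs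
    Qn^2, and the remaining 1/Qn is summable. The variable w is complex because the line of
    integration in w will be moved. *)
Lemma gauss_bound (A B y1 y2 : R) : 0 < y1 -> exists2 K : R, 0 <= K &
  forall z w n, box A y1 y2 z -> `|Re w| <= B -> `|Im w| <= B ->
    nm (gauss z w n) <= K / Qn n ^+ 3.
Proof.
move=> y0; pose M := B ^+ 2 * (y2 + 2 * A ^+ 2 / y1).
pose L := 1 + 2 * B ^+ 2 + 3 / y1.
have L0 : 0 < L.
  have h : 0 < 3 / y1 by rewrite divr_gt0.
  by have := sqr_ge0 B; rewrite /L; lra.
exists (expR (2 * pi * M) * L ^+ 3).
  by rewrite mulr_ge0 ?expR_ge0 // exprn_ge0 // ltW.
move=> z w n [zA /andP[z1 z2]] wr wi.
set u := n%:~R + Re w; set v := Im w; set x := Re z; set y := Im z.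
have yy : 0 < y by apply: lt_le_trans z1.
have pi2 : 2 <= pi :> R := pi_ge2 R.
have EI : Im ((n%:~R + w) ^+ 2 * z) = (u ^+ 2 - v ^+ 2) * y + 2 * u * v * x.
  rewrite expr2 !ImM !ReM ReD ImD Re_int Im_int add0r -/u -/v -/x -/y; ring.
have v2 : v ^+ 2 <= B ^+ 2.
  by rewrite -[v ^+ 2]real_normK ?num_real // lerXn2r // nnegrE (le_trans _ wi).
have x2 : x ^+ 2 <= A ^+ 2.
  by rewrite -[x ^+ 2]real_normK ?num_real // lerXn2r // nnegrE (le_trans _ zA).
have r2 : (Re w) ^+ 2 <= B ^+ 2.
  by rewrite -[(Re w) ^+ 2]real_normK ?num_real // lerXn2r // nnegrE (le_trans _ wr).
(* Completing the square in u absorbs the cross term 2uvx, at the price of half of u^2 y and a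
   bounded quantity. *)
have key : u ^+ 2 * y1 / 2 - M <= Im ((n%:~R + w) ^+ 2 * z).
  rewrite EI.
  have s1 : 0 <= (u * y + 2 * (v * x)) ^+ 2 / (2 * y) by rewrite divr_ge0 ?sqr_ge0 // mulr_ge0 // ltW.
  have s2 : (u * y + 2 * (v * x)) ^+ 2 / (2 * y) = u ^+ 2 * y / 2 + 2 * u * v * x + 2 * (v * x) ^+ 2 / y.
    by field; rewrite gt_eqF.
  have s3 : 2 * (v * x) ^+ 2 / y <= 2 * (B ^+ 2 * A ^+ 2) / y1.
    apply: ler_pM; rewrite ?invr_ge0 ?(ltW yy) //; [by rewrite mulr_ge0 // sqr_ge0| |by rewrite lef_pV2].
    by rewrite ler_wpM2l // exprMn; apply: ler_pM => //; apply: sqr_ge0.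
  have s4 : v ^+ 2 * y <= B ^+ 2 * y2 by rewrite ler_pM ?sqr_ge0 // ltW.
  have s5 : u ^+ 2 * y1 <= u ^+ 2 * y by rewrite ler_wpM2l ?sqr_ge0.
  have -> : M = B ^+ 2 * y2 + 2 * (B ^+ 2 * A ^+ 2) / y1 by rewrite /M; ring.
  rewrite s2 in s1; rewrite mulrBl; lra.
rewrite /gauss nm_e.
set t := 2 * y1 * u ^+ 2.
have t0 : 0 <= t by rewrite mulr_ge0 ?sqr_ge0 // mulr_ge0 // ltW.
have h1 : expR (- (2 * pi * Im ((n%:~R + w) ^+ 2 * z))) <= expR (2 * pi * M) * expR (- t).
  rewrite -expRD ler_expR.
  have uy : 0 <= u ^+ 2 * y1 by rewrite mulr_ge0 ?sqr_ge0 // ltW.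
  have k1 : pi * (u ^+ 2 * y1 - 2 * M) <= pi * (2 * Im ((n%:~R + w) ^+ 2 * z)).
    by rewrite ler_wpM2l ?pi_ge0 //; lra.
  have k2 : 2 * (u ^+ 2 * y1) <= pi * (u ^+ 2 * y1) by rewrite ler_wpM2r.
  rewrite /t; lra.
apply: le_trans h1 _; rewrite -[leRHS]mulrA; apply: ler_wpM2l; first exact: expR_ge0.
apply: le_trans (expRN_cube t0) _.
have Q0 : 0 < Qn n by apply: lt_le_trans (Qn_ge1 n).
have p : 0 < 1 + t / 3 by lra.
have -> : L ^+ 3 / Qn n ^+ 3 = (Qn n / L) ^- 3 by rewrite expr_div_n invf_div.
rewrite lef_pV2 ?posrE ?exprn_gt0 ?divr_gt0 //.
apply: lerXn2r; rewrite ?nnegrE ?(ltW p) ?divr_ge0 // 1?ltW //.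
rewrite ltr_pdivrMr //.
have n2 : (n%:~R : R) ^+ 2 <= 2 * u ^+ 2 + 2 * (Re w) ^+ 2.
  have -> : n%:~R = u - Re w by rewrite /u addrK.
  have := sqr_ge0 (u + Re w); rewrite sqrrD sqrrB; lra.
have k3 : (3 / y1) * (t / 3) = 2 * u ^+ 2 by rewrite /t; field; rewrite gt_eqF.
have k4 : 0 <= t / 3 * (1 + 2 * B ^+ 2).
  by rewrite mulr_ge0 ?divr_ge0 //; have := sqr_ge0 B; lra.
have k5 : 0 < 3 / y1 by rewrite divr_gt0.
rewrite /Qn /L; have : (1 + t / 3) * (1 + 2 * B ^+ 2 + 3 / y1) =
  1 + 2 * B ^+ 2 + 3 / y1 + t / 3 * (1 + 2 * B ^+ 2) + (3 / y1) * (t / 3) by ring.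
move=> ->; rewrite k3; lra.
Qed.

Lemma Qn_good (U : C -> Prop) (t rho rho1 : C -> C) (n : int) (K D : R) : Uconv U ->
  0 <= K -> 0 <= D ->
  (forall z, U z -> [/\ cderiv t z (t z * rho z), cderiv rho z (rho1 z),
      nm (t z) <= K / Qn n ^+ 3, nm (rho z) <= D * Qn n & nm (rho1 z) <= D]) ->
  good U t (fun z => t z * rho z) (K * (1 + D + 4 * (D ^+ 2 + D)) * inv2 R `|n|%N).
Proof.
move=> Uc K0 D0 H; have Q1 := Qn_ge1 n.
have Q0 : 0 < Qn n by apply: lt_le_trans Q1.
have Q2 : Qn n <= Qn n ^+ 2 by rewrite expr2 ler_peMr // ltW.
apply: good_le (good_rho (b := K / Qn n ^+ 3) (r := D * Qn n) (r' := D) Uc _ _ _ H) => //.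
- apply: le_trans (_ : K * (1 + D + 4 * (D ^+ 2 + D)) / Qn n <= _); last first.
    apply: ler_wpM2l; last exact: Qn_inv2.
    by rewrite mulr_ge0 //; have := sqr_ge0 D; lra.
  have -> : K * (1 + D + 4 * (D ^+ 2 + D)) / Qn n =
     K / Qn n ^+ 3 * (Qn n ^+ 2 * (1 + D + 4 * (D ^+ 2 + D))) by field; rewrite gt_eqF.
  apply: ler_wpM2l; first by rewrite divr_ge0 // exprn_ge0 // ltW.
  have -> : Qn n ^+ 2 * (1 + D + 4 * (D ^+ 2 + D)) =
    Qn n ^+ 2 + D * Qn n ^+ 2 + 4 * ((D * Qn n) ^+ 2 + D * Qn n ^+ 2) by ring.
  have k1 : D * Qn n <= D * Qn n ^+ 2 by rewrite ler_wpM2l.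
  have k2 : D <= D * Qn n ^+ 2 by rewrite ler_peMr //; lra.
  lra.
- by rewrite divr_ge0 // exprn_ge0 // ltW.
- by rewrite mulr_ge0 // ltW.
Qed.

Lemma Qn_lin (n : int) (w : C) (B : R) : nm w <= B -> nm (n%:~R + w) <= (1 + B) * Qn n.
Proof.
move=> wB; have B0 : 0 <= B by apply: le_trans wB.
apply: le_trans (nmD _ _) _; rewrite nm_int /Qn -[n%:~R ^+ 2]real_normK ?num_real //.
set a := `|n%:~R|; have a0 : 0 <= a by rewrite /a.
have : 0 <= (a - 1) ^+ 2 by apply: sqr_ge0.
have : 0 <= B * a ^+ 2 by rewrite mulr_ge0 // sqr_ge0.
rewrite sqrrB; nra.
Qed.

Lemma Qn_sq (n : int) (w : C) (B : R) : nm w <= B ->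
  nm ((n%:~R + w) ^+ 2) <= (2 + 2 * B ^+ 2) * Qn n.
Proof.
move=> wB; have B0 : 0 <= B by apply: le_trans wB.
rewrite nmX; set a := `|n%:~R : R|; have a0 : 0 <= a by rewrite /a.
have h : nm (n%:~R + w) <= a + B by apply: le_trans (nmD _ _) _; rewrite nm_int lerD2l.
have : nm (n%:~R + w) ^+ 2 <= (a + B) ^+ 2.
  by apply: lerXn2r; rewrite ?nnegrE // addr_ge0.
rewrite /Qn -[n%:~R ^+ 2]real_normK ?num_real // -/a.
have : 0 <= (a - B) ^+ 2 by apply: sqr_ge0.
have : 0 <= B ^+ 2 * a ^+ 2 by rewrite mulr_ge0 // sqr_ge0.
rewrite sqrrB sqrrD; lra.
Qed.

Lemma nm_leB (w : C) (B : R) : nm w <= B -> `|Re w| <= B /\ `|Im w| <= B.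
Proof. by move=> h; split; apply: le_trans h; [apply: nm_Re|apply: nm_Im]. Qed.

Lemma gauss_has_sum (z w : C) : upper_half z -> has_sum (gauss z w) (Phi z w).
Proof.
rewrite /upper_half /= => zH.
have [K K0 H] := gauss_bound `|Re z| (nm w) (Im z) zH.
have [h1 h2] := nm_leB (lexx (nm w)).
apply: (sum_has_sum (b := fun n : int => K * inv2 R `|n|%N)); last exact: sumbZ (sumb_inv2 R).
move=> n; apply: le_trans (H z w n _ h1 h2) _; first by split; rewrite ?lexx.
apply: ler_wpM2l => //; apply: le_trans (Qn_inv2 n).
rewrite lef_pV2 ?posrE ?exprn_gt0 ?(lt_le_trans ltr01 (Qn_ge1 n)) //.
by rewrite ler_eXnr // Qn_ge1.
Qed.

Lemma Phi_goodH (w : C) : goodH (fun z => Phi z w).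
Proof.
move=> A y1 y2 y0; have [K K0 H] := gauss_bound A (nm w) y2 y0.
have [h1 h2] := nm_leB (lexx (nm w)).
pose D := nm (2 * ofR pi * imagi R) * (2 + 2 * nm w ^+ 2).
have D0 : 0 <= D by rewrite mulr_ge0 //; have := sqr_ge0 (nm w); lra.
do 2!eexists; apply: (good_series (t := fun n z => gauss z w n)
   (t1 := fun n z => gauss z w n * (2 * ofR pi * imagi R * (n%:~R + w) ^+ 2))
   (b := fun n => K * (1 + D + 4 * (D ^+ 2 + D)) * inv2 R `|n|%N)).
- move=> n; apply: (Qn_good (rho := fun=> _) (rho1 := fun=> 0)) => //; first exact: convex_box.
  move=> z Uz; split; [|exact: cderiv_cst|exact: H| |by rewrite nm0].
    by rewrite mulrC /gauss; apply: cderiv_e.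
  rewrite nmM; apply: le_trans (ler_wpM2l (nm_ge0 _) (Qn_sq n (lexx (nm w)))) _.
  by rewrite /D mulrA.
- apply: sumbZ (sumb_inv2 R); rewrite mulr_ge0 //; have := sqr_ge0 D; lra.
- by move=> z [_ /andP[z1 _]]; apply: gauss_has_sum; apply: lt_le_trans z1.
Qed.

Lemma Phi_good (z : C) (B y1 y2 : R) : upper_half z ->
  exists f1 K, good (box B y1 y2) (Phi z) f1 K.
Proof.
rewrite /upper_half /= => zH.
pose B' := `|B| + (`|y1| + `|y2|).
have [K K0 H] := gauss_bound `|Re z| B' (Im z) zH.
have wB w : box B y1 y2 w -> nm w <= B'.
  move=> [h1 /andP[h2 h3]]; apply: le_trans (nm_leRI _) _; apply: lerD.
    by apply: le_trans h1 _; apply: ler_norm.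
  have := ler_norm y1; have := ler_norm y2; have := ler_norm (- y1); have := ler_norm (- y2).
  rewrite !normrN ler_norml; lra.
have B0 : 0 <= B' by rewrite !addr_ge0.
pose k := nm (4 * ofR pi * imagi R * z).
pose D := k * (1 + B').
have D0 : 0 <= D by rewrite mulr_ge0 ?nm_ge0 // addr_ge0.
do 2!eexists; apply: (good_series (t := fun n w => gauss z w n)
   (t1 := fun n w => gauss z w n * (4 * ofR pi * imagi R * z * (n%:~R + w)))
   (b := fun n => K * (1 + D + 4 * (D ^+ 2 + D)) * inv2 R `|n|%N)).
- move=> n; apply: (Qn_good (rho := fun w => 4 * ofR pi * imagi R * z * (n%:~R + w))
      (rho1 := fun=> 4 * ofR pi * imagi R * z)) => //; first exact: convex_box.
  move=> w Uw; have [w1 w2] := nm_leB (wB w Uw).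
  have d1 : cderiv (fun w : C => n%:~R + w) w 1.
    by have := cderivD (cderiv_cst n%:~R w) (cderiv_id w); rewrite add0r.
  split.
  + have := cderiv_comp (f := fun v : C => e (z * v)) (g := fun v : C => (n%:~R + v) ^+ 2)
      (cderiv_e z _) (cderivX (f := fun v : C => n%:~R + v) 2 d1).
    rewrite /gauss; under [X in cderiv X]funext do rewrite mulrC.
    by congr cderiv; rewrite [z * _]mulrC mulr1 expr1; ring.
  + by have := cderivZ (4 * ofR pi * imagi R * z) d1; rewrite mulr1.
  + by apply: H => //; split; rewrite ?lexx.
  + rewrite nmM; apply: le_trans (ler_wpM2l (nm_ge0 _) (Qn_lin n (wB w Uw))) _.
    by rewrite /D mulrA.
  + by rewrite /D ler_peMr ?nm_ge0 // lerDl.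
- apply: sumbZ (sumb_inv2 R); rewrite mulr_ge0 //; have := sqr_ge0 D; lra.
- by move=> w _; apply: gauss_has_sum.
Qed.

Lemma Phi1 (z w : C) : upper_half z -> Phi z (w + 1) = Phi z w.
Proof.
move=> zH.
have E n : gauss z w (n + 1) = gauss z (w + 1) n.
  by rewrite /gauss rmorphD /= -addrA (addrC 1).
have S : has_sum (fun n : int => gauss z w (n + 1)) (Phi z w).
  apply/(has_sum_inj (f := fun n : int => n + 1) (x := gauss z w)); last exact: gauss_has_sum.
    exact: addIr.
  by move=> j /(_ (j - 1)); rewrite subrK.
exact: (has_sum_unique (gauss_has_sum (w := w + 1) zH) (eq_has_sum E S)).
Qed.

(** Expanding the square, (n + w + 1/(2z))^2 z = (n + w)^2 z + n + w + 1/(4z), and e(n) = 1. *)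
Lemma Phi_quasi (z w : C) : upper_half z ->
  Phi z (w + (2 * z)^-1) = e (w + (4 * z)^-1) * Phi z w.
Proof.
move=> zH; have z0 : z != 0.
  by apply: contraTneq zH => ->; rewrite /upper_half /= ltxx.
have S := has_sumZ (c := e (w + (4 * z)^-1)) (gauss_has_sum (w := w) zH).
apply: (has_sum_unique (gauss_has_sum zH) (eq_has_sum _ S)) => n.
rewrite /gauss -eD -[LHS](e_addint _ n).
by congr e; field.
Qed.

End Gaussian.

Section ThetaInversion.
Variable R : realType.
Local Notation C := (CC R).

Lemma H_neq0 (z : C) : upper_half z -> z != 0.
Proof. by move=> zH; apply: contraTneq zH => ->; rewrite /upper_half /= ltxx. Qed.

Lemma upper_scale (x : R) (z : C) : 0 < x -> upper_half z -> upper_half (ofR x * z).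
Proof. by rewrite /upper_half /= => x0 zH; rewrite Im_ofRM mulr_gt0. Qed.

Lemma Im_oppV (z : C) : Im (- z^-1) = Im z / nm z ^+ 2.
Proof.
have [->|z0] := eqVneq z 0; first by rewrite invr0 oppr0 nm0 mul0r.
have n0 : 0 < nm z by rewrite nm_gt0.
have E : z^-1 = ofR (nm z ^- 2) * (ofR (Re z) - imagi R * ofR (Im z)).
  apply: (mulfI z0); rewrite divff // mulrCA {2}(ReIm z).
  have -> : (ofR (Re z) + imagi R * ofR (Im z)) * (ofR (Re z) - imagi R * ofR (Im z)) =
     ofR (Re z) ^+ 2 - imagi R ^+ 2 * ofR (Im z) ^+ 2 by ring.
  by rewrite imagi2 mulN1r opprK -!ofRX -ofRD -nm2 -ofRM mulVf // expf_neq0 // gt_eqF.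
rewrite ImN E Im_ofRM ImB Im_Mi !Re_ofR Im_ofR sub0r mulrN opprK mulrC //.
Qed.

Lemma upper_inv (z : C) : upper_half z -> upper_half (- z^-1).
Proof.
move=> zH; rewrite /upper_half /mkset Im_oppV divr_gt0 // exprn_gt0 // nm_gt0.
exact: H_neq0.
Qed.

Lemma upper_inv4 (z : C) : upper_half z -> upper_half (- (4 * z)^-1).
Proof.
move=> zH; apply: upper_inv; rewrite -(ofR_nat R 4); apply: upper_scale => //.
Qed.

(** Poisson summation without a Gaussian integral. Moving the line by 1/(2z) and using [Phi_quasi]
    gives a two-term recursion, so the n-th coefficient in w is e(-n^2/(4z)) times the zeroth. The
    latter stays unknown and is remembered only as a mean. *)
Lemma Phi_coef (z : C) : upper_half z -> exists c : C,
  is_mean (Phi z) 0 c /\ forall w : C, Phi z w =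
    c * summability.sum (fun n : int => e (n%:~R ^+ 2 * - (4 * z)^-1 + n%:~R * w)).
Proof.
move=> zH; have z0 := H_neq0 zH.
have per y1 y2 w : strip y1 y2 w -> Phi z (w + 1) = Phi z w by move=> _; apply: Phi1.
have gs y1 y2 : exists f1 K, good (strip y1 y2) (Phi z) f1 K.
  have [f1 [K g]] := Phi_good 3 y1 y2 zH.
  by do 2!eexists; apply: good_strip g; apply: per.
have [a am] : exists a : int -> C,
    forall n : int, is_mean (fun w => Phi z w * e (- (n%:~R * w))) 0 (a n).
  have [f1 [K g]] := gs 0 0.
  have S0 : strip 0 0 (0 : C) by rewrite /strip lexx.
  have := choice (fun n => coef_exists (per 0 0) g n S0).
  by case=> a H; exists a.
have am' w n : is_mean (fun w => Phi z w * e (- (n%:~R * w))) w (a n).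
  have [f1 [K g]] := gs (- `|Im w|) `|Im w|.
  have S0 : strip (- `|Im w|) `|Im w| (0 : C) by rewrite /strip /= oppr_le0 normr_ge0.
  have Sw : strip (- `|Im w|) `|Im w| w by rewrite /strip -ler_norml.
  exact: (coef_move (per _ _) g S0 Sw (am n)).
have hs w : has_sum (fun n : int => a n * e (n%:~R * w)) (Phi z w).
  have [f1 [K g]] := gs (Im w) (Im w).
  have Sw : strip (Im w) (Im w) w by rewrite /strip lexx.
  by apply: (fourier_line (per _ _) g Sw) => n; apply: am'.
(* The coefficient is the same on every line, so it is computed here on the one through 1/(2z). *)
have rec n : a n = e ((4 * z)^-1 - n%:~R * (2 * z)^-1) * a (n - 1).
  apply: is_mean_unique (am' (2 * z)^-1 n) _.
  have [c c0 H] := is_meanZ (e ((4 * z)^-1 - n%:~R * (2 * z)^-1)) (am (n - 1)).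
  exists c => // N N0.
  have -> : avg N (fun w => Phi z w * e (- (n%:~R * w))) (2 * z)^-1 =
      avg N (fun w => Phi z (w + (2 * z)^-1) * e (- (n%:~R * (w + (2 * z)^-1)))) 0.
    by rewrite -{1}(add0r (2 * z)^-1); apply: avg_shift.
  apply: le_trans (H N N0); rewrite le_eqVlt; apply/orP; left; apply/eqP.
  congr (nm (_ - _)); congr (_ * _); apply: eq_bigr => j _.
  set w := 0 + _; rewrite Phi_quasi //.
  have -> : e (w + (4 * z)^-1) * Phi z w * e (- (n%:~R * (w + (2 * z)^-1))) =
    (e (w + (4 * z)^-1) * e (- (n%:~R * (w + (2 * z)^-1)))) * Phi z w by ring.
  have -> : e ((4 * z)^-1 - n%:~R / (2 * z)) * (Phi z w * e (- ((n - 1)%:~R * w))) =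
    (e ((4 * z)^-1 - n%:~R / (2 * z)) * e (- ((n - 1)%:~R * w))) * Phi z w by ring.
  by rewrite -!eD; congr (e _ * _); rewrite rmorphB /=; ring.
have aE n : a n = a 0 * e (n%:~R ^+ 2 * - (4 * z)^-1).
  have st n' : a n' = a 0 * e (n'%:~R ^+ 2 * - (4 * z)^-1) <->
      a (n' - 1) = a 0 * e ((n' - 1)%:~R ^+ 2 * - (4 * z)^-1).
    have E : e (n'%:~R ^+ 2 * - (4 * z)^-1) = e ((4 * z)^-1 - n'%:~R * (2 * z)^-1) * e ((n' - 1)%:~R ^+ 2 * - (4 * z)^-1).
      by rewrite -eD; congr e; rewrite rmorphB /=; field.
    rewrite rec E mulrCA; split=> [|->//]; exact: (mulfI (e_neq0 _)).
  elim/int_ind: n => [|n IH|n IH].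
  - by rewrite expr0n mul0r e_0 mulr1.
  - by apply/st; rewrite -addn1 PoszD addrK.
  - have -> : - n.+1%:Z = - n%:Z - 1 by lia.
    exact: (st (- n%:Z)).1.
exists (a 0); split.
  by apply: is_mean_ext (am 0) => x; rewrite mul0r oppr0 e_0 mulr1.
move=> w; have h := hs w.
have E n : a n * e (n%:~R * w) = a 0 * e (n%:~R ^+ 2 * - (4 * z)^-1 + n%:~R * w).
  by rewrite aE eD mulrA.
have S : has_sum (fun n : int => e (n%:~R ^+ 2 * - (4 * z)^-1 + n%:~R * w))
   (summability.sum (fun n : int => e (n%:~R ^+ 2 * - (4 * z)^-1 + n%:~R * w))).
  have zi := upper_inv4 zH.
  have S1 := gauss_has_sum (w := - (2 * z * w)) zi.
  have S2 := has_sumZ (c := e (z * w ^+ 2)) S1.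
  have E2 n : e (z * w ^+ 2) * gauss (- (4 * z)^-1) (- (2 * z * w)) n =
     e (n%:~R ^+ 2 * - (4 * z)^-1 + n%:~R * w).
    by rewrite /gauss -eD; congr e; field.
  have S3 := eq_has_sum E2 S2.
  by rewrite (has_sum_sum S3).
exact: (has_sum_unique (eq_has_sum E h) (has_sumZ (c := a 0) S)).
Qed.

Lemma theta_Phi (z : C) : theta z = Phi z 0.
Proof.
rewrite /theta /Phi; congr summability.sum; apply/funext => n.
by rewrite /gauss addr0 rmorphXn.
Qed.

(** The part of theta over odd squares, since 4 (n + 1/2)^2 = (2n + 1)^2. *)
Definition theta_odd (z : C) : C := Phi (4 * z) 2^-1.

Lemma theta_has_sum (z : C) : upper_half z ->
  has_sum (fun n : int => e ((n ^+ 2)%:~R * z)) (theta z).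
Proof.
move=> zH; rewrite theta_Phi; apply: (eq_has_sum _ (gauss_has_sum zH)) => n.
by rewrite /gauss addr0 rmorphXn.
Qed.

Lemma up4 (z : C) : upper_half z -> upper_half (4 * z).
Proof. by move=> zH; rewrite -(ofR_nat R 4); apply: upper_scale. Qed.

Lemma theta_odd_has_sum (z : C) : upper_half z ->
  has_sum (fun n : int => e (((2 * n + 1) ^+ 2)%:~R * z)) (theta_odd z).
Proof.
move=> /up4 zH; apply: (eq_has_sum _ (gauss_has_sum (w := 2^-1) zH)) => n.
by rewrite /gauss rmorphXn rmorphD rmorphM /=; congr e; field.
Qed.

Lemma upT (z : C) (x : R) : upper_half (z + ofR x) = upper_half z.
Proof. by rewrite /upper_half /mkset ImD Im_ofR addr0. Qed.

(** The same [c] in both identities: they are the cases w = 0 and w = 1/2 of one expansion. *)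
Lemma theta_inversion (z : C) : upper_half z -> exists c : C,
  [/\ is_mean (Phi z) 0 c, theta z = c * theta (- (4 * z)^-1) &
      theta_odd (z / 4) = c * theta (- (4 * z)^-1 + 2^-1)].
Proof.
move=> zH; have [c [h1 h2]] := Phi_coef zH; exists c; split=> //.
  rewrite theta_Phi h2 /theta; congr (_ * _); congr summability.sum.
  by apply/funext => n; rewrite mulr0 addr0 rmorphXn.
rewrite /theta_odd mulrC divfK // h2.
congr (_ * _); rewrite /theta; congr summability.sum; apply/funext => n.
rewrite mulrDr eD [in RHS]eD rmorphXn /=; congr (_ * _).
(* The integers n and n^2 have the same parity, so the sign e(n/2) is the effect of the translation
   by 1/2 on the n-th term. *)
rewrite -[n%:~R / 2](subrK (n%:~R ^+ 2 / 2)) eD.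
rewrite (_ : n%:~R / 2 - n%:~R ^+ 2 / 2 = (- (n * (n - 1)) %/ 2)%Z%:~R); first by rewrite e_int mul1r.
have ev : (2 %| - (n * (n - 1)))%Z.
  rewrite dvdzE abszN abszM Euclid_dvdM //.
  by apply/orP; rewrite !dvdn2; lia.
apply: (mulIf (_ : 2 != 0 :> C)); first by rewrite (pnatr_eq0 _ 2).
rewrite -[X in _ = _ * X]/((2 : int)%:~R) -rmorphM /= divzK // rmorphN rmorphM rmorphB /=.
by field.
Qed.

Lemma theta1 (z : C) : upper_half z -> theta (z + 1) = theta z.
Proof.
move=> zH; have zH' : upper_half (z + 1) by rewrite -ofR1 upT.
apply: (has_sum_unique (theta_has_sum zH')).
apply: (eq_has_sum _ (theta_has_sum zH)) => n.
by rewrite mulrDr mulr1 e_addint.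
Qed.

(** Odd squares are congruent to 1 modulo 8. *)
Lemma theta_odd8 (z : C) : upper_half z -> theta_odd (z + 8^-1) = e 8^-1 * theta_odd z.
Proof.
move=> zH; have zH' : upper_half (z + 8^-1) by rewrite -(ofR_nat R 8) -ofRV upT.
apply: (has_sum_unique (theta_odd_has_sum zH')).
apply: (eq_has_sum _ (has_sumZ (c := e 8^-1) (theta_odd_has_sum zH))) => n.
rewrite -eD mulrDr addrC eD [in RHS]eD; congr (_ * _).
have ev : (2 %| n * (n + 1))%Z.
  rewrite dvdzE abszM Euclid_dvdM //.
  by apply/orP; rewrite !dvdn2; lia.
rewrite -[LHS](e_addint _ ((n * (n + 1)) %/ 2)%Z); congr e.
apply: (mulIf (_ : 2 != 0 :> C)); first by rewrite (pnatr_eq0 _ 2).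
rewrite mulrDl -[X in _ + _ * X]/((2 : int)%:~R) -rmorphM /= divzK //.
by rewrite rmorphXn !rmorphM !rmorphD rmorphM /=; field.
Qed.

Lemma has_sum_classes (N : nat) (x : int -> C) (s : nat -> C) (l : C) : (0 < N)%N ->
  has_sum x l -> (forall j, (j < N)%N -> has_sum (fun n : int => x (n * N%:Z + j%:Z)) (s j)) ->
  l = \sum_(j < N) s j.
Proof.
move=> N0 Hx Hs; pose y (j : nat) (m : int) := if (m %% N%:Z)%Z == j%:Z then x m else 0.
have H (j : 'I_N) : has_sum (y j) (s j).
  apply/(has_sum_inj (f := fun n : int => n * N%:Z + j%:Z)).
  - by move=> a b /addIr /mulIf; apply; rewrite -lt0n.
  - move=> m hm; rewrite /y; case: eqP => // E; case: (hm (m %/ N%:Z)%Z).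
    by rewrite -E -divz_eq.
  - apply: (eq_has_sum _ (Hs j (ltn_ord j))) => n.
    by rewrite /y modzMDl modz_small ?eqxx //= ltz_nat ltn_ord.
have S := has_sum_big (r := index_enum 'I_N) H.
apply: (has_sum_unique Hx (eq_has_sum _ S)) => m; rewrite /y.
have N0' : N%:Z != 0 by rewrite -lt0n.
have jN : (absz (m %% N%:Z)%Z < N)%N.
  by rewrite -ltz_nat gez0_abs ?modz_ge0 // ltz_pmod.
rewrite (bigD1 (Ordinal jN)) //= gez0_abs ?modz_ge0 // eqxx big1 ?addr0 //.
move=> j /eqP hj; case: eqP => // E; case: hj; apply: val_inj => /=.
by rewrite E.
Qed.

Lemma theta_split (z : C) : upper_half z -> theta z = theta (4 * z) + theta_odd z.
Proof.
move=> zH; pose s (j : nat) := if j == 0%N then theta (4 * z) else theta_odd z.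
have := has_sum_classes (N := 2) (s := s) isT (theta_has_sum zH) _.
rewrite !big_ord_recl big_ord0 /= addr0; apply; case=> [|[|//]] _; rewrite /s /=.
  apply: (eq_has_sum _ (theta_has_sum (up4 zH))) => n.
  by congr e; rewrite addr0 !rmorphXn rmorphM /=; ring.
apply: (eq_has_sum _ (theta_odd_has_sum zH)) => n.
by rewrite [2 * n]mulrC.
Qed.

(** The points n + j/N run once through the multiples of 1/N, so a Riemann sum of the periodised
    Gaussian is again a theta value. *)
Lemma avg_Phi (N : nat) (z : C) : (0 < N)%N -> upper_half z ->
  avg N (Phi z) 0 = N%:R^-1 * theta (z / N%:R ^+ 2).
Proof.
move=> N0 zH; have N0' : N%:R != 0 :> C by rewrite pnatr_eq0 -lt0n.
have zN : upper_half (z / N%:R ^+ 2).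
  rewrite mulrC -ofR_nat -ofRX -ofRV; apply: upper_scale => //.
  by rewrite invr_gt0 exprn_gt0 // ltr0n.
congr (_ * _).
rewrite (has_sum_classes N0 (theta_has_sum zN) (s := fun j : nat => Phi z (0 + ofR (j%:R / N%:R)))) //.
move=> j _; apply: (eq_has_sum _ (gauss_has_sum zH)) => n.
rewrite /gauss add0r ofRM ofRV !ofR_nat rmorphXn rmorphD rmorphM /= -!pmulrn.
by congr e; field.
Qed.

(** The substitution rule for the Gaussian integral, read off from [avg_Phi]: N points for z/M^2 and
    NM points for z give the same theta value. *)
Lemma mean_scale (z c : C) (M : nat) : (0 < M)%N -> upper_half z ->
  is_mean (Phi z) 0 c -> is_mean (Phi (z / M%:R ^+ 2)) 0 (M%:R * c).
Proof.
move=> M0 zH [k k0 H]; have M0' : M%:R != 0 :> C by rewrite pnatr_eq0 -lt0n.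
have Mr : 0 < M%:R :> R by rewrite ltr0n.
have zM : upper_half (z / M%:R ^+ 2).
  rewrite mulrC -ofR_nat -ofRX -ofRV; apply: upper_scale => //.
  by rewrite invr_gt0 exprn_gt0.
exists k => // N N0; have N0' : N%:R != 0 :> C by rewrite pnatr_eq0 -lt0n.
have NM0 : (0 < N * M)%N by rewrite muln_gt0 N0.
rewrite avg_Phi // (_ : N%:R^-1 * theta (z / M%:R ^+ 2 / N%:R ^+ 2) = M%:R * avg (N * M) (Phi z) 0); last first.
  rewrite avg_Phi // natrM; have -> : z / M%:R ^+ 2 / N%:R ^+ 2 = z / (N%:R * M%:R) ^+ 2.
    by field; rewrite M0' N0'.
  by field; rewrite M0' N0'.
rewrite -mulrBr nmM nm_nat mulrC -ler_pdivlMr //.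
by apply: le_trans (H _ NM0) _; rewrite natrM invfM mulrA.
Qed.

End ThetaInversion.

(** * Zeros of theta *)

Section ThetaNonvanishing.
Variable R : realType.
Local Notation C := (CC R).

(** At height 7/20, using only pi >= 2, each factor q contributes at most e^(-7/5). The bound 3/10
    makes the two-sided geometric tail 2 (3/7) smaller than 1. *)
Lemma exp75 : expR (- (7 / 5)) <= 3 / 10 :> R.
Proof.
have h : 1 + 7 / 40 <= expR (7 / 40) :> R by apply: expR_ge1Dx.
have h8 : (1 + 7 / 40) ^+ 8 <= expR (7 / 40) ^+ 8 :> R.
  by apply: lerXn2r => //; rewrite nnegrE ?expR_ge0 //; lra.
rewrite expRN -[3 / 10](invrK) lef_pV2 ?posrE ?expR_gt0 ?invr_gt0 ?divr_gt0 //.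
have -> : expR (7 / 5) = expR (7 / 40) ^+ 8 :> R.
  by rewrite -expRM_natl; congr expR; field.
by apply: le_trans h8; rewrite !exprS expr0; lra.
Qed.

Definition geo (n : nat) : R := if n == 0%N then 0 else (3 / 10) ^+ n.

Lemma sumb_geo : sumb (fun n : int => geo `|n|%N) (2 * (3 / 7)).
Proof.
apply: sumb_int => [n|].
  by rewrite /geo; case: ifP => // _; apply: exprn_ge0; lra.
have H N : \sum_(n < N.+1) geo n <= 3 / 7 - 3 / 7 * (3 / 10) ^+ N.
  elim: N => [|N IH]; first by rewrite big_ord_recr big_ord0 /= /geo eqxx expr0; lra.
  rewrite big_ord_recr /=; apply: le_trans (lerD IH (lexx _)) _.
  by rewrite /geo /= !exprS; lra.
case=> [|N]; first by rewrite big_ord0; lra.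
by apply: le_trans (H N) _; rewrite gerBl mulr_ge0 ?exprn_ge0 //; lra.
Qed.

Lemma nm_e_geo (z : C) (m n : int) : 7 / 20 <= Im z -> n != 0 -> (`|n| <= m)%R ->
  nm (e (m%:~R * z)) <= geo `|n|%N.
Proof.
move=> zI n0 nm'; rewrite /geo absz_eq0 (negPf n0).
have pi2 : 2 <= pi :> R := pi_ge2 R.
apply: le_trans (_ : expR (- (7 / 5)) ^+ `|n|%N <= _); last first.
  by apply: lerXn2r; rewrite ?nnegrE ?expR_ge0 ?exp75 //; lra.
rewrite nm_e -ofR_int Im_ofRM -expRM_natl ler_expR mulrN lerN2.
have : `|n|%N%:R <= m%:~R :> R by rewrite pmulrn abszE ler_int.
set u : R := `|n|%N%:R; set v : R := m%:~R; move=> uv.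
have u0 : 0 <= u by rewrite ler0n.
have k : 7 / 5 <= 2 * pi * Im z.
  have : 0 <= (pi - 2) * Im z by rewrite mulr_ge0 //; lra.
  lra.
have -> : 2 * pi * (v * Im z) = v * (2 * pi * Im z) by ring.
by apply: ler_pM => //; lra.
Qed.

Lemma theta_high (z : C) : 7 / 20 <= Im z -> theta z != 0.
Proof.
move=> zI; have zH : upper_half z by apply: lt_le_trans zI; lra.
have S := has_sumB (theta_has_sum zH) (has_sum_delta (c := 1 : C) (0 : int)).
have h : nm (theta z - 1) <= 2 * (3 / 7).
  apply: has_sum_le S _; apply: sumb_le sumb_geo => n.
  case: eqP => [->|/eqP n0].
    by rewrite expr0n mul0r e_0 subrr nm0 /geo eqxx.
  rewrite subr0; apply: nm_e_geo => //; nia.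
apply: contraTneq h => ->; rewrite sub0r nmN nm1 -ltNge; lra.
Qed.

(** After division by e(z/4) the indices 0 and -1 both contribute 1, and the remaining terms are too
    small to cancel 2. *)
Lemma theta_odd_high (z : C) : 7 / 20 <= Im z -> theta_odd (z / 4) != 0.
Proof.
move=> zI; have zH : upper_half z by apply: lt_le_trans zI; lra.
rewrite /theta_odd mulrC divfK //.
have S := gauss_has_sum (w := 2^-1) zH.
have S1 := has_sumZ (c := e (- (z / 4))) S.
have S2 := has_sumB (has_sumB S1 (has_sum_delta (c := 1 : C) (0 : int))) (has_sum_delta (c := 1 : C) (-1 : int)).
have h : nm (e (- (z / 4)) * Phi z 2^-1 - 1 - 1) <= 2 * (3 / 7).
  apply: has_sum_le S2 _; apply: sumb_le sumb_geo => n.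
  have -> : e (- (z / 4)) * gauss z 2^-1 n = e ((n ^+ 2 + n)%:~R * z).
    by rewrite /gauss -eD rmorphD rmorphXn /=; congr e; field.
  case: eqP => [->|/eqP n0].
    by rewrite /= mul0r e_0 subrr subr0 nm0 /geo eqxx.
  case: eqP => [->|/eqP n1].
    rewrite (_ : (-1) ^+ 2 + -1 = 0 :> int) // mul0r e_0 subr0 subrr nm0 /geo /=; lra.
  rewrite !subr0; apply: nm_e_geo => //; nia.
apply: contraTneq h => ->; rewrite mulr0 sub0r -opprD nmN.
by rewrite -[1 + 1]/(2%:R) nm_nat -ltNge; lra.
Qed.

(** The three classical theta constants at 2z. A descent for theta alone would not close up: z -> z
    + 1/2 and z -> -1/(4z) permute these three up to non-zero factors. *)
Definition theta_nv (z : C) :=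
  [/\ theta z != 0, theta (z + 2^-1) != 0 & theta_odd (z / 4) != 0].

Lemma upper_half2 (z : C) : upper_half z -> upper_half (z + 2^-1).
Proof. by rewrite -(ofR_nat R 2) -ofRV upT. Qed.

Lemma inv4K (z : C) : upper_half z -> - (4 * - (4 * z)^-1)^-1 = z.
Proof. by move=> /H_neq0 z0; field. Qed.

Lemma theta_nv_inv (z : C) : upper_half z -> theta_nv (- (4 * z)^-1) -> theta_nv z.
Proof.
move=> zH; have wH := upper_inv4 zH; have Ez := inv4K zH.
have [c [_ h1 h2]] := theta_inversion zH; have [c' [_ k1 k2]] := theta_inversion wH.
rewrite Ez in k1 k2; move=> [n1 n2 n3].
have tz : theta z != 0 by apply: contraNneq n1; rewrite k1 => ->; rewrite mulr0.
split=> //; first by apply: contraNneq n3; rewrite k2 => ->; rewrite mulr0.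
rewrite h2 mulf_neq0 //; apply: contraNneq tz; rewrite h1 => ->; by rewrite mul0r.
Qed.

Lemma theta_nv_half (z : C) : upper_half z -> theta_nv (z + 2^-1) <-> theta_nv z.
Proof.
move=> zH; have zH4 : upper_half (z / 4).
  by rewrite mulrC -(ofR_nat R 4) -ofRV; apply: upper_scale => //; rewrite invr_gt0.
rewrite /theta_nv (_ : z + 2^-1 + 2^-1 = z + 1); last by field.
rewrite theta1 // mulrDl (_ : 2^-1 / 4 = 8^-1 :> C); last by field.
rewrite theta_odd8 // mulf_eq0 (negPf (e_neq0 _)) /=.
by split=> [[]|[]].
Qed.

Lemma theta_nv_halves (n : int) (z : C) : upper_half z ->
  theta_nv (z + n%:~R / 2) <-> theta_nv z.
Proof.
have st (m : int) (w : C) : upper_half w -> upper_half (w + m%:~R / 2).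
  by rewrite -(ofR_nat R 2) -ofR_int -ofRV -ofRM upT.
have nn (m : nat) (w : C) : upper_half w -> theta_nv (w + m%:R / 2) <-> theta_nv w.
  elim: m w => [|m IH] w wH; first by rewrite mul0r addr0.
  rewrite -natr1 mulrDl mul1r addrA theta_nv_half ?IH //.
  by have := st m w wH; rewrite -pmulrn.
move=> zH; case: n => n; first by rewrite -pmulrn; apply: nn.
rewrite NegzE mulrNz -pmulrn -(nn n.+1); last by have := st (- n.+1%:Z) z zH; rewrite mulrNz -pmulrn.
by rewrite mulNr subrK.
Qed.

Lemma theta_nv_all (z : C) : upper_half z -> theta_nv z.
Proof.
(* Shift the real part into [-1/4, 1/4], then invert. Below height 7/20 one has 4|z|^2 <= 4 (1/16 +
   49/400) < 3/4, so the height grows by at least 4/3; [k] bounds the number of inversions. *)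
have main (k : nat) (w : C) : upper_half w -> 7 / 20 <= Im w * (4 / 3) ^+ k -> theta_nv w.
  elim: k w => [|k IH] w wH hk.
    rewrite expr0 mulr1 in hk; split; [exact: theta_high| |exact: theta_odd_high].
    by apply: theta_high; rewrite -(ofR_nat R 2) -ofRV ImD Im_ofR addr0.
  have [hw|hw] := leP (7 / 20) (Im w).
    by apply: IH => //; apply: le_trans hw _; rewrite ler_peMr ?exprn_ege1 //; [move: wH; rewrite /upper_half /= => /ltW|lra].
  pose j : int := Num.floor (2 * Re w + 2^-1).
  have jP := floor_itv (2 * Re w + 2^-1); rewrite -/j rmorphD /= in jP.
  pose z' := w + (- j)%:~R / 2.
  have Ez : z' = w - ofR (j%:~R / 2) by rewrite /z' rmorphN /= mulNr ofRM ofRV (ofR_nat R 2) ofR_int.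
  have zI : Im z' = Im w by rewrite Ez ImB Im_ofR subr0.
  have zR : - (1 / 4) <= Re z' <= 1 / 4 by rewrite Ez ReB Re_ofR; lra.
  have zH' : upper_half z' by rewrite /upper_half /mkset zI.
  apply/(theta_nv_halves (- j) wH); rewrite -/z'.
  apply: theta_nv_inv => //; apply: IH; first exact: upper_inv4.
  apply: le_trans hk _; rewrite exprS mulrA; apply: ler_wpM2r; first by apply: exprn_ge0; lra.
  rewrite Im_oppV -(ofR_nat R 4) nmM nm_ofR ger0_norm // Im_ofRM zI.
  have wI : 0 < Im w := wH.
  have n0 : 0 < nm z' by rewrite nm_gt0; apply: H_neq0.
  have n2 : nm z' ^+ 2 <= 37 / 200.
    have : Re z' ^+ 2 <= 1 / 16.
      have : 0 <= (1 / 4 - Re z') * (1 / 4 + Re z') by rewrite mulr_ge0 //; lra.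
      lra.
    have : Im w ^+ 2 <= 49 / 400.
      have : 0 <= (7 / 20 - Im w) * (7 / 20 + Im w) by rewrite mulr_ge0 //; lra.
      lra.
    rewrite nm2 zI; lra.
  have -> : 4 * Im w / (4 * nm z') ^+ 2 = Im w * (4 * nm z' ^+ 2)^-1 by field; rewrite gt_eqF.
  rewrite ler_pM2l // -[4 / 3]invrK lef_pV2 ?posrE ?invr_gt0 ?mulr_gt0 ?exprn_gt0 ?divr_gt0 //.
  lra.
move=> zH; have [k hk] := exists_nat_ge ((7 / 20) / (Im z / 3)).
apply: (main k.+1) => //.
have wI : 0 < Im z / 3 by rewrite divr_gt0.
move: hk; rewrite ler_pdivrMr // => hk; apply: le_trans hk _.
(* Bernoulli's inequality, enough to see that the heights exceed any bound. *)
have B : 1 + k.+1%:R / 3 <= (4 / 3) ^+ k.+1 :> R.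
  elim: (k.+1) => [|n IH]; first by rewrite expr0; lra.
  have n0 : 0 <= n%:R :> R by rewrite ler0n.
  by rewrite exprS -natr1; lra.
have : 0 <= Im z by apply: ltW.
nra.
Qed.

Lemma theta_neq0 (z : C) : upper_half z -> theta z != 0.
Proof. by case/theta_nv_all. Qed.

Lemma theta_goodH : goodH (@theta R).
Proof. by rewrite (_ : @theta R = fun z => Phi z 0); [apply: Phi_goodH | apply/funext => z; apply: theta_Phi]. Qed.

(** The unknown constant of [theta_inversion], now a holomorphic function of z. It is a square root
    of i/(2z); only the square is computed. *)
Definition theta_mult (z : C) : C := theta z / theta (- (4 * z)^-1).

Lemma theta_multE (z : C) : upper_half z ->
  [/\ is_mean (Phi z) 0 (theta_mult z), theta z = theta_mult z * theta (- (4 * z)^-1) &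
      theta_odd (z / 4) = theta_mult z * theta (- (4 * z)^-1 + 2^-1)].
Proof.
move=> zH; have [c [h1 h2 h3]] := theta_inversion zH.
suff -> : theta_mult z = c by [].
by rewrite /theta_mult h2 mulfK // theta_neq0 //; apply: upper_inv4.
Qed.

Lemma theta_mult_scale (z : C) (M : nat) : (0 < M)%N -> upper_half z ->
  theta_mult (z / M%:R ^+ 2) = M%:R * theta_mult z.
Proof.
move=> M0 zH; have [h _ _] := theta_multE zH.
have zM : upper_half (z / M%:R ^+ 2).
  rewrite mulrC -ofR_nat -ofRX -ofRV; apply: upper_scale => //.
  by rewrite invr_gt0 exprn_gt0 // ltr0n.
have [h' _ _] := theta_multE zM.
exact: is_mean_unique h' (mean_scale M0 zH h).
Qed.

Lemma cderiv_inv4 (z : C) : upper_half z -> cderiv (fun w => - (4 * w)^-1) z (- (- (4 * 1) / (4 * z) ^+ 2)).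
Proof.
move=> /H_neq0 z0; apply: cderivN; apply: (cderivV (f := fun w : C => 4 * w)).
  by rewrite mulf_neq0.
by apply: cderivZ; apply: cderiv_id.
Qed.

Lemma theta_mult_cderiv (z : C) : upper_half z -> exists l, cderiv theta_mult z l.
Proof.
move=> zH; have [l1 h1] := goodH_cderiv theta_goodH zH.
have [l2 h2] := goodH_cderiv theta_goodH (upper_inv4 zH).
eexists; rewrite /theta_mult; apply: cderivM; first exact: h1.
apply: (cderivV (f := fun w : C => theta (- (4 * w)^-1))).
  by apply: theta_neq0; apply: upper_inv4.
exact: (cderiv_comp (g := fun w : C => - (4 * w)^-1) h2 (cderiv_inv4 zH)).
Qed.

(* The ratios (1 + 1/N)^2 accumulate at 1, so invariance under them kills the
   derivative of z theta_mult(z)^2 along each ray, hence the complex derivative. *)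
Lemma theta_mult_ray (z : C) (N : nat) : (0 < N)%N -> upper_half z ->
  let v := z * (N.+1%:R / N%:R) ^+ 2 in v * theta_mult v ^+ 2 = z * theta_mult z ^+ 2.
Proof.
move=> N0 zH v; have N0' : N%:R != 0 :> C by rewrite pnatr_eq0 -lt0n.
have N1' : N.+1%:R != 0 :> C by rewrite pnatr_eq0.
have vH : upper_half v.
  rewrite /v mulrC -!ofR_nat -ofRV -ofRM -ofRX; apply: upper_scale => //.
  by rewrite exprn_gt0 // divr_gt0 // ltr0n.
have h1 := theta_mult_scale N0 zH; have h2 := theta_mult_scale (M := N.+1) isT vH.
have E : v / N.+1%:R ^+ 2 = z / N%:R ^+ 2.
  rewrite /v; move: (N%:R : C) (N.+1%:R : C) N0' N1' => a b a0 b0.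
  by field; rewrite a0 b0.
rewrite E h1 in h2.
have -> : theta_mult v = N%:R / N.+1%:R * theta_mult z.
  apply: (mulfI N1'); rewrite -h2; move: (N%:R : C) (N.+1%:R : C) N1' => a b b0.
  by field.
rewrite /v; move: (N%:R : C) (N.+1%:R : C) N0' N1' => a b a0 b0.
by field; rewrite a0 b0.
Qed.

Lemma theta_mult_sqr (z : C) : upper_half z -> z * theta_mult z ^+ 2 = imagi R / 2.
Proof.
move=> zH; pose g (z : C) := z * theta_mult z ^+ 2.
have gd (w : C) : upper_half w -> cderiv g w 0.
  move=> wH; have [l hl] := theta_mult_cderiv wH.
  have hg : cderiv g w (1 * theta_mult w ^+ 2 + w * (2%:R * l * theta_mult w ^+ 1)).
    by apply: cderivM; [apply: cderiv_id | apply: (cderivX (f := theta_mult) 2)].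
  set L := (X in cderiv _ _ X) in hg; suff <- : L = 0 by [].
  apply: eq_of_nm_small => eps e0; rewrite subr0.
  have w0 : 0 < nm w by rewrite nm_gt0 H_neq0.
  have [d d0 Hd] := hg _ e0.
  have [N hN] := exists_nat_ge ((3 * nm w + d) / d).
  pose h : C := w * ((N.+2%:R / N.+1%:R) ^+ 2 - 1).
  have N0 : 0 < N.+1%:R :> R by rewrite ltr0n.
  have Nc : N.+1%:R != 0 :> C by rewrite pnatr_eq0.
  have gw : g (w + h) = g w.
    have -> : w + h = w * (N.+2%:R / N.+1%:R) ^+ 2 by rewrite /h; ring.
    exact: theta_mult_ray.
  have E : (N.+2%:R / N.+1%:R) ^+ 2 - 1 = ofR ((2 * N.+1%:R + 1) / N.+1%:R ^+ 2) :> C.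
    rewrite ofRM ofRV ofRX ofRD ofRM !ofR_nat -(natr1 N.+1) ofR1; field.
    by [].
  have t0 : 0 < (2 * N.+1%:R + 1) / N.+1%:R ^+ 2 :> R.
    by rewrite divr_gt0 ?exprn_gt0 // addr_gt0 // mulr_gt0.
  have nh : nm h = nm w * ((2 * N.+1%:R + 1) / N.+1%:R ^+ 2).
    by rewrite nmM E nm_ofR gtr0_norm.
  have h0 : 0 < nm h by rewrite nh mulr_gt0.
  have hd : nm h < d.
    rewrite nh mulrA ltr_pdivrMr ?exprn_gt0 //.
    move: hN; rewrite ler_pdivrMr // => hN.
    have N1 : 1 <= N.+1%:R :> R by rewrite ler1n.
    have k1 : nm w * (2 * N.+1%:R + 1) <= 3 * nm w * N.+1%:R.
      have : 0 <= nm w * (N.+1%:R - 1) by rewrite mulr_ge0 //; lra.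
      lra.
    apply: le_lt_trans k1 _.
    rewrite expr2 mulrA ltr_pM2r // mulrC; lra.
  have := Hd h hd; rewrite gw subrr sub0r nmN nmM.
  by rewrite ler_pM2r.
(* The point i/2 is fixed by z -> -1/(4z), so [theta_mult] equals 1 there, which evaluates the
   constant. *)
have gc : g z = g (imagi R / 2).
  apply: (const_on_convex (@convex_H R) gd) => //.
  by rewrite /upper_half /mkset -(ofR_nat R 2) -ofRV Im_Mi Re_ofR invr_gt0.
have h2 : upper_half (imagi R / 2).
  by rewrite /upper_half /mkset -(ofR_nat R 2) -ofRV Im_Mi Re_ofR invr_gt0.
rewrite -/(g z) gc /g; suff -> : theta_mult (imagi R / 2) = 1 by rewrite expr1n mulr1.
rewrite /theta_mult; have -> : - (4 * (imagi R / 2))^-1 = imagi R / 2.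
  have i0 : imagi R != 0 by rewrite -nm_gt0 nm_i.
  apply: (mulIf i0); rewrite [RHS]mulrAC -expr2 imagi2; field.
  by rewrite i0.
by rewrite divff // theta_neq0.
Qed.

Lemma theta_sqr (z : C) : upper_half z ->
  theta z ^+ 2 = imagi R / (2 * z) * theta (- (4 * z)^-1) ^+ 2.
Proof.
move=> zH; have [_ -> _] := theta_multE zH; rewrite exprMn; congr (_ * _).
have z0 := H_neq0 zH; apply: (mulfI z0); rewrite theta_mult_sqr //; field.
by rewrite z0.
Qed.

End ThetaNonvanishing.

(** * The theta multiplier on Gamma0(4) *)

Section ThetaGamma.
Variable R : realType.
Local Notation C := (CC R).

Definition jd (A : 'M[int]_2) (z : C) : C := (A 1 0)%:~R * z + (A 1 1)%:~R.
Definition mob (A : 'M[int]_2) (z : C) : C :=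
  ((A 0 0)%:~R * z + (A 0 1)%:~R) / jd A z.

Lemma mobius_mxQ (A : 'M[int]_2) (z : C) : mobius (mxQ A) z = mob A z.
Proof. by rewrite /mobius /mob /jd /mxQ !mxE !ratr_int. Qed.

Lemma ord2 (i : 'I_2) : i = 0 \/ i = 1.
Proof. by case: i => [[|[|//]] hi]; [left|right]; apply: val_inj. Qed.

Lemma mx2E (T : Type) (a b c d : T) :
  [/\ mx2 a b c d 0 0 = a, mx2 a b c d 0 1 = b, mx2 a b c d 1 0 = c & mx2 a b c d 1 1 = d].
Proof. by rewrite /mx2 !mxE. Qed.

Lemma mx2P (T : Type) (A : 'M[T]_2) : A = mx2 (A 0 0) (A 0 1) (A 1 0) (A 1 1).
Proof.
apply/matrixP => i j; rewrite /mx2 mxE.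
by case: (ord2 i) => ->; case: (ord2 j) => ->.
Qed.

Lemma sum2 (V : nmodType) (F : 'I_2 -> V) : \sum_i F i = F 0 + F 1.
Proof. by rewrite !big_ord_recl big_ord0 addr0; congr (F _ + F _); apply: val_inj. Qed.

Lemma mulmx2 (T : comPzRingType) (A B : 'M[T]_2) (i j : 'I_2) :
  (A *m B) i j = A i 0 * B 0 j + A i 1 * B 1 j.
Proof. by rewrite mxE sum2. Qed.

Lemma det2 (T : comPzRingType) (A : 'M[T]_2) : \det A = A 0 0 * A 1 1 - A 0 1 * A 1 0.
Proof.
rewrite (expand_det_row _ 0) sum2 /cofactor !det_mx11 !mxE /= expr0 mul1r expr1 mulN1r mulrN.
by congr (A _ _ * A _ _ - A _ _ * A _ _); apply: val_inj.
Qed.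

Definition inv2x2 (A : 'M[int]_2) : 'M[int]_2 := mx2 (A 1 1) (- A 0 1) (- A 1 0) (A 0 0).

Lemma mx2_eq (T : Type) (A B : 'M[T]_2) : A 0 0 = B 0 0 -> A 0 1 = B 0 1 ->
  A 1 0 = B 1 0 -> A 1 1 = B 1 1 -> A = B.
Proof. by rewrite (mx2P A) (mx2P B); case: (mx2E (A 0 0) (A 0 1) (A 1 0) (A 1 1)) (mx2E (B 0 0) (B 0 1) (B 1 0) (B 1 1)) => -> -> -> -> [-> -> -> ->] -> -> -> ->. Qed.

Lemma jd_neq0 (A : 'M[int]_2) (z : C) : \det A != 0 -> upper_half z -> jd A z != 0.
Proof.
rewrite det2 /upper_half /mkset => dA zH; apply/eqP => h.
have hI := congr1 (@complex.Im R) h; have hR := congr1 (@complex.Re R) h.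
move: hI hR; rewrite /jd -!ofR_int ImD ReD Im_ofRM Re_ofRM Im_ofR Re_ofR addr0 /=.
move/eqP; rewrite mulf_eq0 (gt_eqF zH) orbF intr_eq0 => /eqP c0.
rewrite c0 mul0r add0r => /eqP; rewrite intr_eq0 => /eqP d0.
by move: dA; rewrite c0 d0 !mulr0 subrr eqxx.
Qed.

Lemma Im_mob (A : 'M[int]_2) (z : C) : \det A != 0 -> upper_half z ->
  Im (mob A z) = (\det A)%:~R * Im z / nm (jd A z) ^+ 2.
Proof.
move=> dA zH; have j0 := jd_neq0 dA zH.
have [c0|c0] := eqVneq (A 1 0) 0.
  have E : mob A z = ofR ((A 0 0)%:~R / (A 1 1)%:~R) * z + ofR ((A 0 1)%:~R / (A 1 1)%:~R).
    have d0 : (A 1 1)%:~R != 0 :> C.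
      by move: j0; rewrite /jd c0 mul0r add0r.
    rewrite /mob /jd c0 mul0r add0r !ofRM !ofRV !ofR_int; field.
    by [].
  have d0 : (A 1 1)%:~R != 0 :> R.
    by rewrite intr_eq0; apply: contraNneq j0 => d0; rewrite /jd c0 d0 mul0r addr0.
  rewrite E ImD Im_ofRM Im_ofR addr0 /jd c0 mul0r add0r nm_int real_normK ?num_real //.
  by rewrite det2 c0 mulr0 subr0 rmorphM /=; field.
have c0' : (A 1 0)%:~R != 0 :> R by rewrite intr_eq0.
have c0c : (A 1 0)%:~R != 0 :> C by rewrite intr_eq0.
have E : mob A z = ofR ((A 0 0)%:~R / (A 1 0)%:~R) + ofR ((\det A)%:~R / (A 1 0)%:~R) * - (jd A z)^-1.
  rewrite /mob det2 rmorphB !rmorphM /= !ofRM ofRV ofRD ofRN !ofRM !ofR_int.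
  rewrite /jd; rewrite /jd in j0; field.
  by rewrite c0c j0.
rewrite E ImD Im_ofRM Im_ofR add0r Im_oppV /jd ImD -!ofR_int Im_ofRM Im_ofR addr0.
have n0 : nm (ofR (A 1 0)%:~R * z + ofR (A 1 1)%:~R) != 0 by rewrite nm_eq0 !ofR_int.
by field; rewrite c0' n0.
Qed.

Lemma mob_up (A : 'M[int]_2) (z : C) : 0 < \det A -> upper_half z -> upper_half (mob A z).
Proof.
move=> dA zH; have dA' : \det A != 0 by rewrite gt_eqF.
rewrite /upper_half /mkset Im_mob //; apply: divr_gt0; first by rewrite mulr_gt0 ?ltr0z.
by apply: exprn_gt0; rewrite nm_gt0 jd_neq0.
Qed.

Lemma mobK (A : 'M[int]_2) (z : C) : jd A z != 0 ->
  mob A z * jd A z = (A 0 0)%:~R * z + (A 0 1)%:~R.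
Proof. by move=> j0; rewrite /mob divfK. Qed.

Lemma jdM (A B : 'M[int]_2) (z : C) : jd B z != 0 -> jd (A *m B) z = jd A (mob B z) * jd B z.
Proof.
move=> j0; have m := mobK j0; rewrite /jd in m *; rewrite !mulmx2.
have -> : ((A 1 0)%:~R * mob B z + (A 1 1)%:~R) * ((B 1 0)%:~R * z + (B 1 1)%:~R) =
  (A 1 0)%:~R * (mob B z * ((B 1 0)%:~R * z + (B 1 1)%:~R))
  + (A 1 1)%:~R * ((B 1 0)%:~R * z + (B 1 1)%:~R) by ring.
by rewrite m !rmorphD !rmorphM /=; ring.
Qed.

Lemma mobM (A B : 'M[int]_2) (z : C) : \det A != 0 -> 0 < \det B -> upper_half z ->
  mob (A *m B) z = mob A (mob B z).
Proof.
move=> dA dB zH; have dB' : \det B != 0 by rewrite gt_eqF.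
have jB := jd_neq0 dB' zH; have jA := jd_neq0 dA (mob_up dB zH).
have jAB : jd (A *m B) z != 0 by rewrite jdM // mulf_neq0.
apply: (mulIf jAB); rewrite mobK // jdM // mulrA mobK //.
have m := mobK jB; rewrite /jd in m *; rewrite !mulmx2.
have -> : ((A 0 0)%:~R * mob B z + (A 0 1)%:~R) * ((B 1 0)%:~R * z + (B 1 1)%:~R) =
  (A 0 0)%:~R * (mob B z * ((B 1 0)%:~R * z + (B 1 1)%:~R))
  + (A 0 1)%:~R * ((B 1 0)%:~R * z + (B 1 1)%:~R) by ring.
by rewrite m !rmorphD !rmorphM /=; ring.
Qed.

Lemma upper_divn (z : C) (n : nat) : upper_half z -> upper_half (z / n.+1%:R).
Proof.
move=> zH; rewrite mulrC -(ofR_nat R n.+1) -ofRV; apply: upper_scale => //.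
Qed.

(** A quotient of two theta constants: the undetermined sign in the transformation of theta drops
    out, so this function can be followed exactly through the descent. *)
Definition thetaD (z : C) : C := theta (z + 2^-1) / theta z.

Lemma thetaD_inv (z : C) : upper_half z ->
  thetaD z = theta_odd (- (4 * z)^-1 / 4) / theta (- (4 * z)^-1).
Proof.
move=> zH; have wH := upper_inv4 zH; have [_ h1 h2] := theta_multE wH.
rewrite inv4K // in h1 h2; rewrite h1 h2 /thetaD.
have t0 : theta_mult (- (4 * z)^-1) != 0.
  by apply: contraNneq (theta_neq0 wH) => E; rewrite h1 E mul0r.
have tz := theta_neq0 zH.
by field; rewrite tz t0.
Qed.

Lemma theta_int (n : int) (z : C) : upper_half z -> theta (z + n%:~R) = theta z.
Proof.
move=> zH; apply: (per_int (f := @theta R) (y1 := Im z) (y2 := Im z)); last by rewrite /strip lexx.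
move=> w /andP[h _]; apply: theta1; exact: lt_le_trans h.
Qed.

Lemma theta_odd4 (n : int) (z : C) : upper_half z ->
  theta_odd (z + n%:~R / 4) = e (n%:~R / 4) * theta_odd z.
Proof.
have up (m : int) (w : C) : upper_half w -> upper_half (w + m%:~R / 4).
  by rewrite -(ofR_nat R 4) -ofR_int -ofRV -ofRM upT.
have one (w : C) : upper_half w -> theta_odd (w + 4^-1) = e 4^-1 * theta_odd w.
  move=> wH; have -> : w + 4^-1 = w + 8^-1 + 8^-1 by field.
  rewrite theta_odd8 ?theta_odd8 // -?(ofR_nat R 8) -?ofRV ?upT // mulrA -eD.
  by congr (e _ * _); rewrite ofRV ofR_nat; field.
have nn (m : nat) (w : C) : upper_half w -> theta_odd (w + m%:R / 4) = e (m%:R / 4) * theta_odd w.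
  elim: m w => [|m IH] w wH; first by rewrite !mul0r addr0 e_0 mul1r.
  rewrite -natr1 mulrDl mul1r addrA one ?IH //; last by have := up m w wH; rewrite -pmulrn.
  by rewrite mulrA -eD; congr (e _ * _); rewrite addrC.
move=> zH; case: n => n; first by rewrite -pmulrn nn.
rewrite NegzE mulrNz mulNr eN -pmulrn; apply: (mulfI (e_neq0 (n.+1%:R / 4))).
rewrite mulrA divff ?e_neq0 // mul1r -nn ?subrK //.
by have := up (- n.+1%:Z) z zH; rewrite mulrNz -pmulrn mulNr.
Qed.

Definition gl2 (a b c d : int) (z : C) : C := (a%:~R * z + b%:~R) / (c%:~R * z + d%:~R).

(* [n] stands for [c / 4]. *)
Definition theta_law (a b n d : int) :=
  exists2 k : int, k ^+ 2 = 1 & forall z : C, upper_half z ->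
    theta (gl2 a b (4 * n) d z) ^+ 2 = k%:~R * ((4 * n)%:~R * z + d%:~R) * theta z ^+ 2 /\
    thetaD (gl2 a b (4 * n) d z) = e (- ((n * d)%:~R / 4)) * thetaD z.

Lemma thetaD_int (n : int) (z : C) : upper_half z -> thetaD (z + n%:~R) = thetaD z.
Proof.
move=> zH; rewrite /thetaD theta_int // addrAC theta_int //; exact: upper_half2.
Qed.

(** The inversion conjugates this map into a translation: -1/(4w) = -1/(4z) - n. The translation
    fixes theta and multiplies the odd part by a fourth root of unity. *)
Lemma lower_law (n : int) (z : C) : upper_half z ->
  theta (z / ((4 * n)%:~R * z + 1)) ^+ 2 = ((4 * n)%:~R * z + 1) * theta z ^+ 2 /\
  thetaD (z / ((4 * n)%:~R * z + 1)) = e (- (n%:~R / 4)) * thetaD z.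
Proof.
move=> zH; have z0 := H_neq0 zH; set w := z / _.
have dl : \det (mx2 1 0 (4 * n) 1 : 'M[int]_2) = 1.
  by rewrite det2; case: (mx2E (1 : int) 0 (4 * n) 1) => -> -> -> ->; ring.
have jl : jd (mx2 1 0 (4 * n) 1) z = (4 * n)%:~R * z + 1.
  by rewrite /jd; case: (mx2E (1 : int) 0 (4 * n) 1) => _ _ -> ->.
have j0 : (4 * n)%:~R * z + 1 != 0.
  by rewrite -jl; apply: jd_neq0 => //; rewrite dl.
have wH : upper_half w.
  have := @mob_up (mx2 1 0 (4 * n) 1) z; rewrite dl => /(_ isT zH).
  by rewrite /mob jl; case: (mx2E (1 : int) 0 (4 * n) 1) => -> -> _ _; rewrite mul1r addr0.
have w0 := H_neq0 wH.
have E : - (4 * w)^-1 = - (4 * z)^-1 + (- n)%:~R.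
  by rewrite /w invfM invf_div rmorphN /= rmorphM /=; field.
have wi := upper_inv4 zH; have w4 := upper_divn 3 wi.
split.
  rewrite (theta_sqr wH) (theta_sqr zH) E theta_int // [RHS]mulrA; congr (_ * _).
  by rewrite /w; rewrite rmorphM /= in j0 *; field; rewrite z0 j0.
rewrite !thetaD_inv // E theta_int // mulrDl theta_odd4 // mulrA.
by congr (e _ * _ / _); rewrite rmorphN mulNr.
Qed.

Lemma int_mul1 (a d : int) : a * d = 1 -> a = d /\ d * d = 1.
Proof.
move=> ad; have := congr1 absz ad; rewrite abszM => /eqP.
rewrite muln_eq1 => /andP[/eqP ha /eqP hd].
have [ea|ea] : a = 1 \/ a = -1 by lia.
  by move: ad; rewrite ea mul1r => ->.
by rewrite ea mulN1r in ad; have -> : d = -1 by lia.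
Qed.

Lemma theta_law_base (a b d : int) : a * d = 1 -> theta_law a b 0 d.
Proof.
move=> ad; have [ea dd] := int_mul1 ad; exists d => // z zH.
have ddc : d%:~R * d%:~R = 1 :> C by rewrite -rmorphM /= dd.
have E : gl2 a b (4 * 0) d z = z + (a * b)%:~R.
  have d0 : d%:~R != 0 :> C.
    by rewrite intr_eq0; apply/eqP => d0; rewrite d0 mulr0 in ad.
  apply: (mulIf d0); rewrite /gl2 mulr0 mul0r add0r divfK // ea rmorphM /=.
  by rewrite mulrDl mulrAC ddc mul1r [z * _]mulrC.
rewrite E theta_int // thetaD_int //; split; last by rewrite !mul0r oppr0 e_0 mul1r.
by rewrite mulr0 mul0r add0r ddc mul1r.
Qed.

Lemma gl2_up (a b c d : int) (z : C) : a * d - b * c = 1 -> upper_half z -> upper_half (gl2 a b c d z).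
Proof.
move=> h zH; have := @mob_up (mx2 a b c d) z; rewrite det2 /mob /jd.
by case: (mx2E a b c d) => -> -> -> ->; rewrite h; apply.
Qed.

Lemma gl2_j0 (a b c d : int) (z : C) : a * d - b * c = 1 -> upper_half z -> c%:~R * z + d%:~R != 0.
Proof.
move=> h zH; have := @jd_neq0 (mx2 a b c d) z; rewrite det2 /jd.
by case: (mx2E a b c d) => -> -> -> ->; rewrite h; apply.
Qed.

Lemma theta_law_T (a b n d m : int) : a * d - b * (4 * n) = 1 ->
  theta_law (a + m * (4 * n)) (b + m * d) n d -> theta_law a b n d.
Proof.
move=> h [k k2 H]; exists k => // z zH; have [h1 h2] := H z zH.
have j0 := gl2_j0 h zH; have up := gl2_up h zH.
have E : gl2 (a + m * (4 * n)) (b + m * d) (4 * n) d z = gl2 a b (4 * n) d z + m%:~R.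
  by apply: (mulIf j0); rewrite /gl2 [in RHS]mulrDl !divfK // !rmorphD !rmorphM /=; ring.
by rewrite E theta_int // in h1; rewrite E thetaD_int // in h2.
Qed.

Lemma theta_law_L (a b n d m : int) : a * d - b * (4 * n) = 1 ->
  theta_law a b (n + m * a) (d + 4 * m * b) -> theta_law a b n d.
Proof.
move=> h [k k2 H]; exists k => // z zH; have [h1 h2] := H z zH.
have h' : a * (d + 4 * m * b) - b * (4 * (n + m * a)) = 1 by apply: etrans h; ring.
set w := gl2 _ _ _ _ z in h1 h2.
have wH : upper_half w by apply: gl2_up.
have j0 := gl2_j0 h zH; have j1 := gl2_j0 h' zH.
have jw : (4 * - m)%:~R * w + 1 = ((4 * n)%:~R * z + d%:~R) / ((4 * (n + m * a))%:~R * z + (d + 4 * m * b)%:~R).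
  have wj := divfK j1 (a%:~R * z + b%:~R); rewrite -/(gl2 _ _ _ _ _) -/w in wj.
  apply: (mulIf j1); rewrite [RHS]divfK // mulrDl mul1r -[_ * w * _]mulrA wj.
  by rewrite !(rmorphD, rmorphM, rmorphN) /=; ring.
have E : gl2 a b (4 * n) d z = w / ((4 * - m)%:~R * w + 1).
  rewrite jw invf_div mulrA {1}/w /gl2 divfK //.
have [l1 l2] := lower_law (- m) wH.
rewrite -E in l1 l2; rewrite l1 l2 h1 h2 jw; split.
  by rewrite mulrA; congr (_ * _); rewrite [k%:~R * _]mulrC mulrA divfK // mulrC.
rewrite mulrA -eD; congr (_ * _).
(* The two exponents differ by this integer, once ad is replaced by 1 + 4bn. *)
rewrite -[LHS](e_addint _ (2 * m * b * n + m ^+ 2 * a * b)); congr e.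
have adc : a%:~R * d%:~R = 1 + b%:~R * (4 * n%:~R) :> C.
  by rewrite -rmorphM /= -[a * d](subrK (b * (4 * n))) h rmorphD /= !rmorphM.
rewrite !(rmorphD, rmorphM, rmorphN, rmorphXn) /=.
have -> : (n%:~R + m%:~R * a%:~R) * (d%:~R + 4 * m%:~R * b%:~R) = n%:~R * d%:~R
  + m%:~R * (a%:~R * d%:~R) + 4 * m%:~R * b%:~R * n%:~R + 4 * m%:~R ^+ 2 * a%:~R * b%:~R :> C by ring.
by rewrite adc; field.
Qed.

(* Descent on [|a| + |4 n|] by translations and by conjugates of translations under
   the inversion z -> -1/(4z). *)
Lemma theta_law_all (a b n d : int) : a * d - b * (4 * n) = 1 -> theta_law a b n d.
Proof.
have [k hk] : exists k : nat, (`|a| + `|(4 * n)%R| < k)%N by eexists; exact: ltnSn.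
elim: k a b n d hk => [//|k IH] a b n d hk h.
have [n0|n0] := eqVneq n 0.
  by subst n; apply: theta_law_base; rewrite -h !mulr0 subr0.
have a0 : a != 0 by apply/eqP => a0; move: h; rewrite a0; lia.
(* A tie would make [a] even, against the determinant; so one of the two reductions strictly
   decreases the size. *)
have odd_a : (`|(4 * n)%R| != 2 * `|a|)%N.
  apply/eqP => E; have [t [Et|Et]] : exists t : int, a = 2 * t \/ a = - (2 * t).
  - by exists n; lia.
  - by move: h; rewrite Et; nia.
  - by move: h; rewrite Et; nia.
have [lt|ge] := ltnP `|(4 * n)%R| (2 * `|a|).
  have [s [s1 hs]] : exists s : int, s * s = 1 /\ (`|(a + s * (4 * n))%R| < `|a|)%N.
    by have [/andP[x y]|] := boolP ((0 <= a) && (0 <= n)); [exists (-1)|have [/andP[x y]|] := boolP ((a < 0) && (n < 0)); [exists (-1)|exists 1]]; lia.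
  apply: (@theta_law_T _ _ _ _ s h); apply: IH; last by apply: etrans h; ring.
  by lia.
have [s [s1 hs]] : exists s : int, s * s = 1 /\ (`|(4 * (n + s * a))%R| < `|(4 * n)%R|)%N.
  by have [/andP[x y]|] := boolP ((0 <= a) && (0 <= n)); [exists (-1)|have [/andP[x y]|] := boolP ((a < 0) && (n < 0)); [exists (-1)|exists 1]]; lia.
apply: (@theta_law_L _ _ _ _ s h); apply: IH; last by apply: etrans h; ring.
by lia.
Qed.

End ThetaGamma.

(** * The theta factor and translations by 1/4 *)

Section ThetaMultiplier.
Variable R : realType.
Local Notation C := (CC R).
Local Notation I := (imagi R).

(** The integer cd/4, whose class modulo 4 is the exponent in the transformation of [thetaD]. It
    will also index the classes on which the slash action of xi depends. *)
Definition qchar (A : 'M[int]_2) : int := (A 1%R 0%R %/ 4)%Z * A 1 1.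

Lemma theta_jE (A : 'M[int]_2) (z : C) : theta_j A z = theta (mob A z) / theta z.
Proof. by rewrite /theta_j mobius_mxQ. Qed.

Lemma Gamma0_sub (N M : nat) (A : 'M[int]_2) : (M %| N)%N -> Gamma0 N A -> Gamma0 M A.
Proof. by move=> MN [dA h]; split=> //; apply: dvdz_trans h; rewrite dvdzE. Qed.

Lemma gamma_law (A : 'M[int]_2) : Gamma0 4 A ->
  theta_law R (A 0 0) (A 0 1) (A 1%R 0%R %/ 4)%Z (A 1 1).
Proof.
move=> [dA h]; apply: theta_law_all; apply: etrans dA; rewrite det2; congr (_ - _ * _).
by rewrite mulrC divzK.
Qed.

Lemma gl2_mob (A : 'M[int]_2) (z : C) : (4 %| A 1%R 0%R)%Z ->
  gl2 (A 0 0) (A 0 1) (4 * (A 1%R 0%R %/ 4)%Z) (A 1 1) z = mob A z.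
Proof.
move=> h; have E : 4 * (A 1%R 0%R %/ 4)%Z = A 1 0 by rewrite mulrC divzK.
by rewrite /gl2 E.
Qed.

Lemma theta_j_sqr (A : 'M[int]_2) : Gamma0 4 A -> exists2 k : int, k ^+ 2 = 1 &
  forall z : C, upper_half z -> theta_j A z ^+ 2 = k%:~R * jd A z.
Proof.
move=> gA; have [k k2 H] := gamma_law gA; exists k => // z zH.
have [h _] := H z zH; have h4 : (4 %| A 1%R 0%R)%Z by case: gA.
rewrite gl2_mob // [4 * _]mulrC divzK // in h.
by rewrite theta_jE expr_div_n h /jd mulfK // expf_neq0 // theta_neq0.
Qed.

Lemma thetaD_gamma (A : 'M[int]_2) (z : C) : Gamma0 4 A -> upper_half z ->
  thetaD (mob A z) = e (- ((qchar A)%:~R / 4)) * thetaD z.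
Proof.
move=> gA zH; have [k k2 H] := gamma_law gA; have [_ h] := H z zH.
by rewrite gl2_mob // in h; case: gA.
Qed.

Lemma theta_j_neq0 (A : 'M[int]_2) (z : C) : 0 < \det A -> upper_half z -> theta_j A z != 0.
Proof.
move=> dA zH; rewrite theta_jE mulf_neq0 ?invr_neq0 ?theta_neq0 //; exact: mob_up.
Qed.

Lemma theta_jM (A B : 'M[int]_2) (z : C) : 0 < \det A -> 0 < \det B -> upper_half z ->
  theta_j (A *m B) z = theta_j A (mob B z) * theta_j B z.
Proof.
move=> dA dB zH; rewrite !theta_jE mobM ?gt_eqF // mulrA divfK //.
by apply: theta_neq0; apply: mob_up.
Qed.

Lemma theta_j_goodH (A : 'M[int]_2) (z : C) : 0 < \det A -> upper_half z ->
  exists l, cderiv (theta_j A) z l.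
Proof.
move=> dA zH; have wH := mob_up dA zH.
have [l1 h1] := goodH_cderiv (@theta_goodH R) wH.
have [l2 h2] := goodH_cderiv (@theta_goodH R) zH.
have j0 := jd_neq0 (lt0r_neq0 dA) zH.
have dlin (a b : int) : cderiv (fun w : C => a%:~R * w + b%:~R) z (a%:~R * 1 + 0).
  by apply: cderivD; [apply: cderivZ; apply: cderiv_id | apply: cderiv_cst].
have dm := cderivM (dlin (A 0 0) (A 0 1)) (cderivV (f := jd A) j0 (dlin (A 1 0) (A 1 1))).
have := cderivM (cderiv_comp (g := mob A) h1 dm) (cderivV (f := @theta R) (theta_neq0 zH) h2).
set l := (X in cderiv _ _ X); move=> h; exists l.
by rewrite (_ : theta_j A = fun w => theta (mob A w) * (theta w)^-1) //; apply/funext => w; apply: theta_jE.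
Qed.

Definition thetaE (z : C) : C := theta (z + 4^-1) / theta z.

Lemma upper_quarter (z : C) : upper_half z -> upper_half (z + 4^-1).
Proof. by rewrite -(ofR_nat R 4) -ofRV upT. Qed.
Lemma upper_quarterB (z : C) : upper_half z -> upper_half (z - 4^-1).
Proof. by rewrite -(ofR_nat R 4) -ofRV -ofRN upT. Qed.

Lemma theta_even_odd (z : C) : upper_half z ->
  theta (4 * z) = (theta z + theta (z + 2^-1)) / 2 /\
  theta_odd z = (theta z - theta (z + 2^-1)) / 2.
Proof.
move=> zH; have z2 := upper_half2 zH.
have h1 := theta_split zH; have h2 := theta_split z2.
have e1 : theta (4 * (z + 2^-1)) = theta (4 * z).
  have -> : 4 * (z + 2^-1) = 4 * z + (2 : int)%:~R by field.
  by rewrite theta_int //; apply: up4.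
have e2 : theta_odd (z + 2^-1) = - theta_odd z.
  have -> : z + 2^-1 = z + (2 : int)%:~R / 4 by field.
  rewrite theta_odd4 // (_ : (2 : int)%:~R / 4 = 2^-1); last by field.
  by rewrite e_half mulN1r.
rewrite e1 e2 in h2; rewrite h2 h1; by split; field.
Qed.

(** Writing theta(z) = theta(4z) + theta_odd(z), a translation by n/4 fixes the first part and
    multiplies the second by e(n/4); both parts are half-sums of theta(z) and theta(z + 1/2) up to
    sign. *)
Lemma theta_quarter (z : C) (n : int) : upper_half z ->
  theta (z + n%:~R / 4) = ((1 + e (n%:~R / 4)) * theta z + (1 - e (n%:~R / 4)) * theta (z + 2^-1)) / 2.
Proof.
move=> zH; have zn : upper_half (z + n%:~R / 4).
  by rewrite -(ofR_nat R 4) -ofR_int -ofRV -ofRM upT.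
have [h1 h2] := theta_even_odd zH.
rewrite theta_split // theta_odd4 // h2.
have -> : 4 * (z + n%:~R / 4) = 4 * z + n%:~R by field.
by rewrite theta_int ?h1 //; [field|apply: up4].
Qed.

Lemma thetaE_D (z : C) : upper_half z -> thetaE z = ((1 + I) + (1 - I) * thetaD z) / 2.
Proof.
move=> zH; have := theta_quarter 1 zH; rewrite mul1r e_quarter => h.
by rewrite /thetaE /thetaD h; field; apply: theta_neq0.
Qed.

Lemma thetaEB_D (z : C) : upper_half z ->
  theta (z - 4^-1) / theta z = ((1 - I) + (1 + I) * thetaD z) / 2.
Proof.
move=> zH; have := theta_quarter (-1) zH; rewrite mulN1r eN e_quarter.
have -> : I^-1 = - I.
  have i0 : I != 0 by rewrite -nm_gt0 nm_i.
  by apply: (mulfI i0); rewrite divff // mulrN -expr2 imagi2 opprK.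
by move=> h; rewrite /thetaD h; field; apply: theta_neq0.
Qed.

Lemma thetaE_neq0 (z : C) : upper_half z -> thetaE z != 0.
Proof.
move=> zH; rewrite mulf_neq0 ?invr_neq0 ?theta_neq0 //; exact: upper_quarter.
Qed.

Lemma thetaE_gamma (A : 'M[int]_2) (z : C) : Gamma0 4 A -> upper_half z ->
  thetaE (mob A z) = ((1 + I) + (1 - I) * e (- ((qchar A)%:~R / 4)) * thetaD z) / 2.
Proof.
move=> gA zH; rewrite thetaE_D ?thetaD_gamma ?mulrA //; apply: mob_up => //.
by case: gA => ->.
Qed.

Lemma e_div4 (n k : int) : (4 %| n - k)%Z -> e (n%:~R / 4) = e (k%:~R / 4) :> C.
Proof.
move=> h; have -> : n = k + ((n - k)%R %/ 4)%Z * 4 :> int by rewrite divzK // addrC subrK.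
by rewrite rmorphD rmorphM /= mulrDl mulfK // e_addint.
Qed.

Lemma e_eighth : e 8^-1 ^+ 2 = I :> C.
Proof. by rewrite -eMn -e_quarter; congr e; field. Qed.

End ThetaMultiplier.

Lemma mod4P (a : int) : exists k : int,
  [\/ a = 4 * k, a = 4 * k + 1, a = 4 * k + 2 | a = 4 * k + 3].
Proof.
exists (a %/ 4)%Z; have := @ltz_pmod a 4 isT; have := @modz_ge0 a 4 isT.
have := divz_eq a 4; set q := (a %/ 4)%Z; set r := (a %% 4)%Z => E r0 r4.
have : [\/ r = 0, r = 1, r = 2 | r = 3].
  have [|/eqP r0'] := eqVneq r 0; first by constructor 1.
  have [|/eqP r1] := eqVneq r 1; first by constructor 2.
  have [|/eqP r2] := eqVneq r 2; first by constructor 3.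
  by constructor 4; lia.
by case=> Er; rewrite Er in E; [constructor 1|constructor 2|constructor 3|constructor 4]; lia.
Qed.

Lemma det_mod4 (a b n d : int) : a * d - b * (4 * n) = 1 -> exists u : int, d - a = 4 * u.
Proof.
move=> h; have [k Ha] := mod4P a; have [l Hd] := mod4P d.
by case: Ha => Ea; case: Hd => Ed; rewrite Ea Ed in h *; (try by exfalso; lia); exists (l - k); lia.
Qed.

Lemma det_odd (a b n d : int) : a * d - b * (4 * n) = 1 ->
  exists k : int, d = 4 * k + 1 \/ d = 4 * k - 1.
Proof.
move=> h; have [l Hd] := mod4P d.
case: Hd => Ed; rewrite Ed in h *; try by exfalso; lia.
  by exists l; left.
by exists (l + 1); right; lia.
Qed.

(** Both d and d' are 1 or -1 modulo 4, so multiplying nd = n'd' by dd' gives nd' = n'd modulo 4.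
    This quantity is a quarter of the lower left entry of the quotient of the two matrices. *)
Lemma qchar_cross (a b n d a' b' n' d' : int) : a * d - b * (4 * n) = 1 ->
  a' * d' - b' * (4 * n') = 1 -> (exists t, n * d - n' * d' = 4 * t) ->
  exists t, n * d' - d * n' = 4 * t.
Proof.
move=> /det_odd [k Ek] /det_odd [k' Ek'] [t Et].
case: Ek => E; case: Ek' => E'; rewrite {}E {}E' in Et *.
- by exists (t + 2 * (n' * k') - n * k - k * n' + n * k' + n' * k' - 2 * (n' * k')); lia.
- by exists (- t + n * k + n * k' - n' * k - n' * k'  - 0); lia.
- by exists (- t + n * k + n * k' - n' * k - n' * k'  - 0); lia.
- by exists (t + 2 * (n' * k') - n * k - k * n' + n * k' + n' * k' - 2 * (n' * k')); lia.
Qed.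

(** * Kohnen's projection *)

Section Kohnen.
Variable R : realType.
Local Notation C := (CC R).
Local Notation I := (imagi R).
Variables (p s : nat).
Hypothesis p_odd : odd p.

Definition invariant_form (f : C -> C) := forall A, Gamma0 (4 * p) A ->
  forall z : C, upper_half z -> f (mob A z) = theta_j A z ^+ (2 * s + 1) * f z.

Definition xiZ : 'M[int]_2 := mx2 4 1 0 4.

Lemma xi1E : (xi R).1 = mxQ xiZ.
Proof.
rewrite /xi /mxQ /xiZ; apply/matrixP => i j; rewrite /mx2 !mxE.
by case: (ord2 i) => ->; case: (ord2 j) => -> /=; rewrite ?mulr0z.
Qed.

Lemma det_xiZ : \det xiZ = 16.
Proof. by rewrite det2 /xiZ; case: (mx2E (4 : int) 1 0 4) => -> -> -> ->. Qed.

Lemma mob_xiZ (z : C) : mob xiZ z = z + 4^-1.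
Proof.
rewrite /mob /jd /xiZ; case: (mx2E (4 : int) 1 0 4) => -> -> -> ->.
by rewrite mulr0z mul0r add0r; field.
Qed.

Lemma xi2E (z : C) : (xi R).2 z = e 8^-1.
Proof.
rewrite /xi /= /e; congr cexp; by rewrite ofRM ofRV (ofR_nat R 4); field.
Qed.

Lemma mxQM (A B : 'M[int]_2) : mxQ (A *m B) = mxQ A *m mxQ B.
Proof. exact: map_mxM. Qed.

(** The pair xi acts as the translation by 1/4 with the constant factor e(1/8), so its product with
    a starred matrix has this explicit form. *)
Definition slash_xi (f : C -> C) (A : 'M[int]_2) (z : C) : C :=
  (e 8^-1 * theta_j A z) ^- (2 * s + 1) * f (mob A z + 4^-1).

Lemma slash_xi_star (f : C -> C) (A : 'M[int]_2) (z : C) : 0 < \det A -> upper_half z ->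
  slash s f (mp_mul (xi R) (star R A)) z = slash_xi f A z.
Proof.
move=> dA zH; rewrite /slash /slash_xi.
have -> : (mp_mul (xi R) (star R A)).2 z = e 8^-1 * theta_j A z by rewrite -(xi2E (mob A z)).
have -> : (mp_mul (xi R) (star R A)).1 = mxQ (xiZ *m A) by rewrite mxQM -xi1E.
by rewrite mobius_mxQ mobM ?det_xiZ // mob_xiZ.
Qed.

Lemma gamma_entries (B : 'M[int]_2) : Gamma0 (4 * p) B -> exists n : int,
  B 1 0 = 4 * n /\ B 0 0 * B 1 1 - B 0 1 * (4 * n) = 1.
Proof.
move=> [dB hp]; have h4 : (4 %| B 1%R 0%R)%Z by apply: dvdz_trans hp; rewrite dvdzE /= dvdn_mulr.
exists (B 1%R 0%R %/ 4)%Z; have E : B 1 0 = 4 * (B 1%R 0%R %/ 4)%Z by rewrite mulrC divzK.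
by rewrite -E -det2.
Qed.

Lemma gamma_4p4 (B : 'M[int]_2) : Gamma0 (4 * p) B -> Gamma0 4 B.
Proof. by apply: Gamma0_sub; rewrite dvdn_mulr. Qed.

(** Conjugation by the translation by 1/4 involves c/4, c/16 and (d - a)/4, all integral when 16
    divides c. The exponent of [thetaD] is then trivial, so the theta factors before and after
    conjugation agree. *)
Lemma slash_xi_conj (f : C -> C) (B : 'M[int]_2) (w : C) : invariant_form f ->
  Gamma0 (4 * p) B -> (16 %| B 1%R 0%R)%Z -> upper_half w ->
  f (mob B w + 4^-1) = theta_j B w ^+ (2 * s + 1) * f (w + 4^-1).
Proof.
move=> fi gB h16 wH; have [dB hp] := gB.
set a := B 0 0; set b := B 0 1; set c := B 1 0 in h16 hp *; set d := B 1 1.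
have det1 : a * d - b * c = 1 by rewrite -dB det2.
have [t Et] : exists t, c = 16 * t by exists (c %/ 16)%Z; rewrite mulrC divzK.
have [u Eu] : exists u, d - a = 4 * u.
  by apply: (@det_mod4 a b (4 * t) d); apply: etrans det1; rewrite Et; ring.
pose B2 : 'M[int]_2 := mx2 (a + 4 * t) (b + u - t) c (d - 4 * t).
have [b00 b01 b10 b11] := mx2E (a + 4 * t) (b + u - t) c (d - 4 * t).
have g2 : Gamma0 (4 * p) B2.
  split; last by rewrite /B2 b10.
  rewrite det2 /B2 b00 b01 b10 b11 Et.
  have Ed : d = a + 4 * u by rewrite -Eu addrC subrK.
  by apply: etrans det1; rewrite Et Ed; ring.
have j0 : jd B w != 0 by apply: jd_neq0 => //; rewrite dB.
have w4 := upper_quarter wH.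
have E : mob B w + 4^-1 = mob B2 (w + 4^-1).
  have jE : jd B2 (w + 4^-1) = jd B w.
    by rewrite /jd /B2 b10 b11 -/c -/d Et rmorphB !rmorphM /=; field.
  apply: (mulIf j0); rewrite mulrDl mobK // -{2}jE mobK ?jE // /jd /B2 b00 b01 -/a -/b -/c -/d.
  have Ed : d%:~R = a%:~R + 4 * u%:~R :> C.
    by rewrite -[d](subrK a) Eu rmorphD rmorphM /= addrC.
  by rewrite Ed Et !(rmorphD, rmorphB, rmorphM) /=; field.
rewrite E (fi _ g2 _ w4); congr (_ ^+ _ * _).
have wB : upper_half (mob B w) by apply: mob_up; rewrite ?dB.
rewrite !theta_jE -E.
have h : thetaE (mob B w) = thetaE w.
  rewrite (thetaE_gamma (gamma_4p4 gB) wH) thetaE_D //.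
  have -> : qchar B = (t * d) * 4.
    rewrite /qchar -/c -/d Et (_ : 16 * t = (4 * t) * 4); last by ring.
    by rewrite mulzK //; ring.
  by rewrite rmorphM /= mulfK ?intr_eq0 // -rmorphN e_int mulr1.
have -> : theta (mob B w + 4^-1) = thetaE w * theta (mob B w).
  by rewrite -h /thetaE divfK // theta_neq0.
have tw := theta_neq0 wH; have tw4 := theta_neq0 w4.
by rewrite /thetaE; field; rewrite tw tw4.
Qed.

Lemma mulmx_inv2x2 (A B : 'M[int]_2) : \det B = 1 -> A *m inv2x2 B *m B = A.
Proof.
rewrite det2 => dB; rewrite -mulmxA.
have -> : inv2x2 B *m B = 1%:M.
  have [i00 i01 i10 i11] := mx2E (B 1 1) (- B 0 1) (- B 1 0) (B 0 0).
  by apply: mx2_eq; rewrite mulmx2 /inv2x2 ?i00 ?i01 ?i10 ?i11 !mxE /=; rewrite -?dB; ring.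
by rewrite mulmx1.
Qed.

Lemma Gamma0M (N : nat) (A B : 'M[int]_2) : Gamma0 N A -> Gamma0 N B -> Gamma0 N (A *m B).
Proof.
move=> [dA hA] [dB hB]; split; first by rewrite det_mulmx dA dB mulr1.
by rewrite mulmx2; apply: rpredD; [apply: dvdz_mulr|apply: dvdz_mull].
Qed.

Lemma Gamma0V (N : nat) (A : 'M[int]_2) : Gamma0 N A -> Gamma0 N (inv2x2 A).
Proof.
move=> [dA hA]; have [i00 i01 i10 i11] := mx2E (A 1 1) (- A 0 1) (- A 1 0) (A 0 0).
split; last by rewrite /inv2x2 i10 rpredN.
by rewrite det2 /inv2x2 i00 i01 i10 i11 -dA det2; ring.
Qed.

Lemma expr_cancel (x y c F : C) (n : nat) : x != 0 ->
  (c * (x * y)) ^- n * (x ^+ n * F) = (c * y) ^- n * F.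
Proof.
move=> x0; rewrite (_ : (c * (x * y)) ^+ n = x ^+ n * (c * y) ^+ n).
  by rewrite invfM mulrACA mulVf ?mul1r // expf_neq0.
by rewrite -exprMn mulrCA.
Qed.

(** By [qchar_cross] the quotient of A by B has lower left entry divisible by 16, and
    [slash_xi_conj] carries it across xi. *)
Lemma slash_xi_eq (f : C -> C) (A B : 'M[int]_2) (z : C) : invariant_form f ->
  Gamma0 (4 * p) A -> Gamma0 (4 * p) B -> (4 %| qchar A - qchar B)%Z -> upper_half z ->
  slash_xi f A z = slash_xi f B z.
Proof.
move=> fi gA gB qAB zH; have [dA _] := gA; have [dB _] := gB.
pose T := A *m inv2x2 B; have gT : Gamma0 (4 * p) T by apply: Gamma0M => //; apply: Gamma0V.
have TB : T *m B = A by apply: mulmx_inv2x2.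
have [dT _] := gT.
have h16 : (16 %| T 1%R 0%R)%Z.
  have [n [En hn]] := gamma_entries gA; have [n' [En' hn']] := gamma_entries gB.
  have [t Et] : exists t, n * B 1 1 - A 1 1 * n' = 4 * t.
    apply: qchar_cross hn hn' _; exists ((qchar A - qchar B)%R %/ 4)%Z.
    rewrite [RHS]mulrC divzK // /qchar En En' ![4 * _]mulrC !mulzK //.
  have [i00 i01 i10 i11] := mx2E (B 1 1) (- B 0 1) (- B 1 0) (B 0 0).
  rewrite /T mulmx2 /inv2x2 i00 i10 En En'.
  have -> : 4 * n * B 1 1 + A 1 1 * - (4 * n') = 16 * t.
    by rewrite [RHS](_ : _ = 4 * (4 * t)); [rewrite -Et; ring|ring].
  by rewrite dvdz_mulr.
have wH : upper_half (mob B z) by apply: mob_up; rewrite ?dB.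
have tT : theta_j T (mob B z) != 0 by apply: theta_j_neq0; rewrite ?dT.
have tB : theta_j B z != 0 by apply: theta_j_neq0; rewrite ?dB.
rewrite /slash_xi -TB mobM ?dT ?dB // theta_jM ?dT ?dB //.
by rewrite (slash_xi_conj fi gT h16 wH) expr_cancel.
Qed.

Lemma slash_xi_mob (f : C -> C) (A B : 'M[int]_2) (z : C) : 0 < \det A -> 0 < \det B ->
  upper_half z -> slash_xi f A (mob B z) = theta_j B z ^+ (2 * s + 1) * slash_xi f (A *m B) z.
Proof.
move=> dA dB zH; rewrite /slash_xi mobM ?gt_eqF // theta_jM // [RHS]mulrA; congr (_ * _).
have t0 := expf_neq0 (2 * s + 1) (theta_j_neq0 dB zH).
rewrite (_ : (_ * (_ * theta_j B z)) ^+ (2 * s + 1) =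
  theta_j B z ^+ (2 * s + 1) * (e 8^-1 * theta_j A (mob B z)) ^+ (2 * s + 1)).
  by rewrite invfM [RHS]mulrA (divff t0) mul1r.
by rewrite -exprMn mulrA mulrC.
Qed.

Lemma A_E (v : int) : [/\ A_ p v 0 0 = 1, A_ p v 0 1 = 0, A_ p v 1 0 = 4 * p%:Z * v & A_ p v 1 1 = 1].
Proof. exact: mx2E. Qed.

Lemma A_Gamma0 (v : int) : Gamma0 (4 * p) (A_ p v).
Proof.
have [a b c d] := A_E v; split; first by rewrite det2 a b c d; ring.
by rewrite c PoszM dvdz_mulr.
Qed.

Lemma qchar_A (v : int) : qchar (A_ p v) = p%:Z * v.
Proof. by have [a b c d] := A_E v; rewrite /qchar c d -mulrA [4 * _]mulrC mulzK // mulr1. Qed.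

(** Multiplication by B on the right moves the class of A_v to that of A_(v+t), with t = ud for c =
    4pu. The four terms are therefore permuted cyclically. *)
Lemma qchar_AM (B : 'M[int]_2) : Gamma0 (4 * p) B -> exists t : int, forall v : int,
  (4 %| qchar (A_ p v *m B) - qchar (A_ p (v + t)))%Z.
Proof.
move=> gB; have [dB hp] := gB; have [n [En hn]] := gamma_entries gB.
have [u Eu] : exists u : int, n = p%:Z * u.
  have E : B 1 0 = (4 * p)%:Z * (B 1%R 0%R %/ (4 * p)%:Z)%Z by rewrite mulrC divzK.
  exists (B 1%R 0%R %/ (4 * p)%:Z)%Z; apply: (@mulfI _ (4 : int)) => //.
  by rewrite -En {1}E PoszM mulrA.
exists (u * B 1 1) => w; rewrite qchar_A /qchar !mulmx2.
have [_ _ -> ->] := A_E w.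
have -> : 4 * p%:Z * w * B 0 0 + 1 * B 1 0 = (p%:Z * w * B 0 0 + n) * 4 by rewrite En; ring.
rewrite mulzK //; set a := B 0 0 in hn *; set b := B 0 1 in hn *; set d := B 1 1 in hn *.
have -> : (p%:Z * w * a + n) * (4 * p%:Z * w * b + 1 * d) - p%:Z * (w + u * d) =
  4 * (p%:Z * w * b * (p%:Z * w * a + n) + p%:Z * w * b * n)
  + p%:Z * w * (a * d - b * (4 * n) - 1) + (n - p%:Z * u) * d by ring.
by rewrite hn subrr mulr0 Eu subrr mul0r !addr0 dvdz_mulr.
Qed.

Definition Wsum (f : C -> C) (z : C) : C :=
  \sum_(v <- [:: -1; 0; 1; 2 : int]) slash_xi f (A_ p v) z.

Lemma sum4_shift (G : int -> C) (t : int) : (forall k l : int, (4 %| k - l)%Z -> G k = G l) ->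
  \sum_(v <- [:: -1; 0; 1; 2 : int]) G (v + t) = \sum_(v <- [:: -1; 0; 1; 2 : int]) G v.
Proof.
move=> per; rewrite !big_cons !big_nil !addr0.
have perE (k l m : int) : k - l = 4 * m -> G k = G l by move=> h; apply: per; rewrite h dvdz_mulr.
have [q [E|E|E|E]] := mod4P t; rewrite E.
- rewrite (perE (-1 + 4 * q) (-1) q); last by ring.
  rewrite (perE (0 + 4 * q) 0 q); last by ring.
  rewrite (perE (1 + 4 * q) 1 q); last by ring.
  by rewrite (perE (2 + 4 * q) 2 q); last by ring.
- rewrite (perE (-1 + (4 * q + 1)) 0 q); last by ring.
  rewrite (perE (0 + (4 * q + 1)) 1 q); last by ring.
  rewrite (perE (1 + (4 * q + 1)) 2 q); last by ring.
  rewrite (perE (2 + (4 * q + 1)) (-1) (q + 1)); last by ring.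
  by ring.
- rewrite (perE (-1 + (4 * q + 2)) 1 q); last by ring.
  rewrite (perE (0 + (4 * q + 2)) 2 q); last by ring.
  rewrite (perE (1 + (4 * q + 2)) (-1) (q + 1)); last by ring.
  rewrite (perE (2 + (4 * q + 2)) 0 (q + 1)); last by ring.
  by ring.
- rewrite (perE (-1 + (4 * q + 3)) 2 q); last by ring.
  rewrite (perE (0 + (4 * q + 3)) (-1) (q + 1)); last by ring.
  rewrite (perE (1 + (4 * q + 3)) 0 (q + 1)); last by ring.
  rewrite (perE (2 + (4 * q + 3)) 1 (q + 1)); last by ring.
  by ring.
Qed.

Lemma Wsum_invariant (f : C -> C) : invariant_form f -> invariant_form (Wsum f).
Proof.
move=> fi B gB z zH; have [dB _] := gB; have [t Ht] := qchar_AM gB.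
have dA v : \det (A_ p v) = 1 by case: (A_Gamma0 v).
rewrite /Wsum (eq_bigr (fun v => theta_j B z ^+ (2 * s + 1) * slash_xi f (A_ p (v + t)) z)).
  rewrite -mulr_sumr (sum4_shift (G := fun k => slash_xi f (A_ p k) z)) // => k l kl.
  apply: (slash_xi_eq fi) => //; try exact: A_Gamma0.
  by rewrite !qchar_A -mulrBr dvdz_mull.
move=> v _; rewrite slash_xi_mob ?dA ?dB //; congr (_ * _).
by apply: (slash_xi_eq fi) => //; [apply: Gamma0M => //; apply: A_Gamma0|apply: A_Gamma0].
Qed.

Definition om : C := e 8^-1 ^+ (2 * s + 1).
Definition al : C := om + om^-1.

Lemma om_neq0 : om != 0. Proof. by rewrite expf_neq0 // e_neq0. Qed.

Lemma om_sqr : om ^+ 2 = I ^+ (2 * s + 1).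
Proof. by rewrite /om exprAC e_eighth. Qed.

Lemma om4 : om ^+ 4 = - 1.
Proof.
rewrite (exprM om 2 2) om_sqr exprAC imagi2 -signr_odd oddD oddM /=; exact: expr1.
Qed.

Lemma al_sqr : al ^+ 2 = 2.
Proof.
have o := om_neq0; have h : om ^+ 2 + om ^- 2 = 0.
  have -> : om ^+ 2 + om ^- 2 = (om ^+ 4 + 1) / om ^+ 2 by field.
  by rewrite om4 addNr mul0r.
have -> : al ^+ 2 = 2 + (om ^+ 2 + om ^- 2) by rewrite /al; field.
by rewrite h addr0.
Qed.

Lemma al_neq0 : al != 0.
Proof. by apply: contra_eq_neq al_sqr => ->; rewrite expr0n /= eq_sym pnatr_eq0. Qed.

Definition kohnen (f : C -> C) (z : C) : C := 2^-1 * (f z + al^-1 * Wsum f z).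

Lemma kohnen_invariant (f : C -> C) : invariant_form f -> invariant_form (kohnen f).
Proof.
move=> fi B gB z zH; rewrite /kohnen (fi B gB z zH) (Wsum_invariant fi gB zH); ring.
Qed.

Lemma slash_xi_A0 (f : C -> C) (z : C) : upper_half z -> slash_xi f (A_ p 0) z = om^-1 * f (z + 4^-1).
Proof.
move=> zH; have [a b c d] := A_E 0; rewrite /slash_xi theta_jE.
have -> : mob (A_ p 0) z = z.
  by rewrite /mob /jd a b c d !mulr0 mul0r addr0 add0r mul1r divr1.
have -> : theta z / theta z = 1 by apply: divff; apply: theta_neq0.
by rewrite mulr1.
Qed.

Lemma e_half_odd (n : int) : e ((2 * n + 1)%:~R / 2) = - 1 :> C.
Proof.
rewrite rmorphD rmorphM /= mulrDl mulrAC divff ?pnatr_eq0 // mul1r addrC e_addint div1r; exact: e_half.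
Qed.

Lemma slash_xi_A2 (f : C -> C) (z : C) : invariant_form f -> upper_half z ->
  slash_xi f (A_ p 2) z = om * f (z - 4^-1).
Proof.
move=> fi zH; have [a b c d] := A_E 2.
have [k Ek] : exists k : int, p%:Z = 2 * k + 1.
  by exists p./2%:Z; rewrite -{1}(odd_double_half p) p_odd; lia.
(* This is T A_2 T for the translation T by 1/4; its upper right entry (p + 1)/2 is integral because
   p is odd. *)
pose G : 'M[int]_2 := mx2 (1 + 2 * p%:Z) (k + 1) (8 * p%:Z) (1 + 2 * p%:Z).
have [Ga Gb Gc Gd] := mx2E (1 + 2 * p%:Z) (k + 1) (8 * p%:Z) (1 + 2 * p%:Z).
have gG : Gamma0 (4 * p) G.
  split; first by rewrite det2 /G Ga Gb Gc Gd Ek; ring.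
  rewrite /G Gc PoszM (_ : 8 * p%:Z = 4 * p%:Z * 2); last by ring.
  by apply: dvdz_mulr; apply: dvdzz.
have [dA _] := A_Gamma0 2.
have zm := upper_quarterB zH; have j0 : jd (A_ p 2) z != 0 by apply: jd_neq0; rewrite ?dA.
have jE : jd G (z - 4^-1) = jd (A_ p 2) z.
  by rewrite /jd /G Gc Gd c d !(rmorphD, rmorphM) /=; field.
have E : mob (A_ p 2) z + 4^-1 = mob G (z - 4^-1).
  apply: (mulIf j0); rewrite mulrDl mobK // -{2}jE mobK ?jE // /G Ga Gb a b /jd c d Ek.
  by rewrite !(rmorphD, rmorphM) /=; field.
have wA : upper_half (mob (A_ p 2) z) by apply: mob_up; rewrite ?dA.
have tz := theta_neq0 zH; have tm := theta_neq0 zm; have tA := theta_neq0 wA.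
(* Here e(-p/2) = -1 interchanges the two signs in the affine formula for [thetaE], which leaves the
   factor I. *)
have key : theta_j G (z - 4^-1) = I * theta_j (A_ p 2) z.
  have h1 := thetaE_gamma (gamma_4p4 (A_Gamma0 2)) zH; have h2 := thetaEB_D zH.
  rewrite qchar_A (_ : - _ = (2 * (- k - 1) + 1)%:~R / 2) in h1; last first.
    by rewrite Ek !(rmorphD, rmorphM, rmorphB, rmorphN) /=; field.
  rewrite e_half_odd in h1.
  have h3 : thetaE (mob (A_ p 2) z) = I * (theta (z - 4^-1) / theta z).
    rewrite h1 h2; have := imagi2 R; move: I => J J2.
    have -> : J * (((1 - J) + (1 + J) * thetaD z) / 2) =
      ((J - J ^+ 2) + (J + J ^+ 2) * thetaD z) / 2 by field.
    by rewrite J2; field.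
  have h4 : theta (mob (A_ p 2) z + 4^-1) = thetaE (mob (A_ p 2) z) * theta (mob (A_ p 2) z).
    by rewrite /thetaE divfK.
  by rewrite !theta_jE -E h4 h3; field; rewrite tz tm.
rewrite /slash_xi E (fi _ gG _ zm) key mulrA; congr (_ * _).
have t0 : theta_j (A_ p 2) z != 0 by apply: theta_j_neq0; rewrite ?dA.
rewrite -e_eighth /om -exprVn -exprMn; congr (_ ^+ _).
by field; rewrite t0 e_neq0.
Qed.

(** For odd v the matrix A_v, conjugated with translations by 1/4, still comes from Gamma0(4p); the
    remaining ratio of theta factors turns out not to depend on z. *)
Lemma slash_xi_A1 (f : C -> C) (v : int) : invariant_form f -> v = 1 \/ v = -1 ->
  exists2 r : C, r = 1 \/ r = om ^+ 2 & forall z : C, upper_half z ->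
    slash_xi f (A_ p v) (z + 4^-1) = r * slash_xi f (A_ p v) z.
Proof.
move=> fi hv; have [a b c d] := A_E v; set x := p%:Z * v.
have [k Ek] : exists k : int, x = 2 * k + 1.
  rewrite /x -(odd_double_half p) p_odd; case: hv => ->; [exists p./2%:Z|exists (- p./2%:Z - 1)]; lia.
have c4 : 4 * p%:Z * v = 4 * x by rewrite /x mulrA.
rewrite c4 in c.
(* G = T A_v T A_v^(-1) T^(-1) for the translation T by 1/4; its upper right entry is ((x + 1)/2)^2,
   integral because x is odd. *)
pose G : 'M[int]_2 := mx2 (1 - x - x ^+ 2) ((k + 1) ^+ 2) (- (4 * x ^+ 2)) (1 + x + x ^+ 2).
have [Ga Gb Gc Gd] := mx2E (1 - x - x ^+ 2) ((k + 1) ^+ 2) (- (4 * x ^+ 2)) (1 + x + x ^+ 2).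
have gG : Gamma0 (4 * p) G.
  split; first by rewrite det2 /G Ga Gb Gc Gd Ek; ring.
  rewrite /G Gc rpredN PoszM (_ : 4 * x ^+ 2 = 4 * p%:Z * (v * x)); last by rewrite /x; ring.
  by apply: dvdz_mulr; apply: dvdzz.
have [dA _] := A_Gamma0 v; have dA' : 0 < \det (A_ p v) by rewrite dA.
(* As x is odd, this is I or -I, and the sign decides between the two values of [r]. *)
pose ep : C := e (- (x%:~R / 4)).
have epE : ep = I \/ ep = - I.
  have : ep ^+ 2 = I ^+ 2.
    rewrite imagi2 -eMn -(e_half_odd (- k - 1)); congr e.
    by rewrite Ek !(rmorphD, rmorphM, rmorphB, rmorphN) /=; field.
  by move/eqP; rewrite eqf_sqr => /orP[]/eqP; [left|right].
have wA (z : C) : upper_half z -> upper_half (mob (A_ p v) z) by move=> zH; apply: mob_up.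
have RE (z : C) : upper_half z -> slash_xi f (A_ p v) (z + 4^-1) =
   (thetaE (mob (A_ p v) (z + 4^-1)) / thetaE (mob (A_ p v) z) * thetaE z) ^+ (2 * s + 1)
    * slash_xi f (A_ p v) z.
  move=> zH; have z4 := upper_quarter zH; have w4 := upper_quarter (wA z zH).
  have j0 : jd (A_ p v) z != 0 by apply: jd_neq0; rewrite ?dA.
  have j4 : jd (A_ p v) (z + 4^-1) != 0 by apply: jd_neq0; rewrite ?dA.
  have jG : jd G (mob (A_ p v) z + 4^-1) != 0 by case: gG => dG _; apply: jd_neq0; rewrite ?dG.
  have mE : mob (A_ p v) z * jd (A_ p v) z = z by rewrite mobK // a b mul1r addr0.
  have mE4 : mob (A_ p v) (z + 4^-1) * jd (A_ p v) (z + 4^-1) = z + 4^-1.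
    by rewrite mobK // a b mul1r addr0.
  have E : mob (A_ p v) (z + 4^-1) + 4^-1 = mob G (mob (A_ p v) z + 4^-1).
    have jGE : jd G (mob (A_ p v) z + 4^-1) * jd (A_ p v) z = jd (A_ p v) (z + 4^-1).
      have -> : jd G (mob (A_ p v) z + 4^-1) * jd (A_ p v) z =
        (- (4 * x ^+ 2))%:~R * (mob (A_ p v) z * jd (A_ p v) z) + ((- (4 * x ^+ 2))%:~R / 4
         + (1 + x + x ^+ 2)%:~R) * jd (A_ p v) z by rewrite {1}/jd /G Gc Gd; ring.
      by rewrite mE /jd c d !(rmorphD, rmorphM, rmorphB, rmorphN, rmorphXn) /=; field.
    apply: (mulIf jG); rewrite mobK // -/(jd _ _); apply: (mulIf j0).
    rewrite -mulrA jGE mulrDl mE4 /G Ga Gb.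
    have -> : ((1 - x - x ^+ 2)%:~R * (mob (A_ p v) z + 4^-1) + ((k + 1) ^+ 2)%:~R) * jd (A_ p v) z
      = (1 - x - x ^+ 2)%:~R * (mob (A_ p v) z * jd (A_ p v) z)
      + ((1 - x - x ^+ 2)%:~R / 4 + ((k + 1) ^+ 2)%:~R) * jd (A_ p v) z by ring.
    by rewrite mE /jd c d Ek !(rmorphD, rmorphM, rmorphB, rmorphN, rmorphXn) /=; field.
  have t1 := theta_neq0 zH; have t2 := theta_neq0 z4; have t3 := theta_neq0 w4.
  have t4 := theta_neq0 (wA _ zH); have t5 := theta_neq0 (wA _ z4).
  have t6 := theta_neq0 (upper_quarter (wA _ z4)).
  rewrite /slash_xi E (fi _ gG _ w4) mulrA [RHS]mulrA; congr (_ * _).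
  rewrite -!exprVn -!exprMn; congr (_ ^+ _); rewrite !theta_jE -E /thetaE.
  move: (e_neq0 (8^-1 : C)) => e8; field.
  by rewrite e8 t1 t2 t3 t4 t5.
(* Every factor is affine or fractional linear in [thetaD z]; after clearing denominators the
   difference is a multiple of I^2 + 1. *)
have Rv (z : C) : upper_half z ->
  thetaE (mob (A_ p v) (z + 4^-1)) / thetaE (mob (A_ p v) z) * thetaE z = if ep == I then 1 else I.
  move=> zH; have z4 := upper_quarter zH.
  have n0 := thetaE_neq0 (wA _ zH); have E0 := thetaE_neq0 zH.
  have h1 := thetaE_gamma (gamma_4p4 (A_Gamma0 v)) zH.
  have h2 := thetaE_gamma (gamma_4p4 (A_Gamma0 v)) z4.
  have h3 := thetaEB_D zH; have h4 := thetaE_D zH.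
  rewrite qchar_A -/x -/ep in h1 h2.
  have h5 : thetaD (z + 4^-1) = (((1 - I) + (1 + I) * thetaD z) / 2) / thetaE z.
    rewrite -h3 /thetaD /thetaE.
    have -> : z + 4^-1 + 2^-1 = z - 4^-1 + (1 : int)%:~R by field.
    rewrite theta_int; last exact: upper_quarterB.
    by field; rewrite !theta_neq0.
  have i2 := imagi2 R.
  apply: (mulIf n0); rewrite mulrAC divfK // h1 h2.
  have Zd : thetaD (z + 4^-1) * thetaE z = ((1 - I) + (1 + I) * thetaD z) / 2 by rewrite h5 divfK.
  have -> : (1 + I + (1 - I) * ep * thetaD (z + 4^-1)) / 2 * thetaE z =
    ((1 + I) * thetaE z + (1 - I) * ep * (thetaD (z + 4^-1) * thetaE z)) / 2 by field.
  rewrite Zd h4; apply/eqP; rewrite -subr_eq0; apply/eqP.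
  have i0 : I != 0 by rewrite -nm_gt0 nm_i.
  have N0 : I ^+ 2 + 1 = 0 by rewrite i2 addNr.
  case: epE => ->.
    rewrite eqxx; have -> : ((1 + I) * ((1 + I + (1 - I) * thetaD z) / 2)
      + (1 - I) * I * ((1 - I + (1 + I) * thetaD z) / 2)) / 2
      - 1 * ((1 + I + (1 - I) * I * thetaD z) / 2)
      = (I ^+ 2 + 1) * ((I - 1) * (1 - thetaD z) / 4) by field.
    by rewrite N0 mul0r.
  have -> : (- I == I) = false.
    apply/negbTE; rewrite eq_sym -addr_eq0 -mulr2n -mulr_natr mulf_neq0 ?pnatr_eq0 //.
  have -> : ((1 + I) * ((1 + I + (1 - I) * thetaD z) / 2)
      + (1 - I) * - I * ((1 - I + (1 + I) * thetaD z) / 2)) / 2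
      - I * ((1 + I + (1 - I) * - I * thetaD z) / 2)
      = (I ^+ 2 + 1) * ((1 - I) * (1 + thetaD z) / 4) by field.
  by rewrite N0 mul0r.
exists ((if ep == I then 1 else I) ^+ (2 * s + 1)); last by move=> z zH; rewrite RE // Rv.
by case: ifP => _; [left; rewrite expr1n|right; rewrite om_sqr].
Qed.

(** On a Fourier term e(nz) this reads om^(-1) i^n + om i^(-n) = al, the equation that singles out
    the plus-space exponents. *)
Lemma kohnen_plus (f : C -> C) (z : C) : invariant_form f -> upper_half z ->
  om^-1 * kohnen f (z + 4^-1) + om * kohnen f (z - 4^-1) = al * kohnen f z.
Proof.
move=> fi zH; have zp := upper_quarter zH; have zm := upper_quarterB zH.
have f1 (w : C) : upper_half w -> f (w + 1) = f w.
  move=> wH; pose T : 'M[int]_2 := mx2 1 1 0 1; have [a b c d] := mx2E (1 : int) 1 0 1.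
  have gT : Gamma0 (4 * p) T.
    by split; [rewrite det2 /T a b c d; ring|rewrite /T c dvdz0].
  have E : mob T w = w + 1 by rewrite /mob /jd /T a b c d mul0r add0r divr1 mul1r.
  have h := fi T gT w wH; rewrite theta_jE E in h.
  rewrite h -[w + 1]/(w + (1 : int)%:~R) theta_int // divff ?theta_neq0 //.
  by rewrite expr1n mul1r.
have [r1 hr1 H1] := slash_xi_A1 (v := 1) fi (or_introl erefl).
have [r2 hr2 H2] := slash_xi_A1 (v := -1) fi (or_intror erefl).
have o := om_neq0; have a0 := al_neq0.
have o2 : om ^+ 2 + om ^- 2 = 0.
  have -> : om ^+ 2 + om ^- 2 = (om ^+ 4 + 1) / om ^+ 2 by field.
  by rewrite om4 addNr mul0r.
(* The odd terms satisfy the identity one by one: om^(-1) r + om r^(-1) = al both for r = 1 and for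
   r = om^2. *)
have U (v : int) (r : C) : r = 1 \/ r = om ^+ 2 -> (forall w : C, upper_half w ->
    slash_xi f (A_ p v) (w + 4^-1) = r * slash_xi f (A_ p v) w) ->
    om^-1 * slash_xi f (A_ p v) (z + 4^-1) + om * slash_xi f (A_ p v) (z - 4^-1)
    = al * slash_xi f (A_ p v) z.
  move=> hr H; have h1 := H z zH; have := H _ zm; rewrite subrK => h2.
  rewrite h1 h2; case: hr => ->; rewrite /al; by field; rewrite o.
have U1 := U 1 r1 hr1 H1; have U2 := U (-1) r2 hr2 H2.
have F0 (w : C) : upper_half w -> kohnen f w = 2^-1 * (f w + al^-1 *
    (slash_xi f (A_ p (-1)) w + om^-1 * f (w + 4^-1) + slash_xi f (A_ p 1) w + om * f (w - 4^-1))).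
  move=> wH; rewrite /kohnen /Wsum !big_cons big_nil addr0 slash_xi_A0 // slash_xi_A2 //.
  by rewrite !addrA.
have e1 : f (z + 4^-1 + 4^-1) = f (z - 4^-1 - 4^-1).
  rewrite -(f1 (z - 4^-1 - 4^-1)); last exact: upper_quarterB.
  by congr f; field.
rewrite !F0 // e1 addrK subrK.
set g1 := slash_xi f (A_ p 1) in U1 *; set g2 := slash_xi f (A_ p (-1)) in U2 *.
set X := f (z - 4^-1 - 4^-1); have -> : om^-1 * (2^-1 * (f (z + 4^-1) + al^-1 * (g2 (z + 4^-1) + om^-1 * X
   + g1 (z + 4^-1) + om * f z))) + om * (2^-1 * (f (z - 4^-1) + al^-1 * (g2 (z - 4^-1)
   + om^-1 * f z + g1 (z - 4^-1) + om * X))) =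
  2^-1 * ((om^-1 * f (z + 4^-1) + om * f (z - 4^-1)) + al^-1 * ((om^-1 * g2 (z + 4^-1) + om * g2 (z - 4^-1))
  + (om^-1 * g1 (z + 4^-1) + om * g1 (z - 4^-1)) + (om ^+ 2 + om ^- 2) * X + 2 * f z)).
  by field; rewrite o a0.
(* The value at z - 1/2 cancels because om^2 + om^(-2) = 0. With 2 = al^2 the plain term and the
   shifted terms exchange roles. *)
rewrite o2 U1 U2 mul0r addr0 (_ : 2 * f z = al ^+ 2 * f z); last by rewrite al_sqr.
by field; rewrite a0 o.
Qed.

End Kohnen.

(** * Poincaré series *)

Section LatticeSum.
Variable R : realType.
Local Notation C := (CC R).

Lemma sumb_prod (I J : choiceType) (b : I -> R) (b' : J -> R) (B B' : R) :
  (forall i, 0 <= b i) -> (forall j, 0 <= b' j) -> sumb b B -> sumb b' B' ->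
  sumb (fun x : I * J => b x.1 * b' x.2) (B * B').
Proof.
move=> b0 b0' hb hb' S.
pose J1 := [fset x.1 | x in S]%fset; pose J2 := [fset x.2 | x in S]%fset.
pose P := [fset x in [seq (i, j) | i <- enum_fset J1, j <- enum_fset J2]]%fset.
have uP : uniq [seq (i, j) | i <- enum_fset J1, j <- enum_fset J2].
  by apply: allpairs_uniq => // -[i j] [i' j'].
have le1 : \sum_(x <- S) b x.1 * b' x.2 <= \sum_(x <- P) b x.1 * b' x.2.
  apply: fsum_sub; first by move=> x; apply: mulr_ge0.
  apply/fsubsetP => x xS; rewrite !inE; apply/allpairsP; exists x; split.
  - by apply/imfsetP; exists x.
  - by apply/imfsetP; exists x.
  - by case: x {xS}.
apply: le_trans le1 _.
rewrite (perm_big [seq (i, j) | i <- enum_fset J1, j <- enum_fset J2]); last first.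
  apply: uniq_perm; [exact: fset_uniq|exact: uP|by move=> x; rewrite !inE].
rewrite big_allpairs_dep /=.
have -> : \sum_(i <- J1) \sum_(j <- J2) b i * b' j = (\sum_(i <- J1) b i) * \sum_(j <- J2) b' j.
  by rewrite mulr_suml; apply: eq_bigr => i _; rewrite mulr_sumr.
have B0 : 0 <= \sum_(j <- J2) b' j by apply: sumr_ge0.
apply: (le_trans (ler_wpM2r B0 (hb J1))); apply: ler_wpM2l (hb' J2).
by have := hb fset0; rewrite big_seq_fset0.
Qed.

(** The exponent 5/2 of |cz + d| is shared equally between c and d, which calls for powers 5/4; the
    maximum with 1 covers a zero entry. *)
Definition quart (n : nat) : R := Num.sqrt (Num.sqrt (maxn 1 n)%:R).

Lemma quart4 (n : nat) : quart n ^+ 4 = (maxn 1 n)%:R.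
Proof. by rewrite (exprM _ 2 2) !sqr_sqrtr // ?sqrtr_ge0. Qed.

Lemma quart_gt0 (n : nat) : 0 < quart n.
Proof. by rewrite !sqrtr_gt0 ltr0n leq_max. Qed.

Lemma quart_ge1 (n : nat) : 1 <= quart n.
Proof.
rewrite -(ler_pXn2r (_ : 0 < 4)%N) ?nnegrE ?ler01 ?(ltW (quart_gt0 n)) //.
by rewrite quart4 expr1n ler1n leq_max.
Qed.

Definition lat (n : nat) : R := quart n ^- 5.

Lemma lat_ge0 (n : nat) : 0 <= lat n.
Proof. by rewrite invr_ge0 exprn_ge0 // ltW // quart_gt0. Qed.

(** The integral comparison for n^(-5/4) in telescoping form. With u and v the fourth roots of n + 1
    and n + 2 it comes down to v^4 - u^4 <= 4 v^3 (v - u). *)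
Lemma lat_step (n : nat) : lat n.+2 <= 4 * ((quart n.+1)^-1 - (quart n.+2)^-1).
Proof.
have u0 := quart_gt0 n.+1; have v0 := quart_gt0 n.+2.
have E : quart n.+2 ^+ 4 - quart n.+1 ^+ 4 = 1.
  have m1 k : maxn 1 k.+1 = k.+1 by apply/maxn_idPr.
  by rewrite !quart4 !m1 -[in LHS](natr1 n.+1); ring.
rewrite /lat; move: (quart n.+1) (quart n.+2) u0 v0 E => u v u0 v0 E.
have uv : u <= v.
  rewrite -(ler_pXn2r (_ : 0 < 4)%N) ?nnegrE ?(ltW u0) ?(ltW v0) //.
  by rewrite -subr_ge0 E.
have -> : v ^- 5 = 1 / v ^+ 5 by rewrite div1r.
rewrite ler_pdivrMr ?exprn_gt0 //.
have -> : 4 * (u^-1 - v^-1) * v ^+ 5 = 4 * (v - u) * v ^+ 4 / u by field; rewrite !gt_eqF.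
rewrite ler_pdivlMr // mul1r.
have h : (v - u) * ((v + u) * (v ^+ 2 + u ^+ 2)) = 1 by rewrite -E; ring.
have h2 : (v + u) * (v ^+ 2 + u ^+ 2) <= 4 * v ^+ 3.
  have -> : 4 * v ^+ 3 = (2 * v) * (2 * v ^+ 2) by ring.
  apply: ler_pM; rewrite ?addr_ge0 ?exprn_ge0 ?(ltW u0) ?(ltW v0) //; first by lra.
  have : u ^+ 2 <= v ^+ 2 by rewrite ler_pXn2r ?nnegrE ?(ltW u0) ?(ltW v0).
  by lra.
have d0 : 0 <= v - u by rewrite subr_ge0.
have h3 : 1 <= (v - u) * (4 * v ^+ 3) by rewrite -[leLHS]h; apply: ler_wpM2l.
have -> : 4 * (v - u) * v ^+ 4 = (v - u) * (4 * v ^+ 3) * v by ring.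
by apply: (le_trans uv); rewrite ler_peMl // ltW.
Qed.

Lemma sumb_lat : sumb (fun x : int * int => lat `|x.1|%N * lat `|x.2|%N) (12 * 12).
Proof.
have h (N : nat) : \sum_(n < N.+2) lat n <= 6 - 4 / quart N.+1.
  elim: N => [|N IH].
    have q0 : quart 0 = 1 by rewrite /quart !sqrtr1.
    have q1 : quart 1 = 1 by rewrite /quart !sqrtr1.
    by rewrite !big_ord_recr big_ord0 /= /lat q0 q1 !expr1n !invr1; lra.
  rewrite big_ord_recr /=; have := lat_step N; have := IH.
  by rewrite mulrBr; lra.
have b6 (N : nat) : \sum_(n < N) lat n <= 6.
  case: N => [|[|N]]; first by rewrite big_ord0.
    apply: le_trans (_ : \sum_(n < 2) lat n <= 6).
      by rewrite !big_ord_recr !big_ord0 /= lerDl lat_ge0.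
    by apply: (le_trans (h 0)); rewrite gerBl divr_ge0 // ltW // quart_gt0.
  by apply: (le_trans (h N)); rewrite gerBl divr_ge0 // ltW // quart_gt0.
have hb : sumb (fun n : int => lat `|n|%N) 12.
  by have := sumb_int lat_ge0 b6; rewrite (_ : 2 * 6 = 12 :> R) //; ring.
apply: (sumb_prod (b := fun n : int => lat `|n|%N) (b' := fun n : int => lat `|n|%N)) => // i; exact: lat_ge0.
Qed.

End LatticeSum.

(** * Automorphy factors and bounds for single terms *)

Section Lifts.
Variable R : realType.
Local Notation C := (CC R).

(* Integral counterpart of [metaplectic]; the constant [k] is not normalised. *)
Definition mpl (M : 'M[int]_2) (phi : C -> C) (k : C) :=
  [/\ 0 < \det M, k != 0, forall z, upper_half z -> exists l, cderiv phi z l &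
      forall z, upper_half z -> phi z ^+ 2 = k * jd M z].

Lemma mpl_neq0 M phi k z : mpl M phi k -> upper_half z -> phi z != 0.
Proof.
move=> [dM k0 _ h] zH; have : phi z ^+ 2 != 0.
  by rewrite h // mulf_neq0 // jd_neq0 // gt_eqF.
by rewrite expf_eq0.
Qed.

Lemma cderiv_sqr_cst (f : C -> C) (z l k c : C) : upper_half z -> f z != 0 -> cderiv f z l ->
  (forall w, upper_half w -> f w ^+ 2 = k * w + c) -> l = k / (2 * f z).
Proof.
move=> zH f0 fl h; have h1 := cderivX 2 fl.
have h2 : cderiv (fun w => f w ^+ 2) z (k * 1 + 0).
  apply: (cderiv_H (f := fun w => k * w + c) zH); first by move=> w wH; rewrite h.
  by apply: cderivD; [apply: cderivZ; apply: cderiv_id|apply: cderiv_cst].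
have := cderiv_unique h1 h2; rewrite mulr1 addr0 /= expr1 => <-; field.
by rewrite f0.
Qed.

(** The derivative of a function with constant non-zero square vanishes, and the half-plane is
    convex. This replaces every choice of a branch of the square root. *)
Lemma sqr_cst (f : C -> C) (k : C) : k != 0 -> (forall z, upper_half z -> exists l, cderiv f z l) ->
  (forall z, upper_half z -> f z ^+ 2 = k) -> forall z w, upper_half z -> upper_half w -> f z = f w.
Proof.
move=> k0 fd h; apply: const_on_convex (@convex_H R) _ => z zH; have [l hl] := fd z zH.
have f0 : f z != 0 by apply: contraNneq k0 => E; rewrite -(h z zH) E expr0n.
have h' w : upper_half w -> f w ^+ 2 = 0 * w + k by move=> wH; rewrite h // mul0r add0r.
by have := cderiv_sqr_cst zH f0 hl h'; rewrite mul0r => E; rewrite E in hl.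
Qed.

(** The square alone determines the logarithmic derivative c / (2(cz + d)), whatever the branch. *)
Lemma mpl_deriv M phi k z : mpl M phi k -> upper_half z ->
  cderiv phi z (phi z * ((M 1 0)%:~R / (2 * jd M z))).
Proof.
move=> hm zH; have p0 := mpl_neq0 hm zH; have [dM k0 d h] := hm; have [l hl] := d z zH.
have j0 := jd_neq0 (lt0r_neq0 dM) zH.
have h' w : upper_half w -> phi w ^+ 2 = (k * (M 1 0)%:~R) * w + k * (M 1 1)%:~R.
  by move=> wH; rewrite h // /jd; ring.
have := cderiv_sqr_cst zH p0 hl h'; rewrite (_ : _ / _ = phi z * ((M 1 0)%:~R / (2 * jd M z))).
  by move=> <-.
have -> : phi z * ((M 1 0)%:~R / (2 * jd M z)) = phi z ^+ 2 * ((M 1 0)%:~R / (2 * jd M z)) / phi z.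
  by field; rewrite p0 j0.
by rewrite h //; field; rewrite p0 j0.
Qed.

Lemma mob_deriv M (z : C) : 0 < \det M -> upper_half z ->
  cderiv (mob M) z ((\det M)%:~R / jd M z ^+ 2).
Proof.
move=> dM zH; have j0 := jd_neq0 (lt0r_neq0 dM) zH.
have dlin (a b : int) : cderiv (fun w : C => a%:~R * w + b%:~R) z (a%:~R * 1 + 0).
  by apply: cderivD; [apply: cderivZ; apply: cderiv_id | apply: cderiv_cst].
have := cderivM (dlin (M 0 0) (M 0 1)) (cderivV (f := jd M) j0 (dlin (M 1 0) (M 1 1))).
rewrite det2 rmorphB !rmorphM /=; congr (cderiv _ _ _).
rewrite /jd; rewrite /jd in j0; field; exact: j0.
Qed.

Lemma mpl_mul A phi k M psi k' : mpl A phi k -> mpl M psi k' ->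
  mpl (A *m M) (fun z => phi (mob M z) * psi z) (k * k').
Proof.
move=> hA hM; have [dA k0 dphi sA] := hA; have [dM k0' dpsi sM] := hM; split.
- by rewrite det_mulmx mulr_gt0.
- by rewrite mulf_neq0.
- move=> z zH; have wH := mob_up dM zH; have [l1 h1] := dphi _ wH; have [l2 h2] := dpsi z zH.
  by eexists; apply: cderivM (cderiv_comp (g := mob M) h1 (mob_deriv dM zH)) h2.
- move=> z zH; have wH := mob_up dM zH; rewrite exprMn sA // sM // jdM; last exact: jd_neq0 (lt0r_neq0 dM) zH.
  by ring.
Qed.

Lemma mpl_star (A : 'M[int]_2) : Gamma0 4 A -> exists2 k : C, nm k = 1 & mpl A (theta_j A) k.
Proof.
move=> gA; have [dA _] := gA; have [k k2 h] := theta_j_sqr R gA.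
have k1 : nm (k%:~R : C) = 1.
  apply/eqP; rewrite -sqrp_eq1 ?nm_ge0 // nm_int -normrX -rmorphXn /= k2 normr1 //.
exists k%:~R => //; split; first by rewrite dA.
- by rewrite -nm_eq0 k1 oner_neq0.
- by move=> z zH; apply: theta_j_goodH => //; rewrite dA.
- by move=> z zH; rewrite h.
Qed.

Lemma mpl_cst (M : 'M[int]_2) (c : C) : 0 < \det M -> M 1 0 = 0 -> c != 0 ->
  mpl M (fun=> c) (c ^+ 2 / (M 1 1)%:~R).
Proof.
move=> dM c0 cn0; have d0 : (M 1 1)%:~R != 0 :> C.
  by rewrite intr_eq0; apply/eqP => d0; move: dM; rewrite det2 c0 d0 !mulr0 subrr ltxx.
split=> //.
- by rewrite mulf_neq0 ?invr_neq0 ?expf_neq0.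
- by move=> z _; exists 0; apply: cderiv_cst.
- by move=> z _; rewrite /jd c0 mul0r add0r divfK.
Qed.

Lemma lin_lower (c d : int) (z : C) (B Y : R) : 0 < Y -> `|Re z| <= B -> Y <= Im z ->
  let j := nm (c%:~R * z + d%:~R) in let L := Y^-1 + 1 + B / Y in
  [/\ 0 < L, `|c|%:~R * Im z <= j, `|c|%:~R <= L * j & `|d|%:~R <= L * j].
Proof.
move=> Y0 xB yY j L; have B0 : 0 <= B by apply: le_trans xB.
have j0 : 0 <= j by apply: nm_ge0.
have hI : `|c|%:~R * Im z <= j.
  have := nm_Im (c%:~R * z + d%:~R); rewrite ImD -!ofR_int Im_ofRM Im_ofR addr0 normrM.
  by rewrite (ger0_norm (le_trans (ltW Y0) yY)) intr_norm /j !ofR_int.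
have hR : `|c%:~R * Re z + d%:~R| <= j.
  by have := nm_Re (c%:~R * z + d%:~R); rewrite ReD -!ofR_int Re_ofRM Re_ofR /j !ofR_int.
have cj : `|c|%:~R <= Y^-1 * j.
  rewrite ler_pdivlMl // mulrC; apply: le_trans hI; exact: ler_wpM2l.
have BY : 0 <= B / Y by rewrite divr_ge0 // ltW.
have Yi : 0 < Y^-1 by rewrite invr_gt0.
split=> //.
- by rewrite /L -addrA ltr_pwDl // addr_ge0.
- by apply: le_trans cj _; apply: ler_wpM2r => //; rewrite /L -addrA lerDl addr_ge0.
have h : `|d|%:~R <= j + `|c|%:~R * B.
  rewrite !intr_norm; have -> : d%:~R = (c%:~R * Re z + d%:~R) - c%:~R * Re z :> R by ring.
  apply: (le_trans (ler_normB _ _)); apply: lerD => //; rewrite normrM.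
  exact: ler_wpM2l.
apply: (le_trans h).
have -> : L * j = j + (Y^-1 * j * B + Y^-1 * j) by rewrite /L; ring.
rewrite lerD2l; apply: (@le_trans _ _ (Y^-1 * j * B)); first exact: ler_wpM2r.
by rewrite lerDl mulr_ge0 // ltW.
Qed.

Lemma bottom_neq0 (M : 'M[int]_2) : 0 < \det M -> (M 1 0 != 0) || (M 1 1 != 0).
Proof.
move=> dM; rewrite -negb_and; apply/andP => -[/eqP c0 /eqP d0].
by move: dM; rewrite det2 c0 d0 !mulr0 subrr ltxx.
Qed.

Lemma jd_lower (M : 'M[int]_2) (z : C) (B Y : R) : 0 < \det M -> 0 < Y -> `|Re z| <= B -> Y <= Im z ->
  let L := Y^-1 + 1 + B / Y in
  [/\ 0 < L, 1 <= L * nm (jd M z), `|M 1 0|%:~R * Im z <= nm (jd M z) &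
     (quart R `|M 1%R 0%R|%N * quart R `|M 1%R 1%R|%N) ^+ 4 <= (L * nm (jd M z)) ^+ 2].
Proof.
move=> dM Y0 xB yY L; have [L0 h1 h2 h3] := lin_lower (M 1 0) (M 1 1) Y0 xB yY.
rewrite -/L -/(jd M z) in L0 h1 h2 h3.
have ge1 : 1 <= L * nm (jd M z).
  case/orP: (bottom_neq0 dM) => n0; [apply: le_trans h2|apply: le_trans h3];
  by rewrite ler1z -gtz0_ge1 normr_gt0.
split=> //; rewrite exprMn !quart4 expr2.
have m (n : int) : `|n|%:~R <= L * nm (jd M z) -> (maxn 1 `|n|%N)%:R <= L * nm (jd M z).
  by move=> h; rewrite /maxn; case: ifP => // _; rewrite natr_absz.
by apply: ler_pM => //; apply: m.
Qed.

Definition term (n : nat) (m : int) (M : 'M[int]_2) (psi : C -> C) (z : C) : C :=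
  psi z ^- n * e (m%:~R * mob M z).

(** The logarithmic derivative of [term]. It is rational in z and does not involve [psi], so it can
    be bounded for all lifts at once. *)
Definition trho (n : nat) (m : int) (M : 'M[int]_2) (z : C) : C :=
  - (n%:R * (M 1 0)%:~R / (2 * jd M z))
  + 2 * ofR pi * imagi R * m%:~R * (\det M)%:~R / jd M z ^+ 2.

Definition trho1 (n : nat) (m : int) (M : 'M[int]_2) (z : C) : C :=
  n%:R * (M 1 0)%:~R ^+ 2 / (2 * jd M z ^+ 2)
  - 4 * ofR pi * imagi R * m%:~R * (\det M)%:~R * (M 1 0)%:~R / jd M z ^+ 3.

Lemma jd_deriv (M : 'M[int]_2) (z : C) : cderiv (jd M) z (M 1 0)%:~R.
Proof.
have := cderivD (cderivZ (M 1 0)%:~R (cderiv_id z)) (cderiv_cst (M 1 1)%:~R z).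
by rewrite mulr1 addr0.
Qed.

Lemma term_deriv n m M psi k z : mpl M psi k -> upper_half z ->
  cderiv (term n m M psi) z (term n m M psi z * trho n m M z) /\
  cderiv (trho n m M) z (trho1 n m M z).
Proof.
move=> hm zH; have p0 := mpl_neq0 hm zH; have [dM k0 _ _] := hm.
have j0 := jd_neq0 (lt0r_neq0 dM) zH; have pn := expf_neq0 n p0.
split; last first.
  have h1 := cderivV j0 (jd_deriv M z).
  have h2 := cderivM h1 h1.
  have := cderivD (cderivN (cderivZ (n%:R * (M 1 0)%:~R / 2) h1))
    (cderivZ (2 * ofR pi * imagi R * m%:~R * (\det M)%:~R) h2).
  set l := (X in cderiv _ _ X); set f := (X in cderiv X _ _).
  have -> : f = trho n m M.
    apply/funext => w; rewrite /f /trho; congr (- _ + _).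
    by rewrite invfM; ring.
    by rewrite -invfM.
  have -> // : l = trho1 n m M z.
  by rewrite /l /trho1; field; rewrite j0.
have h1 := cderivV (f := fun w => psi w ^+ n) pn (cderivX n (mpl_deriv hm zH)).
have h2 := cderiv_comp (g := mob M) (cderiv_e m%:~R (mob M z)) (mob_deriv dM zH).
have := cderivM h1 h2; congr (cderiv _ _ _).
have -> : n%:R * (psi z * ((M 1 0)%:~R / (2 * jd M z))) * psi z ^+ n.-1
  = psi z ^+ n * (n%:R * ((M 1 0)%:~R / (2 * jd M z))).
  case: n {h1 pn} => [|n]; first by rewrite !mul0r mulr0.
  by rewrite exprS /=; ring.
rewrite /term /trho; move: (psi z ^+ n) pn (e _ : C) => q q0 E; field.
by rewrite q0 j0.
Qed.

(** Up to a constant, |psi| is at least the product of the fourth roots of the bottom entries. That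
    product is at least 1, so its power n may be lowered to 5. *)
Lemma lift_lower n M psi k (z : C) (B Y : R) : (5 <= n)%N -> mpl M psi k -> 0 < Y ->
  `|Re z| <= B -> Y <= Im z ->
  nm (psi z ^- n) <= Num.sqrt ((Y^-1 + 1 + B / Y) / nm k) ^+ n *
    (lat R `|M 1%R 0%R|%N * lat R `|M 1%R 1%R|%N).
Proof.
move=> n5 hm Y0 xB yY; have zH : upper_half z by apply: lt_le_trans yY.
have p0 := mpl_neq0 hm zH; have [dM k0 _ hs] := hm; set L := _ + B / Y.
have [L0 ge1 _ h4] := jd_lower dM Y0 xB yY; rewrite -/L in L0 ge1 h4.
have nk : 0 < nm k by rewrite nm_gt0.
set G := Num.sqrt _; have G2 : G ^+ 2 = L / nm k by rewrite sqr_sqrtr // divr_ge0 ?ltW.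
have G0 : 0 < G by rewrite sqrtr_gt0 divr_gt0.
have P0 : 0 < nm (psi z) by rewrite nm_gt0.
have Psq : nm (psi z) ^+ 2 = nm k * nm (jd M z) by rewrite -nmX hs // nmM.
set q1 := quart R `|M 1%R 0%R|%N in h4 *; set q2 := quart R `|M 1%R 1%R|%N in h4 *.
have q10 : 0 < q1 by apply: quart_gt0.
have q20 : 0 < q2 by apply: quart_gt0.
have q0 : 0 < q1 * q2 by rewrite mulr_gt0.
have q1' : 1 <= q1 * q2 by rewrite -[1]mulr1; apply: ler_pM => //; apply: quart_ge1.
have qle : q1 * q2 <= G * nm (psi z).
  rewrite -(ler_pXn2r (_ : 0 < 4)%N) ?nnegrE ?(ltW q0) ?mulr_ge0 ?(ltW G0) ?(ltW P0) //.
  apply: (le_trans h4); rewrite [leRHS]exprMn (exprM G 2 2) (exprM (nm _) 2 2) G2 Psq -exprMn.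
  by rewrite mulrA divfK // gt_eqF.
rewrite nmV nmX -exprVn; apply: (@le_trans _ _ ((G / (q1 * q2)) ^+ n)).
  rewrite ler_pXn2r ?nnegrE ?invr_ge0 ?(ltW P0) ?divr_ge0 ?(ltW G0) ?(ltW q0) //; last by apply: leq_trans n5.
  by rewrite ler_pdivlMr // mulrC ler_pdivrMr.
rewrite expr_div_n; apply: ler_wpM2l; first by rewrite exprn_ge0 // ltW.
rewrite /lat -/q1 -/q2 -invfM -exprMn lef_pV2 ?posrE ?exprn_gt0 //.
by apply: ler_weXn2l.
Qed.

Lemma nm_e_le (m : int) (w : C) (X : R) : 0 <= Im w -> Im w <= X ->
  nm (e (m%:~R * w)) <= expR (2 * pi * `|m%:~R| * X).
Proof.
move=> w0 wX; rewrite nm_e ler_expR -ofR_int Im_ofRM -mulrN -mulrA.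
rewrite -!(mulrA 2) ler_pM2l ?ltr0n // ler_pM2l ?pi_gt0 // -mulNr.
apply: le_trans (_ : `|m%:~R| * Im w <= _); last exact: ler_wpM2l.
by apply: ler_wpM2r => //; rewrite -normrN ler_norm.
Qed.

(** The constant depends on M only through its determinant and on the lift only through |k|, hence
    is common to all cosets; the two [lat] factors carry the rest. *)
Lemma term_good (n : nat) (m D : int) (k0 B y1 y2 : R) : (5 <= n)%N -> 0 < k0 -> 0 < y1 -> 0 <= B ->
  exists2 K : R, 0 <= K & forall M psi k, mpl M psi k -> \det M = D -> nm k = k0 ->
    good (box B y1 y2) (term n m M psi) (fun z => term n m M psi z * trho n m M z)
      (K * (lat R `|M 1%R 0%R|%N * lat R `|M 1%R 1%R|%N)).
Proof.
move=> n5 k00 y10 B0; set L := y1^-1 + 1 + B / y1.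
set G := Num.sqrt (L / k0); have G0 : 0 <= G by apply: sqrtr_ge0.
have L0 : 0 <= L by rewrite !addr_ge0 ?divr_ge0 ?invr_ge0 // ltW.
set X := `|D%:~R| * `|y2| * L ^+ 2.
set E := expR (2 * pi * `|m%:~R| * X).
set r := n%:R / y1 + 2 * pi * `|m%:~R| * `|D%:~R| * L ^+ 2.
set r' := n%:R / y1 ^+ 2 + 4 * pi * `|m%:~R| * `|D%:~R| * (L ^+ 2 / y1).
have pi0 : 0 <= pi :> R by apply: pi_ge0.
have r0 : 0 <= r by rewrite /r addr_ge0 ?divr_ge0 ?mulr_ge0 ?exprn_ge0 // ltW.
have r0' : 0 <= r'.
  apply: addr_ge0; first by rewrite divr_ge0 ?exprn_ge0 // ltW.
  by rewrite !mulr_ge0 ?exprn_ge0 // invr_ge0 ltW.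
exists (G ^+ n * E * (1 + r + 4 * (r ^+ 2 + r'))).
  apply: mulr_ge0; first by rewrite mulr_ge0 ?exprn_ge0 ?expR_ge0.
  by have r2 : 0 <= r ^+ 2 := exprn_ge0 2 r0; lra.
move=> M psi k hm dM nk; have [dM0 kn0 _ hs] := hm.
set l := _ * lat R _; have l0 : 0 <= l by rewrite mulr_ge0 ?lat_ge0.
rewrite [X in good _ _ _ X](_ : _ = (G ^+ n * E * l) * (1 + r + 4 * (r ^+ 2 + r'))); last by ring.
apply: (good_rho (rho1 := trho1 n m M)) => //; first exact: convex_box.
  by apply: mulr_ge0 => //; rewrite mulr_ge0 ?exprn_ge0 ?expR_ge0.
move=> z [xB /andP[yz zy]]; have zH : upper_half z by apply: lt_le_trans yz.
have [d1 d2] := term_deriv n m hm zH.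
have [Lp ge1 hI _] := jd_lower dM0 y10 xB yz; rewrite -/L in Lp ge1.
have j0 : 0 < nm (jd M z) by rewrite nm_gt0 jd_neq0 // gt_eqF.
set Ji := (nm (jd M z))^-1; have Ji0 : 0 < Ji by rewrite invr_gt0.
have JiL : Ji <= L by rewrite /Ji -[leLHS]mul1r ler_pdivrMr.
have cJ : `|M 1 0|%:~R * Ji <= y1^-1.
  rewrite /Ji ler_pdivrMr // ler_pdivlMl // mulrC; apply: le_trans hI.
  by apply: ler_wpM2l => //; rewrite ler0z.
have c0 : 0 <= `|M 1 0|%:~R * Ji by rewrite mulr_ge0 ?ler0z // ltW.
have JiL2 : Ji ^+ 2 <= L ^+ 2 by rewrite ler_pXn2r ?nnegrE // ltW.
have pn : nm (ofR pi : C) = pi by rewrite nm_ofR ger0_norm.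
split=> //.
- rewrite /term nmM [leRHS]mulrAC; apply: ler_pM; rewrite ?nm_ge0 //.
    by rewrite /G -nk; apply: (lift_lower n5 hm y10 xB yz).
  have wH := mob_up dM0 zH; apply: nm_e_le; first exact: ltW wH.
  rewrite Im_mob ?(gt_eqF dM0) // dM -exprVn; apply: ler_pM => //.
  - by rewrite mulr_ge0 ?(ltW zH) // ler0z -dM ltW.
  - by rewrite exprn_ge0 // ltW.
  apply: ler_pM; rewrite ?(ltW zH) // ?ler_norm // ?ler0z -?dM ?(ltW dM0) //.
  exact: le_trans zy (ler_norm _).
- apply: (le_trans (nmD _ _)); rewrite nmN; apply: lerD.
    rewrite !(nmM, nmV) !nm_nat nm_int -intr_norm invfM -/Ji.
    have -> : n%:R * `|M 1 0|%:~R * (2^-1 * Ji) = n%:R * ((`|M 1 0|%:~R * Ji) / 2) by ring.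
    by apply: ler_wpM2l => //; lra.
  rewrite !(nmM, nmV, nmX) nm_nat nm_i pn !nm_int mulr1 dM -exprVn -/Ji.
  by apply: ler_wpM2l => //; rewrite !mulr_ge0.
- apply: (le_trans (nmD _ _)); rewrite nmN; apply: lerD.
    rewrite !(nmM, nmV, nmX) !nm_nat nm_int -intr_norm invfM -exprVn -/Ji -mulrA.
    apply: ler_wpM2l => //.
    rewrite (_ : _ * (2^-1 * _) = (`|M 1 0|%:~R * Ji) ^+ 2 / 2); last by ring.
    rewrite -exprVn.
    have h : (`|M 1 0|%:~R * Ji) ^+ 2 <= y1^-1 ^+ 2 by rewrite ler_pXn2r ?nnegrE // invr_ge0 ltW.
    have : 0 <= (`|M 1 0|%:~R * Ji) ^+ 2 by apply: exprn_ge0.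
    by lra.
  rewrite !(nmM, nmV, nmX) nm_nat nm_i pn !nm_int mulr1 dM -exprVn -/Ji; rewrite intr_norm in cJ c0.
  rewrite -[leLHS]mulrA; apply: ler_wpM2l; first by rewrite !mulr_ge0.
  rewrite (_ : _ * Ji ^+ 3 = Ji ^+ 2 * (`|(M 1 0)%:~R| * Ji)); last by ring.
  by apply: ler_pM => //; rewrite exprn_ge0 // ltW.
Qed.

End Lifts.

(** * Cosets and bottom rows *)

Section BottomRow.

(** The concrete form of equality of cosets of [Gamma_infty]; the sign u accounts for the matrices
    -T. *)
Definition same_bottom (A A' : 'M[int]_2) :=
  exists2 u : int, u * u = 1 & A' 1 0 = u * A 1 0 /\ A' 1 1 = u * A 1 1.

Lemma same_bottom_sym A A' : same_bottom A A' -> same_bottom A' A.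
Proof. by move=> [u u2 [h1 h2]]; exists u => //; rewrite h1 h2 !mulrA u2 !mul1r. Qed.

Lemma same_bottom_trans A B D : same_bottom A B -> same_bottom B D -> same_bottom A D.
Proof.
move=> [u u2 [h1 h2]] [v v2 [h3 h4]]; exists (v * u).
  by rewrite mulrACA u2 v2.
by rewrite h3 h1 h4 h2 !mulrA.
Qed.

Lemma int_sqr1 (u : int) : u * u = 1 -> u = 1 \/ u = -1.
Proof. by move=> h; have := eqf_sqr u 1; rewrite expr2 h expr1n eqxx => /esym/orP[]/eqP; [left|right]. Qed.

Lemma mulmx_adj2 (A A' : 'M[int]_2) : let T := A' *m inv2x2 A in
  T 1 0 = A' 1 0 * A 1 1 - A' 1 1 * A 1 0 /\ T 1 1 = A' 1 1 * A 0 0 - A' 1 0 * A 0 1.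
Proof.
have [a b c d] := mx2E (A 1 1) (- A 0 1) (- A 1 0) (A 0 0).
by rewrite /= !mulmx2 /inv2x2 a b c d; split; ring.
Qed.

Lemma inv2x2_det (A : 'M[int]_2) : \det (inv2x2 A) = \det A.
Proof.
have [a b c d] := mx2E (A 1 1) (- A 0 1) (- A 1 0) (A 0 0).
by rewrite !det2 /inv2x2 a b c d; ring.
Qed.

Lemma mulmx_inv2x2_r (A : 'M[int]_2) : \det A = 1 -> A *m inv2x2 A = 1%:M.
Proof.
rewrite det2 => dA; have [a b c d] := mx2E (A 1 1) (- A 0 1) (- A 1 0) (A 0 0).
by apply: mx2_eq; rewrite mulmx2 /inv2x2 ?a ?b ?c ?d mxE /= -?dA; ring.
Qed.

Lemma upper_unit (T : 'M[int]_2) : \det T = 1 -> T 1 0 = 0 ->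
  T 1 1 * T 1 1 = 1 /\ Gamma_infty T.
Proof.
move=> dT c0; move: dT; rewrite det2 c0 mulr0 subr0 => ad.
have [e1 u2] := int_mul1 ad; split=> //.
have [a b c d] := mx2E 1 (T 0 1) 0 (1 : int).
have [a' b' c' d'] := mx2E 1 (- T 0 1) 0 (1 : int).
have [E|E] := int_sqr1 u2; rewrite E in e1.
  by exists (T 0 1); left; apply: mx2_eq; rewrite ?a ?b ?c ?d.
by exists (- T 0 1); right; apply: mx2_eq; rewrite mxE ?a' ?b' ?c' ?d' ?opprK ?oppr0.
Qed.

Lemma opp2E (A : 'M[int]_2) (i j : 'I_2) : (- A) i j = - A i j.
Proof. by rewrite mxE. Qed.

Lemma same_bottomP A A' : \det A = 1 -> \det A' = 1 ->
  same_bottom A A' <-> exists2 T, Gamma_infty T & A' = T *m A.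
Proof.
move=> dA dA'; split; last first.
  move=> [T [n hT] ->]; have [a b c d] := mx2E 1 n 0 (1 : int).
  case: hT => ->; [exists 1|exists (-1)] => //; rewrite !mulmx2 ?opp2E c d; split; ring.
move=> [u u2 [h1 h2]]; have [t0 t1] := mulmx_adj2 A A'.
exists (A' *m inv2x2 A); last by rewrite mulmx_inv2x2.
apply: (upper_unit _ _).2; first by rewrite det_mulmx inv2x2_det dA dA'.
by rewrite t0 h1 h2; ring.
Qed.

(** Two rows annihilating the same non-zero column are proportional, and rows of determinant 1
    matrices are primitive. This is why at most one coset is exceptional at a given cusp. *)
Lemma same_bottom_col A A' (x y : int) : \det A = 1 -> \det A' = 1 -> (x != 0) || (y != 0) ->
  A 1 0 * x + A 1 1 * y = 0 -> A' 1 0 * x + A' 1 1 * y = 0 -> same_bottom A A'.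
Proof.
move=> dA dA' xy h1 h2; have [t0 t1] := mulmx_adj2 A A'.
have cr : A' 1 0 * A 1 1 - A' 1 1 * A 1 0 = 0.
  have e1 : (A' 1 0 * A 1 1 - A' 1 1 * A 1 0) * x = 0.
    have -> : (A' 1 0 * A 1 1 - A' 1 1 * A 1 0) * x =
      A 1 1 * (A' 1 0 * x + A' 1 1 * y) - A' 1 1 * (A 1 0 * x + A 1 1 * y) by ring.
    by rewrite h1 h2 !mulr0 subrr.
  have e2 : (A' 1 0 * A 1 1 - A' 1 1 * A 1 0) * y = 0.
    have -> : (A' 1 0 * A 1 1 - A' 1 1 * A 1 0) * y =
      A' 1 0 * (A 1 0 * x + A 1 1 * y) - A 1 0 * (A' 1 0 * x + A' 1 1 * y) by ring.
    by rewrite h1 h2 !mulr0 subrr.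
  by case/orP: xy => n0; [move: e1|move: e2] => /eqP; rewrite mulf_eq0 (negbTE n0) orbF => /eqP.
have dT : \det (A' *m inv2x2 A) = 1 by rewrite det_mulmx inv2x2_det dA dA'.
have [|_ gT] := upper_unit dT; first by rewrite t0.
by apply/same_bottomP => //; eexists; [exact: gT|rewrite mulmx_inv2x2].
Qed.

Lemma Gamma_infty_det T : Gamma_infty T -> \det T = 1.
Proof.
move=> [n hT]; have [a b c d] := mx2E 1 n 0 (1 : int).
by case: hT => ->; rewrite det2 ?opp2E a b c d; ring.
Qed.

Section Cosets.
Variable N : nat.

Definition rep (K : cosets N) : 'M[int]_2 := xget 1%:M (val K).

Lemma repP (K : cosets N) : exists2 A, Gamma0 N A &
  val K = [set T *m A | T in Gamma_infty]%classic /\ same_bottom A (rep K) /\ Gamma0 N (rep K).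
Proof.
have [A gA E] := set_valP K; exists A => //; split; first by rewrite E.
have : (val K) (rep K).
  apply: xgetPex; exists A; rewrite -E; exists 1%:M; last by rewrite mul1mx.
  exists 0; left; have [a b c d] := mx2E 1 0 0 (1 : int).
  by apply: mx2_eq; rewrite !mxE ?a ?b ?c ?d.
rewrite -E => -[T gT <-]; have [dA hA] := gA; have dT := Gamma_infty_det gT.
have dTA : \det (T *m A) = 1 by rewrite det_mulmx dT dA.
have sb : same_bottom A (T *m A) by apply/same_bottomP => //; exists T.
split=> //; split=> //; have [u _ [-> _]] := sb; exact: dvdz_mull.
Qed.

Lemma rep_Gamma0 (K : cosets N) : Gamma0 N (rep K).
Proof. by have [A _ [_ [_]]] := repP K. Qed.

Lemma rep_det (K : cosets N) : \det (rep K) = 1.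
Proof. by case: (rep_Gamma0 K). Qed.

Lemma coset_eq (A B : 'M[int]_2) : \det A = 1 -> \det B = 1 -> same_bottom A B ->
  [set T *m A | T in Gamma_infty]%classic = [set T *m B | T in Gamma_infty]%classic.
Proof.
have sub (A' B' : 'M[int]_2) : \det A' = 1 -> \det B' = 1 -> same_bottom A' B' ->
    ([set T *m A' | T in Gamma_infty] `<=` [set T *m B' | T in Gamma_infty])%classic.
  move=> dA dB sb D [T gT <-]; have dT := Gamma_infty_det gT.
  have dTA : \det (T *m A') = 1 by rewrite det_mulmx dT dA.
  have : same_bottom B' (T *m A').
    by apply: same_bottom_trans (same_bottom_sym sb) _; apply/same_bottomP => //; exists T.
  by move=> /same_bottomP[] // T' gT' E; exists T'.
by move=> dA dB sb; apply/seteqP; split; apply: sub => //; apply: same_bottom_sym.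
Qed.

Lemma rep_inj (K K' : cosets N) : same_bottom (rep K) (rep K') -> K = K'.
Proof.
move=> sb; have [A [dA _] [EA [sA _]]] := repP K; have [B [dB _] [EB [sB _]]] := repP K'.
apply: val_inj; rewrite EA EB; apply: coset_eq => //.
by apply: same_bottom_trans sA (same_bottom_trans sb (same_bottom_sym sB)).
Qed.

Lemma rep_ex (A : 'M[int]_2) : Gamma0 N A -> exists K : cosets N, same_bottom A (rep K).
Proof.
move=> gA; have hK : ([set T *m A | T in Gamma_infty]%classic) \in cosets N.
  by apply: mem_set; exists A.
exists (SigSub hK); have [B [dB _] [EB [sB _]]] := repP (SigSub hK).
apply: same_bottom_trans sB; have [dA _] := gA; apply/same_bottomP => //.
have /= : (val (SigSub hK)) B.
  rewrite EB; exists 1%:M; last by rewrite mul1mx.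
  exists 0; left; have [a b c d] := mx2E 1 0 0 (1 : int).
  by apply: mx2_eq; rewrite !mxE ?a ?b ?c ?d.
by move=> [T gT <-]; exists T.
Qed.

End Cosets.
End BottomRow.

(** * The coset sum and its behaviour at large height *)

Section PoincareSeries.
Variable R : realType.
Local Notation C := (CC R).
Variables (p s : nat) (m : int).
Local Notation N := (4 * p)%N.
Local Notation n := (2 * s + 1)%N.
Hypothesis s2 : (2 <= s)%N.

Lemma n_ge5 : (5 <= n)%N. Proof. by lia. Qed.

Lemma n_ge2 : (2 <= n)%N. Proof. by lia. Qed.

Lemma mob_Ginf (T : 'M[int]_2) : Gamma_infty T -> exists k : int, forall z : C, mob T z = z + k%:~R.
Proof.
move=> [k hT]; exists k => z; have [a b c d] := mx2E 1 k 0 (1 : int).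
case: hT => ->; rewrite /mob /jd ?opp2E a b c d ?oppr0 mul0r add0r ?rmorphN /= ?divr1 ?mul1r //.
by rewrite invrN1 mulrN1 mulN1r opprD !opprK.
Qed.

Lemma term_same_bottom (A A' : 'M[int]_2) (z : C) : \det A = 1 -> \det A' = 1 ->
  same_bottom A A' -> upper_half z ->
  term n m A (theta_j A) z = term n m A' (theta_j A') z.
Proof.
move=> dA dA' sb zH; have [T gT ->] := (same_bottomP dA dA').1 sb; have [k hk] := mob_Ginf gT.
have wH : upper_half (mob A z) by apply: mob_up; rewrite ?dA.
have E : mob (T *m A) z = mob A z + k%:~R by rewrite mobM ?hk ?(Gamma_infty_det gT) ?dA.
rewrite /term !theta_jE E theta_int // mulrDr.
by rewrite -[in RHS]rmorphM /= e_addint.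
Qed.

Section Part.
Variables (M : 'M[int]_2) (phi : C -> C) (k0 : C).
Hypothesis hM : mpl M phi k0.

Definition part_term (K : cosets N) (z : C) : C :=
  term n m (rep K *m M) (fun w => theta_j (rep K) (mob M w) * phi w) z.

Lemma det_M : 0 < \det M. Proof. by case: hM. Qed.

Lemma part_mpl (K : cosets N) : exists2 k, nm k = nm k0 &
  mpl (rep K *m M) (fun w => theta_j (rep K) (mob M w) * phi w) k.
Proof.
have [k1 nk1 hA] := mpl_star R (gamma_4p4 (rep_Gamma0 K)).
by exists (k1 * k0); [rewrite nmM nk1 mul1r|apply: mpl_mul].
Qed.

Lemma part_termE (K : cosets N) (z : C) : upper_half z ->
  part_term K z = phi z ^- n * term n m (rep K) (theta_j (rep K)) (mob M z).
Proof.
move=> zH; rewrite /part_term /term mobM ?rep_det ?det_M // exprMn invfM.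
by rewrite [_^-1 * _^-1]mulrC mulrA.
Qed.

(** M is invertible over the rationals, so the bottom row of the product still determines the coset;
    this makes the lattice sum a majorant at every cusp. *)
Lemma part_inj : injective (fun K : cosets N => ((rep K *m M) 1 0, (rep K *m M) 1 1)).
Proof.
move=> K K' [] h1 h2; apply: rep_inj; exists 1 => //; rewrite !mul1r.
have hm (i j : 'I_2) : (rep K *m M *m inv2x2 M) i j = \det M * rep K i j /\
    (rep K' *m M *m inv2x2 M) i j = \det M * rep K' i j.
  have E : M *m inv2x2 M = (\det M)%:M.
    have [a b c d] := mx2E (M 1 1) (- M 0 1) (- M 1 0) (M 0 0).
    by apply: mx2_eq; rewrite mulmx2 /inv2x2 ?a ?b ?c ?d mxE /= det2; ring.
  by rewrite -!mulmxA E !mul_mx_scalar !mxE.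
have dM : \det M != 0 by rewrite gt_eqF // det_M.
split; apply: (mulfI dM).
  by have [<- <-] := hm 1 0; rewrite !(mulmx2 _ (inv2x2 M)) h1 h2.
by have [<- <-] := hm 1 1; rewrite !(mulmx2 _ (inv2x2 M)) h1 h2.
Qed.

Lemma part_sumb (c : R) : 0 <= c -> sumb (fun K : cosets N =>
  c * (lat R `|(rep K *m M) 1%R 0%R|%N * lat R `|(rep K *m M) 1%R 1%R|%N)) (c * (12 * 12)).
Proof.
move=> c0; apply: sumbZ => //.
by apply: (sumb_inj part_inj _ (sumb_lat R)) => K /=.
Qed.

Lemma part_good (B y1 y2 : R) : 0 < y1 -> 0 <= B -> exists2 c : R, 0 <= c &
  forall K, good (box B y1 y2) (part_term K) (fun z => part_term K z * trho n m (rep K *m M) z)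
    (c * (lat R `|(rep K *m M) 1%R 0%R|%N * lat R `|(rep K *m M) 1%R 1%R|%N)).
Proof.
move=> y10 B0; have k00 : 0 < nm k0 by rewrite nm_gt0; case: hM.
have [c c0 h] := @term_good R n m (\det M) (nm k0) B y1 y2 n_ge5 k00 y10 B0.
exists c => // K; have [k nk hk] := part_mpl K; apply: (h _ _ k hk) => //.
by rewrite det_mulmx rep_det mul1r.
Qed.

Lemma part_summable (z : C) : upper_half z ->
  has_sum (fun K => part_term K z) (summability.sum (fun K => part_term K z)).
Proof.
move=> zH; have [c c0 h] := part_good (Im z) zH (normr_ge0 (Re z)).
apply: (sum_has_sum _ (part_sumb c0)) => K; have [_ hb _ _] := h K.
by apply: hb; split; rewrite ?lexx.
Qed.

End Part.

Lemma mpl_id : mpl 1%:M (fun=> 1 : C) 1.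
Proof.
have := @mpl_cst R 1%:M 1; rewrite det1 !mxE /= expr1n divr1; apply => //; exact: oner_neq0.
Qed.

Lemma mob1 (z : C) : mob 1%:M z = z.
Proof. by rewrite /mob /jd !mxE /= mul0r add0r divr1 mul1r addr0. Qed.

Lemma Fcal_has_sum (z : C) : upper_half z ->
  has_sum (fun K : cosets N => term n m (rep K) (theta_j (rep K)) z) (Fcal p s m z).
Proof.
move=> zH; have := part_summable mpl_id zH.
have E : (fun K => part_term 1%:M (fun=> 1) K z) =
    (fun K : cosets N => term n m (rep K) (theta_j (rep K)) z).
  by apply/funext => K; rewrite (part_termE mpl_id) // expr1n invr1 mul1r mob1.
rewrite E /Fcal; congr (has_sum _ (summability.sum _)).
by apply/funext => K; rewrite /slash /star /= mobius_mxQ.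
Qed.

Definition part (M : 'M[int]_2) (phi f : C -> C) (z : C) : C := phi z ^- n * f (mob M z).

Section Part2.
Variables (M : 'M[int]_2) (phi : C -> C) (k0 : C).
Hypothesis hM : mpl M phi k0.

Lemma part_has_sum (z : C) : upper_half z ->
  has_sum (fun K => part_term M phi K z) (part M phi (Fcal p s m) z).
Proof.
move=> zH; have wH := mob_up (det_M hM) zH.
apply: (eq_has_sum _ (has_sumZ (c := phi z ^- n) (Fcal_has_sum wH))) => K.
by rewrite (part_termE hM).
Qed.

Lemma part_goodH : goodH (part M phi (Fcal p s m)).
Proof.
move=> B y1 y2 y10; have [c c0 h] := part_good hM y2 y10 (normr_ge0 B).
eexists; eexists; apply: good_sub (good_series h (part_sumb hM c0) _).
  by move=> z [zB zy]; split=> //; apply: le_trans zB (ler_norm _).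
by move=> z [_ /andP[yz _]]; apply: part_has_sum; apply: lt_le_trans yz.
Qed.

(** Agreement up to o(1) as Im z tends to infinity, uniformly only for bounded Re z; periodicity
    removes this restriction later. *)
Definition approx (g P : C -> C) := forall B eps : R, 0 < eps ->
  exists2 Y : R, 0 < Y & forall z : C, `|Re z| <= B -> Y <= Im z -> nm (g z - P z) <= eps.

(** The two inputs of [tannery]: a summable majorant for Im z >= 1, and decay like 1/Im z of each
    term separately. *)
Lemma term_small (K : cosets N) (z : C) (B : R) :
  (rep K *m M) 1 0 != 0 -> 1 <= Im z ->
  `|Re z| <= B ->
  nm (part_term M phi K z) <= expR (2 * pi * `|m%:~R| * (\det M)%:~R) *
    Num.sqrt ((1 + 1 + B) / nm k0) ^+ n *
    (lat R `|(rep K *m M) 1%R 0%R|%N * lat R `|(rep K *m M) 1%R 1%R|%N) /\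
  (1 <= nm k0 * Im z ->
   nm (part_term M phi K z) <= expR (2 * pi * `|m%:~R| * (\det M)%:~R) / (nm k0 * Im z)).
Proof.
move=> c0 y1 xB; have y0 : 0 < Im z by apply: lt_le_trans y1.
have zH : upper_half z by []. have [k nk hk] := part_mpl hM K; have [dK k1 _ hs] := hk.
have kk : 0 < nm k by rewrite nm_gt0.
have dKE : \det (rep K *m M) = \det M by rewrite det_mulmx rep_det mul1r.
have [_ _ hI _] := jd_lower dK (@ltr01 R) xB y1.
have c1 : 1 <= `|(rep K *m M) 1 0|%:~R :> R by rewrite ler1z -gtz0_ge1 normr_gt0.
have jy : Im z <= nm (jd (rep K *m M) z).
  by apply: le_trans hI; rewrite ler_peMl // ltW.
have j0 : 0 < nm (jd (rep K *m M) z) by apply: lt_le_trans jy.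
have dM0 : 0 <= (\det M)%:~R :> R by rewrite ler0z ltW // (det_M hM).
have eb : nm (e (m%:~R * mob (rep K *m M) z)) <= expR (2 * pi * `|m%:~R| * (\det M)%:~R).
  apply: nm_e_le; first exact: ltW (mob_up dK zH).
  rewrite Im_mob ?gt_eqF // dKE ler_pdivrMr ?exprn_gt0 // ler_wpM2l //.
  by apply: (le_trans jy); rewrite expr2 ler_peMl ?(ltW j0) //; apply: le_trans jy.
have E0 : 0 <= expR (2 * pi * `|m%:~R| * (\det M)%:~R) :> R by apply: expR_ge0.
have p0 := mpl_neq0 hk zH; split.
  rewrite /part_term /term nmM mulrC -[leRHS]mulrA; apply: ler_pM; rewrite ?nm_ge0 //.
  have := lift_lower n_ge5 hk (@ltr01 R) xB y1; by rewrite nk invr1 mulr1.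
move=> ky; rewrite /part_term /term nmM mulrC; apply: ler_pM; rewrite ?nm_ge0 //.
rewrite nmV nmX lef_pV2 ?posrE ?exprn_gt0 ?nm_gt0 //; last by rewrite mulr_gt0 // -nk.
have sq : nm k0 * Im z <= nm (theta_j (rep K) (mob M z) * phi z) ^+ 2.
  by rewrite -nmX hs // nmM nk ler_wpM2l // nm_ge0.
have ge1 : 1 <= nm (theta_j (rep K) (mob M z) * phi z).
  by rewrite -(@expr_ge1 _ 2) ?nm_ge0 //; apply: le_trans sq.
apply: (le_trans sq); move: (nm _) ge1 => P ge1.
exact: ler_weXn2l ge1 _ _ n_ge2.
Qed.

Lemma part_approx (J : {fset cosets N}) :
  (forall K, K \notin J -> (rep K *m M) 1 0 != 0) ->
  approx (part M phi (Fcal p s m)) (fun z => \sum_(K <- J) part_term M phi K z).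
Proof.
move=> hJ B eps eps0.
(* The filter of points tending to infinity upwards inside the vertical strip |Re z| <= B. *)
pose F : set_system C := [set P | exists2 Y : R, 1 <= Y & forall z : C, `|Re z| <= B -> Y <= Im z -> P z]%classic.
have FF : Filter F.
  split.
  - by exists 1.
  - move=> P Q [Y1 h1 H1] [Y2 h2 H2]; exists (Num.max Y1 Y2); first by rewrite le_max h1.
    by move=> z zB; rewrite ge_max => /andP[l1 l2]; split; [apply: H1|apply: H2].
  - by move=> P Q PQ [Y h1 H1]; exists Y => // z zB zY; apply: PQ; apply: H1.
have kk : 0 < nm k0 by rewrite nm_gt0; case: hM.
set E := expR (2 * pi * `|m%:~R| * (\det M)%:~R) : R.
have E0 : 0 < E by apply: expR_gt0.
set c := E * Num.sqrt ((1 + 1 + B) / nm k0) ^+ n.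
have c0 : 0 <= c by rewrite mulr_ge0 ?(ltW E0) // exprn_ge0 // sqrtr_ge0.
have cl (K : cosets N) : 0 <= c * (lat R `|(rep K *m M) 1%R 0%R|%N * lat R `|(rep K *m M) 1%R 1%R|%N).
  by apply: mulr_ge0 => //; apply: mulr_ge0; apply: lat_ge0.
pose x (z : C) (K : cosets N) := if K \in J then 0 else part_term M phi K z.
have [Y Y1 H] : \forall z \near F,
   nm ((part M phi (Fcal p s m) z - \sum_(K <- J) part_term M phi K z) - 0) <= eps.
  apply: (@tannery R C F FF _ _ _ x (fun z => part M phi (Fcal p s m) z
      - \sum_(K <- J) part_term M phi K z) (fun=> 0) 0 (part_sumb hM c0)) => //.
  - exists 1 => // z zB zY K; rewrite /x; case: ifP => KJ.
      by rewrite nm0; apply: cl.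
    by have [] := term_small (hJ K (negbT KJ)) zY zB.
  - exists 1 => // z zB zY; have zH : upper_half z by apply: lt_le_trans zY.
    have h2 := has_sum_fin (x := fun K => if K \in J then part_term M phi K z else 0) (J := J).
    have {h2} := has_sumB (part_has_sum zH) (h2 _).
    rewrite (eq_big_seq (fun K => part_term M phi K z)) => [h|K ->//].
    apply: (eq_has_sum _ (h _)) => [K|K /negbTE -> //].
    by rewrite /x; case: ifP; rewrite ?subrr ?subr0.
  - by move=> K; rewrite nm0; apply: cl.
  - exact: has_sum0.
  - move=> K e1 e10; exists (Num.max 1 (Num.max (nm k0)^-1 (E / (nm k0 * e1)))).
      by rewrite le_max lexx.
    move=> z zB; rewrite !ge_max => /and3P[z1 z2 z3]; rewrite /x subr0; case: ifP => KJ.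
      by rewrite nm0 ltW.
    have [_ h] := term_small (hJ K (negbT KJ)) z1 zB; apply: le_trans (h _) _.
      by rewrite mulrC -ler_pdivrMr // div1r.
    rewrite ler_pdivrMr; last by rewrite mulr_gt0 //; apply: lt_le_trans z1.
    by move: z3; rewrite ler_pdivrMr ?mulr_gt0 // (mulrC e1) mulrCA mulrA.
exists Y; first by apply: lt_le_trans Y1.
by move=> z zB zY; have := H z zB zY; rewrite subr0.
Qed.

Lemma part_approx0 : (forall A, Gamma0 N A -> (A *m M) 1 0 != 0) ->
  approx (part M phi (Fcal p s m)) (fun=> 0).
Proof.
move=> h; have := @part_approx fset0 (fun K _ => h _ (rep_Gamma0 K)).
by move=> H B eps e0; have [Y Y0 hY] := H B eps e0; exists Y => // z zB zY; have := hY z zB zY; rewrite big_seq_fset0.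
Qed.

(** By [same_bottom_col] the coset of A is the only exceptional one, so a single term survives; it
    may be written with A itself instead of the chosen representative. *)
Lemma part_approx1 (A : 'M[int]_2) : Gamma0 N A -> (A *m M) 1 0 = 0 ->
  approx (part M phi (Fcal p s m)) (fun z => phi z ^- n * term n m A (theta_j A) (mob M z)).
Proof.
move=> gA h; have [K sK] := rep_ex gA; have [dA _] := gA.
have rK : (rep K *m M) 1 0 = 0.
  by have [u _ [e1 e2]] := sK; rewrite mulmx2 e1 e2 -!mulrA -mulrDr -mulmx2 h mulr0.
have hK K' : K' \notin [fset K]%fset -> (rep K' *m M) 1 0 != 0.
  rewrite inE; apply: contraNneq => rK'; apply/eqP; apply: rep_inj.
  apply: (@same_bottom_col _ _ (M 0 0) (M 1 0)); rewrite ?rep_det -?mulmx2 //.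
  rewrite -negb_and; apply/andP => -[/eqP a0 /eqP c0].
  by have := det_M hM; rewrite det2 a0 c0 mul0r mulr0 subrr ltxx.
have H := part_approx hK; move=> B eps e0; have [Y Y0 hY] := H B eps e0.
exists Y => // z zB zY; have zH : upper_half z by apply: lt_le_trans zY.
have := hY z zB zY; rewrite big_seq_fset1 (part_termE hM _ zH).
by rewrite (term_same_bottom dA (rep_det K) sK (mob_up (det_M hM) zH)).
Qed.

End Part2.

Lemma Fcal_invariant : invariant_form p s (@Fcal R p s m).
Proof.
move=> A gA z zH; have [dA _] := gA; have wH : upper_half (mob A z) by apply: mob_up; rewrite ?dA.
have gr (K : cosets N) : Gamma0 N (rep K *m A) by apply: Gamma0M => //; apply: rep_Gamma0.
have [f hf] := choice (fun K => rep_ex (gr K)).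
have rA (B : 'M[int]_2) : B = B *m inv2x2 A *m A by rewrite mulmx_inv2x2.
have sbM (B B' D : 'M[int]_2) : same_bottom B B' -> same_bottom (B *m D) (B' *m D).
  by move=> [u u2 [h1 h2]]; exists u => //; rewrite !mulmx2 h1 h2; split; ring.
have f_inj : injective f.
  move=> K K' E; apply: rep_inj.
  have sb : same_bottom (rep K *m A) (rep K' *m A).
    by apply: same_bottom_trans (hf K) _; rewrite E; apply: same_bottom_sym.
  by have := sbM _ _ (inv2x2 A) sb; rewrite -!mulmxA mulmx_inv2x2_r // !mulmx1.
have f_surj (K' : cosets N) : exists K, K' = f K.
  have [K hK] := rep_ex (Gamma0M (rep_Gamma0 K') (Gamma0V gA)); exists K; apply: rep_inj.
  by apply: same_bottom_trans (hf K); rewrite [X in same_bottom X](rA (rep K')); apply: sbM.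
have t0 : theta_j A z != 0 by apply: theta_j_neq0; rewrite ?dA.
have h1 := Fcal_has_sum wH.
have h2 : has_sum (fun K => term n m (rep (f K)) (theta_j (rep (f K))) z) (Fcal p s m z).
  have hx j : (forall i, j <> f i) -> term n m (rep j) (theta_j (rep j)) z = 0.
    by move=> hj; have [K E] := f_surj j; have := hj K.
  have [hh _] := has_sum_inj (Fcal p s m z) f_inj hx; apply: hh.
exact: Fcal_has_sum zH.
apply: (has_sum_unique h1).
apply: (eq_has_sum _ (has_sumZ (c := theta_j A z ^+ n) h2)) => K /=.
rewrite -(term_same_bottom _ _ (hf K) zH) ?rep_det //; last by case: (gr K).
rewrite /term mobM ?dA ?rep_det // theta_jM ?dA ?rep_det //.
move: (theta_j A z) t0 (theta_j (rep K) _) => a a0 b; rewrite exprMn invfM.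
by rewrite mulrA mulrCA divff ?mulr1 // expf_neq0.
Qed.

End PoincareSeries.

(** * Expansions at the cusps *)

Section Period.
Variable R : realType.
Local Notation C := (CC R).
Variables (p s : nat).
Local Notation n := (2 * s + 1)%N.

(** The quotient of the two factors has constant square [c], hence is constant by [sqr_cst]. All
    comparisons of lifts go through this. *)
Lemma mpl_ratio M phi k M' psi k' (c : C) (g : C -> C) (l : C) : c != 0 ->
  mpl M phi k -> mpl M' psi k' -> (forall z, upper_half z -> upper_half (g z)) ->
  (forall z, upper_half z -> cderiv g z l) ->
  (forall z, upper_half z -> k * jd M z = c * (k' * jd M' (g z))) ->
  exists2 r : C, r ^+ 2 = c & forall z, upper_half z -> phi z = r * psi (g z).
Proof.
move=> c0 hM hM' gH dg hc; have [_ _ d h] := hM; have [_ _ d' h'] := hM'.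
have psi0 z : upper_half z -> psi (g z) != 0 by move=> zH; apply: (mpl_neq0 hM' (gH z zH)).
pose r z := phi z * (psi (g z))^-1.
have iH : upper_half (imagi R) by rewrite /upper_half /mkset Im_i ltr01.
have sq z : upper_half z -> r z ^+ 2 = c.
  move=> zH; have [dM' k0' _ _] := hM'.
  have j0 : k' * jd M' (g z) != 0 by rewrite mulf_neq0 // (jd_neq0 (lt0r_neq0 dM') (gH z zH)).
  by rewrite /r exprMn exprVn h // h' ?hc ?mulfK //; apply: gH.
have rd z : upper_half z -> exists l', cderiv r z l'.
  move=> zH; have [l1 h1] := d z zH; have [l2 h2] := d' _ (gH z zH).
  have h3 := cderiv_comp (g := g) h2 (dg z zH).
  by eexists; apply: cderivM h1 (cderivV (f := fun w => psi (g w)) (psi0 z zH) h3).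
exists (r (imagi R)); first exact: sq.
by move=> z zH; rewrite (sqr_cst c0 rd sq iH zH) /r divfK // psi0.
Qed.

Lemma upper_shift (z : C) (k : int) : upper_half z -> upper_half (z + k%:~R).
Proof. by rewrite -ofR_int upT. Qed.

Lemma cderiv_shift (c z : C) : cderiv (fun w => w + c) z 1.
Proof. by have := cderivD (cderiv_id z) (cderiv_cst c z); rewrite addr0. Qed.

(* M T^h M^-1 lies in Gamma0(4p) as soon as 4p det(M) divides h; the factor it
   produces is a constant root of unity, removed by enlarging h. *)
Lemma part_period (f : C -> C) M phi (k0 : C) : (0 < p)%N -> invariant_form p s f -> mpl M phi k0 ->
  exists2 h : nat, (0 < h)%N & forall z, upper_half z ->
    part s M phi f (z + h%:R) = part s M phi f z.
Proof.
move=> p0 fi hM; have [dM k00 _ _] := hM; set D := \det M in dM.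
pose h1 : int := 4 * p%:Z * D; have h10 : 0 < h1 by rewrite /h1 !mulr_gt0 // ltz_nat.
set a := M 0 0; set c := M 1 0.
pose B : 'M[int]_2 := mx2 (1 - 4 * p%:Z * a * c) (4 * p%:Z * a ^+ 2) (- (4 * p%:Z * c ^+ 2)) (1 + 4 * p%:Z * a * c).
have [B1 B2 B3 B4] := mx2E (1 - 4 * p%:Z * a * c) (4 * p%:Z * a ^+ 2) (- (4 * p%:Z * c ^+ 2)) (1 + 4 * p%:Z * a * c).
have gB : Gamma0 (4 * p) B.
  split; first by rewrite det2 /B B1 B2 B3 B4; ring.
  by rewrite /B B3 rpredN PoszM; apply: dvdz_mulr; apply: dvdzz.
have [dB _] := gB.
pose T : 'M[int]_2 := mx2 1 h1 0 1; have [T1 T2 T3 T4] := mx2E 1 h1 0 (1 : int).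
have dT : \det T = 1 by rewrite det2 /T T1 T2 T3 T4; ring.
have mT (z : C) : mob T z = z + h1%:~R by rewrite /mob /jd /T T1 T2 T3 T4 mul0r add0r divr1 mul1r.
have jT (z : C) : jd T z = 1 by rewrite /jd /T T3 T4 mul0r add0r.
have MT : M *m T = B *m M.
  by apply: mx2_eq; rewrite !mulmx2 /T /B ?T1 ?T2 ?T3 ?T4 ?B1 ?B2 ?B3 ?B4 /h1 /D ?det2 -/a -/c; ring.
have mE (z : C) : upper_half z -> mob M (z + h1%:~R) = mob B (mob M z).
  by move=> zH; rewrite -mT -!mobM ?MT ?dT ?dB // gt_eqF.
have [k k2 hk] := theta_j_sqr R (gamma_4p4 gB).
have kc0 : k%:~R != 0 :> C by rewrite intr_eq0; apply/eqP => E; rewrite E expr0n in k2.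
have hB : mpl B (theta_j B) (k%:~R : C).
  split=> //; first by rewrite dB.
  by move=> z zH; apply: theta_j_goodH => //; rewrite dB.
have hc z : upper_half z -> k%:~R * k0 * jd (B *m M) z = k%:~R * (k0 * jd M (z + h1%:~R)).
  by move=> zH; rewrite -mT -MT jdM ?jT ?oner_neq0 // mulr1 mulrA.
have [r r2 hr] := mpl_ratio (g := fun z => z + h1%:~R) kc0 (mpl_mul hB hM) hM
  (fun z zH => upper_shift h1 zH) (fun z _ => cderiv_shift _ z) hc.
have step (z : C) : upper_half z -> part s M phi f (z + h1%:~R) = r ^+ n * part s M phi f z.
  move=> zH; have wH := mob_up dM zH; have h2 := hr z zH; rewrite /= in h2.
  have p1 := mpl_neq0 hM zH; have p2 := mpl_neq0 hM (upper_shift h1 zH).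
  rewrite /part mE // (fi _ gB _ wH) mulrA [RHS]mulrA; congr (_ * _).
  rewrite -!exprVn -!exprMn; congr (_ ^+ _).
  by apply: (mulfI p2); rewrite mulVKf // mulrA [_ * r]mulrC -h2 mulfK.
have r4 : r ^+ 4 = 1 by rewrite (exprM r 2 2) r2 -rmorphXn /= k2.
exists (4 * `|h1|)%N; first by rewrite muln_gt0 absz_gt0 gt_eqF.
move=> z zH; have -> : (4 * `|h1|)%:R = h1%:~R + h1%:~R + h1%:~R + h1%:~R :> C.
  by rewrite natrM natr_absz gtr0_norm //; ring.
rewrite !addrA !step; do ?[exact: zH|apply: upper_shift].
by rewrite !mulrA -!exprMn (_ : r * r * r * r = 1) ?expr1n ?mul1r // -r4; ring.
Qed.

End Period.

(** * Principal parts and expansions *)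

Section Expansion.
Variable R : realType.
Local Notation C := (CC R).

(** A list, not a function of the exponent: contributions of several cosets are concatenated, and
    equal exponents may recur and cancel. *)
Definition princ (L : seq (C * rat)) (z : C) : C := \sum_(x <- L) x.1 * e (ratr x.2 * z).

Lemma ratr_R (q : rat) : ratr q = ofR (ratr q) :> C.
Proof. by rewrite /ratr ofRM ofRV !ofR_int. Qed.

Lemma common_period (L : seq (C * rat)) : exists2 k : nat, (0 < k)%N &
  forall x, x \in L -> exists u : int, x.2 * k%:R = u%:~R.
Proof.
elim: L => [|x L [k k0 hk]]; first by exists 1%N.
exists (k * `|denq x.2|)%N; first by rewrite muln_gt0 k0 absz_gt0 denq_neq0.
have dE : `|denq x.2|%:R = (denq x.2)%:~R :> rat by rewrite natr_absz gtr0_norm // denq_gt0.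
move=> y; rewrite inE => /orP[/eqP ->|yL].
  exists (numq x.2 * k%:Z); rewrite natrM dE mulrCA -numqE rmorphM /= mulrC -pmulrn //.
by have [u hu] := hk y yL; exists (u * denq x.2); rewrite natrM dE mulrA hu rmorphM.
Qed.

Lemma lower_index (L : seq (C * rat)) (h : nat) : exists n0 : int, forall n : int, n < n0 ->
  forall x, x \in L -> x.2 * h%:R != n%:~R.
Proof.
elim: L => [|x L [n0 H]]; first by exists 0.
exists (Num.min n0 (Num.floor (x.2 * h%:R))) => n; rewrite lt_min => /andP[h1 h2] y.
rewrite inE => /orP[/eqP ->|yL]; last exact: H.
rewrite gt_eqF // (lt_le_trans _ (floor_le_tmp (x.2 * h%:R))) // ltr_int //.
Qed.

Lemma goodHB (f g : C -> C) : goodH f -> goodH g -> goodH (fun z => f z - g z).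
Proof.
move=> hf hg; apply: goodH_ext (goodHD hf (goodHZ (-1) hg)) => z _.
by rewrite mulN1r.
Qed.

Lemma goodH_e (l : R) : goodH (fun z : C => e (ofR l * z)).
Proof.
move=> B y1 y2 y10.
apply: (good_exp (b := expR (2 * pi * `|l| * (`|y1| + `|y2|)))); first exact: convex_box.
  exact: expR_ge0.
move=> z [_ /andP[h1 h2]]; rewrite nm_e ler_expR Im_ofRM.
have z0 : 0 <= Im z by apply: le_trans h1; apply: ltW.
apply: (@le_trans _ _ (2 * pi * `|l| * `|Im z|)).
  have pp : 0 <= 2 * pi :> R by rewrite mulr_ge0 // pi_ge0.
  rewrite -mulrN -(mulrA _ `|l|) -normrM -mulrN; apply: ler_wpM2l => //.
  by apply: le_trans (ler_norm _) _; rewrite mulrN normrN.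
apply: ler_wpM2l; first by rewrite !mulr_ge0 // pi_ge0.
by rewrite ger0_norm //; apply: le_trans h2 _; apply: le_trans (ler_norm _) _; rewrite lerDr.
Qed.

Lemma goodH_princ (L : seq (C * rat)) : goodH (princ L).
Proof.
apply: (@goodH_sum R _ L (fun (x : C * rat) z => x.1 * e (ratr x.2 * z))) => x.
by apply: goodHZ; rewrite ratr_R; apply: goodH_e.
Qed.

Lemma princ_periodic (L : seq (C * rat)) (k : nat) (z : C) :
  (forall x, x \in L -> exists u : int, x.2 * k%:R = u%:~R) -> princ L (z + k%:R) = princ L z.
Proof.
move=> hk; apply: eq_big_seq => x xL; have [u hu] := hk x xL.
rewrite mulrDr; have -> : ratr x.2 * k%:R = u%:~R :> C.
  by rewrite -(ratr_nat _ k) -rmorphM /= hu ratr_int.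
by rewrite e_addint.
Qed.

Lemma periodN (g : C -> C) (h : nat) : (forall z, upper_half z -> g (z + h%:R) = g z) ->
  forall (j : int) z, upper_half z -> g (z + (h%:Z * j)%:~R) = g z.
Proof.
move=> per; have nn (j : nat) z : upper_half z -> g (z + (h%:Z * j%:Z)%:~R) = g z.
  elim: j z => [|j IH] z zH; first by rewrite mulr0 addr0.
  rewrite -(IH z zH) intS mulrDr mulr1 rmorphD /= addrCA addrC -pmulrn per //.
  exact: upper_shift.
move=> [j|j] z zH; first exact: nn.
rewrite -[LHS](nn j.+1); last exact: upper_shift.
by rewrite -addrA -rmorphD NegzE mulrN addNr addr0.
Qed.

(** Translation by a multiple of h brings Re z between 0 and h, where [approx] is uniform. *)
Lemma approx_vanishes (g P : C -> C) (h : nat) : (0 < h)%N -> approx g P ->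
  (forall z, upper_half z -> g (z + h%:R) - P (z + h%:R) = g z - P z) ->
  vanishes_infty (fun z => g z - P z).
Proof.
move=> h0 ap per eps eps0; have [Y Y0 H] := ap h%:R eps eps0; exists Y => z zY.
have zH : upper_half z by apply: lt_le_trans zY.
have hR : 0 < h%:R :> R by rewrite ltr0n.
pose j := Num.floor (Re z / h%:R).
have E := periodN per (- j) zH.
rewrite -E; apply: H.
  rewrite ReD Re_int rmorphM rmorphN /= -pmulrn mulrN.
  have h1 : j%:~R <= Re z / h%:R := floor_le_tmp _.
  have h2 : Re z / h%:R < (j + 1)%:~R := floorD1_gt _.
  rewrite ler_pdivlMr // in h1; rewrite ltr_pdivrMr // rmorphD /= in h2.
  by rewrite ger0_norm; lra.
by rewrite ImD Im_int addr0.
Qed.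

(** After a common period is chosen, g minus its principal part vanishes at infinity and so has only
    positive exponents. The coefficients at n <= 0 are thus exactly those recorded in the list. *)
Lemma expansion (g : C -> C) (L : seq (C * rat)) (h : nat) : (0 < h)%N -> goodH g ->
  (forall z, upper_half z -> g (z + h%:R) = g z) -> approx g (princ L) ->
  exists (h' : nat) (a : int -> C), [/\ (0 < h')%N,
    exists n0 : int, forall n, n < n0 -> a n = 0,
    forall z, upper_half z -> has_sum (fun n : int => a n * e (n%:~R * z / h'%:R)) (g z),
    forall n, n <= 0 -> a n = \sum_(x <- L | x.2 * h'%:R == n%:~R) x.1 &
    forall x, x \in L -> exists u : int, x.2 * h'%:R = u%:~R].
Proof.
move=> h0 gg per ap; have [k k0 hk] := common_period L.
pose H := (h * k)%N; have H0 : (0 < H)%N by rewrite muln_gt0 h0.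
have H0c : H%:R != 0 :> C by rewrite pnatr_eq0 -lt0n.
have hH x : x \in L -> exists u : int, x.2 * H%:R = u%:~R.
  move=> xL; have [u hu] := hk x xL; exists (u * h%:Z).
  by rewrite natrM mulrCA hu rmorphM /= mulrC -pmulrn.
have perH z : upper_half z -> g (z + H%:R) = g z.
  by move=> zH; have := periodN per k%:Z zH; rewrite rmorphM /= -!pmulrn -natrM.
have perD z : upper_half z -> g (z + H%:R) - princ L (z + H%:R) = g z - princ L z.
  by move=> zH; rewrite perH // princ_periodic.
have [a' [a0 hs]] := fourier_period H0 (goodHB gg (goodH_princ L)) perD (approx_vanishes H0 ap perD).
exists H, (fun n => a' n + \sum_(x <- L | x.2 * H%:R == n%:~R) x.1); split; first exact: H0.
- have [n0 hn] := lower_index L H; exists (Num.min n0 0) => n; rewrite lt_min => /andP[n1 n2].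
  rewrite a0 ?ltW // add0r big_seq_cond big1 // => x /andP[xL /eqP E].
  by have := hn n n1 x xL; rewrite E eqxx.
- move=> z zH; have S1 := hs z zH.
  have S2 : has_sum (fun n : int => (\sum_(x <- L | x.2 * H%:R == n%:~R) x.1) * e (n%:~R * z / H%:R))
     (princ L z).
    have S3 (x : C * rat) : x \in L -> has_sum (fun n : int =>
        if x.2 * H%:R == n%:~R then x.1 * e (n%:~R * z / H%:R) else 0) (x.1 * e (ratr x.2 * z)).
      move=> xL; have [u hu] := hH x xL.
      apply: (eq_has_sum _ (has_sum_delta (c := x.1 * e (ratr x.2 * z)) u)) => n /=.
      rewrite hu eqr_int eq_sym; case: eqP => // <-; congr (_ * e _).
      have -> : u%:~R = ratr x.2 * H%:R :> C.
        by rewrite -(ratr_nat _ H) -rmorphM /= hu ratr_int.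
      by rewrite [in RHS]mulrAC mulfK.
    have S4 : forall L' : seq (C * rat), {subset L' <= L} -> has_sum (fun n : int =>
        \sum_(x <- L') (if x.2 * H%:R == n%:~R then x.1 * e (n%:~R * z / H%:R) else 0)) (princ L' z).
      elim=> [|x L' IH] sub.
        rewrite /princ big_nil; apply: (eq_has_sum (x := fun=> 0)); last exact: has_sum0.
        by move=> n; rewrite big_nil.
      rewrite /princ big_cons; have hx : x \in L by apply: sub; rewrite inE eqxx.
      have hL : {subset L' <= L} by move=> y yL; apply: sub; rewrite inE yL orbT.
      by apply: (eq_has_sum _ (has_sumD (S3 x hx) (IH hL))) => n; rewrite big_cons.
    apply: (eq_has_sum _ (S4 L (fun x xL => xL))) => n.
    by rewrite -big_mkcond mulr_suml.
  have := has_sumD S1 S2; rewrite subrK; apply: eq_has_sum => n /=.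
  by rewrite mulrDl.
- by move=> n n0; rewrite a0 // add0r.
- exact: hH.
Qed.

End Expansion.

(** * Independence of the matrix and of the lift *)

Section CuspTransfer.
Variable R : realType.
Local Notation C := (CC R).
Variable s : nat.
Local Notation n := (2 * s + 1)%N.

Lemma lift_mpl (G : 'M[int]_2) (X : mpair R) : \det G = 1 -> metaplectic X -> X.1 = mxQ G ->
  exists2 k : C, nm k = 1 & mpl G X.2 k /\ forall f z, slash s f X z = part s G X.2 f z.
Proof.
move=> dG [_ hol [t [t1 ht]]] EX; have t1' : nm t = 1.
  by apply: (@ofR_inj R); rewrite -normE t1 ofR1.
exists t => //; split; last by move=> f z; rewrite /slash /part EX mobius_mxQ.
split; first by rewrite dG.
- by rewrite -nm_eq0 t1' oner_neq0.
- by move=> z zH; apply: derivable_cderiv; apply: hol.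
- move=> z zH; rewrite ht // EX det_map_mx dG ratr_int mulr1z sqrtr1 ofR1 invr1 mulr1.
  by rewrite /mxQ !mxE !ratr_int.
Qed.

Lemma mpl_lift (G : 'M[int]_2) (phi : C -> C) (k : C) : \det G = 1 -> mpl G phi k -> nm k = 1 ->
  metaplectic (mxQ G, phi).
Proof.
move=> dG [_ _ d h] k1; split => /=.
- by rewrite det_map_mx dG /=.
- by move=> z zH; have [l hl] := d z zH; apply: cderiv_derivable hl.
exists k; split; first by rewrite normE k1 ofR1.
move=> z zH; rewrite h // det_map_mx dG ratr_int mulr1z sqrtr1 ofR1 invr1 mulr1.
by rewrite /mxQ !mxE !ratr_int.
Qed.

Lemma same_image (G0 G : 'M[int]_2) : \det G0 = 1 -> \det G = 1 ->
  image_of_infty G = image_of_infty G0 -> exists2 T, Gamma_infty T & G = G0 *m T.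
Proof.
move=> d0 d1 E; have cr : G0 0 0 * G 1 0 - G0 1 0 * G 0 0 = 0.
  move: E; rewrite /image_of_infty.
  have [c0|c0] := eqVneq (G 1 0) 0; have [c1|c1] := eqVneq (G0 1 0) 0 => //.
    by rewrite c0 c1 mulr0 mul0r subrr.
  case=> /eqP; rewrite eqr_div ?intr_eq0 // -!rmorphM eqr_int => /eqP h.
  by rewrite [G0 1 0 * _]mulrC h subrr.
have [a b c d] := mx2E (G0 1 1) (- G0 0 1) (- G0 1 0) (G0 0 0).
exists (inv2x2 G0 *m G).
  apply: (upper_unit _ _).2; first by rewrite det_mulmx inv2x2_det d0 d1.
  by rewrite mulmx2 /inv2x2 c d -cr; ring.
by rewrite mulmxA mulmx_inv2x2_r // mul1mx.
Qed.

(** Matrices sending infinity to the same cusp differ by a signed translation on the right, and the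
    corresponding factors by a constant. *)
Lemma part_transfer (G0 G : 'M[int]_2) (phi0 phi : C -> C) (k0 k : C) :
  mpl G0 phi0 k0 -> mpl G phi k -> (exists2 T, Gamma_infty T & G = G0 *m T) ->
  exists (c : C) (j : int), c != 0 /\ forall f z, upper_half z ->
    part s G phi f z = c * part s G0 phi0 f (z + j%:~R).
Proof.
move=> h0 h [T gT EG]; have [d0 k00 _ _] := h0; have [dG k1 _ _] := h.
have [j hj] := mob_Ginf R gT; have dT := Gamma_infty_det gT.
have [u u2 [u10 u11]] : exists2 u : int, u * u = 1 & T 1 0 = 0 /\ T 1 1 = u.
  have [n [hT|hT]] := gT; have [a b c d] := mx2E 1 n 0 (1 : int).
    by exists 1 => //; rewrite hT c d.
  by exists (-1) => //; rewrite hT !opp2E c d oppr0.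
have u0 : u%:~R != 0 :> C.
  by rewrite intr_eq0; apply/eqP => E; rewrite E mul0r in u2.
have jT (z : C) : jd T z = u%:~R by rewrite /jd u10 u11 mul0r add0r.
have c0 : k * u%:~R / k0 != 0 by rewrite !mulf_neq0 // invr_eq0.
have hc z : upper_half z -> k * jd G z = k * u%:~R / k0 * (k0 * jd G0 (z + j%:~R)).
  by move=> zH; rewrite EG jdM ?jT // hj [RHS]mulrA divfK // -!mulrA [u%:~R * _]mulrC.
have [r r2 hr] := mpl_ratio (g := fun z => z + j%:~R) c0 h h0
  (fun z zH => upper_shift j zH) (fun z _ => cderiv_shift _ z) hc.
exists (r ^- n), j; split.
  by rewrite invr_eq0 expf_neq0 // -sqrf_eq0 r2.
by move=> f z zH; rewrite /part hr // exprMn invfM EG mobM ?hj ?gt_eqF ?dT // mulrA.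
Qed.

(** [at_cusp] ranges over all matrices and lifts, but one choice suffices: any other multiplies each
    coefficient by a non-zero number, and [P] is assumed stable under that. *)
Lemma at_cusp_intro (f : C -> C) (r : option rat) (P : (int -> C) -> Prop) G0 phi0 k0 h a n0 :
  Gamma0 1 G0 -> image_of_infty G0 = r -> mpl G0 phi0 k0 -> (0 < h)%N ->
  (forall n, n < n0 -> a n = 0) ->
  (forall z, upper_half z -> has_sum (fun n : int => a n * e (n%:~R * z / h%:R)) (part s G0 phi0 f z)) ->
  (forall c : int -> C, (forall n, c n != 0) -> P (fun n => c n * a n)) ->
  at_cusp s f r P.
Proof.
move=> [dG0 _] Er h0 hh hn hs hP G X [dG _] EG mX X1; subst r.
have [k k1 [hX hE]] := lift_mpl dG mX X1.
have [c [j [c0 hc]]] := part_transfer h0 hX (same_image dG0 dG EG).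
exists h, (fun n => (c * e (n%:~R * j%:~R / h%:R)) * a n); split; last first.
  by apply: hP => n; rewrite mulf_neq0 // e_neq0.
split; [exact: hh|by exists n0 => n hn'; rewrite hn // mulr0|].
move=> z zH; rewrite hE hc //.
apply: (eq_has_sum _ (has_sumZ (c := c) (hs _ (upper_shift j zH)))) => n /=.
by rewrite mulrDr mulrDl eD; ring.
Qed.

(** With N < 0 the least exponent, e(-Nz/h) g(z) tends to a_N along the imaginary axis while
    e(-Nz/h) tends to 0, so g cannot be small there. *)
Lemma expansion_unbounded (g : C -> C) (h : nat) (a : int -> C) (n0 n1 : int) : (0 < h)%N ->
  (forall n, n < n0 -> a n = 0) -> n1 < 0 -> a n1 <> 0 ->
  (forall z, upper_half z -> has_sum (fun n : int => a n * e (n%:~R * z / h%:R)) (g z)) ->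
  approx g (fun=> 0) -> False.
Proof.
move=> h0 hn n10 /eqP an1 hs ap.
have [N [N0 aN hN]] : exists N : int, [/\ N < 0, a N != 0 & forall n, n < N -> a n = 0].
  have n01 : n0 <= n1 by rewrite leNgt; apply: contraNN an1 => /hn ->.
  have ex : exists k : nat, a (n0 + k%:Z) != 0.
    by exists `|n1 - n0|%N; have -> : n0 + `|n1 - n0|%N%:Z = n1 by lia.
  exists (n0 + (ex_minn ex)%:Z); case: ex_minnP => k ak hk; split=> //.
    apply: le_lt_trans n10; have := hk `|n1 - n0|%N.
    have -> : n0 + `|n1 - n0|%N%:Z = n1 by lia.
    by move=> /(_ an1); lia.
  move=> n; have [lt _|ge lt] := ltP n n0; first exact: hn.
  apply/eqP; apply: contraTT lt => an; rewrite -leNgt.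
  have := hk `|n - n0|%N; have -> : n0 + `|n - n0|%N%:Z = n by lia.
  by move=> /(_ an); lia.
have hR : 0 < h%:R :> R by rewrite ltr0n.
pose u : R := 2 * pi / h%:R; have u0 : 0 < u by rewrite divr_gt0 ?mulr_gt0 ?pi_gt0.
pose zt (y : R) : C := imagi R * ofR y.
have Imz y : Im (zt y) = y by rewrite /zt Im_Mi Re_ofR.
have nme (n : int) (y : R) : nm (e (n%:~R * zt y / h%:R)) = expR (- (u * n%:~R * y)).
  rewrite nm_e -ofR_int -(ofR_nat R h) -ofRV mulrC -mulrA Im_ofRM mulrC mulrAC -mulrA.
  rewrite [X in Im X]mulrC Im_ofRM Imz; congr expR; rewrite /u; ring.
clearbody u.
have iH y : 0 < y -> upper_half (zt y) by rewrite /upper_half /mkset Imz.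
(* Convergence at height 1 bounds a_n by a multiple of e^(un), which makes the tail geometric at
   height 2 and above. *)
have [C0 hC] := has_sum_bounded (hs _ (iH 1 ltr01)).
have hC' n : nm (a n) <= C0 * expR (u * n%:~R).
  have := hC n; rewrite nmM nme mulr1 expRN -ler_pdivlMr ?invr_gt0 ?expR_gt0 // invrK //.
have C00 : 0 <= C0 by apply: le_trans (hC 0); apply: nm_ge0.
pose q := expR (- u); have q1 : q < 1 by rewrite -expR0 ltr_expR oppr_lt0.
have q0 : 0 < q := expR_gt0 _.
pose geom (n : int) : R := q ^+ `|n|%N.
have Sg : sumb geom (2 * (1 - q)^-1).
  apply: (sumb_int (b := fun k => q ^+ k)) => [k|K]; first by rewrite exprn_ge0 // ltW.
  rewrite -[leRHS]mul1r ler_pdivlMr ?subr_gt0 //.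
  have := subrX1 q K; have : 0 <= q ^+ K by rewrite exprn_ge0 // ltW.
  by lra.
set S := 2 * _ in Sg; have S0 : 0 <= S by rewrite mulr_ge0 // invr_ge0 subr_ge0 ltW.
pose K1 := 1 + C0 * expR (u * N%:~R) * S * expR (2 * u).
have aN0 : 0 < nm (a N) by rewrite nm_gt0.
have [Y Y0 hY] := ap 0 1 ltr01.
(* Height 2 controls the tail, Y makes g at most 1, and the last entry defeats |a_N|. *)
pose y := Num.max 2 (Num.max Y (K1 / (u * nm (a N)))).
have y2 : 2 <= y by rewrite le_max lexx.
have yY : Y <= y by rewrite !le_max lexx orbT.
have yK : K1 / (u * nm (a N)) <= y by rewrite !le_max lexx !orbT.
have y0 : 0 < y by apply: lt_le_trans y2.
have zH := iH y y0.
have gb : nm (g (zt y)) <= 1.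
  have := hY (zt y); rewrite /zt Re_Mi Im_ofR oppr0 normr0 lexx -/(zt y) Imz yY subr0.
  by apply.
have hsD := has_sumB (has_sumZ (c := e (- (N%:~R * zt y / h%:R))) (hs _ zH)) (has_sum_delta (c := a N) N).
have bnd : nm (e (- (N%:~R * zt y / h%:R)) * g (zt y) - a N) <= C0 * expR (u * N%:~R) * expR (- (u * (y - 2))) * S.
  have k0 : 0 <= C0 * expR (u * N%:~R) * expR (- (u * (y - 2))) by rewrite !mulr_ge0 ?expR_ge0.
  apply: (has_sum_le hsD); apply: (sumb_inj (f := fun n => n - N)
    (b' := fun n => C0 * expR (u * N%:~R) * expR (- (u * (y - 2))) * geom n)); last exact: sumbZ.
    exact: addIr.
  move=> n; have b0 : 0 <= C0 * expR (u * N%:~R) * expR (- (u * (y - 2))) * geom (n - N).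
    by rewrite mulr_ge0 // exprn_ge0 // ltW.
  have [lt|gt|E] := ltgtP n N.
  - by rewrite hN // mul0r mulr0 subr0 nm0.
  - rewrite subr0 !nmM nme -mulNr -mulNr -rmorphN nme rmorphN /=.
    have nN : (n - N)%:~R = `|n - N|%N%:R :> R by rewrite natr_absz ger0_norm // subr_ge0 ltW.
    have nN1 : 1 <= (n - N)%:~R :> R by rewrite ler1z -gtz0_ge1 subr_gt0.
    rewrite /geom -expRM_natl -nN mulrCA; apply: (@le_trans _ _ (C0 * expR (u * n%:~R) *
      (expR (- (u * - N%:~R * y)) * expR (- (u * n%:~R * y))))).
      by apply: ler_wpM2r (hC' n); rewrite mulr_ge0 ?expR_ge0.
    rewrite -!mulrA; apply: ler_wpM2l => //; rewrite -!expRD ler_expR rmorphB /=.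
    rewrite rmorphB /= in nN1; move: (n%:~R) (N%:~R) nN1 => x x' nN1.
    rewrite -subr_ge0 (_ : _ - _ = u * ((x - x' - 1) * (y - 2))); last by ring.
    by rewrite !mulr_ge0 ?subr_ge0 // ltW.
  - by rewrite E in b0 *; rewrite mulrCA -eD addNr e_0 mulr1 subrr nm0; exact: b0.
have eN1 : nm (e (- (N%:~R * zt y / h%:R)) * g (zt y)) <= expR (- (u * y)).
  rewrite nmM -mulNr -mulNr -rmorphN nme rmorphN /= -[leRHS]mulr1; apply: ler_pM; rewrite ?nm_ge0 ?expR_ge0 //.
  rewrite ler_expR mulrN mulNr opprK -[leRHS]mulN1r mulrAC [leLHS]mulrC.
  apply: ler_wpM2r; first by rewrite mulr_ge0 ?ltW.
  by rewrite (_ : -1 = (-1)%:~R) // ler_int -ltzD1 addNr.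
have aN1 : nm (a N) <= K1 * expR (- (u * y)).
  have -> : a N = e (- (N%:~R * zt y / h%:R)) * g (zt y) - (e (- (N%:~R * zt y / h%:R)) * g (zt y) - a N).
    by rewrite opprB addrC subrK.
  apply: (le_trans (nmB _ _)); apply: (le_trans (lerD eN1 bnd)).
  rewrite /K1 mulrDl mul1r lerD2l (_ : - (u * (y - 2)) = 2 * u + - (u * y)) ?expRD; last by ring.
  by rewrite le_eqVlt; apply/orP; left; apply/eqP; ring.
have := expR_ge1Dx (u * y); rewrite expRN in aN1 => he.
have Ep : 0 < expR (u * y) by apply: expR_gt0.
rewrite ler_pdivlMr // in aN1.
rewrite ler_pdivrMr ?mulr_gt0 // in yK.
have h3 : (1 + u * y) * nm (a N) <= K1.
  by apply: le_trans aN1; rewrite mulrC; apply: ler_wpM2l => //; apply: ltW.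
move: (nm (a N)) aN0 yK h3 => x x0 yK h3.
have : (1 + u * y) * x = x + y * (u * x) by ring.
by lra.
Qed.

End CuspTransfer.

Section Approx.
Variable R : realType.
Local Notation C := (CC R).

Lemma approxD (f g P Q : C -> C) : approx f P -> approx g Q ->
  approx (fun z => f z + g z) (fun z => P z + Q z).
Proof.
move=> hf hg B eps e0; have e2 : 0 < eps / 2 by rewrite divr_gt0.
have [Y Y0 hY] := hf B _ e2; have [Y' Y0' hY'] := hg B _ e2.
exists (Num.max Y Y'); first by rewrite lt_max Y0.
move=> z zB; rewrite ge_max => /andP[y1 y2]; rewrite opprD addrACA (splitr eps).
by apply: (le_trans (nmD _ _)); apply: lerD; [apply: hY|apply: hY'].
Qed.

Lemma approxZ (c : C) (f P : C -> C) : approx f P -> approx (fun z => c * f z) (fun z => c * P z).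
Proof.
move=> hf B eps e0; have c1 : 0 < nm c + 1 by rewrite ltr_wpDl ?nm_ge0.
have e2 : 0 < eps / (nm c + 1) by rewrite divr_gt0.
have [Y Y0 hY] := hf B _ e2; exists Y => // z zB zY; have h := hY z zB zY.
rewrite -mulrBr nmM; rewrite ler_pdivlMr // in h; apply: le_trans h.
by rewrite mulrC; apply: ler_wpM2l; rewrite ?nm_ge0 // lerDl.
Qed.

Lemma approx_ext (f g P Q : C -> C) : (forall z, upper_half z -> f z = g z) ->
  (forall z, upper_half z -> P z = Q z) -> approx f P -> approx g Q.
Proof.
move=> fg PQ hf B eps e0; have [Y Y0 hY] := hf B eps e0; exists Y => // z zB zY.
have zH : upper_half z by apply: lt_le_trans zY.
by rewrite -fg // -PQ //; apply: hY.
Qed.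

Lemma approx_shift (f P : C -> C) (x : R) : approx f P ->
  approx (fun z => f (z + ofR x)) (fun z => P (z + ofR x)).
Proof.
move=> hf B eps e0; have [Y Y0 hY] := hf (B + `|x|) eps e0; exists Y => // z zB zY.
apply: hY; last by rewrite ImD Im_ofR addr0.
by rewrite ReD Re_ofR; apply: le_trans (ler_normD _ _) _; rewrite lerD2r.
Qed.

End Approx.

(** * The projected Poincaré series *)

Section KohnenParts.
Variable R : realType.
Local Notation C := (CC R).
Local Notation I := (imagi R).
Variables (p s : nat) (m : int).
Local Notation N := (4 * p)%N.
Local Notation n := (2 * s + 1)%N.
Hypothesis p_prime : prime p.
Hypothesis p_odd : odd p.
Hypothesis s2 : (2 <= s)%N.
Local Notation f := (@Fcal R p s m).
Local Notation F := (kohnen p s f).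

Let fi : invariant_form p s f := @Fcal_invariant R p s m s2.

Lemma e_eighthV : e (8^-1 : C) * e (- 8^-1) = 1.
Proof. by rewrite -eD subrr e_0. Qed.

(** The square is 2, and the real part is non-negative, which selects the positive root. *)
Lemma sqrt2_sum : e (8^-1 : C) + e (- 8^-1) = ofR (Num.sqrt 2).
Proof.
have h8 : (8^-1 : C) = ofR 8^-1 by rewrite ofRV ofR_nat.
have cE (x : R) : e (ofR x) = Complex (cos (2 * pi * x)) (sin (2 * pi * x)) :> C.
  rewrite /e /cexp; have -> : 2 * ofR pi * imagi R * ofR x = imagi R * ofR (2 * pi * x).
    by rewrite !ofRM ofR_nat; ring.
  by rewrite Re_Mi Im_Mi Re_ofR Im_ofR oppr0 expR0 !mul1r.
have im : Im (e (8^-1 : C) + e (- 8^-1)) = 0.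
  by rewrite h8 -ofRN !cE ImD /= mulrN sinN subrr.
have re : 0 <= Re (e (8^-1 : C) + e (- 8^-1)).
  rewrite h8 -ofRN !cE ReD /= mulrN cosN -mulr2n mulrn_wge0 //.
  apply: cos_ge0_pihalf; have := pi_gt0 R => pi0; apply/andP; split; lra.
have sq : (e (8^-1 : C) + e (- 8^-1)) ^+ 2 = 2.
  have -> : (e (8^-1 : C) + e (- 8^-1)) ^+ 2 = e 8^-1 ^+ 2 + e (- 8^-1) ^+ 2 + 2 * (e 8^-1 * e (- 8^-1)) by ring.
  rewrite e_eighthV eN exprVn e_eighth; have i2 := imagi2 R.
  have i0 : I != 0 by rewrite -nm_gt0 nm_i.
  have -> : I^-1 = - I by apply: (mulfI i0); rewrite divff // mulrN -expr2 i2 opprK.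
  by rewrite subrr add0r mulr1.
set w := _ + _ in im re sq *; have wE : w = ofR (Re w) by apply: ceq; rewrite ?Re_ofR ?Im_ofR.
rewrite wE; congr ofR; have : Re w ^+ 2 = 2.
  by apply: (@ofR_inj R); rewrite ofRX -wE sq ofR_nat.
by move=> <-; rewrite sqrtr_sqr ger0_norm.
Qed.

Lemma al_add2 (t : nat) : al R t.+2 = - al R t.
Proof.
rewrite /al; have -> : om R t.+2 = - om R t.
  rewrite /om (_ : (2 * t.+2 + 1 = 4 + (2 * t + 1))%N); last by lia.
  rewrite exprD (exprM _ 2 2) e_eighth imagi2 mulN1r //.
by rewrite invrN opprD.
Qed.

(** Replacing s by s + 2 negates both sides, so s = 0 and s = 1 decide. This is the origin of the
    sign in the projection. *)
Lemma al_val (t : nat) : al R t = (-1) ^+ t.+1./2 * ofR (Num.sqrt 2).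
Proof.
have two (k : nat) : al R k = (-1) ^+ k.+1./2 * ofR (Num.sqrt 2) /\
    al R k.+1 = (-1) ^+ k.+2./2 * ofR (Num.sqrt 2).
  elim: k => [|k [h1 h2]]; last by split; [exact: h2|rewrite al_add2 h1 /= exprS mulN1r mulNr].
  rewrite /= expr0 mul1r expr1 -sqrt2_sum /al /om !muln0 !muln1 !add0n expr1 -eN; split=> //.
  have e3 : e (8^-1 : C) ^+ 3 = - e (- 8^-1).
    have h : e (8^-1 : C) ^+ 4 = -1 by rewrite (exprM _ 2 2) e_eighth imagi2.
    apply: (mulfI (e_neq0 (8^-1 : C))); rewrite -exprS h mulrN e_eighthV //.
  by rewrite e3 invrN -eN opprK mulN1r opprD addrC.
by case: (two t).
Qed.

(** The constants agree since 3/2 times 1/(3 sqrt 2) is 1/(2 sqrt 2), 3/2 times 1/3 is 1/2, and [al]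
    is the signed square root of 2. *)
Lemma poincare_kohnen (z : C) : upper_half z -> poincare p s m z = F z.
Proof.
move=> zH; rewrite /poincare /pr /kohnen /Wsum.
have -> : \sum_(v <- [:: -1; 0; 1; 2 : int]) slash s f (mp_mul (xi R) (star R (A_ p v))) z =
    \sum_(v <- [:: -1; 0; 1; 2 : int]) slash_xi s f (A_ p v) z.
  apply: eq_bigr => v _; apply: slash_xi_star => //; have [-> _] := A_Gamma0 p v; exact: ltr01.
have a0 := al_neq0 R s; have a2 := al_sqr R s; have av := al_val s.
have sg : (-1) ^+ s.+1./2 * (-1) ^+ s.+1./2 = 1 :> C by rewrite -expr2 sqrr_sign.
have q2 : ofR (Num.sqrt 2) ^+ 2 = 2 :> C by rewrite -ofRX sqr_sqrtr // ofR_nat.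
have q0 : ofR (Num.sqrt 2) != 0 :> C by rewrite -sqrf_eq0 q2 pnatr_eq0.
have -> : (al R s)^-1 = (-1) ^+ s.+1./2 / ofR (Num.sqrt 2).
  by apply: (mulfI a0); rewrite divff // av mulrACA sg mul1r divff.
move: (\sum_(v <- _) _) ((-1) ^+ _) (ofR _) q0 => W x y y0; field.
by rewrite y0.
Qed.

Definition xiM (v : int) (M : 'M[int]_2) : 'M[int]_2 := xiZ *m A_ p v *m M.
(** With [xiM], the integer matrix and factor of xi A_v M: each of the four terms becomes a [part]
    of the plain series and falls under the same estimates. *)
Definition xphi (v : int) (M : 'M[int]_2) (phi : C -> C) (z : C) : C :=
  e 8^-1 * theta_j (A_ p v) (mob M z) * phi z.

Lemma det_A (v : int) : \det (A_ p v) = 1. Proof. by case: (A_Gamma0 p v). Qed.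

Lemma mpl_xphi (v : int) M phi k0 : mpl M phi k0 -> exists k, mpl (xiM v M) (xphi v M phi) k.
Proof.
move=> hM; have [k1 _ hA] := mpl_star R (gamma_4p4 (A_Gamma0 p v)).
have x10 : xiZ 1 0 = 0 by have [_ _ -> _] := mx2E 4 1 0 (4 : int).
have dx : 0 < \det xiZ by rewrite det_xiZ.
have hx := mpl_cst dx x10 (e_neq0 (8^-1 : C)).
by eexists; apply: (mpl_mul (mpl_mul hx hA) hM).
Qed.

Lemma part_slash_xi (v : int) M phi k0 (z : C) : mpl M phi k0 -> upper_half z ->
  part s M phi (slash_xi s f (A_ p v)) z = part s (xiM v M) (xphi v M phi) f z.
Proof.
move=> [dM _ _ _] zH; have wH := mob_up dM zH; have dA := det_A v.
rewrite /part /slash_xi /xiM -mulmxA mobM; first last.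
- exact: zH.
- by rewrite det_mulmx dA mul1r.
- by rewrite det_xiZ.
rewrite mob_xiZ mobM ?dA // /xphi mulrA; congr (_ * _).
move: (e _ * _) (phi z) => x y.
by rewrite exprMn invfM mulrC.
Qed.

Lemma kohnen_part M phi k0 (z : C) : mpl M phi k0 -> upper_half z ->
  part s M phi F z = 2^-1 * (part s M phi f z + (al R s)^-1 *
    \sum_(v <- [:: -1; 0; 1; 2 : int]) part s (xiM v M) (xphi v M phi) f z).
Proof.
move=> hM zH; rewrite (eq_bigr (fun v => part s M phi (slash_xi s f (A_ p v)) z)); last first.
  by move=> v _; rewrite (part_slash_xi v hM zH).
rewrite /part /kohnen /Wsum -mulr_sumr; move: (phi z ^- n) (\sum_(v <- _) _) => x y; ring.
Qed.

Lemma part_kohnen_goodH M phi k0 : mpl M phi k0 -> goodH (part s M phi F).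
Proof.
move=> hM; apply: goodH_ext (fun z zH => esym (kohnen_part hM zH)) _.
apply: goodHZ; apply: goodHD; first exact: part_goodH hM.
apply: goodHZ; apply: goodH_sum => v; have [k hk] := mpl_xphi v hM; exact: part_goodH hk.
Qed.

Lemma kohnen_approx M phi k0 (P : C -> C) (Q : int -> C -> C) : mpl M phi k0 ->
  approx (part s M phi f) P ->
  (forall v, v \in [:: -1; 0; 1; 2 : int] -> approx (part s (xiM v M) (xphi v M phi) f) (Q v)) ->
  approx (part s M phi F) (fun z => 2^-1 * (P z + (al R s)^-1 * \sum_(v <- [:: -1; 0; 1; 2 : int]) Q v z)).
Proof.
move=> hM h0 h; apply: approx_ext (fun z zH => esym (kohnen_part hM zH)) (fun _ _ => erefl) _.
apply: approxZ; apply: approxD => //; apply: approxZ.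
have hs (L : seq int) : {subset L <= [:: -1; 0; 1; 2 : int]} ->
    approx (fun z => \sum_(v <- L) part s (xiM v M) (xphi v M phi) f z) (fun z => \sum_(v <- L) Q v z).
  elim: L => [|v L IH] sub.
    by move=> B eps e0; exists 1 => // z _ _; rewrite !big_nil subrr nm0 ltW.
  apply: approx_ext (approxD (h v (sub v (mem_head _ _))) (IH _)) => [z _|z _|w wL].
  - by rewrite big_cons.
  - by rewrite big_cons.
  - by apply: sub; rewrite inE wL orbT.
by apply: hs.
Qed.

Lemma F_expansion M phi k0 (L : seq (C * rat)) : mpl M phi k0 -> approx (part s M phi F) (princ L) ->
  exists (h' : nat) (a : int -> C), [/\ (0 < h')%N,
    exists n0 : int, forall n, n < n0 -> a n = 0,
    forall z, upper_half z -> has_sum (fun n : int => a n * e (n%:~R * z / h'%:R)) (part s M phi F z),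
    forall n, n <= 0 -> a n = \sum_(x <- L | x.2 * h'%:R == n%:~R) x.1 &
    forall x, x \in L -> exists u : int, x.2 * h'%:R = u%:~R].
Proof.
move=> hM ap; have [h h0 per] := part_period (prime_gt0 p_prime) (kohnen_invariant fi) hM.
exact: expansion h0 (part_kohnen_goodH hM) per ap.
Qed.

(** When A M is upper triangular its automorphy factor has constant square, hence is a constant [c],
    and the coset contributes a single exponential with rational exponent. *)
Lemma exc_term A M phi k0 : Gamma0 N A -> mpl M phi k0 -> (A *m M) 1 0 = 0 ->
  exists2 c : C, c != 0 & forall z, upper_half z -> theta_j A (mob M z) * phi z = c /\
    phi z ^- n * term n m A (theta_j A) (mob M z) =
    c ^- n * e (m%:~R * ((A *m M) 0 1)%:~R / ((A *m M) 1 1)%:~R)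
      * e (ratr (m%:~R * ((A *m M) 0 0)%:~R / ((A *m M) 1 1)%:~R) * z).
Proof.
move=> gA hM h; have [k1 _ hA] := mpl_star R (gamma_4p4 gA).
have hAM := mpl_mul hA hM; have [dAM k0' d sq] := hAM; have [dM _ _ _] := hM; have [dA _] := gA.
have d0 : ((A *m M) 1 1)%:~R != 0 :> C.
  by rewrite intr_eq0; apply/eqP => E; move: dAM; rewrite det2 h E !mulr0 subrr ltxx.
have c0 : k1 * k0 * ((A *m M) 1 1)%:~R != 0 by rewrite mulf_neq0.
have sq' z : upper_half z -> (theta_j A (mob M z) * phi z) ^+ 2 = k1 * k0 * ((A *m M) 1 1)%:~R.
  by move=> zH; rewrite sq // /jd h mul0r add0r.
have iH : upper_half I by rewrite /upper_half /mkset Im_i ltr01.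
exists (theta_j A (mob M I) * phi I); first exact: (mpl_neq0 hAM iH).
move=> z zH; have E := sqr_cst c0 d sq' iH zH; split; first by rewrite -E.
have aux (x y X : C) : x ^- n * (y ^- n * X) = (y * x) ^- n * X.
  by rewrite exprMn invfM mulrA [y ^- n * _]mulrC.
rewrite E /term -mobM ?dA // aux.
have jE : jd (A *m M) z = ((A *m M) 1 1)%:~R by rewrite /jd h mul0r add0r.
rewrite [mob (A *m M) z]/mob jE.
rewrite -[in RHS]mulrA -eD; congr (_ * e _).
by rewrite fmorph_div rmorphM /= !ratr_int; ring.
Qed.

Lemma part_princ M phi k0 : mpl M phi k0 -> exists L, approx (part s M phi f) (princ L).
Proof.
move=> hM; have [[A [gA h]]|no] := pselect (exists A, Gamma0 N A /\ (A *m M) 1 0 = 0).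
  have [c c0 H] := exc_term gA hM h.
  eexists [:: (_, _)]; apply: approx_ext (part_approx1 m s2 hM gA h) => // z zH.
  by rewrite /princ big_seq1 /= (H z zH).2.
exists [::]; apply: approx_ext (part_approx0 m s2 hM _) => [//|z zH|A gA].
  by rewrite /princ big_nil.
by apply/eqP => h; apply: no; exists A.
Qed.

Lemma kohnen_princ M phi k0 : mpl M phi k0 -> exists L, approx (part s M phi F) (princ L).
Proof.
move=> hM; have [L0 h0] := part_princ hM.
have hv v : exists L, approx (part s (xiM v M) (xphi v M phi) f) (princ L).
  by have [k hk] := mpl_xphi v hM; apply: part_princ hk.
have [Lv hLv] := choice hv.
pose sc (c : C) (L : seq (C * rat)) := [seq (c * x.1, x.2) | x <- L].
have scE c L z : princ (sc c L) z = c * princ L z.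
  rewrite /princ big_map mulr_sumr; apply: eq_bigr => x _; by rewrite mulrA.
have catE L L' z : princ (L ++ L') z = princ L z + princ L' z by rewrite /princ big_cat.
exists (sc 2^-1 (L0 ++ sc (al R s)^-1 (flatten [seq Lv v | v <- [:: -1; 0; 1; 2 : int]]))).
apply: approx_ext (kohnen_approx hM h0 (fun v _ => hLv v)) => // z _.
by rewrite scE catE scE /= !catE /princ big_nil !big_cons big_nil -!/(princ _ _).
Qed.

Lemma F_meromorphic r : meromorphic_at s F r.
Proof.
move=> G X [dG _] EG mX X1; have [k k1 [hX hE]] := lift_mpl s dG mX X1.
have [L hL] := kohnen_princ hX; have [h [a [h0 hn hs _ _]]] := F_expansion hX hL.
exists h, a; split; last by [].
split; [exact: h0|exact: hn|].
by move=> z zH; rewrite hE; apply: hs.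
Qed.

Lemma p_ndvd4 : ~~ (p %| 4)%N.
Proof.
apply/negP => h; have : (p %| 2)%N by move: h; rewrite (_ : 4 = 2 ^ 2)%N // Euclid_dvdX // andbT.
by rewrite dvdn_prime2 // => /eqP E; move: p_odd; rewrite E.
Qed.

(** If a lower left entry vanished, reduction modulo p would give p | A_11 y, because p | A_10; but
    p divides neither A_11 nor y. For the xi terms y is 4c modulo p, and p is odd. *)
Lemma F_vanish (M : 'M[int]_2) phi k0 : mpl M phi k0 -> ~~ (p %| `|M 1%R 0%R|)%N ->
  approx (part s M phi F) (princ [::]).
Proof.
move=> hM pc.
have key (x y : int) A : Gamma0 N A -> ~~ (p %| `|y|)%N -> A 1 0 * x + A 1 1 * y != 0.
  move=> [dA /dvdzP[q hq]] py; apply/eqP => h.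
  have pA (w : int) : (p%:Z %| q * N%:Z * w)%Z.
    by apply: dvdz_mulr; apply: dvdz_mull; rewrite PoszM; apply: dvdz_mull.
  have : (p%:Z %| A 1%R 1%R * y)%Z.
    have -> : A 1 1 * y = - (q * N%:Z * x) by rewrite -hq; apply/eqP; rewrite -addr_eq0 addrC h.
    by rewrite rpredN.
  rewrite dvdzE abszM /= Euclid_dvdM // (negbTE py) orbF => pd.
  have : (p%:Z %| \det A)%Z.
    rewrite det2; apply: rpredB; first by apply: dvdz_mull; rewrite dvdzE.
    by rewrite hq mulrC; apply: pA.
  by rewrite dA dvdzE /= dvdn1 => /eqP p1; move: p_prime; rewrite p1.
have z0 : approx (part s M phi f) (fun=> 0).
  by apply: (part_approx0 m s2 hM) => A gA; rewrite mulmx2; apply: key.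
apply: approx_ext (kohnen_approx hM z0 (Q := fun _ _ => 0) _) => [//|z _|v _].
  by rewrite /princ big_nil big1 // mulr0 addr0 mulr0.
have [k hk] := mpl_xphi v hM; apply: (part_approx0 m s2 hk) => A gA; rewrite mulmx2; apply: key => //.
have [a b c d] := A_E p v; have [a' b' c' d'] := mx2E 4 1 0 (4 : int).
rewrite /xiM -mulmxA !mulmx2 /xiZ c' d' c d.
have -> : 0 * (A_ p v 0 0 * M 0 0 + A_ p v 0 1 * M 1 0) + 4 * (4 * p%:Z * v * M 0 0 + 1 * M 1 0)
  = 16 * v * M 0 0 * p%:Z + 4 * M 1 0 by ring.
apply/negP => h; have : (p%:Z %| 4 * M 1%R 0%R)%Z.
  have -> : 4 * M 1 0 = (16 * v * M 0 0 * p%:Z + 4 * M 1 0) - 16 * v * M 0 0 * p%:Z by ring.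
  by apply: rpredB; [rewrite dvdzE|apply: dvdz_mull].
by rewrite dvdzE abszM /= Euclid_dvdM // (negbTE pc) orbF (negbTE p_ndvd4).
Qed.

Lemma F_vanishes_at r : r \in [:: Some 0; Some (1 / 2); Some (1 / 4)] ->
  holomorphic_at s F r /\ vanishes_at s F r.
Proof.
move=> hr.
suff H : vanishes_at s F r.
  split=> // G X gG EG mX X1; have [h [a [ha hz]]] := H G X gG EG mX X1.
  by exists h, a; split=> // n n0; apply: hz; apply: ltW.
move=> G X [dG _] EG mX X1; have [k k1 [hX hE]] := lift_mpl s dG mX X1.
(* The determinant forces the lower left entry to be 1, 2 or 4 up to sign at the cusps 0, 1/2 and
   1/4. *)
have pc : ~~ (p %| `|G 1%R 0%R|)%N.
  have n4 (t : nat) : (t %| 4)%N -> ~~ (p %| t)%N.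
    by move=> t4; apply: contraNN p_ndvd4 => pt; apply: dvdn_trans t4.
  have [t t4 E] : exists2 t : nat, (t %| 4)%N & `|G 1%R 0%R|%N = t; last by rewrite E n4.
  move: EG hr; rewrite /image_of_infty; have [//|c0] := eqVneq (G 1 0) 0.
    by move=> _ <-.
  move=> <-; rewrite det2 in dG; set a := G 0 0 in dG *; set b := G 0 1 in dG; set c := G 1 0 in dG c0 *.
  set d := G 1 1 in dG; have cq : c%:~R != 0 :> rat by rewrite intr_eq0.
  have unit1 (x y : int) : x * y = 1 -> `|x|%N = 1%N.
    by move=> h; have := congr1 absz h; rewrite abszM => /eqP; rewrite muln_eq1 => /andP[/eqP].
  rewrite !inE => /or3P[] /eqP [] h.
  - exists 1%N => //; apply: (unit1 _ (- b)); rewrite -dG.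
    have -> : a = 0 by apply/eqP; move/eqP: h; rewrite mulf_eq0 invr_eq0 (negbTE cq) orbF intr_eq0.
    by ring.
  - have E : c = 2 * a.
      apply/eqP; rewrite -(eqr_int rat) rmorphM /=; apply/eqP.
      by rewrite -[a%:~R](divfK cq) h; field.
    exists 2%N => //; rewrite E abszM (unit1 a (d - 2 * b)) //; apply: etrans dG; rewrite E; ring.
  - have E : c = 4 * a.
      apply/eqP; rewrite -(eqr_int rat) rmorphM /=; apply/eqP.
      by rewrite -[a%:~R](divfK cq) h; field.
    exists 4%N => //; rewrite E abszM (unit1 a (d - 4 * b)) //; apply: etrans dG; rewrite E; ring.
have [h [a [h0 hn hs ha _]]] := F_expansion hX (F_vanish hX pc).
exists h, a; split; last by move=> n n0; rewrite ha // big_nil.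
split; [exact: h0|exact: hn|]; by move=> z zH; rewrite hE; apply: hs.
Qed.

End KohnenParts.

(** * The cusp at infinity *)

Section Infinity.
Variable R : realType.
Local Notation C := (CC R).
Local Notation I := (imagi R).
Variables (p s : nat) (m : int).
Local Notation N := (4 * p)%N.
Local Notation n := (2 * s + 1)%N.

Lemma e_div4_1 (k : int) : e (k%:~R / 4 : C) = 1 -> (4 %| k)%Z.
Proof.
have [q hq] := mod4P k; have E (r : int) : k = 4 * q + r -> e (k%:~R / 4 : C) = e (r%:~R / 4).
  move=> ->; rewrite rmorphD rmorphM /= mulrDl mulrAC divff ?pnatr_eq0 // mul1r addrC e_addint //.
have i2 := imagi2 R.
have i1 : I = 1 -> False.
  by move=> h; have := congr1 (@complex.Im R) h; rewrite Im_i Im1 => /eqP; rewrite oner_eq0.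
have im1 : -1 = 1 :> C -> False.
  move=> h; have := congr1 (@complex.Re R) h; rewrite ReN Re1 => /eqP; rewrite -subr_eq0 => /eqP; lra.
case: hq => Ek.
- by rewrite Ek dvdz_mulr.
- by rewrite (E 1) // mul1r e_quarter => /i1.
- rewrite (E 2) // (_ : (2 : int)%:~R / 4 = 2^-1 :> C); last by field.
  by rewrite e_half => /im1.
- rewrite (E 3) // (_ : (3 : int)%:~R / 4 = 3%:R * 4^-1 :> C) // eMn e_quarter exprS i2 mulrN1.
  by move=> h; exfalso; apply: i1; rewrite -[I]opprK h; apply: etrans (_ : I ^+ 2 = 1); [rewrite i2|rewrite -[I]opprK h sqrrN expr1n].
Qed.

Lemma om_sqr_e : om R s ^+ 2 = e ((n%:Z)%:~R / 4).
Proof. by rewrite om_sqr -e_quarter -eMn -pmulrn. Qed.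

(** With y = e(k/4) the equation becomes (y - 1)(y - om^2) = 0, and om^2 = e(n/4). *)
Lemma plus_factor (k : int) : (om R s)^-1 * e (k%:~R / 4) + om R s * e (- (k%:~R / 4)) = al R s <->
  (4 %| k)%Z \/ (4 %| k - n%:Z)%Z.
Proof.
have o0 := om_neq0 R s; have y0 := e_neq0 (k%:~R / 4 : C); rewrite eN.
have key : (om R s)^-1 * e (k%:~R / 4) + om R s * (e (k%:~R / 4))^-1 - al R s =
    (e (k%:~R / 4) - 1) * (e (k%:~R / 4) - om R s ^+ 2) / (om R s * e (k%:~R / 4)).
  by rewrite /al; field; rewrite o0 y0.
have omk : e (k%:~R / 4) - om R s ^+ 2 = 0 <-> (4 %| k - n%:Z)%Z.
  rewrite om_sqr_e; split=> [/eqP|h]; last by rewrite (e_div4 _ h) subrr.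
  rewrite subr_eq0 => /eqP h; apply: e_div4_1; rewrite rmorphB /= mulrBl eB h divff //.
  exact: e_neq0.
have e1 : e (k%:~R / 4 : C) - 1 = 0 <-> (4 %| k)%Z.
  split=> [/eqP|h]; first by rewrite subr_eq0 => /eqP; apply: e_div4_1.
  have h0 : (4 %| k - 0)%Z by rewrite subr0.
  by rewrite (e_div4 _ h0) mul0r e_0 subrr.
split=> [h|h].
  move: key; rewrite h subrr => /esym/eqP; rewrite !mulf_eq0 invr_eq0 mulf_eq0 (negbTE o0) (negbTE y0) !orbF.
  by move=> /orP[]/eqP; [left; apply/e1|right; apply/omk].
apply/eqP; rewrite -subr_eq0 key.
by case: h => [/e1 h|/omk h]; rewrite h !(mul0r, mulr0).
Qed.

(** Translates between 2s + 1, which comes from the automorphy factor, and the sign (-1)^s of the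
    plus-space condition. *)
Lemma sign_mod4 : exists t : int, n%:Z - (-1) ^+ s = 4 * t.
Proof.
elim: s => [|k [t ht]]; first by exists 0.
have : (-1) ^+ k.+1 = - (-1) ^+ k :> int by rewrite exprS mulN1r.
have [E|E] : (-1) ^+ k = 1 :> int \/ (-1) ^+ k = -1 :> int.
  by rewrite -signr_odd; case: (odd k); [right|left].
- by rewrite E in ht *; move=> ->; exists (t + 1); lia.
- by rewrite E in ht *; move=> ->; exists t; lia.
Qed.

Lemma mod4_0 (k : int) : ((-1) ^+ s * k = 0 %[mod 4])%Z <-> (4 %| k)%Z.
Proof.
have u : (-1) ^+ s * (-1) ^+ s = 1 :> int by rewrite -expr2 sqrr_sign.
have E : (4 %| (-1) ^+ s * k)%Z = (4 %| k)%Z.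
  apply/idP/idP => h; last exact: dvdz_mull.
  have -> : k = (-1) ^+ s * ((-1) ^+ s * k) by rewrite mulrA u mul1r.
  exact: dvdz_mull.
rewrite -E; split=> [/eqP|h]; first by rewrite eqz_mod_dvd subr0.
by apply/eqP; rewrite eqz_mod_dvd subr0.
Qed.

Lemma mod4_1 (k : int) : ((-1) ^+ s * k = 1 %[mod 4])%Z <-> (4 %| k - n%:Z)%Z.
Proof.
have u : (-1) ^+ s * (-1) ^+ s = 1 :> int by rewrite -expr2 sqrr_sign.
have [t ht] := sign_mod4.
have E : k - n%:Z = (-1) ^+ s * ((-1) ^+ s * k - 1) + 4 * - t.
  rewrite mulrBr mulrA u mul1r mulr1 mulrN -ht; ring.
have E' : (-1) ^+ s * k - 1 = (-1) ^+ s * (k - n%:Z + 4 * t).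
  by rewrite E mulrN subrK mulrA u mul1r.
split=> [/eqP|h].
  by rewrite eqz_mod_dvd => h; rewrite E; apply: rpredD; [apply: dvdz_mull|apply: dvdz_mulr].
by apply/eqP; rewrite eqz_mod_dvd E'; apply: dvdz_mull; apply: rpredD => //; apply: dvdz_mulr.
Qed.

Hypothesis p_prime : prime p.
Hypothesis p_odd : odd p.
Hypothesis s2 : (2 <= s)%N.
Local Notation f := (@Fcal R p s m).
Local Notation F := (kohnen p s f).

Let fi : invariant_form p s f := @Fcal_invariant R p s m s2.

Lemma part_id (g : C -> C) (z : C) : part s 1%:M (fun=> 1) g z = g z.
Proof. by rewrite /part expr1n invr1 mul1r mob1. Qed.

Lemma approx_Fcal : approx f (fun z => e (m%:~R * z)).
Proof.
have g1 : Gamma0 N 1%:M by split; [rewrite det1|rewrite mxE /= dvdz0].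
have h1 : (1%:M *m 1%:M : 'M[int]_2) 1 0 = 0 by rewrite mulmx1 mxE.
apply: approx_ext (part_approx1 m s2 (mpl_id R) g1 h1) => z zH; first by rewrite part_id.
by rewrite expr1n invr1 mul1r /term theta_jE !mob1 divff ?theta_neq0 // expr1n invr1 mul1r.
Qed.

(** A parity argument: an exceptional coset would force A_11 to be even, and A_10 is even as well,
    against the determinant. *)
Lemma approx_odd (v : int) : v = 1 \/ v = -1 -> approx (slash_xi s f (A_ p v)) (fun=> 0).
Proof.
move=> hv; have [k hk] := mpl_xphi p v (mpl_id R).
apply: approx_ext (part_approx0 (p := p) m s2 hk _) => [z zH|//|A gA].
  by rewrite -(part_slash_xi p s m v (mpl_id R)) // part_id.
have [dA /dvdzP[w hw]] := gA; have [a b c d] := A_E p v; have [a' b' c' d'] := mx2E 4 1 0 (4 : int).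
rewrite /xiM mulmx1 !mulmx2 /xiZ a' b' c' d' a c hw PoszM.
apply/eqP => h; have [t ht] : exists t : int, A 1 1 = 2 * t.
  have [k' hk'] : exists k' : int, p%:Z = 2 * k' + 1.
    by exists p./2%:Z; rewrite -{1}(odd_double_half p) p_odd; lia.
  have p0 : p%:Z != 0 by rewrite gt_eqF // ltz_nat prime_gt0.
  have e1 : w * (1 + p%:Z * v) + v * A 1 1 = 0.
    apply/eqP; rewrite -(mulrI_eq0 _ (mulfI (mulf_neq0 (isT : (16 : int) != 0) p0))); apply/eqP.
    by apply: etrans h; ring.
  case: hv => ev; rewrite ev hk' in e1.
    by exists (- (w * (k' + 1))); lia.
  by exists (- (w * k')); lia.
move: dA; rewrite det2 ht hw PoszM => dA.
have : 2 * (A 0 0 * t - A 0 1 * w * 2 * p%:Z) = 1 by apply: etrans dA; ring.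
by move: (_ - _) => x; lia.
Qed.

Hypothesis hm : (4 %| m)%Z \/ (4 %| m - n%:Z)%Z.

(** The v = 0 and v = 2 terms are translates of the plain series; by [plus_factor] their leading
    parts add up to al e(mz), so the two halves of F give e(mz) with coefficient 1. *)
Lemma approx_F : approx F (fun z => e (m%:~R * z)).
Proof.
have fq := approx_Fcal; have o0 := om_neq0 R s; have a0 := al_neq0 R s.
have sp := approx_shift 4^-1 fq; have sm := approx_shift (- 4^-1) fq.
have H := approxZ 2^-1 (approxD fq (approxZ (al R s)^-1 (approxD (approxD
  (approxD (approx_odd (or_intror erefl)) (approxZ (om R s)^-1 sp)) (approx_odd (or_introl erefl))) (approxZ (om R s) sm)))).
apply: approx_ext H => z zH; rewrite ?ofRN ofRV (ofR_nat R 4).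
  by rewrite /kohnen /Wsum !big_cons big_nil addr0 slash_xi_A0 // slash_xi_A2 // !addrA.
have h : (om R s)^-1 * e (m%:~R * (z + 4^-1)) + om R s * e (m%:~R * (z - 4^-1)) = al R s * e (m%:~R * z).
  by rewrite -((plus_factor m).2 hm) !mulrDr mulrN !eD; ring.
rewrite add0r addr0 h mulrA mulVf // mul1r.
by field.
Qed.

Lemma F_period1 (z : C) : upper_half z -> F (z + 1) = F z.
Proof.
move=> zH; pose T : 'M[int]_2 := mx2 1 1 0 1; have [a b c d] := mx2E (1 : int) 1 0 1.
have gT : Gamma0 N T by split; [rewrite det2 /T a b c d; ring|rewrite /T c dvdz0].
have E : mob T z = z + 1 by rewrite /mob /jd /T a b c d mul0r add0r divr1 mul1r.
have h := kohnen_invariant fi gT zH; rewrite theta_jE E in h.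
rewrite h -[z + 1]/(z + (1 : int)%:~R) theta_int // divff ?theta_neq0 //.
by rewrite expr1n mul1r.
Qed.

Lemma F_goodH : goodH F.
Proof. by apply: goodH_ext (part_kohnen_goodH p m s2 (mpl_id R)) => z _; rewrite part_id. Qed.

Lemma princ1 (c : C) (k : int) (z : C) : princ [:: (c, k%:~R)] z = c * e (k%:~R * z).
Proof. by rewrite /princ big_seq1 /= ratr_int. Qed.

Lemma zero_coef (b : int -> C) (n0 : int) : (forall k, k < n0 -> b k = 0) ->
  (forall z, upper_half z -> has_sum (fun k : int => b k * e (k%:~R * z)) 0) -> forall k, b k = 0.
Proof.
move=> hn hs k; apply/eqP; apply: contraT => /eqP bk; exfalso.
(* Uniqueness of expansions: multiplying by e(-(k + 1)z) moves the coefficient in question to index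
   -1, where it would produce growth. *)
apply: (@expansion_unbounded R (fun=> 0) 1 (fun j => b (j + (k + 1))) (n0 - (k + 1)) (-1)) => //.
- by move=> j hj; apply: hn; rewrite -ltrBrDr.
- by rewrite addrCA addNr addr0.
- move=> z zH; have S := has_sumZ (c := e (- ((k + 1)%:~R * z))) (hs z zH).
  rewrite mulr0 in S.
  have inj : injective (fun j : int => j + (k + 1)) by apply: addIr.
  have hx j : (forall i : int, j <> i + (k + 1)) -> e (- ((k + 1)%:~R * z)) * (b j * e (j%:~R * z)) = 0.
    by move=> hj; exfalso; apply: (hj (j - (k + 1))); rewrite subrK.
  apply: (eq_has_sum _ ((has_sum_inj 0 inj hx).1 S)) => j /=.
  rewrite mulrCA -eD; congr (_ * e _); rewrite divr1 [(j + _)%:~R]rmorphD /= mulrDl.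
  by rewrite addrCA addNr addr0.
- by move=> B eps e0; exists 1 => // z _ _; rewrite subrr nm0 ltW.
Qed.

Lemma F_q_expansion : exists a : int -> C, [/\ forall k, k <= 0 -> a k = 0,
  forall k, ~ ((4 %| k)%Z \/ (4 %| k - n%:Z)%Z) -> a k = 0 &
  forall z, upper_half z -> has_sum (fun k : int => a k * e (k%:~R * z)) (F z - e (m%:~R * z))].
Proof.
pose L : seq (C * rat) := [:: (1, m%:~R)].
have PE z : princ L z = e (m%:~R * z) by rewrite princ1 mul1r.
have ap : approx F (princ L) by apply: approx_ext approx_F => // z _; rewrite PE.
have per z : upper_half z -> F (z + 1%:R) - princ L (z + 1%:R) = F z - princ L z.
  move=> zH; rewrite F_period1 // princ_periodic // => x; rewrite inE => /eqP ->.
  by exists m; rewrite mulr1.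
have [a [a0 hs]] := fourier_period (isT : (0 < 1)%N) (goodHB F_goodH (goodH_princ L)) per
  (approx_vanishes (isT : (0 < 1)%N) ap per).
have hs1 z : upper_half z -> has_sum (fun k : int => a k * e (k%:~R * z)) (F z - e (m%:~R * z)).
  by move=> zH; rewrite -PE; apply: (eq_has_sum _ (hs z zH)) => k /=; rewrite divr1.
exists a; split=> // k hk.
(* The coefficients of the identity [kohnen_plus] applied to F - e(mz). They all vanish, and the
   factor in front of a_j is non-zero at every forbidden index. *)
pose b (j : int) := ((om R s)^-1 * e (j%:~R / 4) + om R s * e (- (j%:~R / 4)) - al R s) * a j.
have bk : b k = 0.
  apply: (zero_coef (n0 := 1)) => [j j1|z zH].
    by rewrite /b a0 ?mulr0 // -ltzD1.
  have zp := upper_quarter zH; have zm := upper_quarterB zH.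
  have S := has_sumB (has_sumD (has_sumZ (c := (om R s)^-1) (hs1 _ zp)) (has_sumZ (c := om R s) (hs1 _ zm)))
    (has_sumZ (c := al R s) (hs1 _ zH)).
  have lin (o l x1 x2 x3 y1 y2 y3 : C) : o^-1 * x1 + o * x2 = l * x3 ->
      o^-1 * y1 + o * y2 = l * y3 -> o^-1 * (x1 - y1) + o * (x2 - y2) - l * (x3 - y3) = 0.
    move=> e1 e2; have -> : o^-1 * (x1 - y1) + o * (x2 - y2) - l * (x3 - y3) =
      (o^-1 * x1 + o * x2 - l * x3) - (o^-1 * y1 + o * y2 - l * y3) by ring.
    by rewrite e1 e2 !subrr.
  have Z0 : (om R s)^-1 * (F (z + 4^-1) - e (m%:~R * (z + 4^-1)))
      + om R s * (F (z - 4^-1) - e (m%:~R * (z - 4^-1))) - al R s * (F z - e (m%:~R * z)) = 0.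
    have h1 := kohnen_plus p_odd fi zH.
    have h2 : (om R s)^-1 * e (m%:~R * (z + 4^-1)) + om R s * e (m%:~R * (z - 4^-1)) = al R s * e (m%:~R * z).
      by rewrite -((plus_factor m).2 hm) !mulrDr mulrN !eD; ring.
    exact: lin h1 h2.
  rewrite Z0 in S.
  apply: (eq_has_sum _ S) => j /=; rewrite /b !mulrDr mulrN !eD; ring.
move/eqP: bk; rewrite mulf_eq0 => /orP[|/eqP //]; rewrite subr_eq0 => /eqP h.
by exfalso; apply: hk; apply/plus_factor.
Qed.

End Infinity.

(** * Detecting poles from the leading behaviour *)

Section Poles.
Variable R : realType.
Local Notation C := (CC R).
Local Notation I := (imagi R).
Variables (p s : nat) (m : int).
Local Notation N := (4 * p)%N.
Local Notation n := (2 * s + 1)%N.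
Hypothesis p_prime : prime p.
Hypothesis p_odd : odd p.
Hypothesis s2 : (2 <= s)%N.
Hypothesis m0 : m < 0.
Local Notation f := (@Fcal R p s m).
Local Notation F := (kohnen p s f).

(** For c = 0 a pole would contradict [expansion_unbounded]; for c <> 0 the coefficient is read off
    from the principal part. *)
Lemma pole_iff G0 phi0 k0 (c : C) (l : rat) r : Gamma0 1 G0 -> image_of_infty G0 = r ->
  mpl G0 phi0 k0 -> nm k0 = 1 -> l < 0 ->
  approx (part s G0 phi0 F) (fun z => c * e (ratr l * z)) -> has_pole_at s F r <-> c <> 0.
Proof.
move=> gG ir hG k1 l0 ap; split.
  move=> hp c0; have [dG _] := gG; rewrite c0 in ap.
  have [h [a [[h0 [n0 hn] hs] [n1 [n10 an]]]]] := hp G0 (mxQ G0, phi0) gG ir (mpl_lift dG hG k1) erefl.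
  apply: (expansion_unbounded h0 hn n10 an (g := part s G0 phi0 F)).
    by move=> z zH; have := hs z zH; rewrite /slash /part /= mobius_mxQ.
  by apply: approx_ext ap => // z _; rewrite mul0r.
move=> /eqP c0; have {}ap : approx (part s G0 phi0 F) (princ [:: (c, l)]).
  by apply: approx_ext ap => // z _; rewrite /princ big_seq1.
have [h [a [h0 [n0 hn] hs ha hu]]] := F_expansion p_prime s2 hG ap.
have [u Eu] := hu (c, l) (mem_head _ _); rewrite /= in Eu.
have u0 : u < 0 by rewrite -(ltr_int rat) -Eu nmulr_rlt0 // ltr0n.
apply: (at_cusp_intro gG ir hG h0 hn hs) => d d0.
exists u; split=> //; apply/eqP; rewrite mulf_neq0 // ha ?ltW //.
by rewrite big_cons big_nil /= Eu eqxx addr0.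
Qed.

Lemma F_pole_infty : (4 %| m)%Z \/ (4 %| m - n%:Z)%Z -> has_pole_at s F None.
Proof.
move=> hm.
have g1 : Gamma0 1 1%:M by split; [rewrite det1|rewrite mxE /= dvdz0].
have i1 : image_of_infty 1%:M = None by rewrite /image_of_infty mxE eqxx.
have ml : m%:~R < 0 :> rat by rewrite ltrz0.
apply/(pole_iff g1 i1 (mpl_id R) (nm1 R) ml (c := 1)); last by apply/eqP; rewrite oner_neq0.
have h : approx F (fun z => e (m%:~R * z)) := approx_F p_prime p_odd s2 hm.
apply: approx_ext h => z zH; first by rewrite part_id.
by rewrite mul1r ratr_int.
Qed.

End Poles.

(** * The cusps 1/p and 1/(2p) *)

Section PhaseRelations.
Variable R : realType.
Local Notation C := (CC R).
Local Notation I := (imagi R).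

Lemma affine_zero (a b q1 q2 : C) : q1 != q2 -> a * q1 + b = 0 -> a * q2 + b = 0 -> a = 0 /\ b = 0.
Proof.
move=> q12 h1 h2; have a0 : a = 0.
  have : a * (q1 - q2) = 0 by rewrite mulrBr -[RHS](subrr 0) -{1}h1 -h2; ring.
  by move/eqP; rewrite mulf_eq0 subr_eq0 (negbTE q12) orbF => /eqP.
by split=> //; move: h1; rewrite a0 mul0r add0r.
Qed.

(* The four relations X + d Y = c (1 + ep q), one for each fourth root of unity
   ep, with d = ep or d = ep^-1 throughout, determine the ratios of the constants
   c as soon as q takes two values. *)
Lemma phase_relation (ep d c c0 c2 : C) (X Y q G : bool -> C) :
  q true != q false -> (forall b, G b != 0) -> ep ^+ 2 = -1 -> d = ep \/ d = - ep ->
  (forall b, X b + Y b = c0 * G b * (1 + q b)) ->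
  (forall b, X b - Y b = c2 * G b * (1 - q b)) ->
  (forall b, X b + d * Y b = c * G b * (1 + ep * q b)) ->
  if d == ep then c2 = c0 /\ c = c0 else c2 = - c0 /\ c = d * c0.
Proof.
move=> q12 G0 e2 hd h0 h2 h; have e0 : ep != 0.
  by apply: contra_eq_neq e2 => ->; rewrite expr0n /= eq_sym oppr_eq0 oner_neq0.
have key b : ((c0 - c2) + d * (c0 + c2) - 2 * c * ep) * q b + ((c0 + c2) + d * (c0 - c2) - 2 * c) = 0.
  apply: (mulfI (G0 b)); rewrite mulr0.
  have -> : G b * (((c0 - c2) + d * (c0 + c2) - 2 * c * ep) * q b + ((c0 + c2) + d * (c0 - c2) - 2 * c))
    = (c0 * G b * (1 + q b)) * (1 + d) + (c2 * G b * (1 - q b)) * (1 - d) - 2 * (c * G b * (1 + ep * q b)) by ring.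
  by rewrite -h0 -h2 -h; ring.
have [E1 E2] := affine_zero q12 (key true) (key false).
have n2 : (2 : C) != 0 by rewrite pnatr_eq0.
case: hd => ed; rewrite ed in E1 E2 *.
  rewrite eqxx; have h3 : 2 * (c0 - c2) = 0.
    have -> : 2 * (c0 - c2) = (c0 - c2 + ep * (c0 + c2) - 2 * c * ep)
      - ep * (c0 + c2 + ep * (c0 - c2) - 2 * c) + (ep ^+ 2 + 1) * (c0 - c2) by ring.
    by rewrite E1 E2 e2; ring.
  have E : c2 = c0.
    by move/eqP: h3; rewrite mulf_eq0 (negbTE n2) subr_eq0 => /eqP.
  split=> //; apply: (mulfI n2); apply/eqP; rewrite eq_sym -subr_eq0 -E2 E; apply/eqP; ring.
have -> : (- ep == ep) = false.
  by apply/negbTE; rewrite eq_sym -addr_eq0 -mulr2n -mulr_natr mulf_neq0.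
have h3 : (2 * ep) * (c0 + c2) = 0.
  have -> : (2 * ep) * (c0 + c2) = - (c0 - c2 + - ep * (c0 + c2) - 2 * c * ep)
      + ep * (c0 + c2 + - ep * (c0 - c2) - 2 * c) + (ep ^+ 2 + 1) * (c0 - c2) by ring.
  by rewrite E1 E2 e2; ring.
have E : c2 = - c0.
  by move/eqP: h3; rewrite !mulf_eq0 (negbTE n2) (negbTE e0) addrC addr_eq0 => /eqP.
split=> //; apply: (mulfI n2); apply/eqP; rewrite eq_sym -subr_eq0 -E2 E; apply/eqP; ring.
Qed.

Lemma thetaD_neq0 (z : C) : upper_half z -> thetaD z != 0.
Proof.
by move=> zH; rewrite mulf_neq0 ?invr_neq0 ?theta_neq0 //; apply: upper_half2.
Qed.

(** A matrix of Gamma0(4) with [qchar] equal to 1 multiplies the non-zero function [thetaD] by -I.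
    This provides the two values that [phase_relation] needs. *)
Lemma thetaD_nonconst : exists w1 w2 : C, [/\ upper_half w1, upper_half w2 & thetaD w1 != thetaD w2].
Proof.
have iH : upper_half I by rewrite /upper_half /mkset Im_i ltr01.
have g4 : Gamma0 4 (A_ 1 1) by apply: (A_Gamma0 1 1).
have [dA _] := g4.
exists I, (mob (A_ 1 1) I); split=> //; first by apply: mob_up; rewrite ?dA.
rewrite thetaD_gamma // (_ : e (- _) = I^-1); last first.
  by rewrite eN qchar_A -e_quarter; congr (e _)^-1; rewrite rmorphM /=; field.
rewrite eq_sym -subr_eq0 -{2}(mul1r (thetaD I)) -mulrBl.
rewrite mulf_neq0 ?thetaD_neq0 // subr_eq0; apply/eqP => h.
have : I = 1 by rewrite -[I]invrK h invr1.
by move/(congr1 (@complex.Im R)); rewrite Im_i Im1 => /eqP; rewrite oner_eq0.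
Qed.

(** Since p is odd, e(kp/4) is a fourth root of unity different from 1 unless 4 | k, and four
    consecutive powers of it cancel. *)
Lemma root_sum (p : nat) (k : int) : odd p ->
  \sum_(v <- [:: -1; 0; 1; 2 : int]) e ((k * (p%:Z * v))%:~R / 4 : C) = if (4 %| k)%Z then 4 else 0.
Proof.
move=> p_odd; case: ifP => h.
  have -> : \sum_(v <- [:: -1; 0; 1; 2 : int]) e ((k * (p%:Z * v))%:~R / 4 : C)
      = \sum_(v <- [:: -1; 0; 1; 2 : int]) 1.
    apply: eq_bigr => v _; have h0 : (4 %| k * (p%:Z * v) - 0)%Z by rewrite subr0 dvdz_mulr.
    by rewrite (e_div4 _ h0) mul0r e_0.
  by rewrite !big_cons big_nil; ring.
set x := e ((k * p%:Z)%:~R / 4 : C); have x0 : x != 0 by apply: e_neq0.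
have E (v : int) : e ((k * (p%:Z * v))%:~R / 4 : C) = x ^ v.
  by rewrite /x -eMz; congr e; rewrite !rmorphM /=; field.
rewrite !big_cons big_nil !E addr0 expr1z expr0z.
have x4 : x ^+ 4 = 1.
  by rewrite -eMn mulrC divfK ?pnatr_eq0 // e_int.
have x1 : x != 1.
  apply/eqP => /e_div4_1; rewrite Gauss_dvdzl ?h //.
  have h4 : coprime 4 p by rewrite (_ : 4 = 2 ^ 2)%N // coprimeXl // coprime2n.
  by rewrite /coprimez /gcdz /= (eqP h4).
have : (x - 1) * (1 + x + x ^+ 2 + x ^+ 3) = 0 by rewrite (_ : _ * _ = x ^+ 4 - 1); [rewrite x4 subrr|ring].
move/eqP; rewrite mulf_eq0 subr_eq0 (negbTE x1) /= => /eqP h4.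
have -> : x ^ (-1) + (1 + (x + x ^ 2)) = x^-1 * (1 + x + x ^+ 2 + x ^+ 3).
  by rewrite exprN1 (_ : x ^ 2 = x ^+ 2) //; field; rewrite x0.
by rewrite h4 mulr0.
Qed.

End PhaseRelations.

Lemma odd_sqr (a : int) : (exists k, a = 2 * k + 1) -> exists T : int, a ^+ 2 = 8 * T + 1.
Proof.
move=> [k ->]; have [j [E|E]] : exists j : int, k = 2 * j \/ k = 2 * j + 1.
  by exists (k %/ 2)%Z; lia.
- by exists (j * (2 * j + 1)); rewrite E; ring.
- by exists ((2 * j + 1) * (j + 1)); rewrite E; ring.
Qed.

Section PrimeCusps.
Variable R : realType.
Local Notation C := (CC R).
Local Notation I := (imagi R).
Variables (p s : nat) (m : int).
Local Notation N := (4 * p)%N.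
Local Notation n := (2 * s + 1)%N.
Hypothesis p_prime : prime p.
Hypothesis p_odd : odd p.
Hypothesis s2 : (2 <= s)%N.
Hypothesis m0 : m < 0.
Local Notation f := (@Fcal R p s m).
Local Notation F := (kohnen p s f).

Definition Lmx (u : int) : 'M[int]_2 := mx2 1 0 u 1.

Lemma LmxE (u : int) : [/\ Lmx u 0 0 = 1, Lmx u 0 1 = 0, Lmx u 1 0 = u & Lmx u 1 1 = 1].
Proof. exact: mx2E. Qed.

Lemma Lmx_det (u : int) : \det (Lmx u) = 1.
Proof. by have [a b c d] := LmxE u; rewrite det2 a b c d; ring. Qed.

(** A holomorphic square root of uz + 1, up to a constant, is needed. As theta_mult(w)^2 = i/(2w),
    this expression squares to -i (uz + 1) without any choice of branch. *)
Definition Lphi (u : int) (z : C) : C := (ofR (Num.sqrt 2) * theta_mult (u%:~R * z + 1))^-1.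

Lemma Lphi_mpl (u : int) : 0 < u -> mpl (Lmx u) (Lphi u) (- I).
Proof.
move=> u0; have up (z : C) : upper_half z -> upper_half (u%:~R * z + 1).
  move=> zH; rewrite -ofR1 upT -ofR_int; apply: upper_scale => //; by rewrite ltr0z.
have q2 : ofR (Num.sqrt 2) ^+ 2 = 2 :> C by rewrite -ofRX sqr_sqrtr // ofR_nat.
have i2 := imagi2 R; have i0 : I != 0 by rewrite -nm_gt0 nm_i.
have t0 (z : C) : upper_half z -> ofR (Num.sqrt 2) * theta_mult (u%:~R * z + 1) != 0.
  move=> zH; rewrite mulf_neq0 // -sqrf_eq0; first by rewrite q2 pnatr_eq0.
  apply/eqP => E; have := theta_mult_sqr (up z zH); rewrite E mulr0 => /esym/eqP.
  by rewrite mulf_eq0 (negbTE i0) invr_eq0 pnatr_eq0.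
split.
- by rewrite Lmx_det.
- by rewrite oppr_eq0.
- move=> z zH; have [l hl] := theta_mult_cderiv (up z zH).
  have dl : cderiv (fun w : C => u%:~R * w + 1) z (u%:~R * 1 + 0).
    by apply: cderivD; [apply: cderivZ; apply: cderiv_id|apply: cderiv_cst].
  have h := cderivZ (ofR (Num.sqrt 2)) (cderiv_comp (g := fun w => u%:~R * w + 1) hl dl).
  by eexists; apply: (cderivV (f := fun w => ofR (Num.sqrt 2) * theta_mult (u%:~R * w + 1)) (t0 z zH) h).
move=> z zH; have [_ _ c d] := LmxE u; rewrite /jd c d.
have w0 := H_neq0 (up z zH); have := theta_mult_sqr (up z zH).
rewrite /Lphi mulr1z; move: (theta_mult (u%:~R * z + 1)) => x; move: (u%:~R * z + 1) w0 => w w0 h.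
rewrite exprVn exprMn q2.
have -> : x ^+ 2 = I / (2 * w).
  by apply: (mulfI w0); rewrite h; field.
rewrite -[RHS](mulfK i0) mulNr mulNr mulrAC -expr2 i2; field; by rewrite w0 i0.
Qed.

(** An exceptional coset would force A_11 to be even, impossible beside the even entry A_10. *)
Lemma Lpart0 (t : int) : t = 1 \/ t = 2 -> approx (part s (Lmx (p%:Z * t)) (Lphi (p%:Z * t)) f) (fun=> 0).
Proof.
move=> ht; have pt0 : 0 < p%:Z * t by rewrite mulr_gt0 ?ltz_nat ?prime_gt0 //; case: ht => ->.
apply: (part_approx0 m s2 (Lphi_mpl pt0)) => A [dA /dvdzP[w hw]].
have [a b c d] := LmxE (p%:Z * t); rewrite mulmx2 a c hw PoszM mulr1; apply/eqP => h.
have e1 : 4 * w + t * A 1 1 = 0.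
  have p0 : p%:Z != 0 by rewrite gt_eqF // ltz_nat prime_gt0.
  by apply: (mulfI p0); rewrite mulr0 -h; ring.
have [x hx] : exists x, A 1 1 = 2 * x.
  by case: ht => et; rewrite et in e1; [exists (-2 * w)|exists (- w)]; lia.
move: dA; rewrite det2 hx hw PoszM => dA.
have : 2 * (A 0 0 * x - A 0 1 * w * 2 * p%:Z) = 1 by apply: etrans dA; ring.
by move: (_ - _) => y; lia.
Qed.

(** An inverse of the odd number q = 4 + p(1 + 4v) modulo 16, namely q^3, or of q = 2 + p(1 + 2v)
    modulo 8, namely q itself. It appears as the upper right entry of the triangular form. *)
Definition beta (t v : int) : int :=
  if t == 1 then (4 + p%:Z * (1 + 4 * v)) ^+ 3 else 2 + p%:Z * (1 + 2 * v).

(** The first column of xi A_v L is t times a coprime pair (q, 4pw), and the row (-4pw, q)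
    annihilates it. Completing this row to determinant 1 uses q^4 = 1 modulo 16, or q^2 = 1 modulo
    8. *)
Lemma exc_matrix (t v : int) : t = 1 \/ t = 2 -> exists A, Gamma0 N A /\
  A *m xiM p v (Lmx (p%:Z * t)) = mx2 t (beta t v) 0 (if t == 1 then 16 else 8).
Proof.
move=> ht; have [k Ek] : exists k : int, p%:Z = 2 * k + 1.
  by exists p./2%:Z; rewrite -{1}(odd_double_half p) p_odd; lia.
have [a b c d] := A_E p v; have [a' b' c' d'] := mx2E 4 1 0 (4 : int).
have [la lb lc ld] := LmxE (p%:Z * t).
have xE : xiM p v (Lmx (p%:Z * t)) = mx2 (4 + p%:Z * t + 4 * p%:Z * v) 1 (4 * (p%:Z * t + 4 * p%:Z * v)) 4.
  have [x1 x2 x3 x4] := mx2E (4 + p%:Z * t + 4 * p%:Z * v) 1 (4 * (p%:Z * t + 4 * p%:Z * v)) (4 : int).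
  by apply: mx2_eq; rewrite /xiM mulmx2 !(mulmx2 xiZ) /xiZ ?x1 ?x2 ?x3 ?x4 ?a' ?b' ?c' ?d' ?a ?b ?c ?d ?la ?lb ?lc ?ld; ring.
rewrite xE; have [x1 x2 x3 x4] := mx2E (4 + p%:Z * t + 4 * p%:Z * v) 1 (4 * (p%:Z * t + 4 * p%:Z * v)) (4 : int).
have build (x y q D : int) : x * q + 4 * p%:Z * D * y = 1 -> exists A, Gamma0 N A /\
   A = mx2 x y (- (4 * p%:Z * D)) q.
  move=> h; have [y1 y2 y3 y4] := mx2E x y (- (4 * p%:Z * D)) q.
  eexists; split; last by [].
  split; first by rewrite det2 y1 y2 y3 y4 -[RHS]h; ring.
  by rewrite y3 rpredN PoszM; apply: dvdz_mulr; apply: dvdzz.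
case: ht => ?; subst t; rewrite /beta /=.
  set q := 4 + p%:Z * (1 + 4 * v); have [T hT] : exists T : int, q ^+ 2 = 8 * T + 1.
    by apply: odd_sqr; exists (2 + k + 2 * p%:Z * v); rewrite /q Ek; ring.
  have q4 : q ^+ 4 = 16 * (T * (4 * T + 1)) + 1 by rewrite (exprM q 2 2) hT; ring.
  set y := T * (4 * T + 1) in q4.
  have [|A [gA EA]] := build (q ^+ 3 - 4 * y) y q (1 + 4 * v).
    have -> : (q ^+ 3 - 4 * y) * q + 4 * p%:Z * (1 + 4 * v) * y = q ^+ 4 - 16 * y by rewrite /q; ring.
    by rewrite q4; ring.
  exists A; split=> //; rewrite EA.
  have [y1 y2 y3 y4] := mx2E (q ^+ 3 - 4 * y) y (- (4 * p%:Z * (1 + 4 * v))) q.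
  have [z1 z2 z3 z4] := mx2E 1 (q ^+ 3) 0 (16 : int).
  apply: mx2_eq; rewrite mulmx2 ?x1 ?x2 ?x3 ?x4 ?y1 ?y2 ?y3 ?y4 ?z1 ?z2 ?z3 ?z4.
  - have -> : (q ^+ 3 - 4 * y) * (4 + p%:Z * 1 + 4 * p%:Z * v) + y * (4 * (p%:Z * 1 + 4 * p%:Z * v))
      = q ^+ 4 - 16 * y by rewrite /q; ring.
    by rewrite q4; ring.
  - by ring.
  - by rewrite /q; ring.
  - by rewrite /q; ring.
set q := 2 + p%:Z * (1 + 2 * v); have [T hT] : exists T : int, q ^+ 2 = 8 * T + 1.
  by apply: odd_sqr; exists (1 + k + p%:Z * v); rewrite /q Ek; ring.
have [|A [gA EA]] := build (q - 4 * T) T q (1 + 2 * v).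
  have -> : (q - 4 * T) * q + 4 * p%:Z * (1 + 2 * v) * T = q ^+ 2 - 8 * T by rewrite /q; ring.
  by rewrite hT; ring.
exists A; split=> //; rewrite EA.
have [y1 y2 y3 y4] := mx2E (q - 4 * T) T (- (4 * p%:Z * (1 + 2 * v))) q.
have [z1 z2 z3 z4] := mx2E 2 q 0 (8 : int).
apply: mx2_eq; rewrite mulmx2 ?x1 ?x2 ?x3 ?x4 ?y1 ?y2 ?y3 ?y4 ?z1 ?z2 ?z3 ?z4.
- have -> : (q - 4 * T) * (4 + p%:Z * 2 + 4 * p%:Z * v) + T * (4 * (p%:Z * 2 + 4 * p%:Z * v))
    = 2 * (q ^+ 2 - 8 * T) by rewrite /q; ring.
  by rewrite hT; ring.
- by ring.
- by rewrite /q; ring.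
- by rewrite /q; ring.
Qed.

Local Notation D t := (if t == 1 then 16 else 8 : int).
Local Notation L t := (Lmx (p%:Z * t)).
Local Notation phi t := (Lphi (p%:Z * t)).

Lemma L_pos (t : int) : t = 1 \/ t = 2 -> 0 < p%:Z * t.
Proof. by move=> ht; rewrite mulr_gt0 ?ltz_nat ?prime_gt0 //; case: ht => ->. Qed.

(** The constant [c] of the exceptional coset is not computed. Evaluating theta at the triangular
    image in two ways ties it to [thetaD] through a factor common to all v, which is enough to
    compare the four constants. *)
Lemma Lcusp_term (t v : int) : t = 1 \/ t = 2 -> exists c : C, [/\ c != 0,
  approx (part s (xiM p v (L t)) (xphi p v (L t) (phi t)) f) (fun z =>
    c ^- n * e (m%:~R * (beta t v)%:~R / (D t)%:~R) * e (ratr (m%:~R * t%:~R / (D t)%:~R) * z)) &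
  forall z, upper_half z -> theta ((t%:~R * z + (beta t v)%:~R) / (D t)%:~R) =
    c * (theta (mob (L t) z) / (2 * e 8^-1 * phi t z))
      * ((1 + I) + (1 - I) * e (- ((p%:Z * v)%:~R / 4)) * thetaD (mob (L t) z))].
Proof.
move=> ht; have hL := Lphi_mpl (L_pos ht).
have [k hM] := mpl_xphi p v hL; have [A [gA EA]] := exc_matrix v ht.
have [x1 x2 x3 x4] := mx2E t (beta t v) 0 (D t).
have h10 : (A *m xiM p v (L t)) 1 0 = 0 by rewrite EA x3.
have [c c0 H] := exc_term s m gA hM h10; rewrite EA x1 x2 x4 in H.
exists c; split=> //.
  by apply: approx_ext (part_approx1 m s2 hM gA h10) => // z zH; rewrite (H z zH).2.
move=> z zH; have [<- _] := H z zH; have [dL _ _ _] := hL; have [dA _] := gA; have [dM _ _ _] := hM.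
have wH := mob_up dL zH; have [dAv _] := A_Gamma0 p v.
have vH : upper_half (mob (A_ p v) (mob (L t) z)) by apply: mob_up; rewrite ?dAv.
have m1 : mob A (mob (xiM p v (L t)) z) = (t%:~R * z + (beta t v)%:~R) / (D t)%:~R.
  by rewrite -mobM ?dA // EA /mob /jd x1 x2 x3 x4 mul0r add0r.
have m2 : mob (xiM p v (L t)) z = mob (A_ p v) (mob (L t) z) + 4^-1.
  rewrite /xiM -mulmxA mobM; first last.
  - exact: zH.
  - by rewrite det_mulmx dAv mul1r.
  - by rewrite det_xiZ.
  by rewrite mob_xiZ mobM ?dAv.
have h1 := thetaE_gamma (gamma_4p4 (A_Gamma0 p v)) wH; rewrite qchar_A in h1.
have h2 : theta (mob (xiM p v (L t)) z) = thetaE (mob (A_ p v) (mob (L t) z)) * theta (mob (A_ p v) (mob (L t) z)).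
  by rewrite m2 /thetaE divfK // theta_neq0.
have E0 := thetaE_neq0 vH; have t1 := theta_neq0 wH; have t2 := theta_neq0 vH.
have p0 := mpl_neq0 hL zH; have e8 := e_neq0 (8^-1 : C).
have h3 : (1 + I) + (1 - I) * e (- ((p%:Z * v)%:~R / 4)) * thetaD (mob (L t) z) =
    2 * thetaE (mob (A_ p v) (mob (L t) z)) by rewrite h1; field.
rewrite h3 /xphi !theta_jE m1 h2.
move: (thetaE _) E0 (theta (mob (L t) z)) t1 (theta (mob (A_ p v) _)) t2 (phi t z) p0 (e _ : C) e8 (theta _).
move=> a a0 b b0 d d0 u u0 w w0 y; field.
by rewrite a0 b0 d0 u0 w0.
Qed.

(** Modulo 1, beta/D moves by -pv/4 for t = 1 and by pv/4 for t = 2. The minus sign comes from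
    cubing: q grows by 4pv, so q^3 grows by 12pv, which is -4pv modulo 16. *)
Lemma beta_shift (t v : int) : t = 1 \/ t = 2 -> exists j : int,
  4 * beta t v = 4 * beta t 0 + (if t == 1 then -1 else 1) * D t * (p%:Z * v) + 4 * D t * j.
Proof.
move=> ht; case: ht => ?; subst t; rewrite /beta /=; last by exists 0; ring.
have [k Ek] : exists k : int, p%:Z = 2 * k + 1.
  by exists p./2%:Z; rewrite -{1}(odd_double_half p) p_odd; lia.
have [T hT] : exists T : int, (4 + p%:Z * (1 + 4 * 0)) ^+ 2 = 8 * T + 1.
  by apply: odd_sqr; exists (2 + k); rewrite Ek; ring.
have -> : 4 + p%:Z * (1 + 4 * v) = (4 + p%:Z * (1 + 4 * 0)) + 4 * (p%:Z * v) by ring.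
set a := 4 + _ in hT *; set x := p%:Z * v.
exists (x + 6 * T * x + 3 * a * x ^+ 2 + 4 * x ^+ 3).
have -> : 4 * (a + 4 * x) ^+ 3 = 4 * a ^+ 3 + 48 * a ^+ 2 * x + 192 * a * x ^+ 2 + 256 * x ^+ 3 by ring.
by rewrite hT; ring.
Qed.

Lemma beta_frac (t v : int) : t = 1 \/ t = 2 -> exists j : int,
  (beta t v)%:~R / (D t)%:~R = (beta t 0)%:~R / (D t)%:~R
    + ((if t == 1 then -1 else 1) * (p%:Z * v))%:~R / 4 + j%:~R :> C.
Proof.
move=> ht; have [j hj] := beta_shift v ht; exists j.
have D0 : (D t)%:~R != 0 :> C by rewrite intr_eq0; case: ifP.
have h := congr1 (fun x : int => x%:~R : C) hj; rewrite /= !(rmorphD, rmorphM) /= in h.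
apply: (mulfI D0); apply: (@mulfI _ (4 : C)); first by rewrite pnatr_eq0.
rewrite rmorphM /= rmorphM /= [_ * (_ / _)]mulrC divfK //.
move: (D t)%:~R D0 h => d d0 h; rewrite h; field; exact: d0.
Qed.

Lemma Lcusp_phase (t : int) (c : int -> C) : t = 1 \/ t = 2 ->
  (forall v z, upper_half z -> theta ((t%:~R * z + (beta t v)%:~R) / (D t)%:~R) =
    c v * (theta (mob (L t) z) / (2 * e 8^-1 * phi t z))
      * ((1 + I) + (1 - I) * e (- ((p%:Z * v)%:~R / 4)) * thetaD (mob (L t) z))) ->
  forall v, v \in [:: -1; 0; 1; 2 : int] ->
    c v = (if t == 1 then 1 else e ((p%:Z * v)%:~R / 4)) * c 0.
Proof.
move=> ht H; have hL := Lphi_mpl (L_pos ht); have dL := Lmx_det (p%:Z * t).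
have [w1 [w2 [w1H w2H w12]]] := thetaD_nonconst R.
pose w (b : bool) := if b then w1 else w2.
have wH b : upper_half (w b) by case: b.
(* Points whose images under L are the two places where [thetaD] differs. *)
pose z b := mob (inv2x2 (L t)) (w b).
have zH b : upper_half (z b) by apply: mob_up; rewrite ?inv2x2_det ?dL.
have Lz b : mob (L t) (z b) = w b.
  by rewrite /z -mobM ?dL ?inv2x2_det ?dL // mulmx_inv2x2_r // mob1.
have D0 : 0 < (D t)%:~R :> R by rewrite ltr0z; case: ifP.
have t0 : 0 < t%:~R :> R by rewrite ltr0z; case: ht => ->.
pose y b := (t%:~R * z b + (beta t 0)%:~R) / (D t)%:~R.
have yH b : upper_half (y b).
  rewrite /y -!ofR_int -ofRV mulrC mulrDr mulrA -ofRM -ofRM upT; apply: upper_scale => //.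
  by rewrite mulr_gt0 // invr_gt0.
(* By [theta_even_odd], X is theta(4y) and Y is theta_odd(y): a translation of y by k/4 fixes the
   first and multiplies the second by e(k/4). *)
pose X b := (theta (y b) + theta (y b + 2^-1)) / 2.
pose Y b := (theta (y b) - theta (y b + 2^-1)) / 2.
(* Since 1 - I = (1 + I)(-I), the factor 1 + I goes into G and -I into q. *)
pose G b := theta (w b) / (2 * e 8^-1 * phi t (z b)) * (1 + I).
pose q b := - I * thetaD (w b).
have i2 := imagi2 R.
have i0 : I != 0 by rewrite -nm_gt0 nm_i.
have I1 : 1 + I != 0.
  apply/eqP => /(congr1 (@complex.Im R)); rewrite ImD Im1 Im_i Im0 add0r => /eqP; by rewrite oner_eq0.
have G0 b : G b != 0.
  rewrite !mulf_neq0 ?invr_eq0 ?theta_neq0 ?mulf_neq0 ?e_neq0 ?pnatr_eq0 //.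
  exact: mpl_neq0 hL (zH b).
have q12 : q true != q false by rewrite (inj_eq (mulfI _)) // oppr_eq0.
have rel v b : X b + e (((if t == 1 then -1 else 1) * (p%:Z * v))%:~R / 4) * Y b =
    c v * G b * (1 + e (- ((p%:Z * v)%:~R / 4)) * q b).
  have [j hj] := beta_frac v ht.
  have E : (t%:~R * z b + (beta t v)%:~R) / (D t)%:~R =
      y b + ((if t == 1 then -1 else 1) * (p%:Z * v))%:~R / 4 + j%:~R.
    by rewrite /y !mulrDl hj; ring.
  have h := H v (z b) (zH b); rewrite Lz E in h.
  have yvH : upper_half (y b + ((if t == 1 then -1 else 1) * (p%:Z * v))%:~R / 4).
    by rewrite -(ofR_nat R 4) -ofR_int -ofRV -ofRM upT.
  rewrite theta_int // theta_quarter // in h.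
  have -> : X b + e (((if t == 1 then -1 else 1) * (p%:Z * v))%:~R / 4) * Y b =
    ((1 + e (((if t == 1 then -1 else 1) * (p%:Z * v))%:~R / 4)) * theta (y b)
      + (1 - e (((if t == 1 then -1 else 1) * (p%:Z * v))%:~R / 4)) * theta (y b + 2^-1)) / 2.
    by rewrite /X /Y; field.
  rewrite h /G /q.
  have -> : 1 + I + (1 - I) * e (- ((p%:Z * v)%:~R / 4)) * thetaD (w b) =
    (1 + I) * (1 + e (- ((p%:Z * v)%:~R / 4)) * (- I * thetaD (w b)))
      + (I ^+ 2 + 1) * e (- ((p%:Z * v)%:~R / 4)) * thetaD (w b) by ring.
  by rewrite i2 addNr !mul0r addr0 !mulrA.
have [kp Ep] : exists k : int, p%:Z = 2 * k + 1.
  by exists p./2%:Z; rewrite -{1}(odd_double_half p) p_odd; lia.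
have r0 b : X b + Y b = c 0 * G b * (1 + q b).
  by have := rel 0 b; rewrite !mulr0 mul0r oppr0 e_0 !mul1r.
have half_odd (k : int) : (exists j, k = 2 * j + 1) -> e (k%:~R / 2 : C) = -1.
  by move=> [j ->]; apply: e_half_odd.
have r2 b : X b - Y b = c 2 * G b * (1 - q b).
  have := rel 2 b.
  have -> : ((if t == 1 then -1 else 1) * (p%:Z * 2))%:~R / 4 = ((if t == 1 then -1 else 1) * p%:Z)%:~R / 2 :> C.
    by rewrite mulrA intrM; field.
  have -> : - ((p%:Z * 2)%:~R / 4) = (- p%:Z)%:~R / 2 :> C by rewrite intrM rmorphN /=; field.
  rewrite !half_odd ?mulN1r //; first by exists (- kp - 1); rewrite Ep; ring.
  by case: ifP => _; [exists (- kp - 1)|exists kp]; rewrite Ep; ring.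
(* A single odd v determines, besides [c v], also the ratio of [c 2] to [c 0]. *)
have odd_case v : v = 1 \/ v = -1 -> let ep := e (- ((p%:Z * v)%:~R / 4)) : C in
   let d := e (((if t == 1 then -1 else 1) * (p%:Z * v))%:~R / 4) : C in
   [/\ ep ^+ 2 = -1, d = (if t == 1 then ep else - ep) &
    if t == 1 then c 2 = c 0 /\ c v = c 0 else c 2 = - c 0 /\ c v = e ((p%:Z * v)%:~R / 4) * c 0].
Proof.
  move=> hv ep d; have e2 : ep ^+ 2 = -1.
    rewrite /ep -eMn; have -> : 2%:R * - ((p%:Z * v)%:~R / 4) = (- (p%:Z * v))%:~R / 2 :> C.
      by rewrite rmorphN /=; field.
    apply: half_odd; case: hv => ->; [exists (- kp - 1)|exists kp]; rewrite Ep; ring.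
  have ep0 : ep != 0 by apply: e_neq0.
  have epV : e ((p%:Z * v)%:~R / 4) = - ep.
    rewrite -[_ / 4]opprK eN; apply: (mulfI ep0); rewrite divff // mulrN -expr2 e2 opprK //.
  have dE : d = (if t == 1 then ep else - ep).
    rewrite /d; case: ifP => _; last by rewrite mul1r epV.
    by rewrite mulN1r rmorphN mulNr.
  split=> //.
  have n2 : (2 : C) != 0 by rewrite pnatr_eq0.
  have dd : (d == ep) = (t == 1).
    rewrite dE; case: ifP => _; first by rewrite eqxx.
    by apply/negbTE; rewrite eq_sym -addr_eq0 -mulr2n -mulr_natr mulf_neq0.
  have hd : d = ep \/ d = - ep by rewrite dE; case: ifP; [left|right].
  have := phase_relation q12 G0 e2 hd r0 r2 (rel v); rewrite dd.
  by rewrite epV dE; case: (t == 1).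
move=> v; rewrite !inE => /or4P[]/eqP ->.
- have [_ _] := odd_case (-1) (or_intror erefl); case: ifP => _ [_ ->] //; by rewrite mul1r.
- by rewrite mulr0 mul0r e_0; case: ifP; rewrite mul1r.
- have [_ _] := odd_case 1 (or_introl erefl); case: ifP => _ [_ ->] //; by rewrite mul1r.
have [_ _] := odd_case 1 (or_introl erefl); case: ifP => _ [-> _]; first by rewrite mul1r.
have -> : (p%:Z * 2)%:~R / 4 = (p%:Z)%:~R / 2 :> C by rewrite intrM; field.
by rewrite half_odd ?mulN1r //; exists kp.
Qed.

Lemma Lcusp_approx (t : int) : t = 1 \/ t = 2 -> exists2 c : C, c != 0 &
  approx (part s (L t) (phi t) F) (fun z =>
    (c * (if (4 %| (if t == 1 then - m else m - n%:Z)%R)%Z then 4 else 0)) * e (ratr (m%:~R * t%:~R / (D t)%:~R) * z)).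
Proof.
move=> ht; have hL := Lphi_mpl (L_pos ht); have [c hc] := choice (fun v => Lcusp_term v ht).
have ph := Lcusp_phase ht (fun v z zH => let: And3 _ _ h := hc v in h z zH).
have c0 : c 0 != 0 by case: (hc 0).
exists (2^-1 * (al R s)^-1 * c 0 ^- n * e (m%:~R * (beta t 0)%:~R / (D t)%:~R)).
  by rewrite !mulf_neq0 ?invr_eq0 ?expf_neq0 ?al_neq0 ?e_neq0 ?pnatr_eq0.
pose Q v (z : C) := c v ^- n * e (m%:~R * (beta t v)%:~R / (D t)%:~R) * e (ratr (m%:~R * t%:~R / (D t)%:~R) * z).
have hQ v : v \in [:: -1; 0; 1; 2 : int] -> approx (part s (xiM p v (L t)) (xphi p v (L t) (phi t)) f) (Q v).
  by move=> _; case: (hc v).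
apply: approx_ext (kohnen_approx hL (Lpart0 ht) hQ) => // z zH; rewrite /Q.
rewrite add0r -mulr_suml; set E := e (ratr _ * _).
(* The exponent of the phase collects -m or m from m beta/D and, for t = 2, also -n from the power
   of [c v]. *)
have -> : \sum_(v <- [:: -1; 0; 1; 2 : int]) c v ^- n * e (m%:~R * (beta t v)%:~R / (D t)%:~R) =
    c 0 ^- n * e (m%:~R * (beta t 0)%:~R / (D t)%:~R) *
    \sum_(v <- [:: -1; 0; 1; 2 : int]) e (((if t == 1 then - m else m - n%:Z) * (p%:Z * v))%:~R / 4).
  rewrite mulr_sumr; apply: eq_big_seq => v vl; rewrite (ph v vl).
  have [j hj] := beta_frac v ht; rewrite -!mulrA hj !mulrDr.
  rewrite -[m%:~R * j%:~R]rmorphM /= e_addint eD exprMn invfM.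
  rewrite [X in X * _ = _]mulrC -!mulrA; congr (_ * _); rewrite mulrCA; congr (_ * _).
  case: ifP => _; first by rewrite expr1n invr1 mul1r mulN1r mulNr !rmorphN /= !rmorphM /=; congr e; ring.
  rewrite mul1r -eMn -eN -eD; congr e; rewrite mulrBl rmorphB /= !rmorphM /= pmulrn; ring.
rewrite root_sum //; set S := (if (4 %| _)%Z then _ else _).
by move: (al R s)^-1 (c 0 ^- n) (e (m%:~R * _ / _)) E S => x1 x2 x3 x4 x5; ring.
Qed.

Lemma L_image (t : int) : t = 1 \/ t = 2 -> image_of_infty (L t) = Some (1 / (p%:R * t%:~R)).
Proof.
move=> ht; have [a b c d] := LmxE (p%:Z * t); rewrite /image_of_infty c a.
by rewrite (gt_eqF (L_pos ht)) rmorphM /= -pmulrn.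
Qed.

Lemma Lcusp_pole (t : int) : t = 1 \/ t = 2 -> has_pole_at s F (Some (1 / (p%:R * t%:~R))) <->
  (4 %| (if t == 1 then - m else m - n%:Z)%R)%Z.
Proof.
move=> ht; have hL := Lphi_mpl (L_pos ht); have [c c0 ap] := Lcusp_approx ht.
have g1 : Gamma0 1 (L t) by split; [apply: Lmx_det|rewrite dvd1z].
have l0 : m%:~R * t%:~R / (D t)%:~R < 0 :> rat.
  rewrite -mulrA pmulr_llt0 ?ltrz0 // divr_gt0 // ltr0z; first by case: ht => ->.
  by case: ifP.
have k1 : nm (- I) = 1 by rewrite nmN nm_i.
split.
  move=> /(pole_iff p_prime s2 g1 (L_image ht) hL k1 l0 ap) h.
  by apply: contraT => /negbTE E; case: h; rewrite E mulr0.
move=> E; apply/(pole_iff p_prime s2 g1 (L_image ht) hL k1 l0 ap); rewrite E.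
by apply/eqP; rewrite mulf_neq0 // pnatr_eq0.
Qed.

End PrimeCusps.

Lemma at_cusp_ext (R : realType) (s : nat) (f g : CC R -> CC R) r P :
  (forall z, upper_half z -> f z = g z) -> at_cusp s f r P -> at_cusp s g r P.
Proof.
move=> fg H G X gG EG mX X1; have [h [a [[h0 hn hs] ha]]] := H G X gG EG mX X1.
exists h, a; split; last exact: ha.
split; [exact: h0|exact: hn|move=> z zH].
have [dG _] := gG; have -> : slash s g X z = slash s f X z; last exact: hs.
rewrite /slash X1 mobius_mxQ fg //; apply: mob_up => //; by rewrite dG.
Qed.

Theorem theorem2p1 (R : realType) (p s : nat) (m : int)
    (hp : p \in [:: 3; 5; 7; 13]%N) (hs : (2 <= s)%N) (hm : m < 0)
    (hsm : ((-1) ^+ s * m = 0 %[mod 4])%Z \/ ((-1) ^+ s * m = 1 %[mod 4])%Z) :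
  let F : CC R -> CC R := poincare p s m in
  [/\ weakly_holomorphic_form (4 * p) s F,
      exists c : nat -> CC R, forall z : CC R, upper_half z ->
        has_sum (fun n : nat =>
            if (n%:Z == 0 %[mod 4])%Z || (n%:Z == (-1) ^+ s %[mod 4])%Z
            then c n * e (n%:R * z) else 0)
          (F z - e (m%:~R * z)),
      forall r : option rat, r \in [:: Some 0; Some (1 / 2); Some (1 / 4)] ->
        holomorphic_at s F r /\ vanishes_at s F r,
      has_pole_at s F None &
      (has_pole_at s F (Some (1 / p%:R)) <->
         ((-1) ^+ s * m = 0 %[mod 4])%Z) /\
      (has_pole_at s F (Some (1 / (2 * p%:R))) <->
         ((-1) ^+ s * m = 1 %[mod 4])%Z)].
Proof.
have [p_prime p_odd] : prime p /\ odd p.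
  by move: hp; rewrite !inE => /or4P[]/eqP ->.
have hm4 : (4 %| m)%Z \/ (4 %| m - (2 * s + 1)%N%:Z)%Z.
  by case: hsm => [/mod4_0 h|/mod4_1 h]; [left|right].
have PK z : upper_half z -> poincare p s m z = kohnen p s (Fcal p s m) z :> CC R.
  exact: poincare_kohnen.
have KP z : upper_half z -> kohnen p s (Fcal p s m) z = poincare p s m z :> CC R.
  by move=> zH; rewrite PK.
have ext r P : at_cusp s (@poincare R p s m) r P <-> at_cusp s (kohnen p s (Fcal p s m)) r P.
  by split; apply: at_cusp_ext.
move=> F; rewrite /F {F}; split.
- split.
  + by apply: goodH_holomorphic; apply: goodH_ext KP (F_goodH p m hs).
  + move=> A gA z zH; have [dA _] := gA; rewrite mobius_mxQ !PK //; last by apply: mob_up; rewrite ?dA.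
    by rewrite (kohnen_invariant (Fcal_invariant m hs) gA zH).
  + by move=> r; apply/ext; apply: F_meromorphic.
- have [a [a0 a4 ha]] := F_q_expansion R p_prime p_odd hs hm4.
  (* The expansion runs over all integers, but its coefficients at non-positive indices vanish, so
     it restricts to [nat]. *)
  exists (fun k => a k%:Z) => z zH; rewrite PK //.
  have inj : injective Posz by move=> x y [].
  have hx (j : int) : (forall i : nat, j <> i%:Z) -> a j * e (j%:~R * z) = 0.
    by case: j => [j /(_ j)|j _] //; rewrite a0 ?mul0r.
  apply: (eq_has_sum _ ((has_sum_inj _ inj hx).1 (ha z zH))) => k /=.
  rewrite -pmulrn !eqz_mod_dvd subr0; case: ifP => // /negbT; rewrite negb_or => /andP[k0 k1].
  rewrite a4 ?mul0r // => -[h|h]; first by rewrite h in k0.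
  have [t ht] := sign_mod4 s; case/negP: k1.
  have -> : k%:Z - (-1) ^+ s = k%:Z - (2 * s + 1)%N%:Z + 4 * t by rewrite -ht; ring.
  by apply: rpredD => //; apply: dvdz_mulr; apply: dvdzz.
- move=> r hr; have [h1 h2] := F_vanishes_at R m p_prime p_odd hs hr.
  by split; apply/ext.
- by apply/ext; apply: F_pole_infty.
have eqv r P Q : (at_cusp s (kohnen p s (Fcal p s m)) r P <-> Q) -> at_cusp s (@poincare R p s m) r P <-> Q.
  by move=> h; split=> [/ext/h|/h h']; last apply/ext.
split; apply: eqv.
  have := Lcusp_pole R p_prime p_odd hs hm (t := 1) (or_introl erefl).
  rewrite mulr1z mulr1 /= => h; split=> [/h|/mod4_0]; first by rewrite rpredN => ?; apply/mod4_0.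
  by move=> ?; apply/h; rewrite rpredN.
have := Lcusp_pole R p_prime p_odd hs hm (t := 2) (or_intror erefl).
rewrite [p%:R * _]mulrC /= => h; split=> [/h ?|/mod4_1 ?]; first exact/mod4_1.
exact/h.
Qed.
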